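(* Let $N,k$ be integers with $1<k<N$, $s\in(0,1)$ and $p>0$. Then the equation $$\mathcal J_k^+u(x)+u^p(x)=0\quad\text{in }\mathbb R^N$$ has nontrivial (nonnegative, $u\not\equiv0$) viscosity supersolutions if, and only if, $$p>\frac{k}{k-2s}.$$
   Context: Let $C_{k,s}=\Big(\int_{\mathbb R^k}\frac{1-\cos z_1}{|z|^{k+2s}}dz\Big)^{-1}$ and let $\mathcal V_k$ be the family of orthonormal sets $\xi=\{\xi_1,\dots,\xi_k\}$ of $k$ vectors in $\mathbb R^N$. For $\xi\in\mathcal V_k$ set $\mathcal J_\xi u(x)=C_{k,s}\,\mathrm{P.V.}\int_{\mathbb R^k}[u(x+\sum_{i=1}^kz_i\xi_i)-u(x)]|z|^{-(k+2s)}dz$, and $\mathcal J_k^+u(x)=\max_{\xi\in\mathcal V_k}\mathcal J_\xi u(x)$. $L^1_{k,2s}$ is the set of $u\in L^1_{loc}(\mathbb R^N)$ with $\int_V\frac{|u(y)|\,d\mathcal H^k(y)}{1+|y|^{k+2s}}<+\infty$ for every $k$-dimensional affine subspace $V$ of $\mathbb R^N$ ($\mathcal H^k$ is $k$-dimensional Hausdorff measure). A (nonnegative) viscosity supersolution of $\mathcal J_k^+u+u^p=0$ in $\mathbb R^N$ is a lower semicontinuous function $u:\mathbb R^N\to[0,+\infty)$ with $u\in L^1_{k,2s}$ such that for every $x_0\in\mathbb R^N$, $\delta>0$ and $\varphi\in C^2(B_\delta(x_0))$ for which $x_0$ is a minimum point of $u-\varphi$ in $B_\delta(x_0)$, $$\max_{\xi\in\mathcal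 V_k}\Big\{C_{k,s}\,\mathrm{P.V.}\int_{|z|<\delta}\frac{\varphi(x_0+\sum_iz_i\xi_i)-\varphi(x_0)}{|z|^{k+2s}}dz+C_{k,s}\int_{|z|\ge\delta}\frac{u(x_0+\sum_iz_i\xi_i)-u(x_0)}{|z|^{k+2s}}dz\Big\}+u(x_0)^p\le0,$$ where $z=(z_1,\dots,z_k)\in\mathbb R^k$. *)

(* Defs.v *)
From HB Require Import structures.
From mathcomp Require Import all_boot all_order all_algebra.
From mathcomp Require Import all_classical all_reals all_analysis.
Import Order.TTheory GRing.Theory Num.Theory.
Import numFieldNormedType.Exports.

Set Implicit Arguments.
Unset Strict Implicit.
Unset Printing Implicit Defensive.

Local Open Scope classical_set_scope.
Local Open Scope ring_scope.

(* R^n is 'rV[R]_n, whose library norm is the sup norm: it has the Euclidean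
   topology, but lengths, balls and orthonormality need the following. *)
Section euclidean.
Context {R : realType} {n : nat}.
Implicit Types v w : 'rV[R]_n.

Definition edot v w : R := \sum_(i < n) v ord0 i * w ord0 i.

Definition enorm v : R := Num.sqrt (edot v v).

Definition eball (x : 'rV[R]_n) (r : R) : set 'rV[R]_n :=
  [set y | enorm (y - x) < r].

End euclidean.

(* Lebesgue measure on R^n, on the product (= Borel) sigma-algebra of
   n.-tuple R: the n-fold product of lebesgue_measure. *)
Section lebesgue_tuple.
Context {R : realType}.
Local Notation RR := (measurableTypeR R).

Definition tcons n (p : RR * n.-tuple RR) : n.+1.-tuple RR :=
  [the n.+1.-tuple RR of p.1 :: p.2].

Lemma measurable_tcons n : measurable_fun [set: RR * n.-tuple RR] (@tcons n).
Proof. exact: measurable_cons measurable_fst measurable_snd. Qed.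

Lemma product_sigma_finite d1 d2 (T1 : measurableType d1) (T2 : measurableType d2)
    (m1 : {sigma_finite_measure set T1 -> \bar R})
    (m2 : {sigma_finite_measure set T2 -> \bar R}) :
  sigma_finite setT (m1 \x m2)%E.
Proof.
have /sigma_finiteP[F [TF ndF Foo]] := sigma_finiteT m1.
have /sigma_finiteP[G [TG ndG Goo]] := sigma_finiteT m2.
exists (fun i => F i `*` G i).
 rewrite -setXTT TF TG predeqE => -[x y]; split.
    move=> [/= [i _ Fix] [j _ Gjy]]; exists (maxn i j) => //; split.
    - by move: x Fix; exact/subsetPset/ndF/leq_maxl.
    - by move: y Gjy; exact/subsetPset/ndG/leq_maxr.
  by move=> [i _ []/= ? ?]; split; exists i.
move=> i; have [? ?] := Foo i; have [? ?] := Goo i.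
split; first exact: measurableX.
by rewrite product_measure1E// lte_mul_pinfty// ge0_fin_numE.
Qed.

Section step.
Context {n : nat} (m : {sigma_finite_measure set (n.-tuple RR) -> \bar R}).

Definition lebesgue_cons : set (n.+1.-tuple RR) -> \bar R :=
  pushforward (lebesgue_measure \x m)%E (@tcons n).

Let tcons_preimage (A : set (n.+1.-tuple RR)) :
  measurable A -> measurable (@tcons n @^-1` A).
Proof. by move=> mA; rewrite -[X in measurable X]setTI; exact: measurable_tcons. Qed.

Let lebesgue_cons0 : lebesgue_cons set0 = 0%E.
Proof. by rewrite /lebesgue_cons /pushforward preimage_set0 measure0. Qed.

Let lebesgue_cons_ge0 A : (0 <= lebesgue_cons A)%E.
Proof. by rewrite /lebesgue_cons /pushforward measure_ge0. Qed.

Let lebesgue_cons_sigma_additive : semi_sigma_additive lebesgue_cons.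
Proof.
move=> F mF tF mUF; rewrite /lebesgue_cons /pushforward preimage_bigcup.
apply: measure_semi_sigma_additive.
- by move=> i; exact: tcons_preimage.
- apply/trivIsetP => /= i j _ _ ij; rewrite -preimage_setI.
  by move/trivIsetP : tF => /(_ _ _ _ _ ij) ->//; rewrite preimage_set0.
- by rewrite -preimage_bigcup; exact: tcons_preimage.
Qed.

HB.instance Definition _ := isMeasure.Build _ _ _ lebesgue_cons
  lebesgue_cons0 lebesgue_cons_ge0 lebesgue_cons_sigma_additive.

Let lebesgue_cons_sigma_finite : sigma_finite setT lebesgue_cons.
Proof.
pose split_tuple (t : n.+1.-tuple RR) : RR * n.-tuple RR :=
  (thead t, [tuple of behead t]).
have msplit : measurable_fun setT split_tuple.
  apply: measurable_fun_pair; last exact: measurable_behead.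
  exact: (@measurable_tnth _ _ _ ord0).
have tconsK : cancel (@tcons n) split_tuple.
  by move=> [x t]; congr pair; apply/val_inj.
have splitK : cancel split_tuple (@tcons n).
  by move=> t; apply/val_inj; rewrite [in RHS](tuple_eta t).
have [F FT Foo] : sigma_finite setT (lebesgue_measure \x m)%E.
  exact: product_sigma_finite.
exists (fun i => split_tuple @^-1` F i).
  by rewrite -preimage_bigcup -FT preimage_setT.
move=> i; split.
  by rewrite -[X in measurable X]setTI; apply: msplit => //; exact: (Foo i).1.
rewrite /lebesgue_cons /pushforward -comp_preimage.
have -> : split_tuple \o @tcons n = id by apply/funext => p; exact: tconsK.
exact: (Foo i).2.
Qed.

HB.instance Definition _ :=
  Measure_isSigmaFinite.Build _ _ _ lebesgue_cons lebesgue_cons_sigma_finite.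

End step.

Fixpoint lebesgue_tuple n : {sigma_finite_measure set (n.-tuple RR) -> \bar R} :=
  match n with
  | 0 => \d_ [tuple]
  | n'.+1 => lebesgue_cons (lebesgue_tuple n')
  end.

End lebesgue_tuple.

Definition vec {R : realType} n (z : n.-tuple (measurableTypeR R)) :
  'rV[R]_n := \row_(i < n) tnth z i.

Section hausdorff.
Context {R : realType} {N : nat}.
Implicit Types (A : set 'rV[R]_N) (delta : R).
Local Open Scope ereal_scope.

Definition ediam A : \bar R :=
  ereal_sup [set (enorm (xy.1 - xy.2))%:E | xy in A `*` A].

(* omega_k (diam A / 2)^k, omega_k being the volume of the unit ball of R^k;
   this normalization makes H^k agree with Lebesgue measure on k-planes. *)
Definition hausdorff_weight (k : nat) A : \bar R :=
  if A == set0 then 0 else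
  lebesgue_tuple k [set z | (enorm (vec z) <= 1)%R]
    * (ediam A * (2^-1)%:E) ^+ k.

Definition hausdorff_cover delta A : set (set 'rV[R]_N)^nat :=
  [set F | A `<=` \bigcup_i F i /\ forall i, ediam (F i) <= delta%:E].

Definition hausdorff_pre (k : nat) delta A : \bar R :=
  ereal_inf [set \sum_(i <oo) hausdorff_weight k (F i)
            | F in hausdorff_cover delta A].

Definition hausdorff (k : nat) A : \bar R :=
  ereal_sup [set hausdorff_pre k delta A | delta in [set d : R | (0 < d)%R]].

Lemma ediam_ge0 A : A !=set0 -> 0 <= ediam A.
Proof.
move=> [x Ax]; apply: ereal_sup_ubound; exists (x, x) => //=.
by rewrite /enorm /edot subrr big1 ?sqrtr0// => i _; rewrite mxE mul0r.
Qed.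

Lemma hausdorff_weight0 k : hausdorff_weight k set0 = 0.
Proof. by rewrite /hausdorff_weight eqxx. Qed.

Lemma hausdorff_weight_ge0 k A : 0 <= hausdorff_weight k A.
Proof.
rewrite /hausdorff_weight; case: ifPn => // /set0P A0.
by rewrite mule_ge0// expe_ge0// mule_ge0// ediam_ge0.
Qed.

Lemma hausdorff_pre_ge0 k delta A : 0 <= hausdorff_pre k delta A.
Proof.
apply: le_ereal_inf_tmp => _ [F _ <-].
by apply: nneseries_ge0 => *; exact: hausdorff_weight_ge0.
Qed.

Lemma hausdorff_pre0 k delta : hausdorff_pre k delta set0 = 0.
Proof.
apply/eqP; rewrite eq_le hausdorff_pre_ge0 andbT.
apply: ereal_inf_lbound; exists (fun=> set0).
  split=> // i; rewrite /ediam setX0 image_set0 ereal_sup0.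
  by rewrite leNye.
by rewrite eseries0// => i _ _; exact: hausdorff_weight0.
Qed.

Lemma le_hausdorff_pre k delta :
  {homo hausdorff_pre k delta : A B / A `<=` B >-> A <= B}.
Proof.
move=> A B AB; apply/ereal_inf_le_tmp => _ [F [BF dF] <-].
by exists F => //; split => //; exact: subset_trans AB BF.
Qed.

Lemma hausdorff_pre_sigma_subadditive k delta :
  sigma_subadditive (hausdorff_pre k delta).
Proof.
set mu := hausdorff_pre k delta; set w := hausdorff_weight k.
have w_ge0 : forall A, 0 <= w A by exact: hausdorff_weight_ge0.
move=> A; have [[i ioo]|] := pselect (exists i, mu (A i) = +oo).
  rewrite (eseries_pinfty _ _ ioo) ?leey// => n _.
  by rewrite -ltNye (lt_le_trans _ (hausdorff_pre_ge0 _ _ _)).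
rewrite -forallNE => Aoo.
suff add2e (e : {posnum R}) :
    mu (\bigcup_n A n) <= \sum_(i <oo) mu (A i) + e%:num%:E.
  by apply/lee_addgt0Pr => _/posnumP[].
rewrite (le_trans _ (epsilon_trick _ _ _))//; last first.
  by move=> n; exact: hausdorff_pre_ge0.
pose P n (B : (set 'rV[R]_N)^nat) := hausdorff_cover delta (A n) B /\
  \sum_(j <oo) w (B j) <= mu (A n) + (e%:num / (2 ^ n.+1)%:R)%:E.
have [G PG] : {G : ((set 'rV[R]_N)^nat)^nat & forall n, P n (G n)}.
  apply: (@choice _ _ P) => n; rewrite /P /mu /hausdorff_pre.
  set S := (X in ereal_inf X); move infS : (ereal_inf S) => iS.
  case: iS infS => [r Sr|Soo|Soo].
  - have en1 : (0 < e%:num / (2 ^ n.+1)%:R)%R by [].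
    have /(lb_ereal_inf_adherent en1) : ereal_inf S \is a fin_num by rewrite Sr.
    move=> [x [B cB muBx] xS].
    by exists B; split => //; rewrite muBx -Sr; exact/ltW.
  - by have := Aoo n; rewrite /mu /hausdorff_pre Soo.
  - suff : lbound S 0 by move/le_ereal_inf_tmp; rewrite Soo.
    by move=> /= _ [B cB <-]; exact: nneseries_ge0.
have muG_ge0 x : 0 <= (w \o uncurry G) x by exact: w_ge0.
apply: (@le_trans _ _ (\esum_(i in setT) (w \o uncurry G) i)).
  apply: ereal_inf_lbound => /=.
  have /card_esym/ppcard_eqP[f] := card_nat2.
  exists (uncurry G \o f).
    split => [|i]; last first.
      by rewrite /= /uncurry; case: (f i) => a b; exact: (PG a).1.2.
    apply: (@subset_trans _  (\bigcup_n \bigcup_j G n j)) => [t [i _]|].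
      by move=> /(PG i).1.1 -[j _ ?]; exists i => //; exists j.
    move=> t [i _ [j _ Bijt]]; exists (f^-1%FUN (i, j)) => //=.
    by rewrite invK ?inE.
  rewrite -(esum_pred_image (w \o uncurry G) _ xpredT) ?[fun=> _]set_true//.
  by rewrite image_eq.
rewrite (_ : esum _ _ = \sum_(i <oo) \sum_(j <oo ) w (G i j)); last first.
  pose J : nat -> set (nat * nat) := fun i => [set (i, j) | j in setT].
  rewrite (_ : setT = \bigcup_k J k); last first.
    by rewrite predeqE => -[a b]; split => // _; exists a => //; exists b.
  rewrite esum_bigcupT /=; last 2 first.
    - apply/trivIsetP => i j _ _ ij.
      rewrite predeqE => -[n m] /=; split => //= -[] [_] _ [<-{n} _].
      by move=> [m' _] [] /esym/eqP; rewrite (negbTE ij).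
    - by move=> /= [n m]; exact: w_ge0.
  rewrite -(image_id [set: nat]) -fun_true esum_pred_image//; last first.
    by move=> n _; exact: esum_ge0.
  apply: eq_eseriesr => /= j _.
  rewrite -(esum_pred_image (w \o uncurry G) (pair j) predT)//=; last first.
    by move=> ? ? _ _; exact: (@can_inj _ _ _ snd).
  by congr esum; rewrite predeqE => -[a b]; split; move=> [i _ <-]; exists i.
apply: lee_lim.
- apply: is_cvg_nneseries => n *.
  by apply: nneseries_ge0 => m *; exact: (muG_ge0 (n, m)).
- apply: is_cvg_nneseries => n *; apply: adde_ge0 => //.
  exact: hausdorff_pre_ge0.
- by near=> n; apply: lee_sum => i _; exact: (PG i).2.
Unshelve. all: by end_near. Qed.

Lemma le_hausdorff_pre_hausdorff k delta A :
  (0 < delta)%R -> hausdorff_pre k delta A <= hausdorff k A.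
Proof. by move=> d0; apply: ereal_sup_ubound; exists delta. Qed.

Lemma hausdorff_ge0 k A : 0 <= hausdorff k A.
Proof.
by apply: le_trans (hausdorff_pre_ge0 k 1%R A) _; exact: le_hausdorff_pre_hausdorff.
Qed.

Lemma hausdorff0 k : hausdorff k set0 = 0.
Proof.
apply/eqP; rewrite eq_le hausdorff_ge0 andbT.
by apply: ge_ereal_sup => _ [d _ <-]; rewrite hausdorff_pre0.
Qed.

Lemma le_hausdorff k : {homo hausdorff k : A B / A `<=` B >-> A <= B}.
Proof.
move=> A B AB; apply: ge_ereal_sup => _ [d d0 <-].
by apply: le_trans (le_hausdorff_pre k d AB) _; exact: le_hausdorff_pre_hausdorff.
Qed.

Lemma hausdorff_sigma_subadditive k : sigma_subadditive (hausdorff k).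
Proof.
move=> F; apply: ge_ereal_sup => _ [d d0 <-].
apply: le_trans (hausdorff_pre_sigma_subadditive k d F) _.
apply: lee_nneseries => i *; first exact: hausdorff_pre_ge0.
exact: le_hausdorff_pre_hausdorff.
Qed.

(* As a measure, H^k lives on its Caratheodory sigma-algebra. *)
HB.instance Definition _ (k : nat) := isOuterMeasure.Build R 'rV[R]_N
  (hausdorff k) (hausdorff0 k) (hausdorff_ge0 k) (@le_hausdorff k)
  (@hausdorff_sigma_subadditive k).

Definition hausdorff_outer (k : nat) : {outer_measure set 'rV[R]_N -> \bar R} :=
  hausdorff k.

Definition hausdorff_measure (k : nat) :
  {measure set (caratheodory_type (hausdorff_outer k)) -> \bar R} :=
  (hausdorff_outer k : set (caratheodory_type (hausdorff_outer k)) -> \bar R).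

End hausdorff.

Section function_spaces.
Context {R : realType} {N : nat}.
Implicit Types u phi : 'rV[R]_N -> R.

Definition affine_subspace (k : nat) (V : set 'rV[R]_N) :=
  exists x0 : 'rV[R]_N, exists2 W : {vspace 'rV[R]_N},
    \dim W = k & V = [set x | x - x0 \in W].

(* Measurability is Borel measurability, automatic for the lower
   semicontinuous functions considered below. *)
Definition L1loc u :=
  measurable_fun setT (u \o @vec R N) /\
  forall K : set 'rV[R]_N, compact K ->
    (\int[lebesgue_tuple N]_(t in @vec R N @^-1` K) `|u (vec t)|%:E < +oo)%E.

Definition L1_k2s (k : nat) (s : R) u :=
  L1loc u /\
  forall V, affine_subspace k V ->
    (\int[@hausdorff_measure R N k]_(y in V)
       (`|u y| / (1 + enorm (y : 'rV[R]_N) `^ (k%:R + 2 * s)))%:E < +oo)%E.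

Definition basis_vec (i : 'I_N) : 'rV[R]_N := delta_mx ord0 i.

(* U is meant to be open. *)
Definition C2_on (U : set 'rV[R]_N) phi :=
  forall x, U x ->
    {for x, continuous phi} /\
    forall i : 'I_N,
      [/\ derivable phi x (basis_vec i),
          {for x, continuous ('D_(basis_vec i) phi)} &
          forall j : 'I_N,
            derivable ('D_(basis_vec i) phi) x (basis_vec j) /\
            {for x, continuous ('D_(basis_vec j) ('D_(basis_vec i) phi))}].

End function_spaces.

Section operator.
Context {R : realType} {N : nat} (k : nat) (s : R).
Local Notation Rk := (k.-tuple (measurableTypeR R)).

Definition frac_kernel (z : Rk) : R := (enorm (vec z) `^ (k%:R + 2 * s))^-1.

(* z`_0 is the first coordinate of z. *)
Definition C_ks : R :=
  (fine (\int[lebesgue_tuple k]_z ((1 - cos (z`_0 : R)) * frac_kernel z)%:E))^-1.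

Definition orthonormal_frame (xi : 'I_k -> 'rV[R]_N) :=
  forall i j, edot (xi i) (xi j) = (i == j)%:R.

Definition frame_point (xi : 'I_k -> 'rV[R]_N) (x : 'rV[R]_N) (z : Rk) : 'rV[R]_N :=
  x + \sum_(i < k) (tnth z i : R) *: xi i.

Definition increment_integral (xi : 'I_k -> 'rV[R]_N) (f : 'rV[R]_N -> R)
    (x : 'rV[R]_N) (D : set Rk) : \bar R :=
  \int[lebesgue_tuple k]_(z in D) ((f (frame_point xi x z) - f x) * frac_kernel z)%:E.

Local Open Scope ereal_scope.

Definition pv_near xi phi x (delta : R) : \bar R :=
  lim ((fun eps : R => increment_integral xi phi x
          [set z | (eps < enorm (vec z) < delta)%R]) @ 0%R^'+).

Definition away xi u x (delta : R) : \bar R :=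
  increment_integral xi u x [set z | (delta <= enorm (vec z))%R].

(* The maximum over frames is read as a supremum: it need not be attained for a
   merely lower semicontinuous u. It is taken in the extended reals because phi
   may tend to -oo at the boundary of the ball, making pv_near equal to -oo. *)
Definition Jplus_test u phi x (delta : R) : \bar R :=
  ereal_sup [set C_ks%:E * pv_near xi phi x delta + C_ks%:E * away xi u x delta
            | xi in orthonormal_frame].

Definition viscosity_supersolution (p : R) (u : 'rV[R]_N -> R) :=
  [/\ forall x, (0 <= u x)%R,
      lower_semicontinuous (EFin \o u),
      L1_k2s k s u &
      forall (x0 : 'rV[R]_N) (delta : R) (phi : 'rV[R]_N -> R),
        (0 < delta)%R -> C2_on (eball x0 delta) phi ->
        (forall x, eball x0 delta x -> (u x0 - phi x0 <= u x - phi x)%R) ->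
        Jplus_test u phi x0 delta + (u x0 `^ p)%:E <= 0].

End operator.

(* Main.v *)
From mathcomp Require Import all_boot all_order all_algebra.
From mathcomp Require Import all_classical all_reals all_analysis.
From mathcomp Require Import measurable_realfun ring lra.
Require Import Defs.
Import Order.TTheory GRing.Theory Num.Theory.
Import numFieldNormedType.Exports.

Set Implicit Arguments.
Unset Strict Implicit.
Unset Printing Implicit Defensive.

Local Open Scope classical_set_scope.
Local Open Scope ring_scope.

(** Two facts carry the equivalence.

    The first is subordination: [|z| ^ (- k - 2 s)] is, up to a constant, the
    superposition of the heat kernels of R^k over the times [t] with weight
    [t ^ (- 1 - s)] ([kernel_kpart]). Integrated against a function which is
    itself a mixture of Gaussians it acts on the weight of the mixture alone, by
    the semigroup property ([integral_mixture_kpart]), and the computations of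
    the proof become one-dimensional. Keeping only the times above [e] makes
    the kernel integrable, of total mass [e ^ (- s) / s], and the times below
    [e] matter to order [e ^ (1 - s)] ([near_moment], [far_mass_ball]).

    The second is that a supersolution satisfies the inequality of the equation
    for every frame. At a point [x0] a frame may be chosen whose span contains
    [x0 - x1] ([frame_through]); restricted to the corresponding plane, a
    function of [|x - x1|] is a radial function of R^k about its own center. A
    supersolution may thus be compared with radial subsolutions of the
    [k]-dimensional equation ([comparison]), although it is not radial and its
    domain has a larger dimension.

    Nonexistence. Let [u] be positive at [x1]. By lower semicontinuity and
    comparison with a heat kernel, [u] lies above a Gaussian centered at [x1]
    ([gaussian_lower_bound]). If [u ^ p] lies above a combination of heat
    kernels, then [u] lies above a fixed multiple of the combination of their
    potentials ([subsolution_pot], [pot_comparison]). For a Gaussian of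
    amplitude [M] and time [t] this produces the amplitude [K M ^ p t ^ s] at
    the same time, and the amplitude of order [t ^ (s - k / 2)] at larger times
    ([gaussian_spread]). As soon as [K M ^ (p - 1) t ^ s >= 2] the amplitude
    doubles for ever, which is absurd ([gaussian_doubling]). For [p <= 1] this
    happens because [M] is bounded by [u x1] while [t] is free. For [p > 1]
    the exponent of [t] in [(t ^ (s - k / 2)) ^ (p - 1) t ^ s] is nonnegative
    exactly when [p <= k / (k - 2 s)]. At equality it is zero, and the missing
    unbounded factor comes from the slow decay of the lower bound: [u ^ p] is
    at least of order [(1 + |x - x1| ^ 2) ^ (- k / 2)], which dominates the sum
    of the heat kernels of any number of times in geometric progression
    ([heat_sum_le]); at the last of these times each of them contributes a
    comparable amplitude ([exponent_gt_critical]).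

    Existence. For [p > k / (k - 2 s)] the function
    [c0 (1 + |x| ^ 2) ^ (- g / 2)] is a supersolution if [g] is smaller than
    [k - 2 s] but close enough to it. In any plane it has the form
    [c0 (A + |a + z| ^ 2) ^ (- g / 2)] with [A >= 1], by Bessel's inequality; it is a
    mixture of Gaussians, and the operator applied to it is at most a negative
    multiple of [(1 + |x| ^ 2) ^ (- g / 2 - s)] ([bubble_far]). This absorbs
    the nonlinearity if [g p >= g + 2 s] and [c0] is small. Test functions
    enter through a Taylor expansion ([C2_taylor], [bubble_test]). That the
    function has finite weighted integrals over [k]-planes follows from the
    growth of the Hausdorff measure of their bounded parts
    ([hausdorff_plane_ball]). *)

(** * Integration on product spaces, and changes of variable *)

Section general_integration.
Context {R : realType}.
Local Open Scope ereal_scope.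
Local Notation mu := (@lebesgue_measure R).

(** Positive and negative parts are compared separately; their difference is
    monotone in the extended reals even when it is infinite or of the form oo - oo. *)
Lemma le_integral_quasi d (T : measurableType d)
    (m : {measure set T -> \bar R}) (D : set T) (f g : T -> \bar R) :
  measurable D -> measurable_fun D f -> measurable_fun D g ->
  (forall x, D x -> f x <= g x) ->
  \int[m]_(x in D) f x <= \int[m]_(x in D) g x.
Proof.
move=> mD mf mg fg; rewrite integralE [leRHS]integralE; apply: leeB.
  apply: ge0_le_integral => //; try exact: measurable_funepos.
  by move=> x Dx; rewrite !funeposE le_max2//; exact: fg.
apply: ge0_le_integral => //; try exact: measurable_funeneg.
by move=> x Dx; rewrite !funenegE le_max2// leeN2; exact: fg.
Qed.

Lemma tonelli_on d1 d2 (T1 : measurableType d1) (T2 : measurableType d2)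
    (m1 : {sigma_finite_measure set T1 -> \bar R})
    (m2 : {sigma_finite_measure set T2 -> \bar R})
    (D1 : set T1) (D2 : set T2) (f : T1 * T2 -> \bar R) :
  measurable D1 -> measurable D2 -> measurable_fun (D1 `*` D2) f ->
  (forall x, (D1 `*` D2) x -> 0 <= f x) ->
  \int[m1]_(x in D1) \int[m2]_(y in D2) f (x, y) =
  \int[m2]_(y in D2) \int[m1]_(x in D1) f (x, y).
Proof.
move=> mD1 mD2 mf f0; pose g := f \_ (D1 `*` D2).
have mg : measurable_fun setT g.
  by apply/(measurable_restrictT _ _).1 => //; exact: measurableX.
have g0 x : 0 <= g x by rewrite /g patchE; case: ifPn => // /set_mem /f0.
have := fubini_tonelli (m1:=m1) (m2:=m2) g mg g0.
have -> : \int[m1]_x \int[m2]_y g (x, y) = \int[m1]_(x in D1) \int[m2]_(y in D2) f (x, y).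
  rewrite [RHS]integral_mkcond; apply: eq_integral => x _.
  rewrite patchE; case: ifPn => xD; last first.
    rewrite integral0_eq// => y _; rewrite /g patchE ifF//.
    by apply/negbTE; apply: contra xD => /set_mem[/mem_set].
  rewrite [RHS]integral_mkcond; apply: eq_integral => y _.
  by rewrite /g !patchE in_setX xD.
move=> ->; rewrite [RHS]integral_mkcond; apply: eq_integral => y _.
rewrite patchE; case: ifPn => yD; last first.
  rewrite integral0_eq// => x _; rewrite /g patchE ifF//.
  by apply/negbTE; apply: contra yD => /set_mem[_ /mem_set].
rewrite [RHS]integral_mkcond; apply: eq_integral => x _.
by rewrite /g !patchE in_setX yD andbT.
Qed.

Lemma measurable_int_on d1 d2 (T1 : measurableType d1) (T2 : measurableType d2)
    (m2 : {sigma_finite_measure set T2 -> \bar R})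
    (D1 : set T1) (D2 : set T2) (f : T1 * T2 -> \bar R) :
  measurable D1 -> measurable D2 -> measurable_fun (D1 `*` D2) f ->
  (forall x, (D1 `*` D2) x -> 0 <= f x) ->
  measurable_fun D1 (fun x => \int[m2]_(y in D2) f (x, y)).
Proof.
move=> mD1 mD2 mf f0; pose g := f \_ (D1 `*` D2).
have mg : measurable_fun setT g.
  by apply/(measurable_restrictT _ _).1 => //; exact: measurableX.
have g0 x : 0 <= g x by rewrite /g patchE; case: ifPn => // /set_mem /f0.
have mF := measurable_funTS (measurable_fun_fubini_tonelli_F (m2:=m2) g mg g0).
apply: (eq_measurable_fun _ _ (mF D1)) => x xD.
rewrite /fubini_F [RHS]integral_mkcond; apply: eq_integral => y _.
by rewrite /g !patchE in_setX xD.
Qed.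

Lemma ge0_integral_shift (f : R -> \bar R) (b : R) :
  measurable_fun setT f -> (forall x, 0 <= f x) ->
  \int[mu]_x f (x + b)%R = \int[mu]_x f x.
Proof.
move=> mf f0.
have mb : measurable_fun setT (fun x : measurableTypeR R => (x + b)%R : measurableTypeR R).
  exact: measurable_funD.
rewrite -(preimage_setT (fun x : measurableTypeR R => (x + b)%R)).
rewrite -(@ge0_integral_pushforward _ _ _ _ _ _ mb mu setT f)//.
apply: eq_measure_integral => A mA _; apply/esym.
apply: lebesgue_measure_unique => //= _ [[x y]] _ <-.
rewrite /pushforward (_ : _ @^-1` _ = `](x - b)%R, (y - b)%R]%classic); last first.
  by apply/seteqP; split => z /=; rewrite !in_itv/= ltrBlDr lerBrDr.
rewrite !lebesgue_measure_itv/= !lte_fin ltrD2r; case: ifP => // _.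
by rewrite -!EFinB; congr EFin; ring.
Qed.

Lemma ge0_integral_reflect (f : R -> \bar R) :
  measurable_fun setT f -> (forall x, 0 <= f x) ->
  \int[mu]_x f (- x)%R = \int[mu]_x f x.
Proof.
move=> mf f0.
have mb : measurable_fun setT (-%R : measurableTypeR R -> measurableTypeR R).
  exact: oppr_measurable.
rewrite -(preimage_setT (-%R : measurableTypeR R -> measurableTypeR R)).
rewrite -(@ge0_integral_pushforward _ _ _ _ _ _ mb mu setT f)//.
by apply: eq_measure_integral => A mA _; exact: lebesgue_measureN.
Qed.

Lemma ge0_integral_dilate (f : R -> \bar R) (a : R) : (0 < a)%R ->
  measurable_fun setT f -> (forall x, 0 <= f x) ->
  a%:E * \int[mu]_x f (a * x)%R = \int[mu]_x f x.
Proof.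
move=> a0 mf f0.
have mb : measurable_fun setT (fun x : measurableTypeR R => (a * x)%R : measurableTypeR R).
  exact: measurable_funM.
rewrite -(preimage_setT (fun x : measurableTypeR R => (a * x)%R)).
rewrite -(@ge0_integral_pushforward _ _ _ _ _ _ mb mu setT f)//.
have a0' : (0 <= a)%R by exact: ltW.
rewrite -[X in X%:E * _]/((NngNum a0')%:num).
rewrite -ge0_integral_mscale//.
apply: eq_measure_integral => A mA _; apply/esym.
apply: lebesgue_measure_unique => //= _ [[x y]] _ <-.
rewrite /mscale /= /pushforward (_ : _ @^-1` _ = `](x / a)%R, (y / a)%R]%classic); last first.
  by apply/seteqP; split => z /=; rewrite !in_itv/= ltr_pdivrMr// ler_pdivlMr// [(z * a)%R]mulrC.
rewrite !lebesgue_measure_itv/= !lte_fin ltr_pM2r ?invr_gt0//; case: ifP => // _.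
  by rewrite -!EFinB -EFinM; congr EFin; rewrite -mulrBl mulrCA mulfV ?mulr1// gt_eqF.
by rewrite mule0.
Qed.

End general_integration.

(** * Improper integrals of powers *)

Section calculus.
Context {R : realType}.
Local Notation mu := (@lebesgue_measure R).

(** By exhaustion of the interval, so that [f] may blow up at both ends. *)
Lemma ge0_FTC_oo (f F : R -> R) (a b A B : R) : a < b ->
  {in `]a, b[, continuous f} -> {in `]a, b[, forall x, 0 <= f x} ->
  {in `]a, b[, forall x : R, is_derive x 1 F (f x)} ->
  F x @[x --> a^'+] --> A -> F x @[x --> b^'-] --> B ->
  (\int[mu]_(x in `]a, b[) (f x)%:E = (B - A)%:E)%E.
Proof.
move=> ab cf f0 dF FA FB.
have [d dE] : exists d, 3 * d = b - a by exists ((b - a) / 3); field.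
have d0 : 0 < d by lra.
pose u n := a + d / n.+1%:R; pose v n := b - d / n.+1%:R.
have dn n : 0 < d / n.+1%:R by rewrite divr_gt0.
have dnd n : d / n.+1%:R <= d.
  by rewrite ler_pdivrMr// ler_peMr ?(ltW d0)// ler1n.
have uv n : u n < v n.
  by rewrite /u /v; move: (dnd n) (dn n); move: (d / _) => w h1 h2; lra.
have uab n (x : R) : x \in `[u n, v n] -> x \in `]a, b[.
  rewrite !in_itv/= /u /v; move: (dn n); move: (d / _) => w h /andP[ux xv].
  by apply/andP; split; lra.
have cd : d / n.+1%:R @[n --> \oo] --> (0:R).
  by rewrite -(mulr0 d); apply: cvgM; [exact: cvg_cst|exact: cvg_harmonic].
have cu : u n @[n --> \oo] --> a.
  by rewrite -[X in _ --> X]addr0; apply: cvgD; [exact: cvg_cst|exact: cd].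
have cv : v n @[n --> \oo] --> b.
  by rewrite -[X in _ --> X]subr0; apply: cvgB; [exact: cvg_cst|exact: cd].
have UE : \bigcup_n `[u n, v n]%classic = `]a, b[%classic.
  apply/seteqP; split => x /=.
    by move=> [n _ /=]; exact: uab.
  rewrite in_itv/= => /andP[ax xb].
  have [N _ HN] : \forall n \near \oo, d / n.+1%:R < Num.min (x - a) (b - x).
    by apply: (cvgr_lt _ cd); rewrite lt_min !subr_gt0 ax xb.
  exists N => //=; have := HN N (leqnn N); rewrite lt_min in_itv/= /u /v => /andP[].
  by move: (d / _) => w *; apply/andP; split; lra.
have mfo : measurable_fun `]a, b[ f.
  apply: open_continuous_measurable_fun => //.
  by move=> x /set_mem; exact: cf.
have H1 : (\int[mu]_(x in `[u n, v n]) (f x)%:E)%E @[n --> \oo] -->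
    (\int[mu]_(x in `]a, b[) (f x)%:E)%E.
  rewrite -UE; apply: ge0_nondecreasing_set_cvg_integral => //.
  - move=> n m nm; apply/subsetPset => x /=; rewrite !in_itv/= /u /v => /andP[ux xv].
    have : d / m.+1%:R <= d / n.+1%:R.
      by rewrite ler_pM2l// lef_pV2 ?posrE// ler_nat.
    by move: ux xv; move: (d / _) (d / _) => w1 w2 *; apply/andP; split; lra.
  - move=> n; apply/measurable_EFinP; apply: measurable_funS mfo => //.
    by move=> x /=; exact: uab.
  - by move=> n x /= /uab xab; rewrite lee_fin f0.
have H2 n : (\int[mu]_(x in `[u n, v n]) (f x)%:E = (F (v n) - F (u n))%:E)%E.
  rewrite (@continuous_FTC2 _ f F)//.
  - by apply: continuous_in_subspaceT => x /set_mem/= /uab; exact: cf.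
  - split.
    + move=> x; rewrite in_itv/= => /andP[ux xv].
      have xab : x \in `]a, b[ by apply: (uab n); rewrite in_itv/= !ltW.
      by have [] := dF x xab.
    + have xab : u n \in `]a, b[ by apply: (uab n); rewrite in_itv/= lexx ltW.
      have [+ _] := dF _ xab; move=> /derivable1_diffP/differentiable_continuous.
      exact: cvg_at_right_filter.
    + have xab : v n \in `]a, b[ by apply: (uab n); rewrite in_itv/= lexx ltW.
      have [+ _] := dF _ xab; move=> /derivable1_diffP/differentiable_continuous.
      exact: cvg_at_left_filter.
  - move=> x; rewrite in_itv/= => /andP[ux xv].
    have xab : x \in `]a, b[ by apply: (uab n); rewrite in_itv/= !ltW.
    by rewrite derive1E; have [_ ->] := dF x xab.
have H3 : (F (v n) - F (u n))%:E @[n --> \oo] --> (B - A)%:E.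
  apply: cvg_EFin; first by near=> n.
  rewrite /comp/=; apply: cvgB.
    apply: ((cvg_at_leftP F b B).1 FB); split => //.
    by move=> n; rewrite /v ltrBlDr ltrDl.
  apply: ((cvg_at_rightP F a A).1 FA); split => //.
  by move=> n; rewrite /u ltrDl.
rewrite (funext H2) in H1; exact: (cvg_unique _ H1 H3).
Unshelve. all: by end_near. Qed.

Lemma powRD1 (a x : R) : 0 < x -> x `^ (a + 1) = x * x `^ a.
Proof.
by move=> x0; rewrite powRD ?powRr1 1?mulrC ?ltW//; apply/implyP => _; rewrite gt_eqF.
Qed.

Lemma is_derive_powR (a x : R) : 0 < x ->
  is_derive x 1 (fun y => y `^ a) (a * x `^ (a - 1)).
Proof.
move=> x0; have xi : x \in `]0, +oo[ by rewrite in_itv/= x0.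
split; first exact: derivable_powR.
by rewrite -derive1E powR_derive1.
Qed.

Lemma continuous_powR_gt0 (a x : R) : 0 < x ->
  {for x, continuous (fun y => y `^ a)}.
Proof.
move=> x0; have [+ _] := is_derive_powR a x0.
by move=> /derivable1_diffP/differentiable_continuous.
Qed.

Lemma powR_cvg0_right (a : R) : 0 < a -> x `^ a @[x --> (0 : R)^'+] --> (0 : R).
Proof.
move=> a0; apply/cvgrPdist_lt => e e0.
near=> x; rewrite sub0r normrN ger0_norm ?powR_ge0//.
have x0 : 0 < x by near: x; exact: nbhs_right_gt.
have -> : e = (e `^ a^-1) `^ a by rewrite -powRrM mulVf ?gt_eqF// powRr1// ltW.
rewrite gt0_ltr_powR// ?nnegrE ?powR_ge0 ?ltW//.
by near: x; apply: nbhs_right_lt; rewrite powR_gt0.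
Unshelve. all: by end_near. Qed.

Lemma integral_powR0 (b c : R) : 0 < b -> 0 < c ->
  (\int[mu]_(x in `]0%R, b[) (x `^ (c - 1))%:E = (b `^ c / c)%:E)%E.
Proof.
move=> b0 c0; rewrite (@ge0_FTC_oo _ (fun x => c^-1 * x `^ c) 0 b 0 (b `^ c / c))//.
- by rewrite subr0.
- by move=> x; rewrite in_itv/= => /andP[x0 _]; exact: continuous_powR_gt0.
- by move=> x _; rewrite powR_ge0.
- move=> x; rewrite in_itv/= => /andP[x0 _].
  have H := is_deriveZ c^-1 (is_derive_powR c x0).
  apply: (is_derive_eq H); rewrite /GRing.scale/= mulrA mulVf ?mul1r// gt_eqF//.
- have H := powR_cvg0_right c0.
  by rewrite -[X in _ --> X](mulr0 c^-1); apply: cvgM; [exact: cvg_cst|exact: H].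
- rewrite mulrC; apply: cvgM; first exact: cvg_cst.
  apply: cvg_at_left_filter; exact: continuous_powR_gt0.
Qed.

Lemma powR_cvg0_pinfty (a : R) : 0 < a -> x `^ (- a) @[x --> +oo] --> (0 : R).
Proof.
move=> a0; apply/cvgrPdist_lt => e e0.
near=> x; rewrite sub0r normrN ger0_norm ?powR_ge0//.
have x0 : 0 < x by near: x; exact: nbhs_pinfty_gt.
have -> : e = ((e^-1) `^ a^-1) `^ (- a).
  by rewrite powRN -powRrM mulVf ?gt_eqF// powRr1 ?invrK// invr_ge0 ltW.
rewrite !powRN ltf_pV2 ?posrE ?powR_gt0 ?invr_gt0//.
suff : e^-1 `^ a^-1 < x by move=> h; rewrite gt0_ltr_powR ?nnegrE ?powR_ge0 ?(ltW x0).
near: x; apply: nbhs_pinfty_gt; exact: num_real.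
Unshelve. all: by end_near. Qed.

Lemma integral_powRy (e s : R) : 0 < e -> 0 < s ->
  (\int[mu]_(x in `]e, +oo[) (x `^ (- 1 - s))%:E = (e `^ (- s) / s)%:E)%E.
Proof.
move=> e0 s0.
have cF x : e <= x -> {for x, continuous (fun y : R => y `^ (- 1 - s))}.
  by move=> ex; apply: continuous_powR_gt0; exact: lt_le_trans ex.
have dF x : e <= x -> is_derive x 1 (fun x => - s^-1 * x `^ (- s)) (x `^ (- 1 - s)).
  move=> ex; have x0 : 0 < x by exact: lt_le_trans ex.
  have H := is_deriveZ (- s^-1) (is_derive_powR (- s) x0).
  apply: (is_derive_eq H); rewrite /GRing.scale/= (_ : - s - 1 = - 1 - s); last by ring.
  by field; rewrite gt_eqF.
rewrite integral_itv_obnd_cbnd; last first.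
  by apply/measurable_EFinP; apply: measurable_funTS; exact: measurable_powR.
rewrite (@ge0_continuous_FTC2y _ _ (fun x => - s^-1 * x `^ (- s)) e 0)//.
- by rewrite -EFinB; congr EFin; rewrite sub0r mulNr opprK mulrC.
- by move=> x _; rewrite powR_ge0.
- by apply: continuous_in_subspaceT => x /set_mem/=; rewrite in_itv/= andbT; exact: cF.
- rewrite -(mulr0 (- s^-1)); apply: cvgM; [exact: cvg_cst|exact: powR_cvg0_pinfty].
- by move=> x ex; have [] := dF x (ltW ex).
- apply: cvg_at_right_filter.
  by have [+ _] := dF e (lexx _); move=> /derivable1_diffP/differentiable_continuous.
- by move=> x; rewrite in_itv/= andbT => /ltW ex; rewrite derive1E; have [_ ->] := dF x ex.
Qed.

Lemma is_derive_powR_sub (a r x : R) : x < r ->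
  is_derive x 1 (fun y => (r - y) `^ a) (- (a * (r - x) `^ (a - 1))).
Proof.
move=> xr.
have rx : 0 < r - x by rewrite subr_gt0.
have H1 : is_derive x 1 (fun y : R => r - y) (-1).
  have H := is_deriveB (is_derive_cst r x 1) (is_derive_id x (1:R)).
  by apply: (is_derive_eq H); rewrite sub0r.
have := @is_derive1_comp _ (fun y => y `^ a) (fun y : R => r - y) x _ _
  (is_derive_powR a rx) H1.
by move=> H; apply: (is_derive_eq H); rewrite mulrN1.
Qed.

Lemma cvg_powR_sub_left (a r : R) : 0 < a -> (r - x) `^ a @[x --> r^'-] --> (0 : R).
Proof.
move=> a0; apply/cvgrPdist_lt => e e0.
have := powR_cvg0_right a0 => /cvgrPdist_lt/(_ _ e0) [d /= d0 H].
exists d => //= x /= rx xr; apply: H => /=; last by rewrite subr_gt0.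
by rewrite sub0r normrN.
Qed.

(** The singular weight [(r - y) `^ (s - 1)] is annihilated, up to the boundary
    term at [e], by the fractional difference kernel [y `^ (- 1 - s)]: the
    product has the antiderivative [- y `^ (- s) * (r - y) `^ s / (s * r)]. *)
Lemma integral_beta (s e r : R) : 0 < s -> 0 < e -> e < r ->
  (\int[mu]_(y in `]e, r[) ((r - y) `^ (s - 1) * y `^ (- 1 - s))%:E =
   (e `^ (- s) * (r - e) `^ s / (s * r))%:E)%E.
Proof.
move=> s0 e0 er; have r0 : 0 < r by exact: lt_trans er.
have dF x : x \in `]e, r[ -> is_derive x 1
    (fun y => - (s * r)^-1 * (y `^ (- s) * (r - y) `^ s))
    ((r - x) `^ (s - 1) * x `^ (- 1 - s)).
  rewrite in_itv/= => /andP[ex xr]; have x0 : 0 < x by exact: lt_trans ex.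
  have H := is_deriveZ (- (s * r)^-1)
    (is_deriveM (is_derive_powR (- s) x0) (is_derive_powR_sub s xr)).
  apply: (is_derive_eq H); rewrite /GRing.scale/=.
  have -> : x `^ (- s) = x * x `^ (- 1 - s).
    by rewrite -powRD1//; congr (_ `^ _); ring.
  have -> : (r - x) `^ s = (r - x) * (r - x) `^ (s - 1).
    by rewrite -powRD1 ?subr_gt0// subrK.
  have -> : - s - 1 = - 1 - s by ring.
  by field; rewrite !gt_eqF.
have cf x : x \in `]e, r[ -> {for x, continuous (fun y : R => (r - y) `^ (s - 1) * y `^ (- 1 - s))}.
  rewrite in_itv/= => /andP[ex xr]; have x0 : 0 < x by exact: lt_trans ex.
  apply: (@continuousM _ _ (fun y : R => (r - y) `^ (s - 1))); last exact: continuous_powR_gt0.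
  have [+ _] := is_derive_powR_sub (s - 1) xr.
  by move=> /derivable1_diffP/differentiable_continuous.
rewrite (@ge0_FTC_oo _ (fun y => - (s * r)^-1 * (y `^ (- s) * (r - y) `^ s)) e r
  (- (s * r)^-1 * (e `^ (- s) * (r - e) `^ s)) (- (s * r)^-1 * (r `^ (- s) * 0)))//.
- by congr EFin; field; rewrite !gt_eqF.
- by move=> x _; rewrite mulr_ge0 ?powR_ge0.
- apply: cvgM; first exact: cvg_cst.
  apply: cvgM; first by apply: cvg_at_right_filter; exact: continuous_powR_gt0.
  apply: cvg_at_right_filter; have [+ _] := is_derive_powR_sub s er.
  by move=> /derivable1_diffP/differentiable_continuous.
- apply: cvgM; first exact: cvg_cst.
  apply: cvgM; first by apply: cvg_at_left_filter; exact: continuous_powR_gt0.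
  exact: cvg_powR_sub_left.
Qed.

Lemma integral_powR_sub (s a r : R) : 0 < s -> a < r ->
  (\int[mu]_(y in `]a, r[) ((r - y) `^ (s - 1))%:E = ((r - a) `^ s / s)%:E)%E.
Proof.
move=> s0 ar.
have dF x : x < r -> is_derive x 1 (fun y => - s^-1 * (r - y) `^ s) ((r - x) `^ (s - 1)).
  move=> xr; have H := is_deriveZ (- s^-1) (is_derive_powR_sub s xr).
  by apply: (is_derive_eq H); rewrite /GRing.scale/=; field; rewrite gt_eqF.
rewrite (@ge0_FTC_oo _ (fun y => - s^-1 * (r - y) `^ s) a r
  (- s^-1 * (r - a) `^ s) (- s^-1 * 0))//.
- by congr EFin; ring.
- move=> x; rewrite in_itv/= => /andP[ax xr].
  have [+ _] := is_derive_powR_sub (s - 1) xr.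
  by move=> /derivable1_diffP/differentiable_continuous.
- by move=> x _; rewrite powR_ge0.
- by move=> x; rewrite in_itv/= => /andP[ax xr]; exact: dF.
- apply: cvg_at_right_filter; have [+ _] := dF a ar.
  by move=> /derivable1_diffP/differentiable_continuous.
- by apply: cvgM; [exact: cvg_cst|exact: cvg_powR_sub_left].
Qed.

End calculus.

(** * Integration over R^n *)

Section tuple_integration.
Context {R : realType}.
Local Notation RR := (measurableTypeR R).
Local Notation mu := (@lebesgue_measure R).
Local Open Scope ereal_scope.

Lemma integral_tuple_cons n (f : n.+1.-tuple RR -> \bar R) :
  measurable_fun setT f -> (forall z, 0 <= f z) ->
  \int[lebesgue_tuple n.+1]_z f z =
  \int[mu]_x \int[lebesgue_tuple n]_z f (tcons (x, z)).
Proof.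
move=> mf f0.
have mt := @measurable_tcons R n.
transitivity (\int[pushforward (mu \x lebesgue_tuple n) (@tcons R n)]_z f z) => //.
rewrite ge0_integral_pushforward//= preimage_setT.
rewrite fubini_tonelli1//=; exact: measurableT_comp.
Qed.

Lemma tnth_tcons0 n (x : RR) (z : n.-tuple RR) : tnth (tcons (x, z)) ord0 = x.
Proof. by []. Qed.

Lemma tnth_tconsS n (x : RR) (z : n.-tuple RR) i :
  tnth (tcons (x, z)) (lift ord0 i) = tnth z i.
Proof. by rewrite !(tnth_nth x). Qed.

Lemma measurable_tnth_comp n (f : R -> R) (i : 'I_n) : measurable_fun setT f ->
  measurable_fun setT (fun z : n.-tuple RR => f (tnth z i)).
Proof. by move=> mf; apply: (measurableT_comp mf); exact: measurable_tnth. Qed.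

Lemma integral_tuple_prod n (f : 'I_n -> R -> R) (c : 'I_n -> R) :
  (forall i, measurable_fun setT (f i)) -> (forall i x, (0 <= f i x)%R) ->
  (forall i, \int[mu]_x (f i x)%:E = (c i)%:E) ->
  \int[lebesgue_tuple n]_z (\prod_(i < n) f i (tnth z i))%R%:E = (\prod_(i < n) c i)%R%:E.
Proof.
elim: n f c => [|n IH] f c mf f0 fc.
  rewrite [LHS](_ : _ = \int[\d_([tuple] : 0.-tuple RR)]_z (fun=> 1) z); last first.
    by apply: eq_integral => z _; rewrite big_ord0.
  by rewrite integral_dirac// diracT mul1e big_ord0.
rewrite integral_tuple_cons; last 2 first.
- apply/measurable_EFinP; apply: measurable_prod => i _.
  exact: (measurable_tnth_comp i (mf i)).
- by move=> z; rewrite lee_fin prodr_ge0.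
under eq_integral => x _.
  under eq_integral => z _.
    rewrite big_ord_recl tnth_tcons0 EFinM.
    under eq_bigr do rewrite tnth_tconsS.
    over.
  rewrite ge0_integralZl_EFin//; last 2 first.
  - by move=> z _; rewrite lee_fin prodr_ge0.
  - apply/measurable_EFinP; apply: measurable_prod => i _.
    exact: measurable_tnth_comp.
  rewrite (IH (fun i => f (lift ord0 i)) (fun i => c (lift ord0 i)))//.
  over.
rewrite ge0_integralZr//; last 3 first.
- by apply/measurable_EFinP; exact: mf.
- by move=> x _; rewrite lee_fin.
- rewrite lee_fin prodr_ge0// => i _; rewrite -lee_fin -fc.
  by apply: integral_ge0 => x _; rewrite lee_fin.
by rewrite fc -EFinM big_ord_recl.
Qed.

Definition tuple_opp n (z : n.-tuple RR) : n.-tuple RR := [tuple of map -%R z].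

Lemma tnth_opp n (z : n.-tuple RR) i : tnth (tuple_opp z) i = (- tnth z i)%R.
Proof. by rewrite tnth_map. Qed.

Lemma measurable_tuple_opp n : measurable_fun setT (@tuple_opp n).
Proof.
apply/measurable_fun_tnthP => i.
rewrite (_ : _ \o _ = -%R \o (@tnth n RR)^~ i); last first.
  by apply/funext => z /=; rewrite tnth_opp.
apply: measurableT_comp; [exact: oppr_measurable|exact: measurable_tnth].
Qed.

Lemma ge0_integral_tuple_opp n (f : n.-tuple RR -> \bar R) :
  measurable_fun setT f -> (forall z, 0 <= f z) ->
  \int[lebesgue_tuple n]_z f (tuple_opp z) = \int[lebesgue_tuple n]_z f z.
Proof.
elim: n f => [|n IH] f mf f0.
  by apply: eq_integral => z _; congr f; rewrite [LHS]tuple0 [RHS]tuple0.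
have mfo : measurable_fun setT (f \o @tuple_opp n.+1).
  by apply: measurableT_comp => //; exact: measurable_tuple_opp.
have mt := @measurable_tcons R n.
rewrite !integral_tuple_cons//.
have oE x z : tuple_opp (tcons (x, z)) = tcons ((- x)%R, tuple_opp z) :> n.+1.-tuple RR.
  by apply/val_inj.
pose h (x : RR) := \int[lebesgue_tuple n]_z f (tcons (x, z)).
transitivity (\int[mu]_x h (- x)%R).
  apply: eq_integral => x _; under eq_integral do rewrite oE.
  rewrite (IH (fun z => f (tcons ((- x)%R, z))))//.
  apply: (measurableT_comp mf); apply: (measurableT_comp mt).
  exact: measurable_fun_pair.
apply: ge0_integral_reflect; last by move=> x; apply: integral_ge0.
have mf' : measurable_fun (setT `*` setT) (f \o @tcons R n).
  by rewrite setXTT; exact: measurableT_comp.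
by apply: (@measurable_int_on R _ _ _ _ (lebesgue_tuple n) setT setT (f \o @tcons R n)) => // x _ /=; exact: f0.
Qed.

End tuple_integration.

(** * Gaussians *)

Section gaussian.
Context {R : realType}.
Local Notation RR := (measurableTypeR R).
Local Notation mu := (@lebesgue_measure R).

Lemma measurable_invr : measurable_fun [set: R] (fun x : R => x^-1).
Proof.
rewrite (_ : (fun _ => _) = (fun x : R => x * (x ^+ 2) `^ (-1))); last first.
  apply/funext => x; rewrite powR_inv1 ?sqr_ge0//.
  by have [->|x0] := eqVneq x 0; [rewrite invr0 mul0r|field].
apply: measurable_funM => //; apply: (measurableT_comp (measurable_powR _)).
exact: measurable_funX.
Qed.

Definition gauss1 (t x : R) : R := (Num.sqrt (4 * pi * t))^-1 * expR (- (x ^+ 2 / (4 * t))).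

Lemma gauss1_ge0 t x : 0 <= gauss1 t x.
Proof. by rewrite mulr_ge0 ?expR_ge0// invr_ge0 sqrtr_ge0. Qed.

Lemma measurable_gauss1 t : measurable_fun setT (gauss1 t).
Proof.
apply: measurable_funM => //; apply: (measurableT_comp (@measurable_expR R)) => //.
by apply: measurable_funN; apply: measurable_funM => //; exact: measurable_funX.
Qed.

Lemma gauss1_normal (m v x : R) : 0 < v ->
  gauss1 v (x - m) = normal_pdf m (Num.sqrt (2 * v)) x.
Proof.
move=> v0; rewrite normal_pdfE ?gt_eqF ?sqrtr_gt0 ?mulr_gt0//.
rewrite /normal_peak /normal_fun sqr_sqrtr ?mulr_ge0 ?ltW//; congr (_ * _).
  by congr ((Num.sqrt _)^-1); ring.
by congr expR; field; rewrite gt_eqF.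
Qed.

Lemma integral_gauss1 v : 0 < v -> (\int[mu]_x (gauss1 v x)%:E = 1)%E.
Proof.
move=> v0; rewrite -(integral_normal_pdf 0 (Num.sqrt (2 * v))).
by apply: eq_integral => x _; rewrite -gauss1_normal// subr0.
Qed.

(** Completion of the square in the exponent. *)
Lemma gauss1_conv (v t a x : R) : 0 < v -> 0 < t ->
  gauss1 v x * gauss1 t (a + x) =
  gauss1 (v + t) a * gauss1 (v * t / (v + t)) (x - (- (a * v / (v + t)))).
Proof.
move=> v0 t0; have vt : 0 < v + t by exact: addr_gt0.
rewrite /gauss1 mulrACA [RHS]mulrACA -!expRD -!invfM -!sqrtrM ?mulr_ge0 ?pi_ge0 ?ltW//.
congr ((Num.sqrt _)^-1 * expR _); field.
  by rewrite gt_eqF.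
by rewrite !gt_eqF.
Qed.

Lemma integral_gauss1_conv (v t a : R) : 0 < v -> 0 < t ->
  (\int[mu]_x (gauss1 v x * gauss1 t (a + x))%:E = (gauss1 (v + t) a)%:E)%E.
Proof.
move=> v0 t0; have vt : 0 < v * t / (v + t) by rewrite divr_gt0 ?mulr_gt0 ?addr_gt0.
under eq_integral do rewrite gauss1_conv// EFinM gauss1_normal//.
rewrite ge0_integralZl_EFin ?gauss1_ge0//.
- by rewrite integral_normal_pdf mule1.
- by move=> x _; rewrite lee_fin normal_pdf_ge0.
- by apply/measurable_EFinP; exact: measurable_normal_pdf.
Qed.

Section dim.
Variable k : nat.
Local Notation Rk := (k.-tuple RR).

(** The heat kernel of R^k at time [t], as a function of the squared norm. *)
Definition heat (t q : R) : R := (4 * pi * t) `^ (- (k%:R / 2)) * expR (- (q / (4 * t))).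

Definition sqnorm (z : Rk) : R := \sum_(i < k) tnth z i ^+ 2.

Lemma sqnorm_ge0 z : 0 <= sqnorm z.
Proof. by apply: sumr_ge0 => i _; exact: sqr_ge0. Qed.

Lemma heat_ge0 t q : 0 <= heat t q.
Proof. by rewrite mulr_ge0 ?powR_ge0 ?expR_ge0. Qed.

Lemma heat_gt0 t q : 0 < t -> 0 < heat t q.
Proof. by move=> t0; rewrite mulr_gt0 ?powR_gt0 ?expR_gt0// !mulr_gt0 ?pi_gt0. Qed.

Lemma sqrt_powR_half (x : R) : 0 <= x ->
  (Num.sqrt x)^-1 ^+ k = x `^ (- (k%:R / 2)).
Proof.
move=> x0; rewrite powRN (mulrC k%:R) powRrM powR12_sqrt// powR_mulrn ?sqrtr_ge0//.
by rewrite exprVn.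
Qed.

Lemma heat_prod t (a : 'I_k -> R) : 0 < t ->
  \prod_(i < k) gauss1 t (a i) = heat t (\sum_(i < k) a i ^+ 2).
Proof.
move=> t0; rewrite big_split/= prodr_const card_ord sqrt_powR_half; last first.
  by rewrite !mulr_ge0 ?pi_ge0 ?ltW.
by congr (_ * _); rewrite -expR_sum sumrN -mulr_suml.
Qed.

Lemma heatD t p q : heat t (p + q) = expR (- (p / (4 * t))) * heat t q.
Proof. by rewrite /heat [(p + q) / _]mulrDl opprD expRD; ring. Qed.

Lemma integral_heat t : 0 < t -> (\int[lebesgue_tuple k]_z (heat t (sqnorm z))%:E = 1)%E.
Proof.
move=> t0; under eq_integral do rewrite -(heat_prod (fun i => tnth _ i))//.
rewrite (@integral_tuple_prod _ _ (fun=> gauss1 t) (fun=> 1))//.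
- by rewrite big1.
- by move=> _; exact: measurable_gauss1.
- by move=> _ x; exact: gauss1_ge0.
- by move=> _; exact: integral_gauss1.
Qed.

Lemma integral_heat_conv v t (a : 'I_k -> R) : 0 < v -> 0 < t ->
  (\int[lebesgue_tuple k]_z (heat v (sqnorm z) * heat t (\sum_i (a i + tnth z i) ^+ 2))%:E
   = (heat (v + t) (\sum_i a i ^+ 2))%:E)%E.
Proof.
move=> v0 t0; rewrite -heat_prod ?addr_gt0//.
under eq_integral do rewrite -(heat_prod (fun i => tnth _ i))// -heat_prod// -big_split/=.
rewrite (@integral_tuple_prod _ _ (fun i x => gauss1 v x * gauss1 t (a i + x))
   (fun i => gauss1 (v + t) (a i)))//.
- move=> i; apply: measurable_funM; first exact: measurable_gauss1.
  by apply: (measurableT_comp (measurable_gauss1 t)); exact: measurable_funD.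
- by move=> i x; rewrite mulr_ge0// gauss1_ge0.
- by move=> i; exact: integral_gauss1_conv.
Qed.

Lemma measurable_sqnorm : measurable_fun setT sqnorm.
Proof.
apply: measurable_sum => i; apply: (@measurable_tnth_comp R k (fun x => x ^+ 2)).
exact: measurable_funX.
Qed.

Lemma measurable_heat d (T : measurableType d) (D : set T) (f g : T -> R) :
  measurable_fun D f -> measurable_fun D g ->
  measurable_fun D (fun x => heat (f x) (g x)).
Proof.
move=> mf mg; apply: measurable_funM.
  by apply: (measurableT_comp (measurable_powR _)); exact: measurable_funM.
apply: (measurableT_comp (@measurable_expR R)); apply: measurable_funN.
apply: measurable_funM => //; apply: (measurableT_comp measurable_invr).
exact: measurable_funM.
Qed.

End dim.
End gaussian.

(** * Powers as superpositions of exponentials *)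

Section subordination.
Context {R : realType}.
Local Notation RR := (measurableTypeR R).
Local Notation mu := (@lebesgue_measure R).

Lemma powR_le_expR (m y : R) : 0 < m -> 0 <= y -> y `^ m <= m `^ m * expR y.
Proof.
move=> m0 y0; have -> : expR y = expR (y / m) `^ m.
  by rewrite -expRM divfK// gt_eqF.
rewrite -powRM ?expR_ge0 ?(ltW m0)//.
apply: (ge0_ler_powR (ltW m0)); rewrite ?nnegrE ?mulr_ge0 ?expR_ge0 ?(ltW m0)//.
rewrite -ler_pdivrMl//; apply: le_trans (expR_ge1Dx _).
by rewrite mulrC lerDr.
Qed.

Lemma powR_inv (x c : R) : 0 <= x -> (x^-1) `^ c = x `^ (- c).
Proof. by move=> x0; rewrite -(powR_inv1 x0) -powRrM mulN1r. Qed.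

(** The integrand of a superposition of exponentials [expR (- (q / (4 * t)))]
    which is a multiple of [q `^ (- a)]. *)
Definition levy (a q t : R) : R := t `^ (- a - 1) * expR (- (q / (4 * t))).

Lemma levy_ge0 a q t : 0 <= levy a q t.
Proof. by rewrite mulr_ge0 ?powR_ge0 ?expR_ge0. Qed.

Lemma measurable_levy a q : measurable_fun setT (levy a q).
Proof.
apply: measurable_funM; first exact: measurable_powR.
apply: (measurableT_comp (@measurable_expR R)); apply: measurable_funN.
by apply: measurable_funM => //; apply: (measurableT_comp measurable_invr); exact: measurable_funM.
Qed.

Definition levy_mass (a : R) : R := fine (\int[mu]_(t in `]0%R, +oo[) (levy a 1 t)%:E)%E.

(** At small times the exponential beats the power, at large times the power is
    integrable. *)
Lemma levy_mass_lty (a : R) : 0 < a -> (\int[mu]_(t in `]0%R, +oo[) (levy a 1 t)%:E < +oo)%E.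
Proof.
move=> a0; have a1 : 0 < a + 1 by rewrite addr_gt0.
have mE (D : set R) : measurable_fun D (fun t => (levy a 1 t)%:E).
  by apply/measurable_EFinP; apply: measurable_funTS; exact: measurable_levy.
rewrite (_ : `]0%R, +oo[%classic = `]0%R, 1%R] `|` `]1%R, +oo[); last first.
  by rewrite -itv_bndbnd_setU// bnd_simp.
rewrite ge0_integral_setU//=; last 3 first.
- exact: mE.
- by move=> t _; rewrite lee_fin levy_ge0.
- rewrite disj_set2E; apply/eqP/seteqP; split => t //=.
  by rewrite !in_itv/= => -[/andP[_ t1] /andP[]]; rewrite ltNge t1.
apply: lte_add_pinfty.
- pose C := (4 * (a + 1)) `^ (a + 1).
  apply: (@le_lt_trans _ _ (\int[mu]_(t in `]0%R, 1%R]) C%:E)%E).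
    apply: ge0_le_integral => //.
    - by move=> t _; rewrite lee_fin levy_ge0.
    - exact: mE.
    - move=> t /=; rewrite in_itv/= lee_fin => /andP[t0 t1].
      have := @powR_le_expR (a + 1) (1 / (4 * t)) a1.
      rewrite divr_ge0 ?mulr_ge0 ?(ltW t0)// => /(_ isT) H.
      rewrite /levy expRN ler_pdivrMr ?expR_gt0//.
      have -> : - a - 1 = - (a + 1) by ring.
      have t4 : 0 < 4 * t by rewrite mulr_gt0.
      have -> : t `^ (- (a + 1)) = 4 `^ (a + 1) * (1 / (4 * t)) `^ (a + 1).
        rewrite -powRM ?divr_ge0 ?(ltW t4)//.
        have -> : 4 * (1 / (4 * t)) = t^-1 by field; rewrite gt_eqF.
        by rewrite powR_inv// ltW.
      rewrite /C powRM// ?(ltW a1)// -mulrA; exact: ler_wpM2l (powR_ge0 _ _) _ _ H.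
  rewrite integral_cst//= lebesgue_measure_itv/= lte_fin ltr01 -EFinB -EFinM ltry//.
- apply: (@le_lt_trans _ _ (\int[mu]_(t in `]1%R, +oo[) (t `^ (- 1 - a))%:E)%E).
    apply: ge0_le_integral => //.
    - by move=> t _; rewrite lee_fin levy_ge0.
    - exact: mE.
    - by apply/measurable_EFinP; apply: measurable_funTS; exact: measurable_powR.
    - move=> t /=; rewrite in_itv/= lee_fin andbT => t1.
      rewrite /levy (addrC (- 1)) ler_piMr ?powR_ge0// expR_le1 oppr_le0.
      by rewrite divr_ge0// mulr_ge0// ltW// (lt_trans ltr01).
  by rewrite integral_powRy// ltry.
Qed.

Lemma levy_mass_gt0 (a : R) : 0 < a -> 0 < levy_mass a.
Proof.
move=> a0; have mE (D : set R) : measurable_fun D (fun t => (levy a 1 t)%:E).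
  by apply/measurable_EFinP; apply: measurable_funTS; exact: measurable_levy.
have fnum : (\int[mu]_(t in `]0%R, +oo[) (levy a 1 t)%:E)%E \is a fin_num.
  rewrite ge0_fin_numE; first exact: levy_mass_lty.
  by apply: integral_ge0 => t _; rewrite lee_fin levy_ge0.
rewrite -lte_fin fineK//.
pose c : R := 2 `^ (- a - 1) * expR (- 1).
have c0 : 0 < c by rewrite mulr_gt0 ?powR_gt0 ?expR_gt0.
apply: (@lt_le_trans _ _ (\int[mu]_(t in `[1%R, 2%R]) c%:E)%E).
  rewrite integral_cst//= lebesgue_measure_itv/= lte_fin ltr1n -EFinB -EFinM lte_fin.
  by rewrite mulr_gt0// subr_gt0 ltr1n.
apply: (@le_trans _ _ (\int[mu]_(t in `[1%R, 2%R]) (levy a 1 t)%:E)%E).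
  apply: ge0_le_integral => //.
  - by move=> t _; rewrite lee_fin ltW.
  - exact: mE.
  - move=> t /=; rewrite in_itv/= lee_fin => /andP[t1 t2].
    have t0 : 0 < t by exact: lt_le_trans t1.
    rewrite ler_pM ?powR_ge0 ?expR_ge0//.
      have -> : - a - 1 = - (a + 1) by ring.
      rewrite !powRN lef_pV2 ?posrE ?powR_gt0//.
      by apply: ge0_ler_powR => //; rewrite ?nnegrE ?ltW// addr_gt0.
    rewrite ler_expR lerN2 ler_pdivrMr ?mulr_gt0// mul1r.
    by rewrite (le_trans t1)// ler_peMl ?ltW// ltr1n.
apply: ge0_subset_integral => //.
- exact: mE.
- by move=> t _; rewrite lee_fin levy_ge0.
- by move=> t /=; rewrite !in_itv/= andbT => /andP[t1 _]; exact: lt_le_trans t1.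
Qed.

(** The scaling identity behind both the stable subordination of the kernel
    and the representation of powers of [1 + |x|^2] as mixtures of Gaussians. *)
Lemma integral_levy (a q : R) : 0 < a -> 0 < q ->
  (\int[mu]_(t in `]0%R, +oo[) (levy a q t)%:E = (levy_mass a * q `^ (- a))%:E)%E.
Proof.
move=> a0 q0.
pose f q t := ((levy a q t)%:E * (\1_(`]0%R, +oo[%classic : set R) t)%:E)%E.
have fE p : (\int[mu]_(t in `]0%R, +oo[) (levy a p t)%:E = \int[mu]_t f p t)%E.
  rewrite integral_mkcond; apply: eq_integral => t _; rewrite /f patchE indicE.
  by case: ifP => _; rewrite ?mule1 ?mule0.
rewrite fE -(ge0_integral_dilate q0); last 2 first.
- apply: emeasurable_funM; first by apply/measurable_EFinP; exact: measurable_levy.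
  by apply/measurable_EFinP; exact: measurable_indic.
- by move=> t; rewrite mule_ge0// lee_fin ?levy_ge0.
have -> : (\int[mu]_t f q (q * t)%R = (q `^ (- a - 1))%:E * \int[mu]_(t in `]0%R, +oo[) (levy a 1 t)%:E)%E.
  rewrite fE -ge0_integralZl_EFin ?powR_ge0//; last 2 first.
  - by move=> t _; rewrite mule_ge0// lee_fin ?levy_ge0.
  - apply: emeasurable_funM; first by apply/measurable_EFinP; exact: measurable_levy.
    by apply/measurable_EFinP; exact: measurable_indic.
  apply: eq_integral => t _; rewrite /f !indicE !mem_setE !in_itv/= !andbT pmulr_rgt0//.
  case: ltP => [t0|]; rewrite ?mule0// !mule1 -EFinM /levy.
  rewrite powRM ?ltW// -mulrA; congr (_ * (_ * expR (- _)))%:E.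
  by field; rewrite !gt_eqF.
rewrite -(fineK (_ : (\int[mu]_(t in `]0%R, +oo[) (levy a 1 t)%:E)%E \is a fin_num)); last first.
  rewrite ge0_fin_numE; first exact: levy_mass_lty.
  by apply: integral_ge0 => t _; rewrite lee_fin levy_ge0.
by rewrite -!EFinM mulrA -powRD1// subrK mulrC.
Qed.

End subordination.

(** * Subordination of the fractional kernel *)

Section kernel.
Context {R : realType} (k : nat) (s : R).
Hypotheses (s0 : 0 < s) (s1 : s < 1).
Local Notation RR := (measurableTypeR R).
Local Notation Rk := (k.-tuple RR).
Local Notation mu := (@lebesgue_measure R).
Local Notation Lk := (@lebesgue_tuple R k).
Local Open Scope ereal_scope.

Lemma enorm_vec (z : Rk) : enorm (vec z) = Num.sqrt (sqnorm z).
Proof.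
by congr Num.sqrt; apply: eq_bigr => i _; rewrite !mxE -expr2.
Qed.

Lemma frac_kernelE (z : Rk) :
  frac_kernel s z = (sqnorm z `^ (- (k%:R / 2 + s)))%R.
Proof.
rewrite /frac_kernel enorm_vec powRN -(powR12_sqrt (sqnorm_ge0 z)) -powRrM.
by congr ((_ `^ _)^-1)%R; field.
Qed.

Lemma frac_kernel_ge0 (z : Rk) : (0 <= frac_kernel s z)%R.
Proof. by rewrite frac_kernelE powR_ge0. Qed.

Lemma measurable_frac_kernel : measurable_fun setT (frac_kernel s : Rk -> R).
Proof.
rewrite (funext frac_kernelE); apply: (measurableT_comp (measurable_powR _)).
exact: measurable_sqnorm.
Qed.

(** The part of the kernel contributed by the times in [I] when it is written,
    by subordination, as a superposition of heat kernels. *)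
Definition kpart (I : set R) (z : Rk) : \bar R :=
  \int[mu]_(t in I) (heat k t (sqnorm z) * t `^ (- 1 - s))%:E.

Definition ckernel : R := ((4 * pi) `^ (k%:R / 2) / levy_mass (k%:R / 2 + s))%R.

Lemma k2s_gt0 : (0 < k%:R / 2 + s :> R)%R.
Proof. by rewrite ltr_wpDl// divr_ge0. Qed.

Lemma ckernel_gt0 : (0 < ckernel)%R.
Proof.
by rewrite divr_gt0 ?levy_mass_gt0 ?k2s_gt0// powR_gt0// mulr_gt0// pi_gt0.
Qed.

Lemma heat_levy (t q : R) : (0 <= t)%R ->
  (heat k t q * t `^ (- 1 - s) =
   (4 * pi) `^ (- (k%:R / 2)) * levy (k%:R / 2 + s) q t)%R.
Proof.
move=> t0; rewrite /heat /levy powRM ?mulr_ge0 ?pi_ge0//.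
have [->|tn0] := eqVneq t 0%R.
  rewrite (powR0 (_ : - 1 - s != 0)%R) ?mulr0; last first.
    by rewrite -opprD oppr_eq0 gt_eqF// addr_gt0.
  rewrite (powR0 (_ : - (k%:R / 2 + s) - 1 != 0)%R) ?mul0r ?mulr0//.
  by rewrite -opprD oppr_eq0 gt_eqF// addr_gt0 ?k2s_gt0.
have -> : (- (k%:R / 2 + s) - 1 = - (k%:R / 2) + (- 1 - s))%R by ring.
rewrite (@powRD _ t (- (k%:R / 2)) (- 1 - s)); last by apply/implyP => _.
ring.
Qed.

Lemma kernel_kpart (z : Rk) : (0 < sqnorm z)%R ->
  (frac_kernel s z)%:E = ckernel%:E * kpart `]0%R, +oo[ z.
Proof.
move=> z0; rewrite /kpart.
under eq_integral => t.
  rewrite inE/= in_itv/= andbT => /ltW t0; rewrite heat_levy// EFinM; over.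
rewrite ge0_integralZl_EFin ?powR_ge0//; last 2 first.
- by move=> t _; rewrite lee_fin levy_ge0.
- by apply/measurable_EFinP; apply: measurable_funTS; exact: measurable_levy.
rewrite integral_levy ?k2s_gt0// -!EFinM frac_kernelE /ckernel; congr EFin.
rewrite [((4 * pi) `^ (- _))%R]powRN; field.
rewrite !gt_eqF ?levy_mass_gt0 ?k2s_gt0//.
by rewrite powR_gt0// mulr_gt0// pi_gt0.
Qed.

Lemma kpart_ge0 I z : 0 <= kpart I z.
Proof. by apply: integral_ge0 => t _; rewrite lee_fin mulr_ge0 ?heat_ge0 ?powR_ge0. Qed.

(** At the origin the power of 0 is 0 by convention, while the superposition
    diverges: only an inequality survives there. *)
Lemma le_kernel_kpart (z : Rk) :
  (frac_kernel s z)%:E <= ckernel%:E * kpart `]0%R, +oo[ z.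
Proof.
have [z0|z0] := ltP 0%R (sqnorm z); first by rewrite kernel_kpart.
rewrite frac_kernelE (_ : sqnorm z = 0%R); last first.
  by apply/eqP; rewrite eq_le z0 sqnorm_ge0.
rewrite powR0 ?oppr_eq0 ?gt_eqF ?k2s_gt0// mule_ge0 ?kpart_ge0//.
by rewrite lee_fin ltW ?ckernel_gt0.
Qed.

Lemma measurable_heat_powR (D : set (Rk * RR)) :
  measurable_fun D (fun p : Rk * RR => (heat k p.2 (sqnorm p.1) * p.2 `^ (- 1 - s))%R).
Proof.
apply: measurable_funTS; apply: measurable_funM.
  apply: measurable_heat; first exact: measurable_snd.
  apply: (measurableT_comp (@measurable_sqnorm R k)); exact: measurable_fst.
apply: (measurableT_comp (measurable_powR _)); exact: measurable_snd.
Qed.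

Lemma measurable_kpart (I : set R) (D : set Rk) : measurable I -> measurable_fun D (kpart I).
Proof.
move=> mI; apply: measurable_funTS.
apply: (@measurable_int_on R _ _ _ _ mu setT I
  (fun p : Rk * RR => (heat k p.2 (sqnorm p.1) * p.2 `^ (- 1 - s))%:E)) => //.
  by apply/measurable_EFinP; exact: measurable_heat_powR.
by move=> p _; rewrite lee_fin mulr_ge0 ?heat_ge0 ?powR_ge0.
Qed.

Lemma kpart_split (e : R) z : (0 < e)%R ->
  kpart `]0%R, +oo[ z = kpart `]0%R, e] z + kpart `]e, +oo[ z.
Proof.
move=> e0; rewrite /kpart (_ : `]0%R, +oo[%classic = `]0%R, e] `|` `]e, +oo[); last first.
  by rewrite -itv_bndbnd_setU// bnd_simp// ltW.
rewrite ge0_integral_setU//=.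
- apply/measurable_EFinP; apply: measurable_funM.
    by apply: measurable_heat => //; exact: measurable_cst.
  by apply: measurable_funTS; exact: measurable_powR.
- by move=> t _; rewrite lee_fin mulr_ge0 ?heat_ge0 ?powR_ge0.
- rewrite disj_set2E; apply/eqP/seteqP; split => t //=.
  by rewrite !in_itv/= => -[/andP[_ t1] /andP[]]; rewrite ltNge t1.
Qed.

Lemma integral_kpart (F : Rk -> R) (D : set Rk) (I : set R) :
  measurable D -> measurable I -> measurable_fun D F ->
  (forall z, D z -> (0 <= F z)%R) ->
  \int[Lk]_(z in D) ((F z)%:E * kpart I z) =
  \int[mu]_(t in I) ((t `^ (- 1 - s))%:E * \int[Lk]_(z in D) (F z * heat k t (sqnorm z))%:E).
Proof.
move=> mD mI mF F0.
have mF1 : measurable_fun (D `*` I) (fun p : Rk * RR => F p.1).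
  apply: (measurable_comp mD _ mF); last exact: measurable_funTS.
  by move=> _ [p [Dp _] <-].
transitivity (\int[Lk]_(z in D) \int[mu]_(t in I)
    (F z * (heat k t (sqnorm z) * t `^ (- 1 - s)))%:E).
  apply: eq_integral => z /set_mem Dz; rewrite /kpart -ge0_integralZl_EFin//.
  - by move=> t _; rewrite lee_fin mulr_ge0 ?heat_ge0 ?powR_ge0.
  - apply/measurable_EFinP; apply: measurable_funM.
      by apply: measurable_heat => //; exact: measurable_cst.
    by apply: measurable_funTS; exact: measurable_powR.
  - exact: F0.
rewrite (@tonelli_on R _ _ _ _ Lk mu D I (fun p : Rk * RR =>
    (F p.1 * (heat k p.2 (sqnorm p.1) * p.2 `^ (- 1 - s)))%:E))//; last 2 first.
- apply/measurable_EFinP; apply: measurable_funM => //.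
  exact: measurable_heat_powR.
- by move=> p [Dp _]; rewrite lee_fin !mulr_ge0 ?heat_ge0 ?powR_ge0 ?F0.
apply: eq_integral => t _; rewrite -ge0_integralZl_EFin ?powR_ge0//.
- by apply: eq_integral => z _; rewrite -EFinM; congr EFin; ring.
- by move=> z Dz; rewrite lee_fin mulr_ge0 ?heat_ge0 ?F0.
- apply/measurable_EFinP; apply: measurable_funM => //.
  apply: measurable_heat; first exact: measurable_cst.
  by apply: measurable_funTS; exact: measurable_sqnorm.
Qed.

Lemma integral_kpart_far (e : R) : (0 < e)%R ->
  \int[Lk]_z kpart `]e, +oo[ z = (e `^ (- s) / s)%:E.
Proof.
move=> e0; under eq_integral do rewrite -[kpart _ _]mul1e.
rewrite (@integral_kpart (fun=> 1%R))//.
rewrite -integral_powRy//; apply: eq_integral => t; rewrite inE/= in_itv/= andbT => et.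
under eq_integral do rewrite mul1r.
by rewrite integral_heat ?mule1//; exact: lt_trans et.
Qed.

(** Half of the exponent absorbs the factor [q]. *)
Lemma sqnorm_heat_le (t q : R) : (0 < t)%R -> (0 <= q)%R ->
  (q * heat k t q <= 8 * 2 `^ (k%:R / 2) * t * heat k (2 * t) q)%R.
Proof.
move=> t0 q0; rewrite /heat.
have pt : (0 <= 4 * pi * t :> R)%R by rewrite !mulr_ge0 ?pi_ge0 ?ltW.
have -> : ((4 * pi * (2 * t)) = 2 * (4 * pi * t) :> R)%R by ring.
rewrite (powRM _ (_ : 0 <= 2)%R pt)// [(2 `^ (- _))%R]powRN.
have -> : (- (q / (4 * t)) = - (q / (8 * t)) + - (q / (8 * t)))%R.
  by field; rewrite gt_eqF.
have -> : (4 * (2 * t) = 8 * t)%R by ring.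
rewrite expRD.
set P := (_ `^ - _)%R; set E := expR _.
have P0 : (0 <= P)%R by exact: powR_ge0.
have E0 : (0 <= E)%R by exact: expR_ge0.
have -> : (8 * 2 `^ (k%:R / 2) * t * ((2 `^ (k%:R / 2))^-1 * P * E) = (8 * t) * (P * E))%R.
  by field; rewrite gt_eqF// powR_gt0.
have -> : (q * (P * (E * E)) = q * E * (P * E))%R by ring.
rewrite ler_wpM2r ?mulr_ge0// /E expRN ler_pdivrMr ?expR_gt0//.
rewrite -ler_pdivrMl ?mulr_gt0// mulrC.
by apply: le_trans (expR_ge1Dx _); rewrite lerDr.
Qed.

(** The heat kernel of time [t] has a second moment of order [t], so that the
    short times have one of order [e `^ (1 - s)]. Against increments that are
    linear up to a quadratic remainder this is the error made by truncating. *)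
Lemma near_moment : exists2 C : R, (0 <= C)%R & forall e : R, (0 < e)%R ->
  \int[Lk]_z ((sqnorm z)%:E * kpart `]0%R, e] z) <= (C * e `^ (1 - s))%:E.
Proof.
pose A : R := (8 * 2 `^ (k%:R / 2))%R; have A0 : (0 <= A)%R by rewrite mulr_ge0 ?powR_ge0.
have s10 : (0 < 1 - s)%R by rewrite subr_gt0.
exists (A / (1 - s))%R; first by rewrite divr_ge0 ?(ltW s10).
move=> e e0; rewrite integral_kpart//; last 2 first.
- exact: measurable_sqnorm.
- by move=> z _; exact: sqnorm_ge0.
apply: (@le_trans _ _ (\int[mu]_(t in `]0%R, e]) (A * t `^ (1 - s - 1))%:E)).
  have mI : measurable_fun `]0%R, e] (fun t : R =>
      \int[Lk]_z (sqnorm z * heat k t (sqnorm z))%:E).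
    apply: (@measurable_int_on R _ _ _ _ Lk _ setT
      (fun p : RR * Rk => (sqnorm p.2 * heat k p.1 (sqnorm p.2))%:E)) => //.
      apply/measurable_EFinP; apply: measurable_funTS.
      have ms : measurable_fun setT (fun p : RR * Rk => sqnorm p.2).
        by apply: (measurableT_comp (@measurable_sqnorm R k)); exact: measurable_snd.
      by apply: measurable_funM => //; apply: measurable_heat => //; exact: measurable_fst.
    by move=> p _; rewrite lee_fin mulr_ge0 ?heat_ge0 ?sqnorm_ge0.
  apply: ge0_le_integral => //.
  - move=> t _; rewrite mule_ge0 ?lee_fin ?powR_ge0//; apply: integral_ge0 => z _.
    by rewrite lee_fin mulr_ge0 ?heat_ge0 ?sqnorm_ge0.
  - apply: emeasurable_funM => //; apply/measurable_EFinP; apply: measurable_funTS.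
    exact: measurable_powR.
  - by apply/measurable_EFinP; apply: measurable_funTS; apply: measurable_funM => //.
  - move=> t /=; rewrite in_itv/= => /andP[t0 _].
    apply: (@le_trans _ _ ((t `^ (-1 - s))%:E * (A * t)%:E)); last first.
      rewrite -EFinM lee_fin mulrCA ler_wpM2l//.
      have -> : (1 - s - 1 = - 1 - s + 1)%R by ring.
      by rewrite powRD1// mulrC.
    rewrite lee_wpmul2l ?lee_fin ?powR_ge0//.
    apply: (@le_trans _ _ (\int[Lk]_z ((A * t)%:E * (heat k (2 * t) (sqnorm z))%:E))).
      apply: ge0_le_integral => //.
      - by move=> z _; rewrite lee_fin mulr_ge0 ?heat_ge0 ?sqnorm_ge0.
      - apply/measurable_EFinP; apply: measurable_funM; first exact: measurable_sqnorm.
        by apply: measurable_heat => //; exact: measurable_sqnorm.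
      - apply/measurable_EFinP; apply: measurable_funM => //.
        by apply: measurable_heat => //; exact: measurable_sqnorm.
      - by move=> z _; rewrite -EFinM lee_fin sqnorm_heat_le ?sqnorm_ge0.
    rewrite ge0_integralZl_EFin ?mulr_ge0 ?(ltW t0)//.
    - by rewrite integral_heat ?mule1// mulr_gt0.
    - by move=> z _; rewrite lee_fin heat_ge0.
    - apply/measurable_EFinP; apply: measurable_heat => //; exact: measurable_sqnorm.
under eq_integral do rewrite EFinM.
rewrite ge0_integralZl_EFin//; last 2 first.
- by move=> t _; rewrite lee_fin powR_ge0.
- by apply/measurable_EFinP; apply: measurable_funTS; exact: measurable_powR.
rewrite -integral_itv_bndo_bndc; last first.
  by apply/measurable_EFinP; apply: measurable_funTS; exact: measurable_powR.
rewrite integral_powR0// -EFinM.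
by have -> : (A * (e `^ (1 - s) / (1 - s)) = A / (1 - s) * e `^ (1 - s))%R by ring.
Qed.

Lemma measurable_sqnorm_le (r : R) : measurable [set z : Rk | (sqnorm z <= r)%R].
Proof.
rewrite -[X in measurable X]setTI (_ : [set z : Rk | _] = (@sqnorm R k) @^-1` `]-oo, r]).
  by apply: measurable_sqnorm.
by apply/seteqP; split => z /=; rewrite in_itv.
Qed.

(** The times below [r] are controlled by their second moment, the times above
    [r] by their mass. *)
Lemma ball_moment : exists2 C : R, (0 <= C)%R & forall r : R, (0 < r)%R ->
  \int[Lk]_(z in [set z | (sqnorm z <= r)%R]) ((sqnorm z)%:E * (frac_kernel s z)%:E)
    <= (C * r `^ (1 - s))%:E.
Proof.
have [C C0 HC] := near_moment.
have msq (D : set Rk) : measurable_fun D (fun z : Rk => (sqnorm z)%:E).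
  by apply/measurable_EFinP; apply: measurable_funTS; exact: measurable_sqnorm.
have sq0 (z : Rk) : 0 <= (sqnorm z)%:E by rewrite lee_fin sqnorm_ge0.
exists (ckernel * (C + s^-1))%R.
  by rewrite mulr_ge0 ?addr_ge0 ?invr_ge0 ?(ltW s0) ?(ltW ckernel_gt0).
move=> r r0; set B := [set z : Rk | _].
have mB : measurable B by exact: measurable_sqnorm_le.
apply: (@le_trans _ _ (ckernel%:E * \int[Lk]_(z in B) ((sqnorm z)%:E * kpart `]0%R, +oo[ z))).
  rewrite -ge0_integralZl_EFin ?(ltW ckernel_gt0)//; last 2 first.
  - by move=> z _; rewrite mule_ge0 ?kpart_ge0.
  - by apply: emeasurable_funM => //; exact: measurable_kpart.
  apply: ge0_le_integral => //.
  - by move=> z _; rewrite mule_ge0 ?lee_fin ?frac_kernel_ge0 ?sqnorm_ge0.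
  - apply: emeasurable_funM => //; apply/measurable_EFinP; apply: measurable_funTS.
    exact: measurable_frac_kernel.
  - apply: emeasurable_funM => //; apply: emeasurable_funM => //; exact: measurable_kpart.
  - by move=> z _; rewrite muleCA lee_wpmul2l// le_kernel_kpart.
rewrite -[(_ * r `^ _)%R]mulrA [leRHS]EFinM.
apply: lee_wpmul2l; first by rewrite lee_fin ltW ?ckernel_gt0.
under eq_integral do rewrite (kpart_split _ r0) ge0_muleDr ?kpart_ge0//.
rewrite ge0_integralD//; last 4 first.
- by move=> z _; rewrite mule_ge0 ?kpart_ge0.
- by apply: emeasurable_funM => //; exact: measurable_kpart.
- by move=> z _; rewrite mule_ge0 ?kpart_ge0.
- by apply: emeasurable_funM => //; exact: measurable_kpart.
rewrite mulrDl EFinD; apply: leeD.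
  apply: le_trans (HC _ r0); apply: ge0_subset_integral => //.
  - by apply: emeasurable_funM => //; exact: measurable_kpart.
  - by move=> z _; rewrite mule_ge0 ?kpart_ge0.
apply: (@le_trans _ _ (\int[Lk]_(z in B) (r%:E * kpart `]r, +oo[ z))).
  apply: ge0_le_integral => //.
  - by move=> z _; rewrite mule_ge0 ?kpart_ge0.
  - by apply: emeasurable_funM => //; exact: measurable_kpart.
  - by apply: emeasurable_funM => //; exact: measurable_kpart.
  - by move=> z Bz; rewrite lee_wpmul2r ?kpart_ge0.
rewrite ge0_integralZl_EFin ?(ltW r0)//; last 2 first.
- by move=> z _; rewrite kpart_ge0.
- exact: measurable_kpart.
apply: (@le_trans _ _ (r%:E * \int[Lk]_z kpart `]r, +oo[ z)).
  rewrite lee_wpmul2l ?lee_fin ?(ltW r0)//; apply: ge0_subset_integral => //.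
  - exact: measurable_kpart.
  - by move=> z _; rewrite kpart_ge0.
rewrite integral_kpart_far// -EFinM lee_fin mulrA [leRHS]mulrC.
by rewrite ler_wpM2r ?invr_ge0 ?(ltW s0)// (addrC 1%R) powRD1.
Qed.

End kernel.

Section kernel_bounds.
Context {R : realType} (k : nat) (s : R).
Hypotheses (s0 : 0 < s) (s1 : s < 1).
Local Notation RR := (measurableTypeR R).
Local Notation Rk := (k.-tuple RR).
Local Notation mu := (@lebesgue_measure R).
Local Notation Lk := (@lebesgue_tuple R k).
Local Notation kpart := (@kpart R k s).
Local Notation ckernel := (@ckernel R k s).
Local Open Scope ereal_scope.

(** On the ball the heat kernel of time [r / 4] is bounded below, and its
    integral is at most 1. *)
Lemma volume_ball_le (r : R) : (0 < r)%R ->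
  Lk [set z : Rk | (sqnorm z <= r)%R] <= (expR 1 * (pi * r) `^ (k%:R / 2))%:E.
Proof.
move=> r0; have pr : (0 < pi * r)%R by rewrite mulr_gt0 ?pi_gt0.
set C := (expR 1 * _)%R; have C0 : (0 <= C)%R by rewrite mulr_ge0 ?expR_ge0 ?powR_ge0.
rewrite -[leLHS]mul1e -(integral_cst _ (measurable_sqnorm_le _))//.
apply: (@le_trans _ _ (\int[Lk]_(z in [set z : Rk | (sqnorm z <= r)%R])
   (C%:E * (heat k (r / 4) (sqnorm z))%:E))).
  have mh D : measurable_fun D (fun z : Rk => (heat k (r / 4) (sqnorm z))%:E).
    apply/measurable_EFinP; apply: measurable_heat; first exact: measurable_cst.
    by apply: measurable_funTS; exact: measurable_sqnorm.
  apply: ge0_le_integral => //.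
  - exact: measurable_sqnorm_le.
  - by apply: emeasurable_funM.
  - move=> z /= zr; rewrite -EFinM lee_fin /C /heat.
    have -> : (4 * pi * (r / 4) = pi * r)%R by field.
    have -> : (4 * (r / 4) = r)%R by field.
    have -> (a b : R) : (a * (pi * r) `^ (k%:R / 2) * ((pi * r) `^ (- (k%:R / 2)) * b) = a * b)%R.
      by rewrite powRN; field; rewrite gt_eqF ?powR_gt0.
    by rewrite -expRD -[leLHS]expR0 ler_expR subr_ge0 ler_pdivrMr// mul1r.
have mh : measurable_fun setT (fun z : Rk => (heat k (r / 4) (sqnorm z))%:E).
  apply/measurable_EFinP; apply: measurable_heat; first exact: measurable_cst.
  exact: measurable_sqnorm.
rewrite ge0_integralZl_EFin//; last 3 first.
- exact: measurable_sqnorm_le.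
- by move=> z _; rewrite lee_fin heat_ge0.
- exact: measurable_funTS.
rewrite -[leRHS]mule1 lee_wpmul2l ?lee_fin// -(@integral_heat R k (r / 4)%R) ?divr_gt0//.
apply: ge0_subset_integral => //; first exact: measurable_sqnorm_le.
by move=> z _; rewrite lee_fin heat_ge0.
Qed.

Lemma kpart_far_le (e : R) (z : Rk) : (0 < e)%R ->
  kpart `]e, +oo[ z <= ((4 * pi * e) `^ (- (k%:R / 2)) * (e `^ (- s) / s))%:E.
Proof.
move=> e0; have pe : (0 < 4 * pi * e)%R by rewrite !mulr_gt0 ?pi_gt0.
rewrite EFinM -integral_powRy// -ge0_integralZl_EFin ?powR_ge0//; last 2 first.
- by move=> t _; rewrite lee_fin powR_ge0.
- by apply/measurable_EFinP; apply: measurable_funTS; exact: measurable_powR.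
apply: ge0_le_integral => //.
- by move=> t _; rewrite lee_fin mulr_ge0 ?heat_ge0 ?powR_ge0.
- apply/measurable_EFinP; apply: measurable_funM.
    by apply: measurable_heat => //; exact: measurable_cst.
  by apply: measurable_funTS; exact: measurable_powR.
- apply: emeasurable_funM => //.
  by apply/measurable_EFinP; apply: measurable_funTS; exact: measurable_powR.
- move=> t /=; rewrite in_itv/= andbT => et; rewrite -EFinM lee_fin.
  have t0 : (0 < t)%R by exact: lt_trans et.
  rewrite ler_wpM2r ?powR_ge0// /heat -[leRHS]mulr1; apply: ler_pM; rewrite ?powR_ge0 ?expR_ge0//.
    have k20 : (0 <= k%:R / 2 :> R)%R by rewrite divr_ge0.
    rewrite !powRN lef_pV2 ?posrE ?powR_gt0 ?mulr_gt0 ?pi_gt0//.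
    apply: (ge0_ler_powR k20); rewrite ?nnegrE ?mulr_ge0 ?pi_ge0 ?(ltW e0) ?(ltW t0)//.
    by rewrite ler_wpM2l ?mulr_ge0 ?pi_ge0// ltW.
  by rewrite expR_le1 oppr_le0 divr_ge0 ?sqnorm_ge0// mulr_ge0// ltW.
Qed.

(** The truncated kernel is of order [e `^ (- (k%:R / 2 + s))], so that its mass
    in the ball of radius [e] is of order [e `^ (k%:R / 2 - s)]; for [k >= 2] this
    is at most of order [e `^ (1 - s)]. *)
Lemma far_mass_ball : (1 < k)%N -> exists2 C : R, (0 <= C)%R &
  forall e : R, (0 < e)%R -> (e <= 1)%R ->
  \int[Lk]_(z in [set z | (sqnorm z <= e ^+ 2)%R]) kpart `]e, +oo[ z
    <= (C * e `^ (1 - s))%:E.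
Proof.
move=> k1; pose C : R := (expR 1 * 4 `^ (- (k%:R / 2)) / s)%R.
have C0 : (0 <= C)%R by rewrite !mulr_ge0 ?expR_ge0 ?powR_ge0// invr_ge0 ltW.
exists C => // e e0 e1; set B := [set z : Rk | _].
have mB : measurable B by exact: measurable_sqnorm_le.
set m := ((4 * pi * e) `^ (- (k%:R / 2)) * (e `^ (- s) / s))%R.
have m0 : (0 <= m)%R by rewrite !mulr_ge0 ?powR_ge0// invr_ge0 ltW.
apply: (@le_trans _ _ (\int[Lk]_(z in B) m%:E)).
  apply: ge0_le_integral => //.
  - by move=> z _; exact: kpart_ge0.
  - exact: measurable_kpart.
  - by move=> z _; exact: kpart_far_le.
rewrite integral_cst//=.
have e20 : (0 < e ^+ 2)%R by rewrite exprn_gt0.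
apply: (le_trans (lee_wpmul2l _ (volume_ball_le e20))); first by rewrite lee_fin.
rewrite -EFinM lee_fin /m /C.
have -> : (4 * pi * e = 4 * (pi * e))%R by ring.
rewrite (@powRM _ 4 (pi * e)) ?mulr_ge0 ?pi_ge0 ?(ltW e0)//.
have -> : (pi * e ^+ 2 = (pi * e) * e)%R by ring.
rewrite (@powRM _ (pi * e) e) ?mulr_ge0 ?pi_ge0 ?(ltW e0)// [((pi * e) `^ (- _))%R]powRN.
have P0 : (0 < (pi * e) `^ (k%:R / 2))%R by rewrite powR_gt0 ?mulr_gt0 ?pi_gt0.
set P := (_ `^ _)%R in P0 *; set F := (4 `^ _)%R.
have -> : (F / P * (e `^ (- s) / s) * (expR 1 * (P * e `^ (k%:R / 2))) =
   expR 1 * F / s * (e `^ (k%:R / 2) * e `^ (- s)))%R.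
  by field; rewrite !gt_eqF.
rewrite ler_wpM2l// -powRD; last by apply/implyP => _; rewrite gt_eqF.
apply: ger_powR; first by rewrite e0 e1.
rewrite lerD2r ler_pdivlMr// mul1r ler_nat//.
Qed.

(** Away from the origin the short times contribute little, since there
    [1 <= |z|^2 / r]. *)
Lemma near_tail : exists2 C : R, (0 <= C)%R & forall e r : R, (0 < e)%R -> (0 < r)%R ->
  \int[Lk]_(z in [set z | (r <= sqnorm z)%R]) kpart `]0%R, e] z <= (C * e `^ (1 - s) / r)%:E.
Proof.
have [C C0 HC] := near_moment k s1; exists C => // e r e0 r0.
have mB : measurable [set z : Rk | (r <= sqnorm z)%R].
  rewrite -[X in measurable X]setTI (_ : [set z : Rk | _] = (@sqnorm R k) @^-1` `[r, +oo[).
    by apply: measurable_sqnorm.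
  by apply/seteqP; split => z /=; rewrite in_itv/= andbT.
have msq (D : set Rk) : measurable_fun D (fun z : Rk => (sqnorm z)%:E).
  by apply/measurable_EFinP; apply: measurable_funTS; exact: measurable_sqnorm.
rewrite mulrC EFinM lee_pdivlMl// -ge0_integralZl_EFin ?(ltW r0)//; last 2 first.
- by move=> z _; exact: kpart_ge0.
- exact: measurable_kpart.
apply: le_trans (HC _ e0).
apply: (@le_trans _ _ (\int[Lk]_(z in [set z | (r <= sqnorm z)%R])
    ((sqnorm z)%:E * kpart `]0%R, e] z))).
  apply: ge0_le_integral => //.
  - by move=> z _; rewrite mule_ge0 ?kpart_ge0// lee_fin ltW.
  - by apply: emeasurable_funM => //; exact: measurable_kpart.
  - by apply: emeasurable_funM => //; exact: measurable_kpart.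
  - by move=> z rz; rewrite lee_wpmul2r ?kpart_ge0// lee_fin.
apply: ge0_subset_integral => //.
- by apply: emeasurable_funM => //; exact: measurable_kpart.
- by move=> z _; rewrite mule_ge0 ?kpart_ge0 ?lee_fin ?sqnorm_ge0.
Qed.

Lemma measurable_sqnorm_ge (r : R) : measurable [set z : Rk | (r <= sqnorm z)%R].
Proof.
rewrite -[X in measurable X]setTI (_ : [set z : Rk | _] = (@sqnorm R k) @^-1` `[r, +oo[).
  by apply: measurable_sqnorm.
by apply/seteqP; split => z /=; rewrite in_itv/= andbT.
Qed.

Lemma kernel_tail_lty (r : R) : (0 < r)%R ->
  \int[Lk]_(z in [set z | (r <= sqnorm z)%R]) (frac_kernel s z)%:E < +oo.
Proof.
move=> r0; have [C C0 HC] := near_tail.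
have mB := @measurable_sqnorm_ge r.
apply: (@le_lt_trans _ _ (\int[Lk]_(z in [set z | (r <= sqnorm z)%R])
    (ckernel%:E * (kpart `]0%R, 1%R] z + kpart `]1%R, +oo[ z)))).
  apply: ge0_le_integral => //.
  - by move=> z _; rewrite lee_fin frac_kernel_ge0.
  - by apply/measurable_EFinP; apply: measurable_funTS; exact: measurable_frac_kernel.
  - by apply: emeasurable_funM => //; apply: emeasurable_funD; exact: measurable_kpart.
  - by move=> z _; rewrite -kpart_split//; exact: le_kernel_kpart.
rewrite ge0_integralZl_EFin ?(ltW (ckernel_gt0 _ _))//; last 2 first.
- by move=> z _; rewrite adde_ge0 ?kpart_ge0.
- by apply: emeasurable_funD; exact: measurable_kpart.
rewrite lte_mul_pinfty ?lee_fin ?(ltW (ckernel_gt0 _ _))//.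
rewrite ge0_integralD//; last 4 first.
- by move=> z _; rewrite kpart_ge0.
- exact: measurable_kpart.
- by move=> z _; rewrite kpart_ge0.
- exact: measurable_kpart.
apply: lte_add_pinfty.
  by apply: le_lt_trans (HC _ _ ltr01 r0) _; rewrite ltry.
apply: (@le_lt_trans _ _ (\int[Lk]_z kpart `]1%R, +oo[ z)).
  apply: ge0_subset_integral => //; first exact: measurable_kpart.
  by move=> z _; rewrite kpart_ge0.
by rewrite integral_kpart_far// ltry.
Qed.

Lemma norm_sin_le (x : R) : (`|sin x| <= `|x|)%R.
Proof.
wlog x0 : x / (0 <= x)%R.
  move=> H; have [/H//|x0] := leP 0%R x.
  by have := H (- x)%R; rewrite sinN !normrN; apply; rewrite oppr_ge0 ltW.
have cs : {within `[0%R, x], continuous (@sin R)}.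
  by apply: continuous_subspaceT; exact: continuous_sin.
have [c _ cE] := @MVT_segment R sin cos 0 x x0 (fun y _ => is_derive_sin y) cs.
rewrite sin0 !subr0 in cE; rewrite cE normrM ler_piMl ?normr_ge0//.
exact: cos_max.
Qed.

Lemma one_sub_cos_le (x : R) : (1 - cos x <= x ^+ 2)%R.
Proof.
have -> : (1 - cos x = 2 * sin (x / 2) ^+ 2)%R.
  rewrite sin2cos2 -[in cos x](_ : (x / 2) *+ 2 = x)%R; last by rewrite -mulr_natr; field.
  rewrite cos_mulr2n; ring.
have := norm_sin_le (x / 2); rewrite -(@ler_pXn2r _ 2)// ?nnegrE// !real_normK ?num_real//.
by move=> h; have := sqr_ge0 x; lra.
Qed.

(** The integral must be finite and nonzero for its inverse to be meaningful. It
    is finite because [1 - cos x <= x ^+ 2] near the origin, and positive because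
    of the contribution of the cube of points with coordinates between 1 and 2. *)
Lemma C_ks_gt0 : (0 < k)%N -> (0 < @C_ks R k s)%R.
Proof.
move=> k0; have z0E (z : Rk) : z`_0 = tnth z (Ordinal k0) by rewrite (tnth_nth 0%R).
have mK (D : set Rk) : measurable_fun D (fun z : Rk => (frac_kernel s z)%:E).
  by apply/measurable_EFinP; apply: measurable_funTS; exact: measurable_frac_kernel.
have mf D : measurable_fun D (fun z : Rk => ((1 - cos (z`_0 : R)) * frac_kernel s z)%:E).
  apply/measurable_EFinP; apply: measurable_funTS; apply: measurable_funM.
    under eq_fun do rewrite z0E.
    apply: (@measurable_tnth_comp R k (fun x => 1 - cos x)%R).
    apply: measurable_funB => //; apply: continuous_measurable_fun; exact: continuous_cos.
  exact: measurable_frac_kernel.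
have f0 (z : Rk) : 0 <= ((1 - cos (z`_0 : R)) * frac_kernel s z)%:E.
  by rewrite lee_fin mulr_ge0 ?frac_kernel_ge0// subr_ge0 cos_le1.
have z0le (z : Rk) : ((z`_0 : R) ^+ 2 <= sqnorm z)%R.
  by rewrite z0E /sqnorm (bigD1 (Ordinal k0))//= lerDl sumr_ge0// => i _; rewrite sqr_ge0.
rewrite /C_ks invr_gt0; set I := integral _ _ _.
have Ioo : I < +oo.
  rewrite /I (_ : setT = [set z : Rk | (sqnorm z <= 1)%R] `|` ~` [set z | (sqnorm z <= 1)%R]); last first.
    by rewrite setUv.
  have mC : measurable (~` [set z : Rk | (sqnorm z <= 1)%R]).
    by apply: measurableC; exact: measurable_sqnorm_le.
  rewrite ge0_integral_setU//=; last 2 first.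
  - exact: measurable_sqnorm_le.
  - by rewrite disj_set2E setICr.
  apply: lte_add_pinfty.
    have [C C0 HC] := ball_moment k s0 s1; apply: le_lt_trans (le_lt_trans (HC 1%R ltr01) _).
      apply: ge0_le_integral => //.
      - exact: measurable_sqnorm_le.
      - apply: emeasurable_funM => //; apply/measurable_EFinP; apply: measurable_funTS.
        exact: measurable_sqnorm.
      - move=> z _; rewrite EFinM lee_wpmul2r ?lee_fin ?frac_kernel_ge0//.
        by rewrite (le_trans (one_sub_cos_le _)).
    by rewrite ltry.
  apply: (@le_lt_trans _ _ (\int[Lk]_(z in [set z | (1 <= sqnorm z)%R]) (2%:E * (frac_kernel s z)%:E))).
    apply: (@le_trans _ _ (\int[Lk]_(z in ~` [set z | (sqnorm z <= 1)%R]) (2%:E * (frac_kernel s z)%:E))).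
      apply: ge0_le_integral => //.
      - by apply: emeasurable_funM.
      - move=> z _; rewrite EFinM lee_wpmul2r ?lee_fin ?frac_kernel_ge0//.
        by have := cos_geN1 (z`_0 : R); lra.
    apply: ge0_subset_integral => //.
    - exact: measurable_sqnorm_ge.
    - by apply: emeasurable_funM.
    - by move=> z _; rewrite mule_ge0 ?lee_fin ?frac_kernel_ge0.
    - by move=> z /= /negP; rewrite -ltNge => /ltW.
  rewrite ge0_integralZl_EFin//; last 2 first.
  - exact: measurable_sqnorm_ge.
  - by move=> z _; rewrite lee_fin frac_kernel_ge0.
  by rewrite lte_mul_pinfty ?lee_fin// kernel_tail_lty.
rewrite fine_gt0// Ioo andbT.
have pi2 : (2 <= pi :> R)%R by exact: pi_ge2.
have i1 : (1%R : R) \in `[0%R, pi] by rewrite in_itv/= ler01 (le_trans _ pi2)// ler1n.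
pose c := ((1 - cos (1:R)) * (4 * k%:R) `^ (- (k%:R / 2 + s)))%R.
have k40 : (0 < 4 * k%:R :> R)%R by rewrite mulr_gt0// ltr0n.
have c0 : (0 < c)%R.
  have i0 : (0%R : R) \in `[0%R, pi] by rewrite in_itv/= lexx pi_ge0.
  by rewrite mulr_gt0 ?powR_gt0// subr_gt0 -[ltRHS]cos0 ltr_cos.
apply: (@lt_le_trans _ _ c%:E); first by rewrite lte_fin.
pose g (i : 'I_k) (x : R) := (\1_(`[1%R, 2%R]%classic : set R) x : R)%R.
have mg i : measurable_fun setT (g i) by exact: measurable_indic.
have g0 i x : (0 <= g i x)%R by rewrite /g indicE.
have ig i : \int[mu]_x (g i x)%:E = 1.
  by rewrite integral_indic//= setIT lebesgue_measure_itv/= lte_fin ltr1n -EFinB; congr EFin; lra.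
have := integral_tuple_prod mg g0 ig; rewrite big1// => Ig.
rewrite -[leLHS]mule1 -Ig -ge0_integralZl_EFin ?(ltW c0)//; last 2 first.
- by move=> z _; rewrite lee_fin prodr_ge0.
- apply/measurable_EFinP; apply: measurable_prod => i _; exact: measurable_tnth_comp.
apply: ge0_le_integral => //.
- by move=> z _; rewrite mule_ge0// lee_fin ?prodr_ge0// ltW.
- apply: emeasurable_funM => //; apply/measurable_EFinP; apply: measurable_prod => i _.
  exact: measurable_tnth_comp.
move=> z _.
have [/forallP H|/forallPn[i Hi]] := boolP [forall i, (1 <= tnth z i <= 2)%R]; last first.
  rewrite (bigD1 i)//= {1}/g indicE mem_setE in_itv/= (negbTE Hi) mul0r mule0; exact: f0.
rewrite big1 ?mule1; last first.
  by move=> i _; rewrite /g indicE mem_setE in_itv/= H.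
rewrite lee_fin /c; apply: ler_pM.
- by rewrite subr_ge0 cos_le1.
- exact: powR_ge0.
- rewrite lerD2l lerN2 z0E; have /andP[h1 h2] := H (Ordinal k0).
  have [->//|h] := eqVneq (tnth z (Ordinal k0)) 1%R.
  have iz : tnth z (Ordinal k0) \in `[0%R, pi].
    by rewrite in_itv/= (le_trans _ h1)// (le_trans h2).
  by rewrite ltW// ltr_cos// lt_neqAle eq_sym h.
- rewrite frac_kernelE !powRN.
  have sq0 : (0 < sqnorm z)%R.
    apply: lt_le_trans (z0le z); rewrite z0E exprn_gt0//.
    by have /andP[h1 _] := H (Ordinal k0); exact: lt_le_trans h1.
  rewrite lef_pV2 ?posrE ?powR_gt0//.
  apply: ge0_ler_powR; rewrite ?nnegrE ?(ltW sq0) ?(ltW k40) ?(ltW (k2s_gt0 k s0))//.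
  apply: (@le_trans _ _ (\sum_(i < k) 4)%R); last by rewrite sumr_const card_ord mulr_natr.
  apply: ler_sum => i _; have /andP[h1 h2] := H i.
  have -> : (4 = 2 ^+ 2 :> R)%R by ring.
  by rewrite ler_pXn2r ?nnegrE// (le_trans ler01).
Qed.

End kernel_bounds.

(** * Mixtures of heat kernels *)

Section heat_mixtures.
Context {R : realType} (k : nat) (s : R).
Hypotheses (s0 : 0 < s) (s1 : s < 1).
Local Notation RR := (measurableTypeR R).
Local Notation Rk := (k.-tuple RR).
Local Notation mu := (@lebesgue_measure R).
Local Notation Lk := (@lebesgue_tuple R k).
Local Notation kpart := (@kpart R k s).
Local Open Scope ereal_scope.

(** For a mixture of heat kernels the action of the truncated kernel is a
    computation on the weight [w] alone: convolving with the heat kernel of time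
    [t] shifts the time variable by [t], by the semigroup property. *)
Lemma integral_mixture_kpart (w : R -> R) (a : 'I_k -> R) (F : Rk -> R) (e : R) :
  (0 < e)%R -> measurable_fun setT w -> (forall t, (0 <= w t)%R) ->
  (forall t, (t <= 0)%R -> w t = 0%R) ->
  measurable_fun setT F -> (forall z, (0 <= F z)%R) ->
  (forall z, (F z)%:E = \int[mu]_t (w t * heat k t (\sum_i (a i + tnth z i) ^+ 2))%:E) ->
  \int[Lk]_z ((F z)%:E * kpart `]e, +oo[ z) =
  \int[mu]_r ((heat k r (\sum_i a i ^+ 2))%:E *
    \int[mu]_(t in `]e, +oo[) (w (r - t) * t `^ (- 1 - s))%:E).
Proof.
move=> e0 mw w0 wN mF F0 FE; set A := (\sum_i a i ^+ 2)%R.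
rewrite integral_kpart//.
have msum : measurable_fun setT (fun z : Rk => (\sum_i (a i + tnth z i) ^+ 2)%R).
  apply: measurable_sum => i; apply: (@measurable_tnth_comp R k (fun x => (a i + x) ^+ 2)%R).
  by apply: measurable_funX; exact: measurable_funD.
have conv t : (0 < t)%R -> \int[Lk]_z (F z * heat k t (sqnorm z))%:E =
    \int[mu]_r (w r * heat k (t + r) A)%:E.
  move=> t0.
  transitivity (\int[Lk]_z \int[mu]_r
      (w r * (heat k t (sqnorm z) * heat k r (\sum_i (a i + tnth z i) ^+ 2)))%:E).
    apply: eq_integral => z _; rewrite EFinM FE muleC -ge0_integralZl_EFin ?heat_ge0//.
    - by apply: eq_integral => r _; rewrite -EFinM; congr EFin; ring.
    - by move=> r _; rewrite lee_fin mulr_ge0 ?heat_ge0.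
    - apply/measurable_EFinP; apply: measurable_funM => //.
      by apply: measurable_heat => //; exact: measurable_cst.
  rewrite (@tonelli_on R _ _ _ _ Lk mu setT setT (fun p : Rk * RR =>
    (w p.2 * (heat k t (sqnorm p.1) * heat k p.2 (\sum_i (a i + tnth p.1 i) ^+ 2)))%:E))//; last 2 first.
  - rewrite setXTT; apply/measurable_EFinP; apply: measurable_funM.
      by apply: (measurableT_comp mw); exact: measurable_snd.
    apply: measurable_funM; apply: measurable_heat.
    + exact: measurable_cst.
    + by apply: (measurableT_comp (@measurable_sqnorm R k)); exact: measurable_fst.
    + exact: measurable_snd.
    + by apply: (measurableT_comp msum); exact: measurable_fst.
  - move=> p _; rewrite lee_fin; apply: mulr_ge0 => //.
    by apply: mulr_ge0; exact: heat_ge0.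
  apply: eq_integral => r _ /=; under eq_integral do rewrite EFinM.
  rewrite ge0_integralZl_EFin//; last 2 first.
  - by move=> z _; rewrite lee_fin mulr_ge0 ?heat_ge0.
  - apply/measurable_EFinP; apply: measurable_funM; apply: measurable_heat => //; try exact: measurable_cst.
    exact: measurable_sqnorm.
  have [r0|r0] := ltP 0%R r; last by rewrite wN// mul0r mul0e.
  by rewrite integral_heat_conv.
have mg (D : set (RR * RR)) : measurable_fun D (fun p : RR * RR =>
    (p.1 `^ (- 1 - s) * (w (p.2 - p.1) * heat k p.2 A))%:E).
  apply/measurable_EFinP; apply: measurable_funTS; apply: measurable_funM.
    by apply: (measurableT_comp (measurable_powR _)); exact: measurable_fst.
  apply: measurable_funM.
    by apply: (measurableT_comp mw); apply: measurable_funB; [exact: measurable_snd|exact: measurable_fst].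
  by apply: measurable_heat; [exact: measurable_snd|exact: measurable_cst].
transitivity (\int[mu]_(t in `]e, +oo[) \int[mu]_r
    (t `^ (- 1 - s) * (w (r - t) * heat k r A))%:E).
  apply: eq_integral => t; rewrite inE/= in_itv/= andbT => et.
  have mh : measurable_fun setT (fun r : R => (w (r - t) * heat k r A)%:E).
    apply/measurable_EFinP; apply: measurable_funM.
      by apply: (measurableT_comp mw); exact: measurable_funB.
    by apply: measurable_heat => //; exact: measurable_cst.
  rewrite conv ?(lt_trans e0)//.
  under [in RHS]eq_integral do rewrite EFinM.
  rewrite [RHS]ge0_integralZl_EFin ?powR_ge0//; last first.
    by move=> r _; rewrite lee_fin mulr_ge0 ?heat_ge0.
  congr *%E; rewrite -(ge0_integral_shift t (f := fun r : R => (w (r - t) * heat k r A)%:E))//.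
    by apply: eq_integral => r _; rewrite addrK [(t + r)%R]addrC.
  by move=> r; rewrite lee_fin mulr_ge0 ?heat_ge0.
rewrite (@tonelli_on R _ _ _ _ mu mu `]e, +oo[ setT (fun p : RR * RR =>
    (p.1 `^ (- 1 - s) * (w (p.2 - p.1) * heat k p.2 A))%:E))//; last first.
  move=> p _; rewrite lee_fin; apply: mulr_ge0; first exact: powR_ge0.
  by apply: mulr_ge0 => //; exact: heat_ge0.
apply: eq_integral => r _; rewrite -ge0_integralZl_EFin ?heat_ge0//.
- by apply: eq_integral => t _; rewrite -EFinM; congr EFin => /=; ring.
- by move=> t _; rewrite lee_fin mulr_ge0 ?powR_ge0.
- apply/measurable_EFinP; apply: measurable_funTS; apply: measurable_funM.
    by apply: (measurableT_comp mw); exact: measurable_funB.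
  exact: measurable_powR.
Qed.

(** A single heat kernel is a mixture by a point mass, which has no density. *)
Lemma integral_heat_kpart (a : 'I_k -> R) (e u : R) : (0 < e)%R -> (0 < u)%R ->
  \int[Lk]_z ((heat k u (\sum_i (a i + tnth z i) ^+ 2))%:E * kpart `]e, +oo[ z) =
  \int[mu]_(t in `]e, +oo[) (heat k (t + u) (\sum_i a i ^+ 2) * t `^ (- 1 - s))%:E.
Proof.
move=> e0 u0; rewrite integral_kpart//; last 2 first.
- apply: measurable_heat; first exact: measurable_cst.
  apply: measurable_sum => i; apply: (@measurable_tnth_comp R k (fun x => (a i + x) ^+ 2)%R).
  by apply: measurable_funX; exact: measurable_funD.
- by move=> z _; exact: heat_ge0.
apply: eq_integral => t; rewrite inE/= in_itv/= andbT => et.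
have t0 : (0 < t)%R by exact: lt_trans et.
under eq_integral do rewrite mulrC.
by rewrite integral_heat_conv// -EFinM mulrC.
Qed.

End heat_mixtures.

(** * Orthonormal frames, and integrals of odd functions *)

Section euclidean_geometry.
Context {R : realType} {N : nat}.
Implicit Types v w x y : 'rV[R]_N.

Lemma edotC v w : edot v w = edot w v.
Proof. by apply: eq_bigr => i _; rewrite mulrC. Qed.

Lemma edotDl v w x : edot (v + w) x = edot v x + edot w x.
Proof. by rewrite /edot -big_split/=; apply: eq_bigr => i _; rewrite mxE mulrDl. Qed.

Lemma edotZl (c : R) v w : edot (c *: v) w = c * edot v w.
Proof. by rewrite /edot mulr_sumr; apply: eq_bigr => i _; rewrite mxE mulrA. Qed.

Lemma edotDr v w x : edot x (v + w) = edot x v + edot x w.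
Proof. by rewrite edotC edotDl !(edotC x). Qed.

Lemma edotZr (c : R) v w : edot w (c *: v) = c * edot w v.
Proof. by rewrite edotC edotZl (edotC w). Qed.

Lemma edotNl v w : edot (- v) w = - edot v w.
Proof. by rewrite -scaleN1r edotZl mulN1r. Qed.

Lemma edotBl v w x : edot (v - w) x = edot v x - edot w x.
Proof. by rewrite edotDl edotNl. Qed.

Lemma edotBr v w x : edot x (v - w) = edot x v - edot x w.
Proof. by rewrite edotC edotBl !(edotC x). Qed.

Lemma edot0l w : edot 0 w = 0.
Proof. by rewrite -(scale0r (0 : 'rV[R]_N)) edotZl mul0r. Qed.

Lemma edot_sqrD v w : edot (v + w) (v + w) = edot v v + 2 * edot v w + edot w w.
Proof. by rewrite edotDl !edotDr (edotC w v); ring. Qed.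

Lemma edot_suml (I : finType) (f : I -> 'rV[R]_N) w :
  edot (\sum_i f i) w = \sum_i edot (f i) w.
Proof.
elim/big_ind2 : _ => [|v a v' a' <- <-|//]; first exact: edot0l.
exact: edotDl.
Qed.

Lemma edot_ge0 v : 0 <= edot v v.
Proof. by apply: sumr_ge0 => i _; rewrite -expr2 sqr_ge0. Qed.

Lemma edot_eq0 v : (edot v v == 0) = (v == 0).
Proof.
apply/idP/eqP => [|->]; last by rewrite edot0l.
rewrite psumr_eq0 => [/allP H|i _]; last by rewrite -expr2 sqr_ge0.
apply/rowP => i; have := H i (mem_index_enum i); rewrite -expr2 sqrf_eq0 => /eqP ->.
by rewrite mxE.
Qed.

Lemma enorm_sqr v : enorm v ^+ 2 = edot v v.
Proof. by rewrite sqr_sqrtr// edot_ge0. Qed.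

Lemma enorm_ge0 v : 0 <= enorm v.
Proof. exact: sqrtr_ge0. Qed.

Lemma enorm_lt v (r : R) : 0 < r -> (enorm v < r) = (edot v v < r ^+ 2).
Proof. by move=> r0; rewrite -enorm_sqr ltr_pXn2r// ?nnegrE ?enorm_ge0// ltW. Qed.

Lemma coord_sqr_le v i : v ord0 i ^+ 2 <= edot v v.
Proof.
rewrite /edot (bigD1 i)//= -expr2 lerDl; apply: sumr_ge0 => j _.
by rewrite -expr2 sqr_ge0.
Qed.

(** The Householder reflection that maps the first basis vector to the
    direction of [v] turns the standard basis into a frame whose span
    contains [v]. *)
Lemma frame_through (k : nat) v : (0 < k)%N -> (k <= N)%N ->
  exists2 xi : 'I_k -> 'rV[R]_N, orthonormal_frame xi &
    \sum_(i < k) edot v (xi i) ^+ 2 = edot v v.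
Proof.
move=> k0 kN; pose i0 : 'I_k := Ordinal k0.
pose b (i : 'I_k) : 'rV[R]_N := basis_vec (widen_ord kN i).
have vb w i : edot w (b i) = w ord0 (widen_ord kN i).
  rewrite /edot (bigD1 (widen_ord kN i))//= !mxE !eqxx mulr1 big1 ?addr0// => j ji.
  by rewrite !mxE eqxx (negbTE ji) mulr0.
have bb i j : edot (b i) (b j) = (i == j)%:R.
  by rewrite vb !mxE eqxx /= [in RHS]eq_sym.
have [v0|v0] := eqVneq v 0.
  exists b => //.
  by rewrite v0 edot0l big1// => i _; rewrite edot0l expr0n.
have ev : 0 < enorm v by rewrite sqrtr_gt0 lt_neqAle edot_ge0 eq_sym edot_eq0 v0.
pose n := (enorm v)^-1 *: v.
have nn : edot n n = 1.
  by rewrite edotZl edotZr -enorm_sqr; field; rewrite gt_eqF.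
pose w := b i0 - n.
pose c := 2 / edot w w.
pose xi i := b i - (c * edot w (b i)) *: w.
have xio : orthonormal_frame xi.
  move=> i j; rewrite /xi edotBl !edotBr !edotZl !edotZr bb [edot (b i) w]edotC.
  have [w0|w0] := eqVneq (edot w w) 0.
    by rewrite /c w0 invr0 mulr0 !mul0r !subr0.
  rewrite /c; field; exact: w0.
exists xi => //.
have xi0 : xi i0 = n.
  rewrite /xi; have [w0|w0] := eqVneq (edot w w) 0.
    rewrite /c w0 invr0 mulr0 !mul0r scale0r subr0; apply/eqP.
    by rewrite -subr_eq0 -/w -edot_eq0 w0.
  have -> : c * edot w (b i0) = 1.
    have wb : edot w w = 2 * edot w (b i0).
      rewrite /w !edotBl !edotBr nn bb eqxx [edot n (b i0)]edotC /=; ring.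
    by rewrite /c wb; field; move: w0; rewrite wb mulf_eq0 negb_or => /andP[].
  by rewrite scale1r /w opprB addrC subrK.
have vE : v = enorm v *: xi i0.
  by rewrite xi0 scalerA divff ?scale1r// gt_eqF.
rewrite (bigD1 i0)//= big1 ?addr0 => [|i ii0].
  by rewrite xi0 edotZr -enorm_sqr; field; rewrite gt_eqF.
by rewrite vE edotZl xio eq_sym (negbTE ii0) mulr0 expr0n.
Qed.

Section frame.
Context {k : nat} (xi : 'I_k -> 'rV[R]_N).
Hypothesis xio : orthonormal_frame xi.
Local Notation Rk := (k.-tuple (measurableTypeR R)).

Lemma edot_frame_sum (c d : 'I_k -> R) :
  edot (\sum_i c i *: xi i) (\sum_i d i *: xi i) = \sum_i c i * d i.
Proof.
rewrite edot_suml; apply: eq_bigr => i _; rewrite edotZl edotC edot_suml; congr (_ * _).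
rewrite (bigD1 i)//= edotZl xio eqxx mulr1 big1 ?addr0// => j ji.
by rewrite edotZl xio (negbTE ji) mulr0.
Qed.

Lemma edot_frame_suml v (c : 'I_k -> R) :
  edot v (\sum_i c i *: xi i) = \sum_i c i * edot v (xi i).
Proof. by rewrite edotC edot_suml; apply: eq_bigr => i _; rewrite edotZl edotC. Qed.

Lemma edot_frame_vec (z : Rk) :
  edot (\sum_i tnth z i *: xi i) (\sum_i tnth z i *: xi i) = sqnorm z.
Proof. by rewrite edot_frame_sum; apply: eq_bigr => i _; rewrite expr2. Qed.

Lemma edot_frame_point x y (z : Rk) :
  edot (frame_point xi x z - y) (frame_point xi x z - y) =
  edot (x - y) (x - y) + (\sum_i 2 * edot (x - y) (xi i) * tnth z i) + sqnorm z.
Proof.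
rewrite /frame_point addrAC; set S := \sum_(i < k) _.
have SS : edot S S = sqnorm z by exact: edot_frame_vec.
have vS : edot (x - y) S = \sum_i (tnth z i : R) * edot (x - y) (xi i).
  exact: edot_frame_suml.
transitivity (edot (x - y) (x - y) + 2 * edot (x - y) S + edot S S); first exact: edot_sqrD.
rewrite SS vS; congr (_ + _ + _).
by rewrite mulr_sumr; apply: eq_bigr => i _; ring.
Qed.

(** Pythagoras: moving in the plane does not change the component of [x - y]
    orthogonal to it. *)
Lemma edot_frame_point_sq x y (z : Rk) :
  edot (frame_point xi x z - y) (frame_point xi x z - y) =
  (edot (x - y) (x - y) - \sum_i edot (x - y) (xi i) ^+ 2)
    + \sum_i (edot (x - y) (xi i) + tnth z i) ^+ 2.
Proof.
rewrite edot_frame_point -!addrA; congr (_ + _).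
rewrite -sumrN -!big_split/=; apply: eq_bigr => i _; ring.
Qed.

Lemma bessel v : \sum_i edot v (xi i) ^+ 2 <= edot v v.
Proof.
have := edot_ge0 (v - \sum_i edot v (xi i) *: xi i).
rewrite edotBl !edotBr edot_frame_sum [edot (\sum_i _) v]edotC !edot_frame_suml.
by rewrite subrr subr0 subr_ge0; under [in leLHS]eq_bigr do rewrite -expr2.
Qed.

Lemma measurable_frame_point x (u : 'rV[R]_N -> R) :
  measurable_fun setT (u \o @vec R N) ->
  measurable_fun setT (fun z : Rk => u (frame_point xi x z)).
Proof.
move=> mu; pose h (z : Rk) : N.-tuple (measurableTypeR R) :=
  [tuple (frame_point xi x z) ord0 i | i < N].
have hE z : frame_point xi x z = vec (h z).
  by apply/rowP => i; rewrite [RHS]mxE tnth_mktuple.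
under eq_fun do rewrite hE.
apply: (measurableT_comp mu); apply/measurable_fun_tnthP => i.
rewrite (_ : _ \o _ = fun z : Rk => x ord0 i + \sum_(j < k) tnth z j * xi j ord0 i); last first.
  apply/funext => z /=; rewrite tnth_mktuple /frame_point mxE; congr (_ + _).
  by rewrite summxE; apply: eq_bigr => j _; rewrite mxE.
apply: measurable_funD => //; apply: measurable_sum => j.
apply: measurable_funM => //; exact: measurable_tnth.
Qed.

End frame.
End euclidean_geometry.

Section odd_integrals.
Context {R : realType} (k : nat).
Local Notation Rk := (k.-tuple (measurableTypeR R)).
Local Notation Lk := (@lebesgue_tuple R k).
Local Open Scope ereal_scope.

Lemma tuple_oppK : involutive (@tuple_opp R k).
Proof. by move=> z; apply: eq_from_tnth => i; rewrite !tnth_opp opprK. Qed.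

Lemma sqnorm_opp (z : Rk) : sqnorm (tuple_opp z) = sqnorm z.
Proof. by apply: eq_bigr => i _; rewrite tnth_opp sqrrN. Qed.

Lemma ge0_integral_opp_on (D : set Rk) (f : Rk -> \bar R) : measurable D ->
  (forall z, D z -> D (tuple_opp z)) -> measurable_fun D f ->
  (forall z, D z -> 0 <= f z) ->
  \int[Lk]_(z in D) f (tuple_opp z) = \int[Lk]_(z in D) f z.
Proof.
move=> mD sD mf f0; rewrite integral_mkcond [RHS]integral_mkcond.
have sD' z : (tuple_opp z \in D) = (z \in D).
  apply/idP/idP; rewrite !inE; last exact: sD.
  by move=> /sD; rewrite tuple_oppK.
rewrite -[RHS]ge0_integral_tuple_opp.
- by apply: eq_integral => z _; rewrite !patchE sD'.
- exact/(measurable_restrictT _ _).1.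
- by move=> z; rewrite patchE; case: ifPn => // /set_mem/f0.
Qed.

Lemma integral_odd0 (D : set Rk) (f : Rk -> \bar R) : measurable D ->
  (forall z, D z -> D (tuple_opp z)) -> Lk.-integrable D f ->
  (forall z, f (tuple_opp z) = - f z) ->
  \int[Lk]_(z in D) f z = 0.
Proof.
move=> mD sD intf fo; have mf := measurable_int _ intf.
rewrite integralE.
have -> : \int[Lk]_(z in D) f^\- z = \int[Lk]_(z in D) f^\+ z.
  rewrite -[RHS]ge0_integral_opp_on//; last exact: measurable_funepos.
  by apply: eq_integral => z _; rewrite funenegE funeposE fo.
by rewrite subee// integrable_pos_fin_num.
Qed.

Definition linform (c : 'I_k -> R) (z : Rk) : R := (\sum_i c i * tnth z i)%R.

Lemma measurable_linform c : measurable_fun setT (linform c).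
Proof.
apply: measurable_sum => i; apply: measurable_funM => //; exact: measurable_tnth.
Qed.

Lemma linform_le c : exists2 A : R, (0 <= A)%R &
  forall z, (`|linform c z| <= A * (1 + sqnorm z))%R.
Proof.
exists (\sum_i `|c i|)%R; first exact: sumr_ge0.
move=> z; rewrite mulr_suml; apply: (le_trans (ler_norm_sum _ _ _)).
apply: ler_sum => i _; rewrite normrM ler_wpM2l//.
apply: (@le_trans _ _ (1 + tnth z i ^+ 2)%R).
  by rewrite -(@real_normK _ (tnth z i)) ?num_real//; have := sqr_ge0 (`|tnth z i : R| - 1)%R; nra.
by rewrite lerD2l /sqnorm (bigD1 i)//= lerDl sumr_ge0// => j _; rewrite sqr_ge0.
Qed.

Lemma integrable_linform c (D : set Rk) (K : Rk -> R) : measurable D ->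
  Lk.-integrable D (EFin \o K) ->
  Lk.-integrable D (fun z => (sqnorm z * K z)%:E) ->
  Lk.-integrable D (fun z => (linform c z * K z)%:E).
Proof.
move=> mD iK isK; have [A A0 HA] := linform_le c.
have mK : measurable_fun D K by have /measurable_EFinP := measurable_int _ iK.
apply: (@le_integrable _ _ _ _ _ mD _ (fun z => A%:E * ((EFin \o K) z + (sqnorm z * K z)%:E))).
- apply/measurable_EFinP; apply: measurable_funM => //.
  by apply: measurable_funTS; exact: measurable_linform.
- move=> z _.
  have -> : A%:E * ((EFin \o K) z + (sqnorm z * K z)%:E) = (A * (1 + sqnorm z) * K z)%:E.
    by rewrite /= -EFinD -EFinM; congr EFin; ring.
  rewrite lee_fin normrM [leRHS]normrM ler_wpM2r// [leRHS]ger0_norm//.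
  by rewrite mulr_ge0// addr_ge0// sqnorm_ge0.
- by apply: integrableZl => //; exact: integrableD.
Qed.

Lemma integral_linform0 c (D : set Rk) (K : Rk -> R) : measurable D ->
  (forall z, D z -> D (tuple_opp z)) -> (forall z, K (tuple_opp z) = K z) ->
  Lk.-integrable D (EFin \o K) ->
  Lk.-integrable D (fun z => (sqnorm z * K z)%:E) ->
  \int[Lk]_(z in D) (linform c z * K z)%:E = 0.
Proof.
move=> mD sD eK iK isK; apply: integral_odd0 => //; first exact: integrable_linform.
move=> z; rewrite eK -EFinN -mulNr; congr (_ * _)%:E.
by rewrite /linform -sumrN; apply: eq_bigr => i _; rewrite tnth_opp mulrN.
Qed.

(** The first order part of an increment does not contribute to its integral
    against an even kernel. *)
Lemma integral_ge_quadratic c (B : R) (D : set Rk) (K f : Rk -> R) : measurable D ->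
  (forall z, D z -> D (tuple_opp z)) -> (forall z, K (tuple_opp z) = K z) ->
  (forall z, D z -> (0 <= K z)%R) ->
  Lk.-integrable D (EFin \o K) ->
  Lk.-integrable D (fun z => (sqnorm z * K z)%:E) ->
  measurable_fun D f -> (forall z, D z -> (linform c z - B * sqnorm z <= f z)%R) ->
  (- B)%:E * \int[Lk]_(z in D) (sqnorm z * K z)%:E <= \int[Lk]_(z in D) (f z * K z)%:E.
Proof.
move=> mD sD eK K0 iK isK mf Hf.
have mK : measurable_fun D K by have /measurable_EFinP := measurable_int _ iK.
have iL := integrable_linform c mD iK isK.
rewrite -[leLHS]add0e -(integral_linform0 c mD sD eK iK isK) -integralZl//.
rewrite -integralD//; last exact: integrableZl.
apply: le_integral_quasi => //.
- apply: emeasurable_funD; first exact: measurable_int iL.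
  by apply: emeasurable_funM => //; exact: measurable_int isK.
- by apply/measurable_EFinP; exact: measurable_funM.
- move=> z Dz; rewrite -EFinM -EFinD lee_fin mulrA -mulrDl ler_wpM2r ?K0//.
  by rewrite mulNr; exact: Hf.
Qed.

End odd_integrals.

(** * Truncation of the kernel, and principal values *)

Section truncated_kernels.
Context {R : realType} (k : nat) (s : R).
Hypotheses (s0 : 0 < s) (s1 : s < 1).
Local Notation RR := (measurableTypeR R).
Local Notation Rk := (k.-tuple RR).
Local Notation mu := (@lebesgue_measure R).
Local Notation Lk := (@lebesgue_tuple R k).
Local Notation kpart := (@kpart R k s).
Local Notation ckernel := (@ckernel R k s).
Local Notation K := (@frac_kernel R k s).
Local Open Scope ereal_scope.

Lemma measurable_sqnorm_pre (I : set R) : measurable I ->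
  measurable [set z : Rk | I (sqnorm z)].
Proof.
by move=> mI; rewrite -[X in measurable X]setTI; exact: measurable_sqnorm.
Qed.

(** The parts of the kernel, divided by [ckernel], that come from the times above
    and below [e]. The second is defined by subtraction, so that the two add up
    to the kernel at the origin too. *)
Definition farK (e : R) (z : Rk) : R := fine (kpart `]e, +oo[ z).
Definition nearK (e : R) (z : Rk) : R := (K z / ckernel - farK e z)%R.

Lemma farKE e z : (0 < e)%R -> (farK e z)%:E = kpart `]e, +oo[ z.
Proof.
move=> e0; rewrite fineK// ge0_fin_numE ?kpart_ge0//.
by apply: le_lt_trans (kpart_far_le s0 z e0) _; rewrite ltry.
Qed.

Lemma nearKE e z : (0 < e)%R -> (0 < sqnorm z)%R -> (nearK e z)%:E = kpart `]0%R, e] z.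
Proof.
move=> e0 z0; have c0 := ckernel_gt0 k s0.
have := kernel_kpart s0 z0; rewrite (kpart_split _ _ e0) -(farKE z e0) => KE.
have fn : kpart `]0%R, e] z \is a fin_num.
  rewrite ge0_fin_numE ?kpart_ge0// ltNge leye_eq; apply/negP => /eqP E.
  by move: KE; rewrite E addye// gt0_muley ?lte_fin.
move: KE; rewrite -(fineK fn) -EFinD -EFinM => -[KE].
by rewrite /nearK KE; congr EFin; field; rewrite gt_eqF.
Qed.

Lemma farK_ge0 e z : (0 <= farK e z)%R.
Proof. exact/fine_ge0/kpart_ge0. Qed.

Lemma nearK_ge0 e z : (0 < e)%R -> (0 < sqnorm z)%R -> (0 <= nearK e z)%R.
Proof. by move=> e0 z0; rewrite -lee_fin nearKE// kpart_ge0. Qed.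

Lemma measurable_farK e D : measurable_fun D (farK e).
Proof.
apply: measurable_funTS; apply: (measurableT_comp (fine_measurable measurableT)) => //.
exact: measurable_kpart.
Qed.

Lemma measurable_nearK e D : measurable_fun D (nearK e).
Proof.
apply: measurable_funB; last exact: measurable_farK.
by apply: measurable_funTS; apply: measurable_funM => //; exact: measurable_frac_kernel.
Qed.

Lemma frac_kernel_opp z : K (tuple_opp z) = K z.
Proof. by rewrite !frac_kernelE sqnorm_opp. Qed.

Lemma farK_opp e z : farK e (tuple_opp z) = farK e z.
Proof. by rewrite /farK /kpart sqnorm_opp. Qed.

Lemma nearK_opp e z : nearK e (tuple_opp z) = nearK e z.
Proof. by rewrite /nearK farK_opp frac_kernel_opp. Qed.

Lemma frac_kernel_split e z : K z = (ckernel * nearK e z + ckernel * farK e z)%R.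
Proof. by rewrite /nearK; field; rewrite gt_eqF ?ckernel_gt0. Qed.

Lemma integral_farK e : (0 < e)%R -> \int[Lk]_z (farK e z)%:E = (e `^ (- s) / s)%:E.
Proof.
by move=> e0; under eq_integral do rewrite farKE//; rewrite integral_kpart_far.
Qed.

Lemma integrable_ge0 d (T : measurableType d) (m : {measure set T -> \bar R})
    (D : set T) (f : T -> R) : measurable D -> measurable_fun D f ->
  (forall x, D x -> (0 <= f x)%R) -> \int[m]_(x in D) (f x)%:E < +oo ->
  m.-integrable D (EFin \o f).
Proof.
move=> mD mf f0 foo; apply/integrableP; split; first exact/measurable_EFinP.
rewrite (_ : \int[m]_(x in D) _ = \int[m]_(x in D) (f x)%:E)//.
by apply: eq_integral => x /set_mem Dx /=; rewrite ger0_norm// f0.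
Qed.

Lemma integrable_farK e (D : set Rk) : (0 < e)%R -> measurable D ->
  Lk.-integrable D (EFin \o farK e).
Proof.
move=> e0 mD; apply: (integrableS measurableT) => //.
apply: integrable_ge0 => //; first exact: measurable_farK.
- by move=> z _; exact: farK_ge0.
- by rewrite integral_farK// ltry.
Qed.

Lemma integrable_kernel_tail (r : R) (D : set Rk) : (0 < r)%R -> measurable D ->
  (forall z, D z -> (r <= sqnorm z)%R) -> Lk.-integrable D (EFin \o K).
Proof.
move=> r0 mD Dr; suff : Lk.-integrable [set z : Rk | (r <= sqnorm z)%R] (EFin \o K).
  by apply: integrableS => //; exact: measurable_sqnorm_ge.
apply: integrable_ge0.
- exact: measurable_sqnorm_ge.
- by apply: measurable_funTS; exact: measurable_frac_kernel.
- by move=> z _; exact: frac_kernel_ge0.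
- exact: kernel_tail_lty.
Qed.

Lemma integrable_kernel_moment (r : R) (D : set Rk) : (0 < r)%R -> measurable D ->
  (forall z, D z -> (sqnorm z <= r)%R) ->
  Lk.-integrable D (fun z => (sqnorm z * K z)%:E).
Proof.
move=> r0 mD Dr; suff : Lk.-integrable [set z : Rk | (sqnorm z <= r)%R] (fun z => (sqnorm z * K z)%:E).
  by apply: integrableS => //; exact: measurable_sqnorm_le.
apply: (@integrable_ge0 _ _ _ _ (fun z => sqnorm z * K z)%R).
- exact: measurable_sqnorm_le.
- apply: measurable_funTS; apply: measurable_funM; [exact: measurable_sqnorm|exact: measurable_frac_kernel].
- by move=> z _; rewrite mulr_ge0 ?sqnorm_ge0 ?frac_kernel_ge0.
- have [C _ HC] := ball_moment k s0 s1.
  by apply: le_lt_trans (HC _ r0) _; rewrite ltry.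
Qed.

Lemma integrable_nearK e r (D : set Rk) : (0 < e)%R -> (0 < r)%R -> measurable D ->
  (forall z, D z -> (r <= sqnorm z)%R) -> Lk.-integrable D (EFin \o nearK e).
Proof.
move=> e0 r0 mD Dr.
rewrite (_ : _ \o _ = (fun z => (ckernel^-1)%:E * (EFin \o K) z - (EFin \o farK e) z)).
  apply: integrableB => //; last exact: integrable_farK.
  by apply: integrableZl => //; exact: (@integrable_kernel_tail r).
by apply/funext => z; rewrite /= -EFinM -EFinB /nearK mulrC.
Qed.

Lemma near_moment_nearK : exists2 C : R, (0 <= C)%R & forall (e r : R) (D : set Rk),
  (0 < e)%R -> (0 < r)%R -> measurable D -> (forall z, D z -> (r <= sqnorm z)%R) ->
  Lk.-integrable D (fun z => (sqnorm z * nearK e z)%:E) /\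
  \int[Lk]_(z in D) (sqnorm z * nearK e z)%:E <= (C * e `^ (1 - s))%:E.
Proof.
have [C C0 HC] := near_moment k s1; exists C => // e r D e0 r0 mD Dr.
have z0 z : D z -> (0 < sqnorm z)%R by move=> /Dr; exact: lt_le_trans.
have msK : measurable_fun D (fun z => sqnorm z * nearK e z)%R.
  apply: measurable_funM; last exact: measurable_nearK.
  by apply: measurable_funTS; exact: measurable_sqnorm.
have le : \int[Lk]_(z in D) (sqnorm z * nearK e z)%:E <= (C * e `^ (1 - s))%:E.
  apply: le_trans (HC _ e0).
  rewrite (_ : \int[Lk]_(z in D) _ = \int[Lk]_(z in D) ((sqnorm z)%:E * kpart `]0%R, e] z)).
    apply: ge0_subset_integral => //.
    - apply: emeasurable_funM; last exact: measurable_kpart.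
      by apply/measurable_EFinP; exact: measurable_sqnorm.
    - by move=> z _; rewrite mule_ge0 ?kpart_ge0 ?lee_fin ?sqnorm_ge0.
  by apply: eq_integral => z /set_mem Dz; rewrite EFinM nearKE// z0.
split => //; apply: (@integrable_ge0 _ _ _ _ (fun z => sqnorm z * nearK e z)%R) => //.
- by move=> z Dz; rewrite mulr_ge0 ?sqnorm_ge0// nearK_ge0// z0.
- by apply: le_lt_trans le _; rewrite ltry.
Qed.

Lemma annulusE (a b : R) : (0 < a)%R -> (0 < b)%R ->
  [set z : Rk | (a < enorm (vec z) < b)%R] = [set z : Rk | `](a ^+ 2)%R, (b ^+ 2)%R[%classic (sqnorm z)].
Proof.
move=> a0 b0; apply/seteqP; split => z /=; rewrite in_itv/= enorm_vec.
  rewrite -{3 4}(sqr_sqrtr (sqnorm_ge0 z)) => /andP[h1 h2].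
  by rewrite !ltr_pXn2r ?nnegrE ?sqrtr_ge0 ?h1 ?h2// ltW.
rewrite -{1 2}(sqr_sqrtr (sqnorm_ge0 z)) => /andP[].
by rewrite !ltr_pXn2r ?nnegrE ?sqrtr_ge0 ?(ltW a0) ?(ltW b0)// => -> ->.
Qed.

Lemma outsideE (a : R) : (0 < a)%R ->
  [set z : Rk | (a <= enorm (vec z))%R] = [set z : Rk | (a ^+ 2 <= sqnorm z)%R].
Proof.
move=> a0; apply/funext => z; apply/propext; rewrite /= enorm_vec.
by rewrite -[sqnorm z in X in _ <-> X](sqr_sqrtr (sqnorm_ge0 z)) ler_pXn2r ?nnegrE ?sqrtr_ge0 ?(ltW a0).
Qed.

(** On an annulus the linear part integrates to 0 by oddness; what remains is
    absolutely integrable on the ball, with a bound given by the second moment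
    of the kernel. *)
Lemma pv_cvg : exists2 M : R, (0 <= M)%R &
  forall (f : Rk -> R) (c : 'I_k -> R) (C d : R), (0 < d)%R -> (0 <= C)%R ->
  measurable_fun [set z : Rk | (sqnorm z < d ^+ 2)%R] f ->
  (forall z, (sqnorm z < d ^+ 2)%R -> (`|f z - linform c z| <= C * sqnorm z)%R) ->
  exists2 L : R, (`|L| <= C * (M * (d ^+ 2) `^ (1 - s)))%R &
    \int[Lk]_(z in [set z : Rk | (e < enorm (vec z) < d)%R]) (f z * K z)%:E
      @[e --> (0%R : R)^'+] --> L%:E.
Proof.
have [M M0 HM] := ball_moment k s0 s1; exists M => // f c C d d0 C0 mf Hf.
set D := [set z : Rk | _] in mf.
have mD : measurable D.
  rewrite (_ : D = [set z | `]-oo, (d ^+ 2)%R[%classic (sqnorm z)]).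
    exact: measurable_sqnorm_pre.
  by apply/seteqP; split => z /=; rewrite in_itv.
have mK (A : set Rk) : measurable_fun A K.
  by apply: measurable_funTS; exact: measurable_frac_kernel.
pose g z := ((f z - linform c z) * K z)%R.
have mg : measurable_fun D g.
  apply: measurable_funM => //; apply: measurable_funB => //.
  by apply: measurable_funTS; exact: measurable_linform.
have gb z : D z -> (`|g z| <= C * (sqnorm z * K z))%R.
  move=> Dz; rewrite /g normrM (ger0_norm (frac_kernel_ge0 _ _)) mulrA.
  by rewrite ler_wpM2r ?frac_kernel_ge0// Hf.
have dd0 : (0 < d ^+ 2)%R by rewrite exprn_gt0.
have isK A : measurable A -> A `<=` D -> Lk.-integrable A (fun z => (sqnorm z * K z)%:E).
  by move=> mA AD; apply: (integrable_kernel_moment dd0) => // z /AD /ltW.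
have ig A : measurable A -> A `<=` D -> Lk.-integrable A (EFin \o g).
  move=> mA AD; apply: (@le_integrable _ _ _ _ _ mA _ (fun z => C%:E * (sqnorm z * K z)%:E)).
  - by apply/measurable_EFinP; exact: measurable_funS mg.
  - by move=> z /AD /gb h; rewrite -EFinM /= lee_fin (le_trans h)// ler_norm.
  - by apply: integrableZl => //; exact: isK.
have gle (r : R) A : (0 < r)%R -> measurable A -> A `<=` D -> (forall z, A z -> (sqnorm z <= r)%R) ->
    `|\int[Lk]_(z in A) (g z)%:E| <= (C * (M * r `^ (1 - s)))%:E.
  move=> r0 mA AD Ar; apply: (@le_trans _ _ (\int[Lk]_(z in A) (C%:E * (sqnorm z * K z)%:E))).
    apply: (le_trans (le_abse_integral _ mA _)); first exact: measurable_int (ig _ mA AD).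
    apply: ge0_le_integral => //.
    - by apply: measurableT_comp => //; exact: measurable_int (ig _ mA AD).
    - by apply: emeasurable_funM => //; exact: measurable_int (isK _ mA AD).
    - by move=> z /AD /gb h; rewrite -EFinM /= lee_fin.
  rewrite ge0_integralZl_EFin//; last 2 first.
  - by move=> z _; rewrite lee_fin mulr_ge0 ?sqnorm_ge0 ?frac_kernel_ge0.
  - exact: measurable_int (isK _ mA AD).
  rewrite [leRHS]EFinM lee_wpmul2l ?lee_fin//; apply: le_trans (HM _ r0).
  apply: ge0_subset_integral => //.
  - exact: measurable_sqnorm_le.
  - apply/measurable_EFinP; apply: measurable_funM => //.
    by apply: measurable_funTS; exact: measurable_sqnorm.
  - by move=> z _; rewrite lee_fin mulr_ge0 ?sqnorm_ge0 ?frac_kernel_ge0.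
have fin : \int[Lk]_(z in D) (g z)%:E \is a fin_num by exact: integrable_fin_num (ig _ mD _).
exists (fine (\int[Lk]_(z in D) (g z)%:E)).
  rewrite -lee_fin; have := gle _ D dd0 mD (fun z h => h) (fun z h => ltW h).
  by rewrite -{1}(fineK fin).
have split e : (0 < e)%R -> (e < d)%R ->
    \int[Lk]_(z in [set z : Rk | (e < enorm (vec z) < d)%R]) (f z * K z)%:E =
    \int[Lk]_(z in D) (g z)%:E - \int[Lk]_(z in [set z : Rk | (sqnorm z <= e ^+ 2)%R]) (g z)%:E.
  move=> e0 ed; rewrite annulusE//; set A := [set z : Rk | _]; set B := [set z : Rk | _].
  have mA : measurable A by exact: measurable_sqnorm_pre.
  have mB : measurable B by exact: measurable_sqnorm_le.
  have ee : (0 < e ^+ 2)%R by rewrite exprn_gt0.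
  have AD : A `<=` D by move=> z; rewrite /A/= in_itv/= => /andP[].
  have BD : B `<=` D.
    by move=> z /= h; apply: le_lt_trans h _; rewrite ltr_pXn2r ?nnegrE// ltW.
  have DE : D = A `|` B.
    apply/seteqP; split => z; last by case=> [/AD|/BD].
    rewrite /D /A /B /= in_itv/= => ->; rewrite andbT.
    by case: (ltP (e ^+ 2)%R (sqnorm z)) => h; [left|right].
  rewrite [in X in _ = X - _]DE integral_setU//; last 2 first.
  - by rewrite -DE; exact: measurable_int (ig _ mD _).
  - rewrite disj_set2E; apply/eqP/seteqP; split => z //; rewrite /A /B /= in_itv/= => -[/andP[h _]].
    by rewrite leNgt h.
  rewrite addeK; last exact: integrable_fin_num (ig _ mB BD).
  have Ale z : A z -> (e ^+ 2 <= sqnorm z)%R by rewrite /A/= in_itv/= => /andP[/ltW].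
  have iK : Lk.-integrable A (EFin \o K) by exact: integrable_kernel_tail ee mA Ale.
  have sA z : A z -> A (tuple_opp z) by rewrite /A/= sqnorm_opp.
  rewrite -[RHS]adde0 -(integral_linform0 c mA sA frac_kernel_opp iK (isK _ mA AD)).
  rewrite -integralD//; last 2 first.
  - exact: ig.
  - by apply: integrable_linform => //; exact: isK.
  apply: eq_integral => z _; rewrite -EFinD /g; congr EFin; ring.
apply/fine_cvgP; split.
  near=> e; have e0 : (0 < e)%R by near: e; exact: nbhs_right_gt.
  have ed : (e < d)%R by near: e; exact: nbhs_right_lt.
  rewrite split// fin_numB fin/=; apply: integrable_fin_num; first exact: measurable_sqnorm_le.
  apply: ig; first exact: measurable_sqnorm_le.
  by move=> z /= h; apply: le_lt_trans h _; rewrite ltr_pXn2r ?nnegrE// ltW.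
apply/cvgrPdist_le => eps eps0.
have cvg0 : (C * (M * (e ^+ 2) `^ (1 - s)))%R @[e --> (0%R : R)^'+] --> (0 : R)%R.
  rewrite -[X in _ --> X](mulr0 C); apply: cvgM; first exact: cvg_cst.
  rewrite -[X in _ --> X](mulr0 M); apply: cvgM; first exact: cvg_cst.
  have s10 : (0 < 2 * (1 - s))%R by rewrite mulr_gt0// subr_gt0.
  have := powR_cvg0_right s10; apply: cvg_trans; apply: near_eq_cvg; near=> e.
  have e0 : (0 < e)%R by near: e; exact: nbhs_right_gt.
  by rewrite powRrM powR_mulrn// ltW.
near=> e; have e0 : (0 < e)%R by near: e; exact: nbhs_right_gt.
have ed : (e < d)%R by near: e; exact: nbhs_right_lt.
have BD : [set z : Rk | (sqnorm z <= e ^+ 2)%R] `<=` D.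
  by move=> z /= h; apply: le_lt_trans h _; rewrite ltr_pXn2r ?nnegrE// ltW.
have mB : measurable [set z : Rk | (sqnorm z <= e ^+ 2)%R] by exact: measurable_sqnorm_le.
have finB : \int[Lk]_(z in [set z : Rk | (sqnorm z <= e ^+ 2)%R]) (g z)%:E \is a fin_num.
  by apply: integrable_fin_num => //; exact: ig.
have E : fine (\int[Lk]_(z in [set z : Rk | (e < enorm (vec z) < d)%R]) (f z * K z)%:E) =
    (fine (\int[Lk]_(z in D) (g z)%:E) -
     fine (\int[Lk]_(z in [set z : Rk | (sqnorm z <= e ^+ 2)%R]) (g z)%:E))%R.
  by rewrite split// fineB.
rewrite [X in (_ - X)%R]E opprB addrC subrK.
apply: (@le_trans _ _ (C * (M * (e ^+ 2) `^ (1 - s)))%R).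
  have ee : (0 < e ^+ 2)%R by rewrite exprn_gt0.
  by have := gle _ _ ee mB BD (fun z h => h); rewrite -{1}(fineK finB).
apply: le_trans (ler_norm _) _; near: e; exact: (cvgr0_norm_le _ cvg0).
Unshelve. all: by end_near. Qed.

End truncated_kernels.

(** * Paraboloids as test functions *)

Section paraboloids.
Context {R : realType} {N : nat}.
Implicit Types x y : 'rV[R]_N.

Lemma is_derive_quadratic (f : 'rV[R]_N -> R) x v (a c : R) :
  (forall h, f (h *: v + x) = f x + h * a + h ^+ 2 * c) -> is_derive x v f a.
Proof.
move=> fE.
have cvgf : h^-1 *: ((f \o shift x) (h *: v) - f x) @[h --> (0 : R)^'] --> a.
  have : (a + h * c) @[h --> (0 : R)^'] --> a.
    rewrite -[X in _ --> X]addr0; apply: cvgD; first exact: cvg_cst.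
    rewrite -[X in _ --> X](mul0r c); apply: cvgM; last exact: cvg_cst.
    exact: nbhs_dnbhs.
  apply: cvg_trans; apply: near_eq_cvg; near=> h.
  have h0 : h != 0 by near: h; exact: nbhs_dnbhs_neq.
  by rewrite /= fE /GRing.scale/=; field.
split; first by apply/cvg_ex; exists a.
exact: cvg_lim cvgf.
Unshelve. all: by end_near. Qed.

Lemma cvg_sum_real (T I : Type) (F : set_system T) {FF : Filter F} (r : seq I)
    (f : I -> T -> R) (l : I -> R) : (forall i, f i x @[x --> F] --> l i) ->
  (\sum_(i <- r) f i x) @[x --> F] --> \sum_(i <- r) l i.
Proof.
move=> H; elim: r => [|i r IH].
  by rewrite big_nil; under eq_fun do rewrite big_nil; exact: cvg_cst.
by rewrite big_cons; under eq_fun do rewrite big_cons; exact: cvgD.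
Qed.

Lemma continuous_coord_sub y i : continuous (fun x : 'rV[R]_N => (x - y) ord0 i).
Proof.
have -> : (fun x : 'rV[R]_N => (x - y) ord0 i) = (fun x => x ord0 i - y ord0 i).
  by apply/funext => x; rewrite !mxE.
move=> x; have H := @coord_continuous R 1 N ord0 i x.
have H2 := @cst_continuous 'rV[R]_N R (y ord0 i) x.
exact: (@continuousB R R 'rV[R]_N (fun x => x ord0 i) (fun=> y ord0 i) x H H2).
Qed.

Lemma continuous_edot_sub y : continuous (fun x : 'rV[R]_N => edot (x - y) (x - y)).
Proof.
move=> x; rewrite /edot; apply: (@cvg_sum_real _ _ (nbhs x) (nbhs_filter x) _ (fun i (x : 'rV[R]_N) => (x - y) ord0 i * (x - y) ord0 i)) => i.
have cf := @continuous_coord_sub y i x; exact: (cvgM cf cf).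
Qed.

Lemma edot_basis x (i : 'I_N) : edot x (basis_vec i) = x ord0 i.
Proof.
rewrite /edot (bigD1 i)//= !mxE !eqxx mulr1 big1 ?addr0// => j ji.
by rewrite !mxE eqxx (negbTE ji) mulr0.
Qed.

Lemma C2_paraboloid (b : R) y U : C2_on U (fun x : 'rV[R]_N => - b * edot (x - y) (x - y)).
Proof.
set f := fun x : 'rV[R]_N => _.
have df (i : 'I_N) x : is_derive x (basis_vec i) f (- b * 2 * (x - y) ord0 i).
  apply: (@is_derive_quadratic _ _ _ _ (- b)) => h; rewrite /f -addrA [in LHS]edot_sqrD.
  rewrite !edotZl edotZr [edot (basis_vec i) (x - y)]edotC !edot_basis [basis_vec i ord0 i]mxE !eqxx/=; ring.
have DE (i : 'I_N) : 'D_(basis_vec i) f = fun x => - b * 2 * (x - y) ord0 i.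
  by apply/funext => x; have [_ ->] := df i x.
have ddf (i j : 'I_N) x : is_derive x (basis_vec j) ('D_(basis_vec i) f) (- b * 2 * (i == j)%:R).
  rewrite DE; apply: (@is_derive_quadratic _ _ _ _ 0) => h.
  have -> : (h *: basis_vec j + x - y) ord0 i = h * (i == j)%:R + (x - y) ord0 i.
    by rewrite /basis_vec !mxE eqxx/=; ring.
  ring.
have ccoord (i : 'I_N) x : {for x, continuous (fun x' : 'rV[R]_N => - b * 2 * (x' - y) ord0 i)}.
  have H := @cst_continuous 'rV[R]_N R (- b * 2) x.
  exact: (@continuousM R 'rV[R]_N (fun=> - b * 2) (fun x => (x - y) ord0 i) x H (@continuous_coord_sub y i x)).
move=> x _; split.
  have H := @cst_continuous 'rV[R]_N R (- b) x.
  exact: (@continuousM R 'rV[R]_N (fun=> - b) _ x H (@continuous_edot_sub y x)).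
move=> i; split; first by have [] := df i x.
  by rewrite DE; exact: ccoord.
move=> j; split; first by have [] := ddf i j x.
rewrite (_ : 'D_(basis_vec j) _ = fun=> - b * 2 * (i == j)%:R).
  exact: (@cst_continuous 'rV[R]_N R (- b * 2 * (i == j)%:R) x).
by apply/funext => z; have [_ ->] := ddf i j z.
Qed.

End paraboloids.

Section supersolution_test.
Context {R : realType} (N k : nat) (s p : R).
Hypotheses (k1 : (1 < k)%N) (s0 : 0 < s) (s1 : s < 1).
Local Notation Rk := (k.-tuple (measurableTypeR R)).
Local Notation Lk := (@lebesgue_tuple R k).
Local Notation K := (@frac_kernel R k s).
Local Notation kpart := (@kpart R k s).
Local Open Scope ereal_scope.

Lemma integrable_bounded_mul (D : set Rk) (f g : Rk -> R) (B : R) : measurable D ->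
  measurable_fun D f -> (forall z, D z -> (`|f z| <= B)%R) ->
  Lk.-integrable D (EFin \o g) -> Lk.-integrable D (fun z => (f z * g z)%:E).
Proof.
move=> mD mf fB ig; apply: (@le_integrable _ _ _ _ _ mD _ (fun z => B%:E * (EFin \o g) z)).
- apply/measurable_EFinP; apply: measurable_funM => //.
  by have /measurable_EFinP := measurable_int _ ig.
- move=> z Dz; rewrite -EFinM /= lee_fin !normrM ler_wpM2r//.
  by apply: le_trans (fB _ Dz) _; exact: ler_norm.
- exact: integrableZl.
Qed.

(** A function touching [u] from below and opening downwards no faster than a
    paraboloid may be used, all over R^N, in place of a test function. The
    truncated kernel stands for the principal value up to a small error. *)
Lemma supersolution_test (u W : 'rV[R]_N -> R) (x0 x1 : 'rV[R]_N) (b B : R)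
    (xi : 'I_k -> 'rV[R]_N) :
  viscosity_supersolution k s p u -> orthonormal_frame xi -> (0 <= b)%R ->
  (forall x, 0 <= W x <= B)%R -> measurable_fun setT (W \o @vec R N) ->
  (forall x, W x - W x0 <= u x - u x0)%R ->
  (forall x, - b * (edot (x - x1) (x - x1) - edot (x0 - x1) (x0 - x1)) <= W x - W x0)%R ->
  exists2 C : R, (0 <= C)%R & forall e : R, (0 < e)%R -> (e <= 1)%R ->
    \int[Lk]_z ((W (frame_point xi x0 z))%:E * kpart `]e, +oo[ z) <=
    (W x0 * (e `^ (- s) / s) + C * e `^ (1 - s)
      - u x0 `^ p / (@C_ks R k s * ckernel k s))%:E.
Proof.
move=> [u0 _ [[mu _] _] usup] xio b0 W01 mW uW Wb.
have [M M0 pvM] := @pv_cvg R k s s0 s1.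
have [C1 C10 HC1] := @near_moment_nearK R k s s0 s1.
have [C2 C20 HC2] := @far_mass_ball R k s s0 k1.
have ck0 := @ckernel_gt0 R k s s0; set ck := ckernel k s in ck0 *.
have Cs0 := C_ks_gt0 s0 s1 (ltnW k1); set Cs := C_ks k s in Cs0 *.
have B0 : (0 <= B)%R by have /andP[] := W01 x0; exact: le_trans.
exists (b * M / ck + b * C1 + B * C2)%R.
  by rewrite !addr_ge0 ?mulr_ge0// invr_ge0 ltW.
move=> e e0 e1.
pose c i := (2 * edot (x0 - x1) (xi i))%R.
pose q x := edot (x - x1) (x - x1).
have qE z : (q (frame_point xi x0 z) - q x0 = linform c z + sqnorm z)%R.
  have -> : linform c z = (\sum_i 2 * edot (x0 - x1) (xi i) * tnth z i)%R by [].
  by rewrite /q edot_frame_point//; ring.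
pose f z := (W (frame_point xi x0 z) - W x0)%R.
pose phi x := (- b * edot (x - x1) (x - x1))%R.
have linZ z : linform (fun i => - b * c i)%R z = (- b * linform c z)%R.
  by rewrite /linform mulr_sumr; apply: eq_bigr => i _; ring.
have phiE z : (phi (frame_point xi x0 z) - phi x0 =
    linform (fun i => - b * c i)%R z - b * sqnorm z)%R.
  by rewrite /phi -mulrBr -/(q _) -/(q _) qE linZ; ring.
have mWf : measurable_fun setT (fun z : Rk => W (frame_point xi x0 z)).
  exact: measurable_frame_point.
have mf : measurable_fun setT f by exact: measurable_funB.
have muf : measurable_fun setT (fun z : Rk => u (frame_point xi x0 z)).
  exact: measurable_frame_point.
have fB z : (`|f z| <= B)%R.
  by rewrite /f; have /andP[] := W01 (frame_point xi x0 z); have /andP[] := W01 x0; rewrite ler_norml; lra.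
(* the radius of the test is the truncation parameter, so that all that the
   paraboloid contributes is of order [e `^ (1 - s)] *)
have [L Lle Lcvg] : exists2 L : R, (`|L| <= b * (M * (e ^+ 2) `^ (1 - s)))%R &
    pv_near s xi phi x0 e = L%:E.
  have [||L Lle Lcvg] := pvM (fun z => phi (frame_point xi x0 z) - phi x0)%R
     (fun i => - b * c i)%R b e e0 b0.
  - apply: measurable_funTS; under eq_fun do rewrite phiE.
    apply: measurable_funB; first exact: measurable_linform.
    by apply: measurable_funM => //; exact: measurable_sqnorm.
  - by move=> z _; rewrite phiE addrAC subrr add0r normrN normrM !ger0_norm ?sqnorm_ge0.
  by exists L => //; exact: cvg_lim Lcvg.
have tst := usup x0 e phi e0 (C2_paraboloid b x1 (U := _)).
have {}tst : Cs%:E * L%:E + Cs%:E * away s xi u x0 e + (u x0 `^ p)%:E <= 0.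
  apply: le_trans (tst _); last first.
    by move=> x _; have := uW x; have := Wb x; rewrite /phi; lra.
  rewrite leeD2r// -Lcvg; apply: ereal_sup_ubound; exists xi => //.
have awle : away s xi u x0 e <= (- (u x0 `^ p) / Cs - L)%:E.
  move: tst; case: (away _ _ _ _ _) => [a| |].
  - rewrite -!EFinM -!EFinD !lee_fin => h.
    have -> : (a = (Cs * L + Cs * a + u x0 `^ p) / Cs + (- (u x0 `^ p) / Cs - L))%R.
      by field; rewrite gt_eqF.
    rewrite gerDr; apply: mulr_le0_ge0 => //; rewrite invr_ge0 ltW//.
  - by rewrite gt0_muley ?lte_fin// -EFinM addey// addye.
  - by rewrite leNye.
rewrite /away /increment_integral outsideE// in awle.
set E := [set z : Rk | _] in awle.
have mE : measurable E by exact: measurable_sqnorm_ge.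
have ee : (0 < e ^+ 2)%R by rewrite exprn_gt0.
have sE z : E z -> E (tuple_opp z) by rewrite /E/= sqnorm_opp.
have iKE : Lk.-integrable E (EFin \o K) by exact: (@integrable_kernel_tail _ _ _ s0 s1 (e ^+ 2)%R).
have inE' : Lk.-integrable E (EFin \o nearK s e).
  exact: (@integrable_nearK _ _ _ s0 s1 e (e ^+ 2)%R).
have ifar D : measurable D -> Lk.-integrable D (EFin \o farK s e) by move=> mD; exact: integrable_farK.
have [isn snle] := HC1 e (e ^+ 2)%R E e0 ee mE (fun z h => h).
have ifK : Lk.-integrable E (fun z => (f z * K z)%:E).
  by apply: (@integrable_bounded_mul _ _ _ B) => //; exact: measurable_funTS.
have ifn : Lk.-integrable E (fun z => (f z * nearK s e z)%:E).
  by apply: (@integrable_bounded_mul _ _ _ B) => //; exact: measurable_funTS.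
have iff : Lk.-integrable E (fun z => (f z * farK s e z)%:E).
  by apply: (@integrable_bounded_mul _ _ _ B) => //; [exact: measurable_funTS|exact: ifar].
have iWf D : measurable D -> Lk.-integrable D (fun z => (W (frame_point xi x0 z) * farK s e z)%:E).
  move=> mD; apply: (@integrable_bounded_mul _ _ _ B) => //; last exact: ifar.
    exact: measurable_funTS.
  by move=> z _; have /andP[? ?] := W01 (frame_point xi x0 z); rewrite ger0_norm.
have aw2 : \int[Lk]_(z in E) (f z * K z)%:E <= (- (u x0 `^ p) / Cs - L)%:E.
  apply: le_trans awle; apply: le_integral_quasi => //.
  - exact: measurable_int ifK.
  - apply/measurable_EFinP; apply: measurable_funTS; apply: measurable_funM.
      exact: measurable_funB.
    exact: measurable_frac_kernel.
  - by move=> z _; rewrite lee_fin ler_wpM2r ?frac_kernel_ge0//; exact: uW.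
have split : \int[Lk]_(z in E) (f z * K z)%:E =
    ck%:E * \int[Lk]_(z in E) (f z * nearK s e z)%:E + ck%:E * \int[Lk]_(z in E) (f z * farK s e z)%:E.
  rewrite -!integralZl// -integralD//; try exact: integrableZl.
  apply: eq_integral => z _; rewrite -!EFinM -EFinD (frac_kernel_split s0 e); congr EFin; rewrite -/ck; ring.
have far : \int[Lk]_(z in E) (f z * farK s e z)%:E =
    \int[Lk]_(z in E) (W (frame_point xi x0 z) * farK s e z)%:E
    - (W x0)%:E * \int[Lk]_(z in E) (farK s e z)%:E.
  rewrite -integralZl//; last exact: ifar.
  rewrite -integralB//; last 2 first.
  - exact: iWf.
  - by apply: integrableZl => //; exact: ifar.
  by apply: eq_integral => z _; rewrite -EFinM -EFinB; congr EFin; rewrite /f; ring.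
pose Bl := [set z : Rk | (sqnorm z <= e ^+ 2)%R].
have mBl : measurable Bl by exact: measurable_sqnorm_le.
have W0 z : (0 <= W (frame_point xi x0 z))%R by have /andP[] := W01 (frame_point xi x0 z).
have tot : \int[Lk]_z (W (frame_point xi x0 z) * farK s e z)%:E <=
    \int[Lk]_(z in E) (W (frame_point xi x0 z) * farK s e z)%:E
    + \int[Lk]_(z in Bl) (W (frame_point xi x0 z) * farK s e z)%:E.
  have mfar D : measurable_fun D (fun z : Rk => (W (frame_point xi x0 z) * farK s e z)%:E).
    by apply/measurable_EFinP; apply: measurable_funM; [exact: measurable_funTS|exact: measurable_farK].
  rewrite -(setUv E) ge0_integral_setU//; last 3 first.
  - exact: measurableC.
  - by move=> z _; rewrite lee_fin mulr_ge0 ?farK_ge0.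
  - by rewrite disj_set2E setICr.
  rewrite leeD2l//; apply: ge0_subset_integral => //.
  - exact: measurableC.
  - by move=> z _; rewrite lee_fin mulr_ge0 ?farK_ge0.
  - by move=> z /= /negP; rewrite -ltNge => /ltW.
have ball : \int[Lk]_(z in Bl) (W (frame_point xi x0 z) * farK s e z)%:E <= (B * (C2 * e `^ (1 - s)))%:E.
  apply: (@le_trans _ _ (\int[Lk]_(z in Bl) (B%:E * kpart `]e, +oo[ z))).
    apply: ge0_le_integral => //.
    - by move=> z _; rewrite lee_fin mulr_ge0 ?farK_ge0.
    - by apply/measurable_EFinP; apply: measurable_funM; [exact: measurable_funTS|exact: measurable_farK].
    - by apply: emeasurable_funM => //; exact: measurable_kpart.
    - move=> z _; rewrite -(farKE s0 z e0) -EFinM lee_fin ler_wpM2r ?farK_ge0//.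
      by have /andP[] := W01 (frame_point xi x0 z).
  rewrite ge0_integralZl_EFin//; last 2 first.
  - by move=> z _; exact: kpart_ge0.
  - exact: measurable_kpart.
  by rewrite [leRHS]EFinM lee_wpmul2l ?lee_fin// HC2.
have farle : \int[Lk]_(z in E) (farK s e z)%:E <= (e `^ (- s) / s)%:E.
  rewrite -(@integral_farK R k s s0 e e0); apply: ge0_subset_integral => //.
  - by apply/measurable_EFinP; exact: measurable_farK.
  - by move=> z _; rewrite lee_fin farK_ge0.
have nearge : (- b)%:E * \int[Lk]_(z in E) (sqnorm z * nearK s e z)%:E <=
    \int[Lk]_(z in E) (f z * nearK s e z)%:E.
  apply: (@integral_ge_quadratic R k (fun i => - b * c i)%R b E (nearK s e) f).
  - exact: mE.
  - exact: sE.
  - exact: nearK_opp.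
  - by move=> z Ez; apply: nearK_ge0 => //; exact: lt_le_trans ee Ez.
  - exact: inE'.
  - exact: isn.
  - exact: measurable_funTS.
  - move=> z _; rewrite /f -phiE -mulrBr; exact: Wb.
have -> : \int[Lk]_z ((W (frame_point xi x0 z))%:E * kpart `]e, +oo[ z) =
    \int[Lk]_z (W (frame_point xi x0 z) * farK s e z)%:E.
  by apply: eq_integral => z _; rewrite EFinM farKE.
have fin (D : set Rk) (g : Rk -> \bar R) : measurable D -> Lk.-integrable D g ->
    exists r : R, \int[Lk]_(z in D) g z = r%:E.
  by move=> mD ig; exists (fine (\int[Lk]_(z in D) g z)); rewrite fineK//; exact: integrable_fin_num.
have [r1 E1] := fin _ _ measurableT (iWf _ measurableT).
have [r2 E2] := fin _ _ mE (iWf _ mE).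
have [r3 E3] := fin _ _ mBl (iWf _ mBl).
have [r4 E4] := fin _ _ mE ifn.
have [r5 E5] := fin _ _ mE (ifar _ mE).
have [r6 E6] := fin _ _ mE isn.
rewrite /= in E5.
have {}aw2 : (ck * r4 + ck * (r2 - W x0 * r5) <= - (u x0 `^ p) / Cs - L)%R.
  by rewrite -lee_fin; apply: le_trans aw2; rewrite split far E2 E4 E5.
rewrite E1 E2 E3 -EFinD lee_fin in tot; rewrite E3 lee_fin in ball.
rewrite E5 lee_fin in farle; rewrite E4 E6 -EFinM lee_fin in nearge.
rewrite E6 lee_fin in snle; rewrite E1 lee_fin.
have e2 : ((e ^+ 2) `^ (1 - s) <= e `^ (1 - s))%R.
  have s10 : (0 <= 1 - s)%R by rewrite subr_ge0 ltW.
  by apply: (ge0_ler_powR s10); rewrite ?nnegrE ?(ltW ee) ?(ltW e0)// expr2 ler_piMl// ltW.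
have Lge : (- L <= b * (M * e `^ (1 - s)))%R.
  apply: (le_trans (ler_norm _)); rewrite normrN; apply: (le_trans Lle).
  by rewrite ler_wpM2l// ler_wpM2l.
have /andP[Wx0 _] := W01 x0.
have a1 : (r4 + (r2 - W x0 * r5) <= (- (u x0 `^ p) / Cs - L) / ck)%R.
  by rewrite ler_pdivlMr// mulrC mulrDr.
have a2 : ((- (u x0 `^ p) / Cs - L) / ck <= - (u x0 `^ p / (Cs * ck)) + b * M / ck * e `^ (1 - s))%R.
  have -> : ((- (u x0 `^ p) / Cs - L) / ck = - (u x0 `^ p / (Cs * ck)) + (- L) / ck)%R.
    by field; rewrite !gt_eqF.
  rewrite lerD2l ler_pdivrMr//.
  have -> : (b * M / ck * e `^ (1 - s) * ck = b * (M * e `^ (1 - s)))%R by field; rewrite gt_eqF.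
  exact: Lge.
have a3 : (W x0 * r5 <= W x0 * (e `^ (- s) / s))%R by rewrite ler_wpM2l.
have a4 : (b * r6 <= b * (C1 * e `^ (1 - s)))%R by rewrite ler_wpM2l.
by rewrite !mulrDl; lra.
Qed.

End supersolution_test.

(** * Comparison with radial subsolutions *)

Section minima.
Context {R : realType}.

Lemma seq_min (T : eqType) (f : T -> R) (l : seq T) (x0 : T) : x0 \in l ->
  exists2 x, x \in l & forall y, y \in l -> f x <= f y.
Proof.
elim: l x0 => // a l IH x0 _; case: l IH => [_|b l IH].
  by exists a; rewrite ?mem_head// => y; rewrite inE => /eqP ->.
have [x xl xmin] := IH b (mem_head _ _).
have [ax|xa] := leP (f a) (f x).
  exists a; first exact: mem_head.
  by move=> y; rewrite inE => /orP[/eqP ->//|/xmin]; exact: le_trans.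
exists x; first by rewrite inE xl orbT.
by move=> y; rewrite inE => /orP[/eqP ->|/xmin//]; exact: ltW.
Qed.

(** Otherwise the open sets on which [f] exceeds one of its values on [A] would
    cover [A]; at the point where the smallest of the values of a finite subcover
    is taken, [f] would exceed another of them. *)
Lemma compact_lsc_min (T : ptopologicalType) (A : set T) (f : T -> R) :
  compact A -> A !=set0 ->
  (forall x a, a < f x -> \forall y \near x, a < f y) ->
  exists2 x, A x & forall y, A y -> f x <= f y.
Proof.
move=> cA [a0 Aa0] lsc; apply: contrapT => nomin.
have H x : A x -> exists2 y, A y & f y < f x.
  move=> Ax; apply: contrapT => h; apply: nomin; exists x => // y Ay.
  by rewrite leNgt; apply/negP => yx; apply: h; exists y.
move: cA; rewrite compact_cover => cA.
pose O (y : T) : set T := [set x | f y < f x].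
have [] := cA T A O.
- move=> y _; rewrite openE => x Oyx; exact: lsc.
- by move=> x /H[y Ay yx]; exists y.
move=> D DA AO.
have [d0 d0D _] := AO _ Aa0.
have [d dD dmin] := @seq_min T f (finmap.enum_fset D) d0 d0D.
have [|d' d'D] := AO d; first by have /set_mem := DA _ dD.
by rewrite /O /= ltNge dmin.
Qed.

End minima.

Section comparison.
Context {R : realType} (N k : nat) (s p : R).
Hypotheses (k1 : (1 < k)%N) (kN : (k <= N)%N) (s0 : 0 < s) (s1 : s < 1).
Local Notation Rk := (k.-tuple (measurableTypeR R)).
Local Notation Lk := (@lebesgue_tuple R k).
Local Notation kpart := (@kpart R k s).

(** What comparison asks of a radial function: boundedness makes the integrals
    converge, decay makes minima exist, and tangents of bounded slope provide
    paraboloids as test functions. *)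
Definition profile (g : R -> R) := exists2 B : R, 0 <= B &
  [/\ forall q, 0 <= q -> 0 <= g q <= B,
      forall q, 0 <= q -> exists2 b, 0 <= b <= B &
        forall q', 0 <= q' -> - b * (q' - q) <= g q' - g q &
      forall e, 0 < e -> exists rho, forall q, rho <= q -> g q <= e].

(** The tangents at [q] and [q'] bound the increment from both sides. *)
Lemma profile_lipschitz g : profile g -> exists2 B : R, 0 <= B &
  forall q q', 0 <= q -> 0 <= q' -> `|g q - g q'| <= B * `|q - q'|.
Proof.
move=> [B B0 [_ tan _]]; exists B => // q q' q0 q'0.
have [b /andP[b0 bB] Hb] := tan q q0; have [b' /andP[b'0 b'B] Hb'] := tan q' q'0.
have h1 := Hb q' q'0; have h2 := Hb' q q0.
have n1 : `|q - q'| >= q - q' by exact: ler_norm.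
have n2 : `|q - q'| >= q' - q by rewrite distrC; exact: ler_norm.
have n0 : 0 <= `|q - q'| by [].
by rewrite ler_norml; apply/andP; split; nra.
Qed.

Lemma profile_add g h : profile g -> profile h -> profile (fun q => g q + h q).
Proof.
move=> [B B0 [g1 g2 g3]] [C C0 [h1 h2 h3]]; exists (B + C); first exact: addr_ge0.
split.
- by move=> q q0; have /andP[? ?] := g1 q q0; have /andP[? ?] := h1 q q0; apply/andP; split; lra.
- move=> q q0; have [b /andP[? ?] Hb] := g2 q q0; have [c /andP[? ?] Hc] := h2 q q0.
  exists (b + c); first by apply/andP; split; lra.
  by move=> q' q'0; have := Hb q' q'0; have := Hc q' q'0; lra.
- move=> e e0; have e20 : 0 < e / 2 by rewrite divr_gt0.
  have [r Hr] := g3 _ e20; have [t Ht] := h3 _ e20.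
  exists (Num.max r t) => q; rewrite ge_max => /andP[/Hr ? /Ht ?]; lra.
Qed.

Lemma profile_scale c g : 0 <= c -> profile g -> profile (fun q => c * g q).
Proof.
move=> c0 [B B0 [g1 g2 g3]]; exists (c * B); first exact: mulr_ge0.
split.
- by move=> q q0; have /andP[? ?] := g1 q q0; rewrite mulr_ge0//= ler_wpM2l.
- move=> q q0; have [b /andP[? ?] Hb] := g2 q q0.
  exists (c * b); first by rewrite mulr_ge0//= ler_wpM2l.
  by move=> q' q'0; have := Hb q' q'0; nra.
- move=> e e0; have [->|cn0] := eqVneq c 0; first by exists 0 => q _; rewrite mul0r ltW.
  have cp : 0 < c by rewrite lt_neqAle eq_sym cn0.
  have [r Hr] := g3 (e / c) (divr_gt0 e0 cp); exists r => q /Hr.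
  by rewrite ler_pdivlMr// mulrC.
Qed.

Lemma profile0 : profile (fun=> 0).
Proof.
exists 0 => //; split=> [q _|q _|e e0]; first by rewrite lexx.
  by exists 0; [rewrite lexx|move=> q' _; lra].
by exists 0 => q _; exact: ltW.
Qed.

Lemma profile_sum (I : Type) (l : seq I) (g : I -> R -> R) :
  (forall i, profile (g i)) -> profile (fun q => \sum_(i <- l) g i q).
Proof.
move=> Hg; elim: l => [|i l IH].
  by under eq_fun do rewrite big_nil; exact: profile0.
by under eq_fun do rewrite big_cons; exact: profile_add.
Qed.

(** The truncated kernel has total mass [e `^ (- s) / s], so that the two sides
    differ by an integral of increments: up to a vanishing error, [g] is a
    subsolution of [J w = - h], with kernel divided by [ckernel], at the points
    at squared distance [q0] from the center, in planes containing the center. *)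
Definition subsolution_at (g : R -> R) (h q0 : R) := exists2 C : R, 0 <= C &
  forall a : 'I_k -> R, \sum_i a i ^+ 2 = q0 -> forall e, 0 < e -> e <= 1 ->
  ((g q0 * (e `^ (- s) / s) - h - C * e `^ (1 - s))%:E <=
   \int[Lk]_z ((g (\sum_i (a i + tnth z i) ^+ 2))%:E * kpart `]e, +oo[ z))%E.

Lemma continuous_radial g (x1 : 'rV[R]_N) : profile g ->
  continuous (fun x : 'rV[R]_N => g (edot (x - x1) (x - x1))).
Proof.
move=> pg x; have [B B0 HB] := profile_lipschitz pg.
have FF : Filter (nbhs (x : 'rV[R]_N)) by exact: nbhs_filter.
apply/(@cvgrPdist_le _ _ _ (nbhs (x : 'rV[R]_N)) FF) => e e0.
have B1 : 0 < B + 1 by rewrite ltr_wpDl.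
have c := @continuous_edot_sub R N x1 x.
have eB : 0 < e / (B + 1) by rewrite divr_gt0.
have := @cvgr_dist_le R R 'rV[R]_N (nbhs x) FF _ _ c _ eB; apply: filterS => y yx.
apply: (le_trans (HB _ _ (edot_ge0 _) (edot_ge0 _))).
apply: (@le_trans _ _ ((B + 1) * (e / (B + 1)))); last by rewrite mulrCA divff ?mulr1// gt_eqF.
by apply: ler_pM => //; rewrite lerDl.
Qed.

Lemma compact_edot_ball (x1 : 'rV[R]_N) (r : R) :
  compact [set x : 'rV[R]_N | edot (x - x1) (x - x1) <= r].
Proof.
apply: bounded_closed_compact.
  exists (`|x1| + Num.sqrt r); split; first exact: num_real.
  move=> M HM x /= xr; rewrite -[x](subrK x1).
  apply: (le_trans (ler_normD _ _)); rewrite addrC; apply: le_trans (ltW HM).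
  rewrite lerD2l [leLHS]mx_normrE; apply: bigmax_le; first exact: sqrtr_ge0.
  move=> [i j] _ /=; rewrite [i]ord1 -sqrtr_sqr ler_sqrt.
    exact: le_trans (coord_sqr_le _ _) xr.
  exact: le_trans (edot_ge0 _) xr.
rewrite (_ : [set x | _] = (fun x : 'rV[R]_N => edot (x - x1) (x - x1)) @^-1` [set y | y <= r])//.
apply: preimage_closed; first by move=> x _; exact: continuous_edot_sub.
exact: closed_le.
Qed.

(** Otherwise [u - g] has a negative minimum, since [u] is nonnegative and lower
    semicontinuous and [g] vanishes at infinity. At a minimum point the tangents
    of [g] provide a paraboloid touching [u] from below, and in a frame whose
    plane contains the center the inequality for [u] contradicts the one for
    [g] as the truncation parameter tends to 0. *)
Lemma comparison (u : 'rV[R]_N -> R) (x1 : 'rV[R]_N) (g : R -> R) :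
  viscosity_supersolution k s p u -> profile g -> measurable_fun setT g ->
  (forall x, u x < g (edot (x - x1) (x - x1)) ->
    exists2 h, subsolution_at g h (edot (x - x1) (x - x1)) &
      h < u x `^ p / (@C_ks R k s * ckernel k s)) ->
  forall x, g (edot (x - x1) (x - x1)) <= u x.
Proof.
move=> su pg mg sub y; rewrite leNgt; apply/negP => uy.
pose q (x : 'rV[R]_N) := edot (x - x1) (x - x1).
pose W (x : 'rV[R]_N) := g (q x).
have [u0 lscu _ _] := su.
have [B B0 [gB gtan gdec]] := pg.
have q0 x : 0 <= q x by exact: edot_ge0.
have d0 : 0 < (W y - u y) / 2 by rewrite divr_gt0// subr_gt0.
have [rho Hrho] := gdec _ d0.
have cW : continuous W by exact: continuous_radial.
have [x0 /= x0A x0min] : exists2 x0, q x0 <= Num.max rho (q y) &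
    forall x, q x <= Num.max rho (q y) -> u x0 - W x0 <= u x - W x.
  apply: (@compact_lsc_min R 'rV[R]_N _ (fun x => u x - W x)).
  - exact: compact_edot_ball.
  - by exists y => /=; rewrite le_max lexx orbT.
  - move=> x a ax.
    pose d := (u x - W x - a) / 2; have dd : 0 < d by rewrite divr_gt0// subr_gt0.
    have dx : ((u x - d)%:E < (EFin \o u) x)%E by rewrite lte_fin gtrBl.
    have [V nV HV] := lscu x (u x - d) dx.
    have FF : Filter (nbhs (x : 'rV[R]_N)) by exact: nbhs_filter.
    have nW := @cvgr_dist_lt R R 'rV[R]_N (nbhs x) FF _ _ (cW x) _ dd.
    near=> z.
    have uz : u x - d < u z.
      by rewrite -lte_fin; apply: HV; near: z.
    have : `|W x - W z| < d by near: z; exact: nW.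
    by rewrite ltr_norml => /andP[h1 h2]; move: uz h1 h2; rewrite /d; lra.
have x0y : u x0 - W x0 <= u y - W y by apply: x0min; rewrite le_max lexx orbT.
have glob x : u x0 - W x0 <= u x - W x.
  have [/x0min//|] := leP (q x) (Num.max rho (q y)).
  rewrite gt_max => /andP[/ltW /Hrho h _]; have := u0 x; move: h x0y d0; rewrite -/(W x); lra.
have ux0 : u x0 < W x0 by lra.
have [h [C1 C10 HC1] hlt] := sub x0 ux0.
have [xi xio xiE] := frame_through (x0 - x1) (ltnW k1) kN.
have [b /andP[b0 _] Hb] := gtan (q x0) (q0 x0).
have mW : measurable_fun setT (W \o @vec R N).
  apply: (measurableT_comp mg).
  under eq_fun => z.
    rewrite /q /edot; under eq_bigr => i _ do rewrite !mxE. over.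
  apply: measurable_sum => i.
  by apply: measurable_funM; apply: measurable_funB => //; exact: measurable_tnth.
have glob' x : W x - W x0 <= u x - u x0 by have := glob x; lra.
have [C C0 HC] := @supersolution_test R N k s p k1 s0 s1 u W x0 x1 b B xi su xio b0
   (fun x => gB _ (q0 x)) mW glob' (fun x => Hb _ (q0 x)).
have E e : 0 < e -> e <= 1 -> u x0 `^ p / (@C_ks R k s * ckernel k s) - h <= (C + C1) * e `^ (1 - s).
  move=> e0 e1; have h1 := HC1 (fun i => edot (x0 - x1) (xi i)) xiE e e0 e1.
  have h2 := HC e e0 e1.
  have h12 : (\int[Lk]_z ((g (\sum_i (edot (x0 - x1) (xi i) + tnth z i) ^+ 2))%:E * kpart `]e, +oo[ z) =
      \int[Lk]_z ((W (frame_point xi x0 z))%:E * kpart `]e, +oo[ z))%E.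
    by apply: eq_integral => z _; rewrite /W /q edot_frame_point_sq// xiE subrr add0r.
  rewrite h12 in h1; have := le_trans h1 h2.
  by rewrite lee_fin -/(q x0) -/(W x0) mulrDl; lra.
have D0 : 0 < u x0 `^ p / (@C_ks R k s * ckernel k s) - h by rewrite subr_gt0.
set D := _ - h in D0 E.
have CC : 0 < C + C1 + 1 by rewrite ltr_wpDl// addr_ge0.
have s10 : 0 < 1 - s by rewrite subr_gt0.
pose e := Num.min 1 ((D / (2 * (C + C1 + 1))) `^ (1 - s)^-1).
have e0 : 0 < e by rewrite lt_min ltr01 powR_gt0// divr_gt0// mulr_gt0.
have e1 : e <= 1 by rewrite ge_min lexx.
have es : e `^ (1 - s) <= D / (2 * (C + C1 + 1)).
  have -> : D / (2 * (C + C1 + 1)) = ((D / (2 * (C + C1 + 1))) `^ (1 - s)^-1) `^ (1 - s).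
    by rewrite -powRrM mulVf ?gt_eqF// powRr1// divr_ge0 ?ltW// mulr_gt0.
  by apply: (ge0_ler_powR (ltW s10)); rewrite ?nnegrE ?powR_ge0 ?(ltW e0)// ge_min lexx orbT.
have := E e e0 e1; apply/negP; rewrite -ltNge.
apply: (@le_lt_trans _ _ ((C + C1 + 1) * (D / (2 * (C + C1 + 1))))).
  by apply: ler_pM => //; rewrite ?addr_ge0 ?powR_ge0// lerDl.
have -> : (C + C1 + 1) * (D / (2 * (C + C1 + 1))) = D / 2 by field; rewrite gt_eqF.
by rewrite ltr_pdivrMr// ltr_pMr// ltr1n.
Unshelve. all: by end_near. Qed.

End comparison.

(** * Heat kernels and potentials as subsolutions *)

Section real_integrals.
Context {R : realType}.
Local Notation mu := (@lebesgue_measure R).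
Local Open Scope ereal_scope.

Lemma integral_indic_mul d (T : measurableType d) (m : {measure set T -> \bar R})
    (D : set T) (f : T -> R) :
  \int[m]_(x in D) (f x)%:E = \int[m]_x (f x * \1_D x)%:E.
Proof.
rewrite integral_mkcond; apply: eq_integral => x _; rewrite patchE indicE.
by case: ifPn; rewrite ?mulr1 ?mulr0.
Qed.

Lemma integral_indic_mulr d (T : measurableType d) (m : {measure set T -> \bar R})
    (D E : set T) (f : T -> R) : E `<=` D ->
  \int[m]_(x in D) (f x * \1_E x)%:E = \int[m]_(x in E) (f x)%:E.
Proof.
move=> ED; rewrite integral_indic_mul.
rewrite [LHS]integral_indic_mul; apply: eq_integral => x _; congr EFin; rewrite -mulrA; congr (_ * _)%R.
rewrite !indicE; case: (boolP (x \in E)) => xE; rewrite ?mul0r// mul1r.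
by rewrite mem_set//; apply: ED; exact: set_mem.
Qed.

Lemma measurable_powR_sub (t0 c : R) : measurable_fun setT (fun r : R => (r - t0) `^ c)%R.
Proof. by apply: (measurableT_comp (measurable_powR _)); exact: measurable_funB. Qed.

Lemma integral_powR_shift (t0 b c : R) : (0 < b)%R -> (0 < c)%R ->
  \int[mu]_(r in `]t0, (t0 + b)%R[) ((r - t0) `^ (c - 1))%:E = (b `^ c / c)%:E.
Proof.
move=> b0 c0; rewrite -(integral_powR0 b0 c0) [LHS]integral_indic_mul [RHS]integral_indic_mul.
rewrite -[RHS](@ge0_integral_shift _ _ (- t0)).
- apply: eq_integral => r _; congr EFin; congr (_ * _)%R; rewrite !indicE; congr (nat_of_bool _)%:R.
  by apply/idP/idP => /set_mem/=; rewrite in_itv/= => /andP[? ?]; apply/mem_set; rewrite /= in_itv/=; apply/andP; split; lra.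
- apply/measurable_EFinP; apply: measurable_funM; first exact: measurable_powR.
  exact: measurable_indic.
- by move=> r; rewrite lee_fin mulr_ge0 ?powR_ge0.
Qed.

Lemma integral_powR_shifty (t0 e c : R) : (0 < e)%R -> (0 < c)%R ->
  \int[mu]_(r in `](t0 + e)%R, +oo[) ((r - t0) `^ (- 1 - c))%:E = (e `^ (- c) / c)%:E.
Proof.
move=> e0 c0; rewrite -(integral_powRy e0 c0) [LHS]integral_indic_mul [RHS]integral_indic_mul.
rewrite -[RHS](@ge0_integral_shift _ _ (- t0)).
- apply: eq_integral => r _; congr EFin; congr (_ * _)%R; rewrite !indicE; congr (nat_of_bool _)%:R.
  by apply/idP/idP => /set_mem/=; rewrite in_itv/= => /andP[? _]; apply/mem_set; rewrite /= in_itv/=; apply/andP; split => //; lra.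
- apply/measurable_EFinP; apply: measurable_funM; first exact: measurable_powR.
  exact: measurable_indic.
- by move=> r; rewrite lee_fin mulr_ge0 ?powR_ge0.
Qed.

End real_integrals.

Section heat_bounds.
Context {R : realType} (k : nat).
Local Notation heat := (@heat R k).

Lemma heat_le_gauss t0 r q : 0 < t0 -> t0 <= r ->
  heat r q <= (4 * pi * t0) `^ (- (k%:R / 2)) * expR (- (q / (4 * r))).
Proof.
move=> t00 tr; rewrite ler_wpM2r ?expR_ge0// !powRN lef_pV2 ?posrE ?powR_gt0 ?mulr_gt0 ?pi_gt0 ?(lt_le_trans t00 tr)//.
have k0 : (0 : R) <= k%:R / 2 by rewrite divr_ge0.
by apply: (ge0_ler_powR k0); rewrite ?nnegrE ?mulr_ge0 ?pi_ge0 ?(ltW t00) ?(ltW (lt_le_trans t00 tr))// ler_wpM2l// mulr_ge0 ?pi_ge0.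
Qed.

Lemma heat_ge_gauss t0 r q : 0 <= q -> 0 < t0 -> t0 <= r ->
  (4 * pi * r) `^ (- (k%:R / 2)) * expR (- (q / (4 * t0))) <= heat r q.
Proof.
move=> q0 t00 tr; rewrite ler_wpM2l ?powR_ge0// ler_expR lerN2 ler_wpM2l//.
by rewrite lef_pV2 ?posrE ?mulr_gt0 ?(lt_le_trans t00 tr)// ler_wpM2l.
Qed.

Lemma heat_le0 t q : 0 < t -> 0 <= q -> heat t q <= (4 * pi * t) `^ (- (k%:R / 2)).
Proof.
move=> t0 q0; rewrite ler_piMr ?powR_ge0// -expR0 ler_expR oppr_le0.
by rewrite divr_ge0// mulr_ge0// ltW.
Qed.

(** The exponential lies above its tangents. *)
Lemma heat_tangent t q q' : 0 < t ->
  heat t q - heat t q / (4 * t) * (q' - q) <= heat t q'.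
Proof.
move=> t0; rewrite -[in leRHS](subrK q q') heatD.
have -> : heat t q - heat t q / (4 * t) * (q' - q) = (1 + - ((q' - q) / (4 * t))) * heat t q.
  by field; rewrite gt_eqF.
by rewrite ler_wpM2r ?heat_ge0// expR_ge1Dx.
Qed.

Lemma expR_le_inv (x : R) : 0 <= x -> expR (- x) <= (1 + x)^-1.
Proof.
move=> x0; have h := expR_ge1Dx x; rewrite expRN lef_pV2 ?posrE ?expR_gt0//.
by rewrite ltr_pwDl.
Qed.

Lemma heat_growth t0 A : 0 < t0 -> 0 <= A -> exists2 E : R, 0 <= E &
  forall v, 0 <= v -> heat (t0 + v) A <= heat t0 A * (1 + E * v).
Proof.
move=> t00 A0; pose c := A / (4 * t0).
have c0 : 0 <= c by rewrite divr_ge0// mulr_ge0// ltW.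
exists (expR c * c / t0); first by rewrite divr_ge0 ?(ltW t00)// mulr_ge0 ?expR_ge0.
move=> v v0; have tv : 0 < t0 + v by rewrite ltr_wpDr.
apply: (le_trans (heat_le_gauss _ t00 (_ : t0 <= t0 + v))); first by rewrite lerDl.
rewrite /heat -[leRHS]mulrA ler_wpM2l ?powR_ge0//.
pose x := c * (v / (t0 + v)).
have x0 : 0 <= x by rewrite mulr_ge0// divr_ge0// ltW.
have xc : x <= c by rewrite ler_piMr// ler_pdivrMr// mul1r lerDr ltW.
have xv : x <= c * (v / t0).
  by rewrite ler_wpM2l// ler_wpM2l// lef_pV2 ?posrE// lerDl.
have -> : - (A / (4 * (t0 + v))) = - (A / (4 * t0)) + x.
  by rewrite /x /c; field; rewrite !gt_eqF.
rewrite expRD ler_wpM2l ?expR_ge0//.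
have h : 1 - x <= expR (- x) by exact: expR_ge1Dx.
have xe : expR (- x) * expR x = 1 by rewrite -expRD addNr expR0.
have e0 := expR_gt0 x.
have h2 : expR x <= 1 + x * expR x by nra.
apply: (le_trans h2); rewrite lerD2l.
have -> : expR c * c / t0 * v = (c * (v / t0)) * expR c by rewrite -!mulrA; ring.
by apply: ler_pM => //; rewrite ?expR_ge0// ler_expR.
Qed.

Lemma profile_heat t : 0 < t -> profile (heat t).
Proof.
move=> t0; pose B0 := (4 * pi * t) `^ (- (k%:R / 2)).
have B00 : 0 <= B0 by exact: powR_ge0.
have t4 : 0 < 4 * t by rewrite mulr_gt0.
have i4 : 0 <= (4 * t)^-1 by rewrite invr_ge0 ltW.
exists (B0 + B0 / (4 * t)); first by rewrite addr_ge0// mulr_ge0.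
split.
- by move=> q q0; rewrite heat_ge0/= (le_trans (heat_le0 _ _))// lerDl mulr_ge0.
- move=> q q0; exists (heat t q / (4 * t)).
    rewrite divr_ge0 ?heat_ge0 ?(ltW t4)//= (le_trans (ler_wpM2r _ (heat_le0 t0 q0)))//.
    by rewrite lerDr.
  by move=> q' q'0; have := heat_tangent q q' t0; lra.
- move=> e e0; exists (4 * t * B0 / e) => q qe.
  have q0 : 0 <= q by apply: le_trans qe; rewrite divr_ge0 ?mulr_ge0 ?(ltW e0)// ltW.
  have x0 : 0 <= q / (4 * t) by rewrite divr_ge0// ltW.
  rewrite /heat -/B0; apply: (le_trans (ler_wpM2l B00 (expR_le_inv x0))).
  rewrite ler_pdivrMr; last by rewrite ltr_pwDl.
  rewrite mulrDr mulr1 ler_wpDl ?(ltW e0)//.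
  by move: qe; rewrite mulrA ler_pdivlMr// ler_pdivrMr//; nra.
Qed.

End heat_bounds.

Section heat_potentials.
Context {R : realType} (k : nat) (s : R).
Hypotheses (k1 : (1 < k)%N) (s0 : 0 < s) (s1 : s < 1).
Local Notation RR := (measurableTypeR R).
Local Notation Rk := (k.-tuple RR).
Local Notation mu := (@lebesgue_measure R).
Local Notation Lk := (@lebesgue_tuple R k).
Local Notation kpart := (@kpart R k s).
Local Notation heat := (@heat R k).

Definition pot_weight (t0 T r : R) : R :=
  (r - t0) `^ (s - 1) * \1_(`]t0, t0 + T[%classic : set R) r.

(** Up to a constant factor, the inverse of the fractional Laplacian of R^k
    applied to the heat kernel of time [t0], with the time integral of its
    subordination formula cut at [T]. *)
Definition pot (t0 T q : R) : R :=
  fine (\int[mu]_r (pot_weight t0 T r * heat r q)%:E)%E.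

Lemma pot_weight_ge0 t0 T r : 0 <= pot_weight t0 T r.
Proof. by rewrite mulr_ge0 ?powR_ge0// indicE. Qed.

Lemma measurable_pot_weight t0 T : measurable_fun setT (pot_weight t0 T).
Proof.
apply: measurable_funM; first exact: measurable_powR_sub.
exact: measurable_indic.
Qed.

Lemma measurable_pot_integrand t0 T q (f : R -> R) : measurable_fun setT f ->
  measurable_fun setT (fun r : R => (pot_weight t0 T r * (heat r q * f r))%:E).
Proof.
move=> mf; apply/measurable_EFinP; apply: measurable_funM; first exact: measurable_pot_weight.
by apply: measurable_funM => //; apply: measurable_heat; [exact: measurable_id|exact: measurable_cst].
Qed.

Lemma pot_weight_mulE t0 T (f : R -> R) :
  (\int[mu]_r (pot_weight t0 T r * f r)%:E =
   \int[mu]_(r in `]t0, (t0 + T)%R[) ((r - t0) `^ (s - 1) * f r)%:E)%E.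
Proof.
rewrite [RHS]integral_indic_mul; apply: eq_integral => r _; congr EFin.
by rewrite /pot_weight mulrAC.
Qed.

Lemma pot_integral_le t0 T (f : R -> R) (c : R) : 0 < t0 -> 0 < T -> 0 <= c ->
  measurable_fun setT f ->
  (forall r, t0 < r -> r < t0 + T -> f r <= c) -> (forall r, 0 <= f r) ->
  (\int[mu]_r (pot_weight t0 T r * f r)%:E <= (c * (T `^ s / s))%:E)%E.
Proof.
move=> t00 T0 c0 mf fc f0; rewrite pot_weight_mulE EFinM -(integral_powR_shift t0 T0 s0).
rewrite -ge0_integralZl_EFin//; last first.
- by apply/measurable_EFinP; apply: measurable_funTS; exact: measurable_powR_sub.
- by move=> r _; rewrite lee_fin powR_ge0.
apply: ge0_le_integral => //.
- by move=> r _; rewrite lee_fin mulr_ge0 ?powR_ge0.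
- apply/measurable_EFinP; apply: measurable_funTS; apply: measurable_funM => //.
  exact: measurable_powR_sub.
- apply: emeasurable_funM => //.
  by apply/measurable_EFinP; apply: measurable_funTS; exact: measurable_powR_sub.
move=> r; rewrite /= in_itv/= => /andP[h1 h2].
by rewrite -EFinM lee_fin mulrC ler_wpM2r ?powR_ge0// fc.
Qed.

Let hbound (t0 : R) : R := (4 * pi * t0) `^ (- (k%:R / 2)).

Lemma heat_le_hbound t0 r q : 0 < t0 -> 0 <= q -> t0 < r ->
  heat r q <= hbound t0 * expR (- (q / (4 * r))) .
Proof. by move=> t00 q0 /ltW; exact: heat_le_gauss. Qed.

Lemma pot_upper t0 T q : 0 < t0 -> 0 < T -> 0 <= q ->
  (\int[mu]_r (pot_weight t0 T r * heat r q)%:E <=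
   (hbound t0 * expR (- (q / (4 * (t0 + T)))) * (T `^ s / s))%:E)%E.
Proof.
move=> t00 T0 q0; apply: pot_integral_le => //.
- by rewrite mulr_ge0 ?powR_ge0 ?expR_ge0.
- by apply: measurable_heat; [exact: measurable_id|exact: measurable_cst].
- move=> r r1 r2; apply: (le_trans (heat_le_hbound t00 q0 r1)).
  rewrite ler_wpM2l ?powR_ge0// ler_expR lerN2 ler_wpM2l// lef_pV2 ?posrE ?mulr_gt0 ?addr_gt0 ?(lt_trans t00 r1)//.
  by rewrite ler_wpM2l// ltW.
- by move=> r; exact: heat_ge0.
Qed.

Lemma potE t0 T q : 0 < t0 -> 0 < T -> 0 <= q ->
  ((pot t0 T q)%:E = \int[mu]_r (pot_weight t0 T r * heat r q)%:E)%E.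
Proof.
move=> t00 T0 q0; rewrite fineK// ge0_fin_numE.
  by apply: (le_lt_trans (pot_upper t00 T0 q0)); exact: ltry.
by apply: integral_ge0 => r _; rewrite lee_fin mulr_ge0 ?pot_weight_ge0 ?heat_ge0.
Qed.

Lemma pot_ge0 t0 T q : 0 <= pot t0 T q.
Proof.
apply: fine_ge0; apply: integral_ge0 => r _.
by rewrite lee_fin mulr_ge0 ?pot_weight_ge0 ?heat_ge0.
Qed.

Lemma measurable_pot t0 T : measurable_fun setT (pot t0 T).
Proof.
apply: (measurableT_comp (fine_measurable measurableT)).
apply: (@measurable_int_on R _ _ RR RR mu setT setT
  (fun p : RR * RR => (pot_weight t0 T p.2 * heat p.2 p.1)%:E)) => //.
  rewrite setXTT; apply/measurable_EFinP; apply: measurable_funM.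
    exact: (measurableT_comp (measurable_pot_weight t0 T) measurable_snd).
  by apply: measurable_heat; [exact: measurable_snd|exact: measurable_fst].
by move=> p _; rewrite lee_fin mulr_ge0 ?pot_weight_ge0 ?heat_ge0.
Qed.

Lemma profile_pot t0 T : 0 < t0 -> 0 < T -> profile (pot t0 T).
Proof.
move=> t00 T0; pose B0 := hbound t0 * (T `^ s / s).
have B00 : 0 <= B0 by rewrite mulr_ge0 ?powR_ge0// divr_ge0 ?powR_ge0// ltW.
have tT : 0 < 4 * (t0 + T) by rewrite mulr_gt0// addr_gt0.
have t4 : 0 < 4 * t0 by rewrite mulr_gt0.
have potB q : 0 <= q -> pot t0 T q <= B0 * expR (- (q / (4 * (t0 + T)))).
  by move=> q0; rewrite -lee_fin potE// mulrAC; exact: pot_upper.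
have potB0 q : 0 <= q -> pot t0 T q <= B0.
  move=> q0; apply: (le_trans (potB _ q0)); rewrite ler_piMr// expR_le1 oppr_le0.
  by rewrite divr_ge0// ltW.
exists (B0 + B0 / (4 * t0)); first by rewrite addr_ge0// divr_ge0// ltW.
split.
- by move=> q q0; rewrite pot_ge0/= (le_trans (potB0 _ q0))// lerDl divr_ge0// ltW.
- move=> q q0.
  pose I := (\int[mu]_r (pot_weight t0 T r * (heat r q * (4 * r)^-1 * \1_(`]0%R, +oo[%classic : set R) r))%:E)%E.
  have mI : measurable_fun setT (fun r : R => heat r q * (4 * r)^-1 * \1_(`]0%R, +oo[%classic : set R) r).
    apply: measurable_funM; last exact: measurable_indic.
    apply: measurable_funM; first by apply: measurable_heat; [exact: measurable_id|exact: measurable_cst].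
    by apply: (measurableT_comp measurable_invr); exact: measurable_funM.
  have I0 (r : R) : 0 <= heat r q * (4 * r)^-1 * \1_(`]0%R, +oo[%classic : set R) r.
    rewrite indicE; case: (boolP (_ \in _)) => [/set_mem/=|]; rewrite ?mulr0// mulr1 in_itv/= andbT => r0.
    by rewrite mulr_ge0 ?heat_ge0// invr_ge0 mulr_ge0// ltW.
  have IB : (I <= (B0 / (4 * t0))%:E)%E.
    rewrite /B0 -mulrA mulrCA; apply: (le_trans (@pot_integral_le t0 T _ (hbound t0 / (4 * t0)) t00 T0 _ mI _ I0)).
    - by rewrite divr_ge0 ?powR_ge0// ltW.
    - move=> r r1 r2; have r0 := lt_trans t00 r1.
      rewrite indicE mem_set ?mulr1; last by rewrite /= in_itv/= r0.
      apply: ler_pM; rewrite ?heat_ge0 ?invr_ge0 ?mulr_ge0 ?(ltW r0)//.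
        apply: (le_trans (heat_le_hbound t00 q0 r1)); rewrite ler_piMr ?powR_ge0// expR_le1 oppr_le0.
        by rewrite divr_ge0// mulr_ge0// ltW.
      by rewrite lef_pV2 ?posrE ?mulr_gt0// ler_wpM2l// ltW.
    - by rewrite lee_fin le_eqVlt; apply/orP; left; apply/eqP; ring.
  have Ige : (0 <= I)%E by apply: integral_ge0 => r _; rewrite lee_fin mulr_ge0 ?pot_weight_ge0.
  have If : I \is a fin_num by rewrite ge0_fin_numE// (le_lt_trans IB)// ltry.
  exists (fine I); first by rewrite fine_ge0//= -lee_fin fineK// (le_trans IB)// lee_fin lerDr.
  move=> q' q'0; suff : pot t0 T q + fine I * q <= pot t0 T q' + fine I * q' by lra.
  rewrite -lee_fin !EFinD !(mulrC (fine I)) !EFinM !potE// fineK//.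
  have mh c : measurable_fun setT (fun r : R => (pot_weight t0 T r * heat r c)%:E).
    have := measurable_pot_integrand t0 T c (@measurable_cst _ _ R R setT 1).
    by under eq_fun do rewrite mulr1.
  have mi : measurable_fun setT (fun r : R => (pot_weight t0 T r * (heat r q * (4 * r)^-1 * \1_(`]0%R, +oo[%classic : set R) r))%:E).
    by apply/measurable_EFinP; apply: measurable_funM => //; exact: measurable_pot_weight.
  have h0 c r : (0 <= (pot_weight t0 T r * heat r c)%:E)%E.
    by rewrite lee_fin mulr_ge0 ?pot_weight_ge0 ?heat_ge0.
  have i0 r : (0 <= (pot_weight t0 T r * (heat r q * (4 * r)^-1 * \1_(`]0%R, +oo[%classic : set R) r))%:E)%E.
    by rewrite lee_fin mulr_ge0 ?pot_weight_ge0.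
  have mq (c : R) : measurable_fun setT (fun r : R => (c%:E * (pot_weight t0 T r * (heat r q * (4 * r)^-1 * \1_(`]0%R, +oo[%classic : set R) r))%:E)%E).
    by apply: emeasurable_funM => //; exact: mi.
  have q1 (c r : R) : 0 <= c -> (0 <= c%:E * (pot_weight t0 T r * (heat r q * (4 * r)^-1 * \1_(`]0%R, +oo[%classic : set R) r))%:E)%E.
    by move=> c0; rewrite mule_ge0.
  have ZI (c : R) : 0 <= c -> (c%:E * I = \int[mu]_r (c%:E * (pot_weight t0 T r * (heat r q * (4 * r)^-1 * \1_(`]0%R, +oo[%classic : set R) r))%:E))%E.
    by move=> c0; rewrite ge0_integralZl_EFin.
  rewrite !ZI// -!ge0_integralD//; try (by move=> r _; exact: q1); try exact: mh; try exact: mq.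
  apply: ge0_le_integral => //.
  - by move=> r _; apply: adde_ge0 => //; exact: q1.
  - by apply: emeasurable_funD; [exact: mh|exact: mq].
  - by apply: emeasurable_funD; [exact: mh|exact: mq].
  move=> r _; rewrite -!EFinM -!EFinD lee_fin /pot_weight !indicE.
  case: (boolP (r \in _)) => [/set_mem/=|]; rewrite ?mulr0 ?mul0r ?mulr0 ?addr0//.
  rewrite in_itv/= mulr1 => /andP[r1 _]; have r0 := lt_trans t00 r1.
  rewrite mem_set ?mulr1; last by rewrite /= in_itv/= r0.
  have := heat_tangent k q q' r0; have := powR_ge0 (r - t0) (s - 1).
  set P := _ `^ _; set h := heat r q; set h' := heat r q'; set iv := _^-1 => P0 H.
  by have := ler_wpM2l P0 H; lra.
- move=> e e0; exists (4 * (t0 + T) * B0 / e) => q qe.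
  have q0 : 0 <= q by apply: le_trans qe; rewrite divr_ge0 ?(ltW e0)// mulr_ge0// ltW.
  have x0 : 0 <= q / (4 * (t0 + T)) by rewrite divr_ge0// ltW.
  apply: (le_trans (potB q q0)); apply: (le_trans (ler_wpM2l B00 (expR_le_inv x0))).
  rewrite ler_pdivrMr; last by rewrite ltr_pwDl.
  rewrite mulrDr mulr1 ler_wpDl ?(ltW e0)//.
  by move: qe; rewrite (mulrA e) ler_pdivlMr// ler_pdivrMr//; lra.
Qed.

(** The time integral of the convolution with the truncated kernel is the
    potential itself, up to a boundary term at the initial time; that term is
    carried by the heat kernel of time [t0], with a constant that depends on
    [s] only. *)
Lemma subsolution_pot t0 T A : 0 < t0 -> 0 < T -> 0 <= A ->
  subsolution_at k s (pot t0 T) ((2 / s ^+ 2 + (s * (1 - s))^-1) * heat t0 A) A.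
Proof.
move=> t00 T0 A0; have s10 : 0 < 1 - s by rewrite subr_gt0.
have [E E0 HE] := heat_growth k t00 A0; set H := heat t0 A in HE *.
have H0 : 0 <= H by exact: heat_ge0.
exists (H * E * (T `^ s / s ^+ 2)).
  apply: mulr_ge0; first exact: mulr_ge0.
  by rewrite divr_ge0 ?powR_ge0// exprn_ge0// ltW.
move=> a aA e e0 _.
have sum0 (z : Rk) : 0 <= \sum_i (a i + tnth z i) ^+ 2 by apply: sumr_ge0 => i _; exact: sqr_ge0.
have msum : measurable_fun setT (fun z : Rk => (\sum_i (a i + tnth z i) ^+ 2)%R).
  apply: measurable_sum => i; apply: (@measurable_tnth_comp R k (fun x => (a i + x) ^+ 2)%R).
  by apply: measurable_funX; exact: measurable_funD.
rewrite (@integral_mixture_kpart R k s (pot_weight t0 T) a (fun z => pot t0 T (\sum_i (a i + tnth z i) ^+ 2)) e e0); last 6 first.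
- exact: measurable_pot_weight.
- exact: pot_weight_ge0.
- move=> t t_0; rewrite /pot_weight indicE memNset ?mulr0// /= in_itv/= => /andP[t1 _]; lra.
- exact: (measurableT_comp (measurable_pot t0 T) msum).
- by move=> z; exact: pot_ge0.
- by move=> z; exact: potE.
rewrite aA; set c := e `^ (1 - s).
pose G r : \bar R := (\int[mu]_(y in `]e, +oo[) (pot_weight t0 T (r - y) * y `^ (- 1 - s))%:E)%E.
have G0 r : (0 <= G r)%E.
  by apply: integral_ge0 => y _; rewrite lee_fin mulr_ge0 ?pot_weight_ge0 ?powR_ge0.
have mG : measurable_fun setT G.
  apply: (@measurable_int_on R _ _ RR RR mu setT `]e, +oo[%classic
    (fun q : RR * RR => (pot_weight t0 T (q.1 - q.2) * q.2 `^ (- 1 - s))%:E)) => //.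
    apply: measurable_funTS; apply/measurable_EFinP; apply: measurable_funM.
      by apply: (measurableT_comp (measurable_pot_weight t0 T)); exact: measurable_funB.
    by apply: (measurableT_comp (measurable_powR _)).
  by move=> q _; rewrite lee_fin mulr_ge0 ?pot_weight_ge0 ?powR_ge0.
(* [J1] pays for the times close to [t0], at which the truncated kernel does not
   act yet, [J2] for the replacement of [(r - t0) `^ s] by [(r - t0 - e) `^ s] at later
   times, and [J3] for the growth of the heat kernel since the time [t0] *)
pose J1 r := (r - t0) `^ (s - 1) * \1_(`]t0, t0 + 2 * e[%classic : set R) r.
pose J2 r := (r - t0) `^ (- 1 - (1 - s)) * \1_(`]t0 + e, +oo[%classic : set R) r.
pose J3 r := pot_weight t0 T r.
have mJ1 : measurable_fun setT J1.
  by apply: measurable_funM; [exact: measurable_powR_sub|exact: measurable_indic].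
have mJ2 : measurable_fun setT J2.
  by apply: measurable_funM; [exact: measurable_powR_sub|exact: measurable_indic].
have mJ3 : measurable_fun setT J3 by exact: measurable_pot_weight.
have J10 r : 0 <= J1 r by rewrite mulr_ge0 ?powR_ge0// indicE.
have J20 r : 0 <= J2 r by rewrite mulr_ge0 ?powR_ge0// indicE.
have J30 r : 0 <= J3 r by exact: pot_weight_ge0.
have c0 : 0 <= c by exact: powR_ge0.
have es0 : 0 <= e `^ (- s) by exact: powR_ge0.
pose c1 := H * (e `^ (- s) / s); pose c2 := H * (c / s); pose c3 := H * (E * (c / s)).
have c10 : 0 <= c1 by rewrite mulr_ge0// divr_ge0// ltW.
have c20 : 0 <= c2 by rewrite mulr_ge0// divr_ge0// ltW.
have c30 : 0 <= c3 by rewrite mulr_ge0// mulr_ge0// divr_ge0// ltW.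
pose rem r := c1 * J1 r + c2 * J2 r + c3 * J3 r.
have rem0 r : 0 <= rem r by rewrite !addr_ge0// mulr_ge0.
have mrem : measurable_fun setT (EFin \o rem).
  by apply/measurable_EFinP; apply: measurable_funD; [apply: measurable_funD|]; apply: measurable_funM.
have Irem : (\int[mu]_r (rem r)%:E <= ((2 / s ^+ 2 + (s * (1 - s))^-1) * H + H * E * (T `^ s / s ^+ 2) * c)%:E)%E.
  have ZJ (J : R -> R) c' : measurable_fun setT J -> (forall r, 0 <= J r) -> 0 <= c' ->
      (\int[mu]_r (c' * J r)%:E = c'%:E * \int[mu]_r (J r)%:E)%E.
    move=> mJ J0 c'0; rewrite -ge0_integralZl_EFin//.
    - by move=> r _; rewrite lee_fin.
    - exact/measurable_EFinP.
  have mZ (J : R -> R) c' : measurable_fun setT J -> measurable_fun setT (fun r => (c' * J r)%:E).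
    by move=> mJ; apply/measurable_EFinP; exact: measurable_funM.
  have Z0 (J : R -> R) c' r : (forall r, 0 <= J r) -> 0 <= c' -> (0 <= (c' * J r)%:E)%E.
    by move=> J0 c'0; rewrite lee_fin mulr_ge0.
  have -> : (\int[mu]_r (rem r)%:E = c1%:E * \int[mu]_r (J1 r)%:E + c2%:E * \int[mu]_r (J2 r)%:E + c3%:E * \int[mu]_r (J3 r)%:E)%E.
    rewrite -!ZJ// -!ge0_integralD//; try (by move=> r _; exact: Z0); try exact: mZ.
      by move=> r _; apply: adde_ge0; exact: Z0.
    by apply: emeasurable_funD; exact: mZ.
  have e20 : 0 < 2 * e by rewrite mulr_gt0.
  have -> : (\int[mu]_r (J1 r)%:E = ((2 * e) `^ s / s)%:E)%E.
    by rewrite -(integral_powR_shift t0 e20 s0) [RHS]integral_indic_mul.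
  have -> : (\int[mu]_r (J2 r)%:E = (e `^ (- (1 - s)) / (1 - s))%:E)%E.
    by rewrite -(integral_powR_shifty t0 e0 s10) [RHS]integral_indic_mul.
  have -> : (\int[mu]_r (J3 r)%:E = (T `^ s / s)%:E)%E.
    by rewrite -(integral_powR_shift t0 T0 s0) [RHS]integral_indic_mul.
  rewrite -!EFinM -!EFinD lee_fin.
  have ee : e `^ (- s) * e `^ s = 1 by rewrite -powRD ?addNr ?powRr0// (gt_eqF e0) implybT.
  have cc : c * e `^ (- (1 - s)) = 1 by rewrite -powRD ?subrr ?powRr0// (gt_eqF e0) implybT.
  rewrite /c1 /c2 /c3 powRM ?(ltW e0)//.
  have h2 : (2 : R) `^ s <= 2.
    by rewrite -[leRHS]powRr1//; apply: ler_powR; rewrite ?ler1n// ltW.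
  have -> : H * (e `^ (- s) / s) * (2 `^ s * e `^ s / s) = (e `^ (- s) * e `^ s) * H * (2 `^ s / s ^+ 2).
    by field; rewrite gt_eqF.
  have -> : H * (c / s) * (e `^ (- (1 - s)) / (1 - s)) = (c * e `^ (- (1 - s))) * H / (s * (1 - s)).
    by field; rewrite !gt_eqF.
  have -> : H * (E * (c / s)) * (T `^ s / s) = H * E * (T `^ s / s ^+ 2) * c.
    by field; rewrite gt_eqF.
  rewrite ee cc !mul1r lerD2r mulrDl; apply: lerD; last by rewrite mulrC.
  by rewrite mulrC ler_wpM2r// ler_wpM2r// invr_ge0 exprn_ge0// ltW.
have key r : ((pot_weight t0 T r * heat r A * (e `^ (- s) / s))%:E <= (heat r A)%:E * G r + (rem r)%:E)%E.
  have hG : (0 <= (heat r A)%:E * G r)%E by rewrite mule_ge0// lee_fin heat_ge0.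
  have [rD|rD] := boolP (r \in (`]t0, t0 + T[%classic : set R)); last first.
    rewrite /pot_weight indicE (negbTE rD) mulr0 !mul0r; apply: adde_ge0 => //.
    by rewrite lee_fin.
  have pwE : pot_weight t0 T r = (r - t0) `^ (s - 1) by rewrite /pot_weight indicE rD mulr1.
  move: rD => /set_mem/=; rewrite in_itv/= => /andP[r1 r2].
  pose v := r - t0; have v0 : 0 < v by rewrite subr_gt0.
  have rE : r = t0 + v by rewrite /v; ring.
  have hr : heat r A <= H * (1 + E * v) by rewrite rE HE// ltW.
  have hr0 : 0 <= heat r A by exact: heat_ge0.
  have P0 : 0 <= v `^ (s - 1) by exact: powR_ge0.
  have ec : e `^ (- s) * e = c.
    by rewrite /c addrC powRD1// mulrC.
  have [ve|ev] := leP v e.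
    apply: (@le_trans _ _ (rem r)%:E); last by rewrite leeDr.
    rewrite lee_fin /rem.
    have -> : J1 r = v `^ (s - 1).
      by rewrite /J1 indicE mem_set ?mulr1// /= in_itv/= r1/= rE ltrD2l; lra.
    rewrite /J3 pwE -/v.
    apply: (@le_trans _ _ (c1 * v `^ (s - 1) + c3 * v `^ (s - 1))); last first.
      by rewrite lerD2r lerDl mulr_ge0.
    have h1 : H * (1 + E * v) * (e `^ (- s) / s) <= c1 + c3.
      rewrite /c1 /c3 mulrDr mulr1 mulrDl lerD2l.
      rewrite -[leLHS]mulrA ler_wpM2l// -[leLHS]mulrA ler_wpM2l// mulrA ler_wpM2r ?invr_ge0 ?(ltW s0)//.
      by rewrite -ec mulrC ler_wpM2l.
    rewrite -mulrDl -mulrA [leLHS]mulrC ler_wpM2r//; apply: le_trans h1.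
    by rewrite ler_wpM2r// divr_ge0// ltW.
  have Gge : ((e `^ (- s) * (v - e) `^ s / (s * v))%:E <= G r)%E.
    rewrite -(integral_beta s0 e0 ev) /G.
    apply: (@le_trans _ _ (\int[mu]_(y in `]e, v[) (pot_weight t0 T (r - y) * y `^ (- 1 - s))%:E)%E).
      rewrite le_eqVlt; apply/orP; left; apply/eqP; apply: eq_integral => y.
      rewrite inE/= in_itv/= => /andP[y1 y2]; congr EFin; congr (_ * _).
      rewrite /pot_weight indicE mem_set ?mulr1 ?rE; last by rewrite /= in_itv/=; apply/andP; split; lra.
      by congr (_ `^ _); ring.
    apply: ge0_subset_integral => //.
    - apply/measurable_EFinP; apply: measurable_funTS; apply: measurable_funM; last exact: measurable_powR.
      by apply: (measurableT_comp (measurable_pot_weight t0 T)); exact: measurable_funB.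
    - by move=> y _; rewrite lee_fin mulr_ge0 ?pot_weight_ge0 ?powR_ge0.
    - by move=> y /=; rewrite !in_itv/= andbT => /andP[].
  apply: (@le_trans _ _ ((heat r A * (e `^ (- s) * (v - e) `^ s / (s * v)))%:E + (rem r)%:E)%E); last first.
    by rewrite leeD2r// EFinM lee_wpmul2l.
  rewrite -EFinD lee_fin /rem.
  have -> : J2 r = v `^ (s - 1) / v.
    rewrite /J2 indicE mem_set ?mulr1; last by rewrite /= in_itv/= rE andbT ltrD2l.
    rewrite -/v (_ : s - 1 = - 1 - (1 - s) + 1); last by ring.
    by rewrite powRD1// mulrC mulrA mulVf ?mul1r// gt_eqF.
  rewrite /J3 pwE -/v.
  have vs : v `^ s = v * v `^ (s - 1) by rewrite -powRD1// subrK.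
  (* [y `^ (s - 1)] decreases in [y] *)
  have key1 : v `^ (s - 1) * (v - e) / v <= (v - e) `^ s / v.
    rewrite ler_wpM2r ?invr_ge0 ?(ltW v0)//.
    have -> : (v - e) `^ s = (v - e) * (v - e) `^ (s - 1) by rewrite -powRD1 ?subrK// subr_gt0.
    rewrite mulrC ler_wpM2l ?subr_ge0 ?(ltW ev)//.
    rewrite -(opprB 1 s) !powRN lef_pV2 ?posrE ?powR_gt0 ?subr_gt0//.
    by apply: (ge0_ler_powR (ltW s10)); rewrite ?nnegrE ?subr_ge0 ?gerBl; exact: ltW.
  set P := v `^ (s - 1) in P0 key1 *; set Q := (v - e) `^ s in key1 *.
  have key2 : P * (e `^ (- s) / s) <= e `^ (- s) * Q / (s * v) + c / s * (P / v).
    have -> : P * (e `^ (- s) / s) = (e `^ (- s) / s) * (P * (v - e) / v) + (e `^ (- s) * e) / s * (P / v).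
      by field; rewrite !gt_eqF.
    rewrite ec lerD2r.
    have -> : e `^ (- s) * Q / (s * v) = (e `^ (- s) / s) * (Q / v) by field; rewrite !gt_eqF.
    by rewrite ler_wpM2l// divr_ge0// ltW.
  have := ler_wpM2l hr0 key2; rewrite mulrDr.
  have Pv0 : 0 <= P / v by rewrite divr_ge0// ltW.
  have cs0 : 0 <= c / s by rewrite divr_ge0// ltW.
  have h3 : heat r A * (c / s * (P / v)) <= c2 * (P / v) + c3 * P.
    apply: (le_trans (ler_wpM2r (mulr_ge0 cs0 Pv0) hr)).
    rewrite /c2 /c3 le_eqVlt; apply/orP; left; apply/eqP; field; rewrite !gt_eqF//.
  have h4 : 0 <= c1 * J1 r by rewrite mulr_ge0.
  have -> : P * heat r A * (e `^ (- s) / s) = heat r A * (P * (e `^ (- s) / s)) by ring.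
  by move=> h; apply: (le_trans h); rewrite lerD2l (le_trans h3)// -addrA lerDr.
have mpot : measurable_fun setT (fun r : R => (pot_weight t0 T r * heat r A)%:E).
  apply/measurable_EFinP; apply: measurable_funM; first exact: measurable_pot_weight.
  by apply: measurable_heat; [exact: measurable_id|exact: measurable_cst].
have mhG : measurable_fun setT (fun r : R => (heat r A)%:E * G r)%E.
  apply: emeasurable_funM => //; apply/measurable_EFinP.
  by apply: measurable_heat; [exact: measurable_id|exact: measurable_cst].
have hG0 r : (0 <= (heat r A)%:E * G r)%E by rewrite mule_ge0// lee_fin heat_ge0.
have tot : ((pot t0 T A * (e `^ (- s) / s))%:E <=
    \int[mu]_r ((heat r A)%:E * G r) + \int[mu]_r (rem r)%:E)%E.
  rewrite mulrC EFinM potE// -ge0_integralZl_EFin//; last 2 first.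
  - by move=> r _; rewrite lee_fin mulr_ge0 ?pot_weight_ge0 ?heat_ge0.
  - by rewrite divr_ge0// ltW.
  rewrite -ge0_integralD//; last by move=> r _; rewrite lee_fin.
  apply: ge0_le_integral => //.
  - move=> r _; rewrite -EFinM lee_fin; apply: mulr_ge0; first by rewrite divr_ge0// ltW.
    by rewrite mulr_ge0 ?pot_weight_ge0 ?heat_ge0.
  - by apply: emeasurable_funM.
  - by apply: emeasurable_funD.
  - by move=> r _; rewrite -EFinM mulrC; exact: key.
rewrite -addrA -opprD EFinB leeBlDr//.
apply: (le_trans tot); rewrite leeD2l//.
Qed.

End heat_potentials.

Section subsolutions.
Context {R : realType} (k : nat) (s : R).
Hypotheses (k1 : (1 < k)%N) (s0 : 0 < s) (s1 : s < 1).
Local Notation RR := (measurableTypeR R).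
Local Notation Rk := (k.-tuple RR).
Local Notation mu := (@lebesgue_measure R).
Local Notation Lk := (@lebesgue_tuple R k).
Local Notation kpart := (@kpart R k s).
Local Notation heat := (@heat R k).
Local Notation pot := (@pot R k s).
Local Notation subsolution_at := (@subsolution_at R k s).

Let msum (a : 'I_k -> R) : measurable_fun setT (fun z : Rk => (\sum_i (a i + tnth z i) ^+ 2)%R).
Proof.
apply: measurable_sum => i; apply: (@measurable_tnth_comp R k (fun x => (a i + x) ^+ 2)%R).
by apply: measurable_funX; exact: measurable_funD.
Qed.

Let mint (g : R -> R) (a : 'I_k -> R) (e : R) : measurable_fun setT g ->
  measurable_fun setT (fun z : Rk => (g (\sum_i (a i + tnth z i) ^+ 2))%:E * kpart `]e, +oo[ z)%E.
Proof.
move=> mg; apply: emeasurable_funM; last exact: measurable_kpart.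
by apply/measurable_EFinP; apply: (measurableT_comp mg); exact: msum.
Qed.

Lemma subsolution_at0 q0 : subsolution_at (fun=> 0) 0 q0.
Proof.
exists 0 => // a _ e e0 e1; rewrite !mul0r !subr0; apply: integral_ge0 => z _.
by rewrite mule_ge0// kpart_ge0.
Qed.

Lemma subsolution_at_scale (c : R) (g : R -> R) (h q0 : R) : 0 <= c -> measurable_fun setT g -> (forall q, 0 <= g q) ->
  subsolution_at g h q0 -> subsolution_at (fun q => c * g q) (c * h) q0.
Proof.
move=> c0 mg g0 [C C0 HC]; exists (c * C); first exact: mulr_ge0.
move=> a aq e e0 e1; under eq_integral do rewrite EFinM -muleA.
rewrite ge0_integralZl_EFin//; last 2 first.
- by move=> z _; rewrite mule_ge0 ?kpart_ge0// lee_fin.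
- exact: mint.
have -> : c * g q0 * (e `^ (- s) / s) - c * h - c * C * e `^ (1 - s) =
    c * (g q0 * (e `^ (- s) / s) - h - C * e `^ (1 - s)) by ring.
by rewrite EFinM lee_wpmul2l ?lee_fin//; exact: HC.
Qed.

Lemma subsolution_at_add (g g' : R -> R) (h h' q0 : R) :
  measurable_fun setT g -> (forall q, 0 <= g q) ->
  measurable_fun setT g' -> (forall q, 0 <= g' q) ->
  subsolution_at g h q0 -> subsolution_at g' h' q0 ->
  subsolution_at (fun q => g q + g' q) (h + h') q0.
Proof.
move=> mg g0 mg' g'0 [C C0 HC] [C' C'0 HC']; exists (C + C'); first exact: addr_ge0.
move=> a aq e e0 e1.
have -> : (\int[Lk]_z ((g (\sum_i (a i + tnth z i) ^+ 2) + g' (\sum_i (a i + tnth z i) ^+ 2))%:E * kpart `]e, +oo[ z) =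
  \int[Lk]_z ((g (\sum_i (a i + tnth z i) ^+ 2))%:E * kpart `]e, +oo[ z) +
  \int[Lk]_z ((g' (\sum_i (a i + tnth z i) ^+ 2))%:E * kpart `]e, +oo[ z))%E.
  rewrite -ge0_integralD//; try exact: mint; try (by move=> z _; rewrite mule_ge0 ?kpart_ge0// lee_fin).
  by apply: eq_integral => z _; rewrite EFinD ge0_muleDl// lee_fin.
have -> : (g q0 + g' q0) * (e `^ (- s) / s) - (h + h') - (C + C') * e `^ (1 - s) =
    (g q0 * (e `^ (- s) / s) - h - C * e `^ (1 - s)) + (g' q0 * (e `^ (- s) / s) - h' - C' * e `^ (1 - s)) by ring.
by rewrite EFinD; apply: leeD; [exact: HC|exact: HC'].
Qed.

Lemma measurable_heat_q t : measurable_fun setT (heat t).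
Proof. by apply: measurable_heat; [exact: measurable_cst|exact: measurable_id]. Qed.

Lemma heat_ratio t v A : 0 < t -> 0 <= v ->
  heat (t + v) A = heat t A *
    ((1 + v / t) `^ (- (k%:R / 2)) * expR (A / (4 * t) * ((v / t) / (1 + v / t)))).
Proof.
move=> t0 v0; have tv : 0 < t + v by rewrite ltr_wpDr.
have vt : 0 < 1 + v / t by rewrite ltr_pwDl// divr_ge0// ltW.
rewrite /heat; have -> : 4 * pi * (t + v) = (4 * pi * t) * (1 + v / t) by field; rewrite gt_eqF.
rewrite powRM ?(ltW vt)//; last by rewrite !mulr_ge0 ?pi_ge0// ltW.
rewrite -mulrA -[in RHS]mulrA; congr (_ * _); rewrite mulrCA; congr (_ * _).
rewrite -expRD; congr expR; field; rewrite !gt_eqF//=.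
Qed.

(** Far from the origin, relative to the time, the heat kernel is a strict
    subsolution: running it forward increases its value there, by a factor
    large enough to outweigh the loss at late times. *)
Lemma subsolution_heat : exists2 c : R, 0 < c & forall t A, 0 < t -> c * t <= A ->
  exists2 h, h < 0 & subsolution_at (heat t) h A.
Proof.
pose m : R := k%:R / 2; have m0 : 0 <= m by rewrite divr_ge0.
pose P3 : R := 3 `^ m; have P30 : 0 < P3 by rewrite powR_gt0.
have s4 : 0 < 4 / s by rewrite divr_gt0.
(* large enough for the heat kernel to have increased at the times up to [3 * t],
   and by the factor [L] at those between [2 * t] and [3 * t] *)
exists (4 * (3 * m + 2 * P3 * (4 / s))).
  by rewrite mulr_gt0// ltr_wpDl ?mulr_ge0// mulr_gt0// mulr_gt0.
move=> t A t0 cA; pose c := A / (4 * t); pose H := heat t A.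
have t40 : 0 < 4 * t by rewrite mulr_gt0.
have cge : 3 * m + 2 * P3 * (4 / s) <= c.
  rewrite /c ler_pdivlMr//; apply: le_trans cA; rewrite le_eqVlt; apply/orP; left; apply/eqP; ring.
have m30 : 0 <= 3 * m by exact: mulr_ge0.
have P40 : 0 <= 2 * P3 * (4 / s) by apply: mulr_ge0; [apply: mulr_ge0|]; rewrite ?(ltW P30) ?(ltW s4).
have c0 : 0 <= c by apply: le_trans cge; exact: addr_ge0.
have cm : 3 * m <= c by apply: le_trans cge; rewrite lerDl.
have cP : 2 * P3 * (4 / s) <= c by apply: le_trans cge; rewrite lerDr.
pose L := expR (c / 2) / P3.
have H0 : 0 < H by exact: heat_gt0.
have L4 : 4 / s < L.
  rewrite ltr_pdivlMr//; apply: lt_le_trans (expR_ge1Dx _); lra.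
have L0 : 0 < L by exact: lt_trans L4.
have ratio1 v : 0 <= v -> v <= 2 * t -> H <= heat (t + v) A.
  move=> v0 v2; rewrite heat_ratio// -/H -/c; set x := v / t.
  have x0 : 0 <= x by rewrite divr_ge0// ltW.
  have x2 : x <= 2 by rewrite ler_pdivrMr.
  have x1 : 0 < 1 + x by rewrite ltr_pwDl.
  rewrite ler_peMr ?(ltW H0)// powRN -/m mulrC ler_pdivlMr ?powR_gt0// mul1r.
  apply: (@le_trans _ _ (expR x `^ m)).
    by apply: (ge0_ler_powR m0); rewrite ?nnegrE ?expR_ge0 ?(ltW x1)//; exact: expR_ge1Dx.
  rewrite -expRM ler_expR [leRHS]mulrA ler_pdivlMr//.
  have mx : m * (1 + x) <= c.
    by apply: le_trans cm; rewrite mulrC ler_wpM2r//; lra.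
  by rewrite -[leLHS]mulrA [leRHS]mulrC ler_wpM2l.
have ratio2 v : t < v -> v < 2 * t -> L * H <= heat (t + v) A.
  move=> v1 v2; have v0 : 0 < v by exact: lt_trans v1.
  rewrite heat_ratio ?(ltW v0)// -/H -/c; set x := v / t.
  have x1 : 1 < x by rewrite ltr_pdivlMr// mul1r.
  have x2 : x <= 2 by rewrite ler_pdivrMr// ltW.
  have x10 : 0 < 1 + x by lra.
  rewrite mulrC ler_wpM2l ?(ltW H0)// /L mulrC powRN -/m.
  apply: ler_pM; rewrite ?invr_ge0 ?(ltW P30) ?expR_ge0//.
    rewrite lef_pV2 ?posrE ?powR_gt0//.
    by apply: (ge0_ler_powR m0); rewrite ?nnegrE ?(ltW x10)//; lra.
  by rewrite ler_expR ler_wpM2l// ler_pdivlMr//; lra.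
pose y := L * H * (2 `^ (- 1 - s) * t `^ (- s)).
pose h := H * (t `^ (- s) / s) - y.
have ts0 : 0 < t `^ (- s) by exact: powR_gt0.
have h0 : h < 0.
  have -> : h = H * t `^ (- s) * (s^-1 - L * 2 `^ (- 1 - s)) by rewrite /h /y; ring.
  have HT : 0 < H * t `^ (- s) by exact: mulr_gt0.
  rewrite (pmulr_rlt0 _ HT) subr_lt0.
  apply: (@lt_le_trans _ _ (L * 4^-1)); first by rewrite ltr_pdivlMr// mulrC.
  rewrite ler_wpM2l ?(ltW L0)//.
  have -> : - 1 - s = - (1 + s) by ring.
  rewrite powRN lef_pV2 ?posrE ?powR_gt0//.
  have -> : (4 : R) = 2 `^ 2%:R by rewrite powR_mulrn//; ring.
  by apply: ler_powR; [rewrite ler1n|have := s1; lra].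
exists h => //.
have t1s : 0 < t `^ (1 - s) by exact: powR_gt0.
have C0 : 0 <= (H * (t `^ (- s) / s) - h) / t `^ (1 - s).
  rewrite divr_ge0 ?(ltW t1s)// subr_ge0 (le_trans (ltW h0))//.
  by apply: mulr_ge0; [exact: ltW|rewrite divr_ge0// ltW].
exists ((H * (t `^ (- s) / s) - h) / t `^ (1 - s)) => // a aA e e0 e1.
rewrite integral_heat_kpart// aA -/H.
have es0 : 0 <= e `^ (- s) / s by rewrite divr_ge0 ?powR_ge0// ltW.
have [et|te] := leP e t; last first.
  apply: (@le_trans _ _ 0%E); last first.
    by apply: integral_ge0 => v _; rewrite lee_fin mulr_ge0 ?heat_ge0 ?powR_ge0.
  rewrite lee_fin subr_le0; apply: (@le_trans _ _ (H * (t `^ (- s) / s) - h)).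
    rewrite lerD2r ler_wpM2l ?(ltW H0)// ler_wpM2r ?invr_ge0 ?(ltW s0)//.
    rewrite !powRN lef_pV2 ?posrE ?powR_gt0//.
    by apply: (ge0_ler_powR (ltW s0)); rewrite ?nnegrE ?(ltW t0) ?(ltW e0) ?(ltW te).
  rewrite -[leLHS](divfK (lt0r_neq0 t1s)) ler_wpM2l//.
  have s10 : 0 <= 1 - s by rewrite subr_ge0 ltW.
  by apply: (ge0_ler_powR s10); rewrite ?nnegrE ?(ltW t0) ?(ltW e0) ?(ltW te).
apply: (@le_trans _ _ (H * (e `^ (- s) / s) - h)%:E).
  by rewrite lee_fin lerBlDr lerDl mulr_ge0// powR_ge0.
have mP : measurable_fun setT (fun v : R => v `^ (- 1 - s)) by exact: measurable_powR.
have mh : measurable_fun setT (fun v : R => heat (v + t) A).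
  by apply: measurable_heat; [exact: measurable_funD|exact: measurable_cst].
have mE (f : R -> R) (D : set R) : measurable_fun setT f -> measurable_fun D (EFin \o f).
  by move=> mf; apply/measurable_EFinP; exact: measurable_funTS.
pose f1 (v : R) := heat (v + t) A * v `^ (- 1 - s).
pose f2 (v : R) := H * v `^ (- 1 - s) * \1_(`]t, +oo[%classic : set R) v.
pose f3 (v : R) := H * v `^ (- 1 - s).
pose f4 (v : R) := L * H * v `^ (- 1 - s) * \1_(`]t, 2 * t[%classic : set R) v.
have mf1 : measurable_fun setT f1 by exact: measurable_funM.
have mf3 : measurable_fun setT f3 by exact: measurable_funM.
have mf2 : measurable_fun setT f2 by apply: measurable_funM => //; exact: measurable_indic.
have mf4 : measurable_fun setT f4.
  by apply: measurable_funM; [exact: measurable_funM|exact: measurable_indic].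
have f10 v : 0 <= f1 v by rewrite mulr_ge0 ?heat_ge0 ?powR_ge0.
have f20 v : 0 <= f2 v by rewrite !mulr_ge0 ?(ltW H0) ?powR_ge0// indicE.
have f30 v : 0 <= f3 v by rewrite mulr_ge0 ?(ltW H0) ?powR_ge0.
have LH0 : 0 <= L * H by apply: mulr_ge0; exact: ltW.
have f40 v : 0 <= f4 v.
  by apply: mulr_ge0; [apply: mulr_ge0 => //; exact: powR_ge0|rewrite indicE].
pose D : set R := `]e, +oo[%classic; have mD : measurable (D : set RR) by rewrite /D.
have key : (\int[mu]_(v in D) (f3 v)%:E + \int[mu]_(v in D) (f4 v)%:E <=
    \int[mu]_(v in D) (f1 v)%:E + \int[mu]_(v in D) (f2 v)%:E)%E.
  rewrite -!ge0_integralD//; try exact: mE; try (by move=> v _; rewrite lee_fin).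
  apply: ge0_le_integral => //; try (by move=> v _; rewrite adde_ge0// lee_fin);
    try (by apply: emeasurable_funD; exact: mE).
  move=> v; rewrite /D/= in_itv/= andbT => ev; rewrite -!EFinD lee_fin /f1 /f2 /f3 /f4 !indicE.
  have v0 : 0 < v by exact: lt_trans ev.
  have p0 : 0 <= v `^ (- 1 - s) by exact: powR_ge0.
  have [vt|tv] := leP v t.
    rewrite !memNset ?mulr0 ?addr0; last 2 first.
    - by rewrite /= in_itv/= andbT; apply/negP; rewrite -leNgt.
    - by rewrite /= in_itv/= => /andP[h1 _]; lra.
    by rewrite ler_wpM2r// addrC ratio1// ?(ltW v0)//; lra.
  rewrite [v \in `]t, +oo[%classic]mem_set ?mulr1; last by rewrite /= in_itv/= tv.
  have [v2|v2] := ltP v (2 * t).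
    rewrite mem_set ?mulr1; last by rewrite /= in_itv/= tv.
    by rewrite addrC lerD2r ler_wpM2r// [v + t]addrC ratio2.
  rewrite memNset ?mulr0 ?addr0; last by rewrite /= in_itv/= => /andP[_ h1]; lra.
  by rewrite lerDr mulr_ge0// heat_ge0.
have HZ : (\int[mu]_(v in D) (f3 v)%:E = (H * (e `^ (- s) / s))%:E)%E.
  rewrite EFinM -(integral_powRy e0 s0) -ge0_integralZl_EFin ?(ltW H0)//.
  - by move=> v _; rewrite lee_fin powR_ge0.
  - exact: mE.
have H2 : (\int[mu]_(v in D) (f2 v)%:E = (H * (t `^ (- s) / s))%:E)%E.
  rewrite integral_indic_mulr; last first.
    by move=> v; rewrite /D/= !in_itv/= !andbT; exact: le_lt_trans.
  rewrite EFinM -(integral_powRy t0 s0) -ge0_integralZl_EFin ?(ltW H0)//.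
  - by move=> v _; rewrite lee_fin powR_ge0.
  - exact: mE.
have H4 : (y%:E <= \int[mu]_(v in D) (f4 v)%:E)%E.
  rewrite integral_indic_mulr; last first.
    by move=> v; rewrite /D/= !in_itv/= !andbT => /andP[h1 _]; exact: le_lt_trans h1.
  apply: (@le_trans _ _ (\int[mu]_(v in `]t, (2 * t)%R[) (L * H * (2 * t) `^ (- 1 - s))%:E)%E).
    rewrite integral_cst//= lebesgue_measure_itv/= lte_fin ifT; last lra.
    rewrite -EFinD -EFinM lee_fin le_eqVlt; apply/orP; left; apply/eqP.
    rewrite /y powRM ?(ltW t0)//.
    have -> : t `^ (- s) = t * t `^ (- 1 - s) by rewrite -powRD1//; congr (_ `^ _); ring.
    ring.
  apply: ge0_le_integral => //.
  - by move=> v _; rewrite lee_fin; apply: mulr_ge0 => //; exact: powR_ge0.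
  - by apply: mE; apply: measurable_funM.
  - move=> v; rewrite /= in_itv/= => /andP[h1 h2]; rewrite lee_fin.
    rewrite ler_wpM2l//.
    have -> : - 1 - s = - (1 + s) by ring.
    have v0 := lt_trans t0 h1.
    rewrite !powRN lef_pV2 ?posrE ?powR_gt0 ?mulr_gt0//.
    have s1' : 0 <= 1 + s by rewrite addr_ge0// ltW.
    by apply: (ge0_ler_powR s1'); rewrite ?nnegrE ?mulr_ge0 ?(ltW v0) ?(ltW h2) ?(ltW t0).
rewrite HZ H2 in key.
have key2 : ((H * (e `^ (- s) / s))%:E + y%:E <= \int[mu]_(v in D) (f1 v)%:E + (H * (t `^ (- s) / s))%:E)%E.
  by apply: le_trans key; rewrite leeD2l.
by rewrite /h opprB addrA EFinB leeBlDr// EFinD.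
Qed.

End subsolutions.

(** * Nonexistence up to the critical exponent *)

Section pot_lower_bound.
Context {R : realType} (k : nat) (s : R).
Hypotheses (s0 : 0 < s) (s1 : s < 1).
Local Notation mu := (@lebesgue_measure R).
Local Notation heat := (@heat R k).
Local Notation pot := (@pot R k s).

(** Only the times between [t0 + t] and [t0 + 2 * t] of the integral are kept:
    there the Gaussian factor is at least the one of time [t], and the other
    factors are comparable with powers of [t]. *)
Lemma pot_lower (m t0 t q : R) : 0 < t0 -> t0 <= m * t -> 0 < t -> 0 <= q ->
  2 `^ (s - 1) * (4 * pi * (2 + m)) `^ (- (k%:R / 2)) * t `^ (s - k%:R / 2) *
    expR (- (q / (4 * t))) <= pot t0 (2 * t) q.
Proof.
move=> t00 t0m t_0 q0.
have t20 : 0 < 2 * t by rewrite mulr_gt0.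
have mt0 : 0 < m * t by exact: lt_le_trans t0m.
have m0 : 0 < m by rewrite -(pmulr_lgt0 _ t_0).
have m20 : 0 < 2 + m by rewrite addr_gt0.
pose c := (2 * t) `^ (s - 1) * ((4 * pi * ((2 + m) * t)) `^ (- (k%:R / 2)) * expR (- (q / (4 * t)))).
have c0 : 0 <= c by apply: mulr_ge0; [exact: powR_ge0|rewrite mulr_ge0 ?powR_ge0 ?expR_ge0].
rewrite -lee_fin potE// pot_weight_mulE.
apply: (@le_trans _ _ (\int[mu]_(r in `](t0 + t)%R, (t0 + 2 * t)%R[) c%:E)%E).
  rewrite integral_cst//= lebesgue_measure_itv/= lte_fin ifT; last lra.
  rewrite -EFinD -EFinM lee_fin le_eqVlt; apply/orP; left; apply/eqP.
  have pi40 : 0 <= 4 * pi * (2 + m) :> R.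
    by apply: mulr_ge0; [rewrite mulr_ge0 ?pi_ge0|exact: ltW].
  rewrite /c [in RHS]powRM ?(ltW t_0)// (mulrA (4 * pi)) [X in _ * (X * _) * _]powRM ?(ltW t_0)//.
  have -> : t `^ (s - k%:R / 2) = t * t `^ (s - 1) * t `^ (- (k%:R / 2)).
    by rewrite -powRD1// subrK -powRD// (gt_eqF t_0) implybT.
  ring.
have mf : measurable_fun setT (fun r : R => (r - t0) `^ (s - 1) * heat r q).
  apply: measurable_funM; first exact: measurable_powR_sub.
  by apply: measurable_heat; [exact: measurable_id|exact: measurable_cst].
apply: (@le_trans _ _ (\int[mu]_(r in `](t0 + t)%R, (t0 + 2 * t)%R[) ((r - t0) `^ (s - 1) * heat r q)%:E)%E); last first.
  apply: ge0_subset_integral => //.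
  - by apply/measurable_EFinP; exact: measurable_funTS.
  - by move=> r _; rewrite lee_fin mulr_ge0 ?powR_ge0 ?heat_ge0.
  - by move=> r /=; rewrite !in_itv/= => /andP[h1 h2]; apply/andP; split => //; lra.
apply: ge0_le_integral => //.
- by apply/measurable_EFinP; exact: measurable_funTS.
move=> r; rewrite /= in_itv/= => /andP[h1 h2]; rewrite lee_fin.
have r0 : 0 < r by lra.
have rm : r <= (2 + m) * t by lra.
have rt0 : 0 < r - t0 by lra.
rewrite /c; apply: ler_pM; first exact: powR_ge0.
- by rewrite mulr_ge0 ?powR_ge0 ?expR_ge0.
- rewrite -(opprB 1 s) !powRN lef_pV2 ?posrE ?powR_gt0//.
  have s10 : 0 <= 1 - s by rewrite subr_ge0 ltW.
  by apply: (ge0_ler_powR s10); rewrite ?nnegrE ?(ltW rt0) ?(ltW t20)//; lra.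
- apply: (@le_trans _ _ ((4 * pi * r) `^ (- (k%:R / 2)) * expR (- (q / (4 * t))))).
    rewrite ler_wpM2r ?expR_ge0// !powRN.
    have pi4 : 0 < 4 * pi :> R by rewrite mulr_gt0 ?pi_gt0.
    have h3 : 0 < 4 * pi * r by rewrite mulr_gt0.
    have h4 : 4 * pi * r <= 4 * pi * ((2 + m) * t) by rewrite ler_wpM2l// ltW.
    rewrite lef_pV2 ?posrE ?powR_gt0//; last exact: lt_le_trans h4.
    have k20 : 0 <= k%:R / 2 :> R by rewrite divr_ge0.
    by apply: (ge0_ler_powR k20); rewrite ?nnegrE ?(ltW h3) ?(le_trans (ltW h3) h4).
  apply: heat_ge_gauss => //; lra.
Qed.

End pot_lower_bound.

Section geometric_heat_sum.
Context {R : realType} (k : nat).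
Hypothesis k1 : (1 < k)%N.
Local Notation heat := (@heat R k).

(** Up to a constant and the factor [(t + q) `^ (- (k%:R / 2))], the heat kernel
    is a bump in logarithmic time, bounded by an increment of [v / (1 + v)]
    between [v] and [4 * v]. Along a geometric sequence of times these
    increments telescope. *)
Lemma heat_sum_le : exists2 C : R, 0 < C & forall (t q : R) (n : nat), 0 < t -> 0 <= q ->
  \sum_(j < n) heat (t * 4 ^+ j) q <= C * (t + q) `^ (- (k%:R / 2)).
Proof.
pose m : R := k%:R / 2; have m1 : 1 <= m by rewrite /m ler_pdivlMr// mul1r ler_nat.
have m10 : 0 <= m - 1 by rewrite subr_ge0.
have m0 : 0 < m by exact: lt_le_trans m1.
pose K : R := (m + 1) `^ (m + 1) * expR 1.
have K0 : 0 < K by rewrite mulr_gt0 ?expR_gt0// powR_gt0// ltr_wpDr.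
have bump w : 0 < w -> w `^ m * expR (- w) <= K * (w / (1 + w) ^+ 2).
  move=> w0; have w10 : 0 < 1 + w by rewrite addr_gt0.
  have wm : w `^ m = w * w `^ (m - 1) by rewrite -powRD1// subrK.
  have h1 : w `^ (m - 1) <= (1 + w) `^ (m - 1).
    by apply: (ge0_ler_powR m10); rewrite ?nnegrE ?(ltW w0) ?(ltW w10)// lerDr.
  have h2 : (1 + w) `^ (m - 1) * (1 + w) ^+ 2 <= K * expR w.
    have -> : (1 + w) `^ (m - 1) * (1 + w) ^+ 2 = (1 + w) `^ (m + 1).
      rewrite (_ : m + 1 = m - 1 + 1 + 1); last by ring.
      by rewrite !powRD1//; ring.
    have := @powR_le_expR R (m + 1) (1 + w) (ltr_wpDr ler01 m0) (ltW w10).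
    by rewrite expRD mulrA.
  rewrite expRN mulrA ler_pdivrMr ?expR_gt0// mulrAC ler_pdivlMr ?exprn_gt0//.
  rewrite wm -mulrA [K * w]mulrC -[leRHS]mulrA ler_wpM2l ?(ltW w0)//.
  by apply: le_trans h2; rewrite ler_wpM2r// exprn_ge0// ltW.
pose th (v : R) := v / (1 + v).
have thE v : 0 < v -> v / (1 + v) ^+ 2 <= 4 / 3 * (th (4 * v) - th v).
  move=> v0; have v1 : 0 < 1 + v by rewrite addr_gt0.
  have v4 : 0 < 1 + 4 * v by rewrite addr_gt0// mulr_gt0.
  have -> : 4 / 3 * (th (4 * v) - th v) = 4 * v / ((1 + v) * (1 + 4 * v)).
    by rewrite /th; field; rewrite !gt_eqF.
  rewrite ler_pdivrMr ?exprn_gt0// mulrAC ler_pdivlMr ?mulr_gt0//.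
  by rewrite -!mulrA [leRHS]mulrCA ler_wpM2l ?(ltW v0)//; nra.
pose C := expR 4^-1 * pi `^ (- m) * K * (4 / 3).
have C0 : 0 < C by rewrite mulr_gt0// mulr_gt0// mulr_gt0 ?expR_gt0 ?powR_gt0 ?pi_gt0.
exists C => // t q n t0 q0; have Q0 : 0 < t + q by rewrite ltr_wpDr.
set Q := t + q in Q0 *; pose w j : R := Q / (4 * (t * 4 ^+ j)).
have tj j : 0 < t * 4 ^+ j by rewrite mulr_gt0 ?exprn_gt0.
have w0 j : 0 < w j by rewrite divr_gt0// mulr_gt0.
have wS j : w j = 4 * w j.+1.
  by rewrite /w exprS; field; rewrite !gt_eqF ?exprn_gt0.
have heatle j : heat (t * 4 ^+ j) q <= C * Q `^ (- m) * (th (4 * w j) - th (w j)).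
  have pQ0 : 0 <= expR 4^-1 * (pi * Q) `^ (- m) by rewrite mulr_ge0 ?expR_ge0 ?powR_ge0.
  apply: (@le_trans _ _ (expR 4^-1 * (pi * Q) `^ (- m) * (w j `^ m * expR (- w j)))).
    rewrite /heat -/m [X in X * _ <= _](_ : _ = (pi * Q) `^ (- m) * w j `^ m); last first.
      rewrite (_ : 4 * pi * (t * 4 ^+ j) = (pi * Q) * (w j)^-1); last first.
        by rewrite /w; field; rewrite !gt_eqF ?exprn_gt0.
      rewrite powRM ?invr_ge0 ?(ltW (w0 j))//; last by rewrite mulr_ge0 ?pi_ge0// ltW.
      by rewrite powR_inv ?(ltW (w0 j))// opprK.
    have -> : expR 4^-1 * (pi * Q) `^ (- m) * (w j `^ m * expR (- w j)) =
       ((pi * Q) `^ (- m) * w j `^ m) * expR (4^-1 - w j) by rewrite expRD; ring.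
    rewrite ler_wpM2l ?mulr_ge0 ?powR_ge0// ler_expR.
    have h4 : 0 < 4 * (t * 4 ^+ j) by rewrite mulr_gt0.
    have -> : 4^-1 - w j = - (q / (4 * (t * 4 ^+ j))) + (4^-1 - t / (4 * (t * 4 ^+ j))).
      by rewrite /w /Q; ring.
    rewrite lerDl subr_ge0 ler_pdivrMr// (mulrA _ 4) mulVf ?mul1r ?pnatr_eq0//.
    by rewrite ler_peMr ?(ltW t0)// exprn_ege1// ler1n.
  apply: (le_trans (ler_wpM2l pQ0 (bump _ (w0 j)))).
  apply: (@le_trans _ _ (expR 4^-1 * (pi * Q) `^ (- m) * (K * (4 / 3 * (th (4 * w j) - th (w j)))))).
    by rewrite ler_wpM2l// ler_wpM2l ?(ltW K0)// thE.
  rewrite powRM ?pi_ge0 ?(ltW Q0)// /C le_eqVlt; apply/orP; left; apply/eqP; ring.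
apply: (@le_trans _ _ (\sum_(j < n) C * Q `^ (- m) * (th (4 * w j) - th (w j)))).
  by apply: ler_sum => j _; exact: heatle.
have tel : \sum_(j < n) C * Q `^ (- m) * (th (4 * w j) - th (w j)) =
    C * Q `^ (- m) * (th (4 * w 0%N) - th (4 * w n)).
  elim: n => [|n IH]; first by rewrite big_ord0 subrr mulr0.
  by rewrite big_ord_recr/= IH -mulrDr -(wS n); congr (_ * _); ring.
rewrite tel ler_piMr ?mulr_ge0 ?powR_ge0 ?(ltW C0)//.
have h1 v : 0 < v -> 0 <= th v <= 1.
  move=> v0; have v1 : 0 < 1 + v by rewrite addr_gt0.
  by rewrite /th divr_ge0 ?(ltW v0) ?(ltW v1)//= ler_pdivrMr// mul1r lerDr.
have /andP[_ a1] := h1 (4 * w 0%N) (mulr_gt0 (ltr0Sn _ 3) (w0 _)).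
have /andP[a2 _] := h1 (4 * w n) (mulr_gt0 (ltr0Sn _ 3) (w0 _)).
lra.
Qed.

End geometric_heat_sum.

Section nonexistence.
Context {R : realType} (N k : nat) (s p : R).
Hypotheses (k1 : (1 < k)%N) (kN : (k <= N)%N) (s0 : 0 < s) (s1 : s < 1) (p0 : 0 < p).
Local Notation heat := (@heat R k).
Local Notation pot := (@pot R k s).
Local Notation subsolution_at := (@subsolution_at R k s).
Variables (u : 'rV[R]_N -> R) (x1 : 'rV[R]_N).
Hypotheses (su : viscosity_supersolution k s p u) (ux1 : 0 < u x1).
Local Notation q := (fun x : 'rV[R]_N => edot (x - x1) (x - x1)).

Let q0 x : 0 <= q x. Proof. exact: edot_ge0. Qed.
Let u0 x : 0 <= u x. Proof. by have [] := su. Qed.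

Let CK0 : 0 < @C_ks R k s * ckernel k s.
Proof. by rewrite mulr_gt0 ?ckernel_gt0 ?C_ks_gt0// ltnW. Qed.

(** Lower semicontinuity gives a positive lower bound in a ball. A heat kernel
    whose time is small compared to the squared radius is a strict subsolution
    outside that ball. *)
Lemma gaussian_lower_bound : exists t M : R,
  [/\ 0 < t, 0 < M & forall x, M * expR (- (q x / (4 * t))) <= u x].
Proof.
have [c c0 Hc] := @subsolution_heat R k s s0 s1.
have [_ lscu _ _] := su.
have du : ((u x1 / 2)%:E < (EFin \o u) x1)%E by rewrite lte_fin ltr_pdivrMr// ltr_pMr// ltr1n.
have [V nV HV] := lscu x1 (u x1 / 2) du.
have [r r0 Hr] : exists2 r : R, 0 < r & forall x, q x < r -> V x.
  have [r /= r0 Hr] := (nbhs_ballP x1 V).1 nV.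
  exists (r ^+ 2); first by rewrite exprn_gt0.
  move=> x xr; apply: Hr; rewrite -ball_normE/= distrC.
  rewrite [ltLHS]mx_normrE; apply: bigmax_lt => // -[i j] _ /=.
  rewrite [i]ord1 -(@ltr_pXn2r _ 2)// ?nnegrE ?(ltW r0)// real_normK ?num_real//.
  by apply: le_lt_trans xr; exact: coord_sqr_le.
pose t := r / c; have t0 : 0 < t by rewrite divr_gt0.
have h00 : 0 < heat t 0 by exact: heat_gt0.
pose a := u x1 / 2 / heat t 0.
have a0 : 0 < a by rewrite !divr_gt0.
have H : forall x, a * heat t (q x) <= u x.
  apply: (@comparison R N k s p k1 kN s0 s1 u x1 (fun y => a * heat t y) su).
  - by apply: profile_scale (ltW a0) _; exact: profile_heat.
  - by apply: measurable_funM => //; exact: measurable_heat_q.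
  move=> x ux.
  have rx : c * t <= q x.
    rewrite /t mulrCA divff ?gt_eqF// mulr1 leNgt; apply/negP => /Hr /HV.
    rewrite lte_fin ltNge => /negP; apply; apply: (le_trans (ltW ux)).
    rewrite /a -mulrA ler_piMr ?divr_ge0 ?(ltW ux1)//.
    rewrite ler_pdivrMl// mulr1 /heat ler_wpM2l ?powR_ge0// mul0r oppr0 expR0 expR_le1 oppr_le0.
    by apply: divr_ge0; [exact: edot_ge0|apply: mulr_ge0 => //; exact: ltW].
  have [h hn sub] := Hc t (q x) t0 rx.
  exists (a * h).
    apply: subsolution_at_scale => //; first exact: ltW.
    + exact: measurable_heat_q.
    + by move=> y; exact: heat_ge0.
  apply: (@lt_le_trans _ _ 0); first by rewrite pmulr_rlt0.
  by rewrite divr_ge0 ?powR_ge0// ltW.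
exists t, (a * (4 * pi * t) `^ (- (k%:R / 2))); split => //.
  have pi4 : 0 < 4 * pi :> R by rewrite mulr_gt0 ?pi_gt0.
  by apply: mulr_gt0 => //; apply: powR_gt0; exact: mulr_gt0.
by move=> x; rewrite -mulrA; exact: H.
Qed.

(** Each potential is a subsolution whose right-hand side is its own heat kernel
    times a constant that depends on [s] only. The factor [c] makes the right-hand
    side of the combination at most half of the nonlinear term. *)
Lemma pot_comparison : exists2 c : R, 0 < c & forall n (a t T : 'I_n -> R),
  (forall j, 0 <= a j) -> (forall j, 0 < t j) -> (forall j, 0 < T j) ->
  (forall x, 0 < \sum_j a j * heat (t j) (q x) <= u x `^ p) ->
  forall x, c * \sum_j a j * pot (t j) (T j) (q x) <= u x.
Proof.
have s10 : 0 < 1 - s by rewrite subr_gt0.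
pose Cs := 2 / s ^+ 2 + (s * (1 - s))^-1.
have Cs0 : 0 < Cs by rewrite addr_gt0 ?divr_gt0 ?invr_gt0 ?exprn_gt0 ?mulr_gt0.
pose c := (2 * Cs * (@C_ks R k s * ckernel k s))^-1.
have c0 : 0 < c by rewrite invr_gt0; apply: mulr_gt0 => //; exact: mulr_gt0.
exists c => // n a t T a0 t0 T0 H.
have prof (j : 'I_n) : profile (fun y => a j * pot (t j) (T j) y).
  by apply: profile_scale => //; exact: profile_pot.
have mpot (j : 'I_n) : measurable_fun setT (fun y => a j * pot (t j) (T j) y).
  by apply: measurable_funM => //; exact: measurable_pot.
apply: (@comparison R N k s p k1 kN s0 s1 u x1 (fun y => c * \sum_j a j * pot (t j) (T j) y) su).
- apply: profile_scale; first exact: ltW.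
  exact: (profile_sum _ prof).
- apply: measurable_funM => //; exact: measurable_sum.
move=> x _; exists (c * \sum_j Cs * (a j * heat (t j) (q x))); last first.
  have /andP[h1 h2] := H x; rewrite -mulr_sumr.
  set S := \sum_j _ in h1 h2 *.
  have -> : c * (Cs * S) = S / (@C_ks R k s * ckernel k s) / 2.
    have E (a' b' c' : R) : 0 < a' -> 0 < b' -> (2 * a' * b')^-1 * (a' * c') = c' / b' / 2.
      by move=> ? ?; field; rewrite !gt_eqF.
    exact: E.
  apply: (@lt_le_trans _ _ (S / (@C_ks R k s * ckernel k s))).
    have D0 := divr_gt0 h1 CK0.
    by rewrite ltr_pdivrMr// ltr_pMr// ltr1n.
  by rewrite ler_wpM2r// invr_ge0 ltW.
have pot0 (j : 'I_n) y : 0 <= a j * pot (t j) (T j) y by rewrite mulr_ge0 ?pot_ge0.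
have S : forall l : seq 'I_n, [/\ measurable_fun setT (fun y => \sum_(j <- l) a j * pot (t j) (T j) y),
    (forall y, 0 <= \sum_(j <- l) a j * pot (t j) (T j) y) &
    subsolution_at (fun y => \sum_(j <- l) a j * pot (t j) (T j) y)
      (\sum_(j <- l) Cs * (a j * heat (t j) (q x))) (q x)].
  elim=> [|j l [IHm IH0 IHs]].
    split=> [|y|]; rewrite ?big_nil//; under eq_fun do rewrite big_nil; first exact: measurable_cst.
    exact: subsolution_at0.
  split=> [|y|]; rewrite ?big_cons.
  - by under eq_fun do rewrite big_cons; apply: measurable_funD => //; exact: mpot.
  - exact: addr_ge0.
  - under eq_fun do rewrite big_cons.
    apply: subsolution_at_add => //.
    rewrite mulrCA; apply: subsolution_at_scale => //.
    + exact: measurable_pot.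
    + by move=> y; exact: pot_ge0.
    + exact: subsolution_pot.
have [S1 S2 S3] := S (index_enum 'I_n).
by apply: subsolution_at_scale => //; exact: ltW.
Qed.

(** A power of a Gaussian is a multiple of the heat kernel of time [t0 / p]; the
    corresponding potential is bounded below by a Gaussian of time [t]. *)
Lemma gaussian_spread : exists2 K : R, 0 < K & forall t0 t M : R,
  0 < t0 -> t0 <= t -> 0 < M -> (forall x, M * expR (- (q x / (4 * t0))) <= u x) ->
  forall x, K * M `^ p * t0 `^ (k%:R / 2) * t `^ (s - k%:R / 2) * expR (- (q x / (4 * t))) <= u x.
Proof.
have [c c0 Hc] := pot_comparison.
pose m : R := k%:R / 2.
have p10 : 0 < p^-1 by rewrite invr_gt0.
have pi4 : 0 < 4 * pi :> R by rewrite mulr_gt0 ?pi_gt0.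
have pip : 0 < 4 * pi / p by rewrite mulr_gt0.
have p2 : 0 < 4 * pi * (2 + p^-1) by rewrite mulr_gt0// addr_gt0.
pose k' : R := 2 `^ (s - 1) * (4 * pi * (2 + p^-1)) `^ (- m).
have k'0 : 0 < k' by rewrite mulr_gt0// powR_gt0.
exists (c * ((4 * pi / p) `^ m) * k').
  by apply: mulr_gt0 => //; apply: mulr_gt0 => //; exact: powR_gt0.
move=> t0 t M t00 tt M0 HM x; have t_0 : 0 < t by exact: lt_le_trans tt.
have tp : 0 < t0 / p by exact: mulr_gt0.
pose a := M `^ p * (4 * pi * (t0 / p)) `^ m.
have a0 : 0 < a by apply: mulr_gt0; apply: powR_gt0 => //; exact: mulr_gt0.
have HH y : 0 < \sum_(j < 1) a * heat (t0 / p) (q y) <= u y `^ p.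
  rewrite big_ord1; apply/andP; split; first by apply: mulr_gt0 => //; exact: heat_gt0.
  apply: (@le_trans _ _ ((M * expR (- (q y / (4 * t0)))) `^ p)); last first.
    by apply: (ge0_ler_powR (ltW p0)); rewrite ?nnegrE ?u0// mulr_ge0 ?expR_ge0// ltW.
  rewrite powRM ?expR_ge0 ?(ltW M0)// -expRM /a /heat -/m -mulrA ler_wpM2l ?powR_ge0//.
  have pt0 : 0 < 4 * pi * (t0 / p) by exact: mulr_gt0.
  rewrite mulrA -powRD; last by rewrite (gt_eqF pt0) implybT.
  rewrite subrr powRr0 mul1r ler_expR le_eqVlt; apply/orP; left; apply/eqP.
  by field; rewrite !gt_eqF.
have := Hc 1%N (fun=> a) (fun=> t0 / p) (fun=> 2 * t) (fun=> ltW a0) (fun=> tp)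
  (fun=> mulr_gt0 (ltr0Sn _ 1) t_0) HH x; rewrite big_ord1; apply: le_trans.
have tpt : t0 / p <= p^-1 * t by rewrite mulrC ler_wpM2l// ltW.
have := @pot_lower R k s s0 s1 p^-1 (t0 / p) t (q x) tp tpt t_0 (q0 x); rewrite -/m -/k' => hp.
apply: (@le_trans _ _ (c * (a * (k' * t `^ (s - m) * expR (- (q x / (4 * t))))))); last first.
  by rewrite ler_wpM2l ?(ltW c0)// ler_wpM2l ?(ltW a0).
rewrite /a (_ : 4 * pi * (t0 / p) = 4 * pi / p * t0); last by ring.
rewrite (powRM _ (ltW pip) (ltW t00)) le_eqVlt; apply/orP; left; apply/eqP; ring.
Qed.

(** Doubling without end contradicts the finiteness of [u x1]. *)
Lemma gaussian_doubling (t M0 : R) : 0 < t -> 0 < M0 ->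
  (forall x, M0 * expR (- (q x / (4 * t))) <= u x) ->
  (forall M, M0 <= M -> (forall x, M * expR (- (q x / (4 * t))) <= u x) ->
    forall x, 2 * M * expR (- (q x / (4 * t))) <= u x) -> False.
Proof.
move=> t0 M00 H0 H.
have step n : forall x, 2 ^+ n * M0 * expR (- (q x / (4 * t))) <= u x.
  elim: n => [|n IH]; first by rewrite expr0 mul1r.
  rewrite exprS -mulrA; apply: H => //.
  by rewrite ler_peMl ?(ltW M00)// exprn_ege1// ler1n.
have q1 : q x1 = 0 by rewrite subrr edot0l.
pose n := Num.truncn (u x1 / M0).
have nlt : u x1 / M0 < n.+1%:R by exact: truncnS_gt.
have := step n.+1 x1; rewrite q1 mul0r oppr0 expR0 mulr1 leNgt => /negP; apply.
rewrite -ltr_pdivrMr//; apply: (lt_le_trans nlt).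
by rewrite -natrX ler_nat ltnW// ltn_expl.
Qed.

(** If [p <= 1], the factor [M `^ (p - 1)] gained by spreading a Gaussian of
    amplitude [M] is bounded below, as [M <= u x1]; a large time then makes the
    amplitude double. *)
Lemma exponent_gt1 : 1 < p.
Proof.
rewrite ltNge; apply/negP => p1.
have [t0 [M [t00 M0 HM]]] := gaussian_lower_bound.
have [K K0 HK] := gaussian_spread.
pose U := u x1 `^ (p - 1); have U0 : 0 < U by exact: powR_gt0.
have KU : 0 < 2 / (K * U) by rewrite divr_gt0// mulr_gt0.
pose t := Num.max t0 ((2 / (K * U)) `^ s^-1).
have tt : t0 <= t by rewrite le_max lexx.
have t_0 : 0 < t by exact: lt_le_trans tt.
have ts : 2 / (K * U) <= t `^ s.
  have -> : 2 / (K * U) = ((2 / (K * U)) `^ s^-1) `^ s.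
    by rewrite -powRrM mulVf ?gt_eqF// powRr1// ltW.
  by apply: (ge0_ler_powR (ltW s0)); rewrite ?nnegrE ?powR_ge0 ?(ltW t_0)// le_max lexx orbT.
pose M1 := K * M `^ p * t0 `^ (k%:R / 2) * t `^ (s - k%:R / 2).
have M10 : 0 < M1 by rewrite !mulr_gt0 ?powR_gt0.
apply: (@gaussian_doubling t M1 t_0 M10); first exact: HK.
move=> N' MN HN x; have N0 : 0 < N' by exact: lt_le_trans MN.
apply: le_trans (HK t t N' t_0 (lexx t) N0 HN x).
rewrite ler_wpM2r ?expR_ge0//.
have -> : K * N' `^ p * t `^ (k%:R / 2) * t `^ (s - k%:R / 2) = K * N' `^ p * t `^ s.
  rewrite -mulrA -powRD; last by rewrite (gt_eqF t_0) implybT.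
  by congr (_ * _ `^ _); ring.
have -> : N' `^ p = N' * N' `^ (p - 1) by rewrite -powRD1// subrK.
have NU : N' <= u x1.
  by have := HN x1; rewrite subrr edot0l mul0r oppr0 expR0 mulr1.
have UN : U <= N' `^ (p - 1).
  rewrite /U -(opprB 1 p) !powRN lef_pV2 ?posrE ?powR_gt0//.
  have p10 : 0 <= 1 - p by rewrite subr_ge0.
  by apply: (ge0_ler_powR p10); rewrite ?nnegrE ?(ltW N0) ?(ltW ux1).
have h1 : 2 <= K * U * t `^ s by rewrite mulrC -ler_pdivrMr ?mulr_gt0.
apply: (@le_trans _ _ (N' * (K * U * t `^ s))).
  by rewrite mulrC ler_wpM2l// ltW.
have -> : K * (N' * N' `^ (p - 1)) * t `^ s = N' * (K * N' `^ (p - 1) * t `^ s) by ring.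
by rewrite ler_wpM2l ?(ltW N0)// ler_wpM2r ?powR_ge0// ler_wpM2l// ltW.
Qed.

(** At each point the initial Gaussian is spread up to a time of the order of the
    squared distance to [x1]. *)
Lemma power_lower_bound : exists t c : R,
  [/\ 1 <= t, 0 < c & forall x, c * (t + q x) `^ (s - k%:R / 2) <= u x].
Proof.
have [t0 [M [t00 M0 HM]]] := gaussian_lower_bound.
have [K K0 HK] := gaussian_spread.
exists (Num.max 1 t0), (K * M `^ p * t0 `^ (k%:R / 2) * expR (- 4^-1)); split.
- by rewrite le_max lexx.
- by rewrite mulr_gt0 ?expR_gt0// !mulr_gt0 ?powR_gt0.
move=> x; set t := Num.max 1 t0 + q x.
have t0t : t0 <= t by rewrite /t -[leLHS]addr0 lerD// le_max lexx orbT.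
have t_0 : 0 < t by exact: lt_le_trans t0t.
apply: le_trans (HK t0 t M t00 t0t M0 HM x).
rewrite mulrAC ler_wpM2l//.
  by apply: mulr_ge0; [apply: mulr_ge0; [apply: mulr_ge0; [exact: ltW|]|]|]; exact: powR_ge0.
rewrite ler_expR lerN2 ler_pdivrMr ?mulr_gt0// mulrA mulVf ?mul1r ?pnatr_eq0//.
by rewrite /t lerDr le_max ler01.
Qed.

(** Up to the critical exponent the power of [u] dominates the heat kernels of
    arbitrarily many times in geometric progression, and at the last of these times the amplitudes
    of their potentials are comparable: their sum passes the doubling threshold. *)
Lemma exponent_gt_critical : k%:R / (k%:R - 2 * s) < p.
Proof.
have ks : 0 < k%:R - 2 * s.
  have : (2 : R) <= k%:R by rewrite ler_nat.
  by move: s1; lra.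
rewrite ltNge; apply/negP => pk.
have p1 := exponent_gt1.
have pk2 : p * (k%:R / 2 - s) <= k%:R / 2 by move: pk; rewrite ler_pdivlMr//; lra.
have [ts [c [ts1 c0 Hc]]] := power_lower_bound.
have ts0 : 0 < ts by exact: lt_le_trans ts1.
have [C C0 HC] := @heat_sum_le R k k1.
have [d d0 Hd] := pot_comparison.
have [K K0 HK] := gaussian_spread.
pose t n : R := ts * 4 ^+ n.
have t0 n : 0 < t n by rewrite mulr_gt0 ?exprn_gt0.
have t1 n : 1 <= t n by rewrite -[1]mulr1 ler_pM// exprn_ege1// ler1n.
pose a := c `^ p / C; have a0 : 0 < a by rewrite divr_gt0// powR_gt0.
have pi12 : 0 < 4 * pi * (2 + 1) :> R by rewrite mulr_gt0// mulr_gt0 ?pi_gt0.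
pose k' : R := 2 `^ (s - 1) * (4 * pi * (2 + 1)) `^ (- (k%:R / 2)).
have k'0 : 0 < k' by rewrite mulr_gt0// powR_gt0.
have H n x : d * a * k' * n.+1%:R * t n `^ (s - k%:R / 2) * expR (- (q x / (4 * t n))) <= u x.
  have sumle y : 0 < \sum_(j < n.+1) a * heat (t j) (q y) <= u y `^ p.
    apply/andP; split.
      rewrite big_ord_recl ltr_pwDl//; first by apply: mulr_gt0 => //; exact: heat_gt0.
      by apply: sumr_ge0 => j _; apply: mulr_ge0; [exact: ltW|exact: heat_ge0].
    rewrite -mulr_sumr; apply: (le_trans (ler_wpM2l (ltW a0) (HC ts (q y) n.+1 ts0 (q0 y)))).
    rewrite /a mulrA divfK ?gt_eqF//.
    have Q1 : 1 <= ts + q y by rewrite -[1]addr0 lerD// edot_ge0.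
    have Q0 : 0 < ts + q y by exact: lt_le_trans Q1.
    apply: (@le_trans _ _ ((c * (ts + q y) `^ (s - k%:R / 2)) `^ p)); last first.
      by apply: (ge0_ler_powR (ltW p0)); rewrite ?nnegrE ?u0// mulr_ge0 ?powR_ge0// ltW.
    rewrite powRM ?(ltW c0) ?powR_ge0// ler_wpM2l ?powR_ge0// -powRrM.
    by apply: ler_powR => //; lra.
  have := Hd n.+1 (fun=> a) (fun j => t j) (fun=> 2 * t n) (fun=> ltW a0) (fun j => t0 j)
    (fun=> mulr_gt0 (ltr0Sn _ 1) (t0 n)) sumle x; apply: le_trans.
  have tj (j : 'I_n.+1) : t j <= 1 * t n.
    rewrite mul1r ler_wpM2l ?(ltW ts0)// ler_weXn2l ?ler1n//.
    by rewrite -ltnS.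
  have hp (j : 'I_n.+1) := @pot_lower R k s s0 s1 1 (t j) (t n) (q x) (t0 j) (tj j) (t0 n) (q0 x).
  apply: (@le_trans _ _ (d * \sum_(j < n.+1) a * (k' * t n `^ (s - k%:R / 2) * expR (- (q x / (4 * t n)))))).
    rewrite sumr_const card_ord -mulr_natl le_eqVlt; apply/orP; left; apply/eqP; ring.
  rewrite ler_wpM2l ?(ltW d0)//; apply: ler_sum => j _.
  by rewrite ler_wpM2l ?(ltW a0).
pose b := d * a * k'; have b0 : 0 < b by apply: mulr_gt0 => //; exact: mulr_gt0.
have p10 : 0 < p - 1 by rewrite subr_gt0.
(* the number of times needed to pass the doubling threshold *)
pose n := Num.truncn ((2 / K) `^ (p - 1)^-1 / b).
have nlt : (2 / K) `^ (p - 1)^-1 <= b * n.+1%:R.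
  by rewrite [leRHS]mulrC -ler_pdivrMr//; apply: ltW; exact: truncnS_gt.
have K2 : 0 < 2 / K by rewrite divr_gt0.
have bn0 : 0 < b * n.+1%:R by rewrite mulr_gt0.
have Kb : 2 <= K * (b * n.+1%:R) `^ (p - 1).
  rewrite mulrC -ler_pdivrMr//.
  have -> : 2 / K = ((2 / K) `^ (p - 1)^-1) `^ (p - 1).
    by rewrite -powRrM mulVf ?gt_eqF// powRr1// ltW.
  by apply: (ge0_ler_powR (ltW p10)); rewrite ?nnegrE ?powR_ge0 ?(ltW bn0).
pose M1 := b * n.+1%:R * t n `^ (s - k%:R / 2).
have M10 : 0 < M1 by rewrite mulr_gt0// powR_gt0.
apply: (@gaussian_doubling (t n) M1 (t0 n) M10); first exact: H.
move=> M MM HM x; have M0 : 0 < M by exact: lt_le_trans MM.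
apply: le_trans (HK (t n) (t n) M (t0 n) (lexx _) M0 HM x).
rewrite ler_wpM2r ?expR_ge0//.
have -> : K * M `^ p * t n `^ (k%:R / 2) * t n `^ (s - k%:R / 2) = K * M `^ p * t n `^ s.
  rewrite -mulrA -powRD; last by rewrite (gt_eqF (t0 n)) implybT.
  by congr (_ * _ `^ _); ring.
have -> : M `^ p = M * M `^ (p - 1) by rewrite -powRD1// subrK.
have -> : K * (M * M `^ (p - 1)) * t n `^ s = M * (K * M `^ (p - 1) * t n `^ s) by ring.
rewrite mulrC ler_wpM2l ?(ltW M0)//; apply: (le_trans Kb).
rewrite -[leRHS]mulrA ler_wpM2l ?(ltW K0)//.
apply: (@le_trans _ _ (M1 `^ (p - 1) * t n `^ s)); last first.
  rewrite ler_wpM2r ?powR_ge0//.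
  by apply: (ge0_ler_powR (ltW p10)); rewrite ?nnegrE ?(ltW M0) ?(ltW M10).
rewrite /M1 [in leRHS](powRM _ (ltW bn0) (powR_ge0 _ _)) -[leRHS]mulrA ler_peMr ?powR_ge0//.
rewrite -powRrM -powRD; last by rewrite (gt_eqF (t0 n)) implybT.
rewrite -[leLHS](powRr0 (t n)); apply: ler_powR => //; lra.
Qed.

End nonexistence.

(** * Powers of 1 + |x|^2 *)

Section bubbles.
Context {R : realType} (k : nat) (s g : R).
Hypotheses (k1 : (1 < k)%N) (s0 : 0 < s) (s1 : s < 1) (g0 : 0 < g).
Local Notation RR := (measurableTypeR R).
Local Notation Rk := (k.-tuple RR).
Local Notation mu := (@lebesgue_measure R).
Local Notation Lk := (@lebesgue_tuple R k).
Local Notation kpart := (@kpart R k s).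
Local Notation heat := (@heat R k).

Lemma powR_tangent (h x : R) : 0 <= h -> h <= 1 -> 0 < x -> x `^ h <= 1 + h * (x - 1).
Proof.
move=> h0 h1 x0; rewrite /powR gt_eqF//; set y := ln x.
have xE : x = expR y by rewrite /y lnK.
have a1 : expR (h * y) * (1 + (1 - h) * y) <= x.
  rewrite [leRHS]xE (_ : expR y = expR (h * y) * expR ((1 - h) * y)); last first.
    by rewrite -expRD; congr expR; ring.
  by rewrite ler_wpM2l ?expR_ge0// expR_ge1Dx.
have a2 : expR (h * y) * (1 - h * y) <= 1.
  rewrite [leRHS](_ : 1 = expR (h * y) * expR (- (h * y))); last by rewrite -expRD subrr expR0.
  by rewrite ler_wpM2l ?expR_ge0// expR_ge1Dx.
have h10 : 0 <= 1 - h by rewrite subr_ge0.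
have := ler_wpM2l h0 a1; have := ler_wpM2l h10 a2.
move: (expR (h * y)) => E b1 b2.
rewrite (_ : E = (1 - h) * (E * (1 - h * y)) + h * (E * (1 + (1 - h) * y))); last by ring.
by apply: (le_trans (lerD b1 b2)); lra.
Qed.

(** The density in time of the mixture that represents [(A + q) `^ (- b)]. The
    normalization is the one for [b = g / 2]; the exponent [g / 2 + s], that of
    the gain, is used with the same factor. *)
Definition bubble_weight (b A t : R) : R :=
  (levy_mass (g / 2))^-1 * (4 * pi * t) `^ (k%:R / 2) * levy b A t
  * \1_(`]0, +oo[%classic : set R) t.

Lemma bubble_weight_ge0 b A t : 0 <= bubble_weight b A t.
Proof.
apply: mulr_ge0; last by rewrite indicE.
apply: mulr_ge0; last exact: levy_ge0.
by apply: mulr_ge0; [rewrite invr_ge0 ltW// levy_mass_gt0 ?divr_gt0|exact: powR_ge0].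
Qed.

Lemma bubble_weight0 b A t : t <= 0 -> bubble_weight b A t = 0.
Proof.
by move=> t0; rewrite /bubble_weight indicE memNset ?mulr0//= in_itv/= andbT; apply/negP; rewrite -leNgt.
Qed.

Lemma measurable_bubble_weight b A : measurable_fun setT (bubble_weight b A).
Proof.
apply: measurable_funM; last exact: measurable_indic.
apply: measurable_funM; last exact: measurable_levy.
apply: measurable_funM => //; apply: (measurableT_comp (measurable_powR _)).
exact: measurable_funM.
Qed.

Lemma bubble_weight_heat b A q t :
  bubble_weight b A t * heat t q =
  (levy_mass (g / 2))^-1 * levy b (A + q) t * \1_(`]0, +oo[%classic : set R) t.
Proof.
rewrite /bubble_weight indicE; have [t0|t0] := leP t 0.
  by rewrite memNset ?mulr0 ?mul0r//= in_itv/= andbT; apply/negP; rewrite -leNgt.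
rewrite mem_set ?mulr1; last by rewrite /= in_itv/= t0.
have pt : 0 < 4 * pi * t by rewrite mulr_gt0// mulr_gt0 ?pi_gt0.
have e1 : (4 * pi * t) `^ (k%:R / 2) * (4 * pi * t) `^ (- (k%:R / 2)) = 1.
  by rewrite -powRD ?subrr ?powRr0// (gt_eqF pt) implybT.
have -> : levy b (A + q) t = levy b A t * expR (- (q / (4 * t))).
  by rewrite /levy -mulrA -expRD; congr (_ * expR _); ring.
rewrite /heat; set P := _ `^ (k%:R / 2) in e1 *; set P' := _ `^ (- _) in e1 *.
transitivity ((levy_mass (g / 2))^-1 * levy b A t * expR (- (q / (4 * t))) * (P * P')); first by ring.
by rewrite e1 mulr1 -mulrA.
Qed.

Lemma bubble_mixture b A q : 0 < b -> 0 < A + q ->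
  ((levy_mass b / levy_mass (g / 2) * (A + q) `^ (- b))%:E =
   \int[mu]_t (bubble_weight b A t * heat t q)%:E)%E.
Proof.
move=> b0 Aq.
have mg : 0 < levy_mass (g / 2) by apply: levy_mass_gt0; rewrite divr_gt0.
under eq_integral do rewrite bubble_weight_heat -mulrA EFinM.
rewrite ge0_integralZl_EFin//; last 3 first.
- by move=> t _; rewrite lee_fin mulr_ge0 ?levy_ge0// indicE.
- apply/measurable_EFinP; apply: measurable_funM; first exact: measurable_levy.
  exact: measurable_indic.
- by rewrite invr_ge0 ltW.
rewrite -integral_indic_mul integral_levy// -EFinM; congr EFin; ring.
Qed.

(** The integrand is bounded at small times. *)
Lemma levy_near0 b Q : 0 < b -> 0 < Q -> exists2 C : R, 0 <= C & forall e : R, 0 < e ->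
  ((levy_mass b * Q `^ (- b))%:E <=
    (C * e)%:E + \int[mu]_(t in `]e, +oo[) (levy b Q t)%:E)%E.
Proof.
move=> b0 Q0; pose m := b + 1; have m0 : 0 < m by rewrite addr_gt0.
pose C := m `^ m * (Q / 4) `^ (- m).
have C0 : 0 <= C by rewrite mulr_ge0 ?powR_ge0.
exists C => // e e0; rewrite -integral_levy//.
have -> : (`]0%R, +oo[%classic : set R) = `]0%R, e]%classic `|` `]e, +oo[%classic.
  apply/seteqP; split=> t /=; rewrite !in_itv/= !andbT.
    by move=> t0; have [te|te] := leP t e; [left; rewrite t0|right].
  by case=> [/andP[]//|]; exact: lt_trans.
have mE (D : set R) : measurable_fun D (fun t => (levy b Q t)%:E).
  by apply/measurable_EFinP; apply: measurable_funTS; exact: measurable_levy.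
rewrite ge0_integral_setU//; last 3 first.
- exact: mE.
- by move=> t _; rewrite lee_fin levy_ge0.
- apply/disj_setPS => t /= [] /=; rewrite !in_itv/= andbT => /andP[_ h1] h2; lra.
rewrite leeD2r//.
apply: (@le_trans _ _ (\int[mu]_(t in `]0%R, e]) C%:E)%E).
  apply: ge0_le_integral => //.
  - by move=> t _; rewrite lee_fin levy_ge0.
  - exact: mE.
  move=> t /=; rewrite in_itv/= => /andP[t0 _]; rewrite lee_fin.
  have Qt : 0 <= Q / (4 * t) by rewrite divr_ge0 ?(ltW Q0)// mulr_ge0// ltW.
  have := @powR_le_expR R m _ m0 Qt.
  rewrite /levy /C expRN ler_pdivrMr ?expR_gt0//.
  have -> : Q / (4 * t) = (Q / 4) * t^-1 by field; rewrite gt_eqF.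
  have Q4 : 0 < Q / 4 by rewrite divr_gt0.
  rewrite powRM ?(ltW Q4) ?invr_ge0 ?(ltW t0)// powR_inv ?(ltW t0)//.
  have -> : - b - 1 = - m by rewrite /m; ring.
  move=> h.
  have e1 : (Q / 4) `^ (- m) * (Q / 4) `^ m = 1.
    by rewrite -powRD ?addNr ?powRr0// (gt_eqF Q4) implybT.
  have := ler_wpM2l (powR_ge0 (Q / 4) (- m)) h.
  by rewrite mulrA e1 mul1r mulrCA !mulrA.
by rewrite integral_cst//= lebesgue_measure_itv/= lte_fin e0 oppr0 adde0 -EFinM.
Qed.

(** The powers of [1 + |x|^2] that decay slower than the fundamental solution
    are strict supersolutions of the linear equation. In the time variable of
    the mixture the truncated kernel sees the power [t `^ (h + s - 1)], where [h]
    is half the distance of the decay exponent to the critical one; comparing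
    with the explicit integral for [h = 0] by concavity produces the gain. *)
Lemma bubble_far (a : 'I_k -> R) (A : R) (h := (k%:R - g) / 2 - s) :
  0 < h -> h <= 1 -> 0 < A ->
  exists2 C : R, 0 <= C & forall e : R, 0 < e ->
  (\int[Lk]_z (((A + \sum_i (a i + tnth z i) ^+ 2) `^ (- (g / 2)))%:E * kpart `]e, +oo[ z) <=
   ((A + \sum_i a i ^+ 2) `^ (- (g / 2)) * (e `^ (- s) / s)
    - h / s * (levy_mass (g / 2 + s) / levy_mass (g / 2)) * (A + \sum_i a i ^+ 2) `^ (- (g / 2 + s))
    + C * e)%:E)%E.
Proof.
move=> h0 h1 A0; set S := \sum_i a i ^+ 2.
have S0 : 0 <= S by apply: sumr_ge0 => i _; exact: sqr_ge0.
have Q0 : 0 < A + S by rewrite ltr_pwDl.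
have b0 : 0 < g / 2 by rewrite divr_gt0.
have bs0 : 0 < g / 2 + s by rewrite addr_gt0.
have mg : 0 < levy_mass (g / 2) by exact: levy_mass_gt0.
have [C C0 HC] := levy_near0 bs0 Q0.
have hs0 : 0 <= h / s by rewrite divr_ge0// ltW.
exists (h / s * (C / levy_mass (g / 2))).
  by apply: mulr_ge0 => //; rewrite divr_ge0// ltW.
move=> e e0.
pose w := bubble_weight (g / 2) A; pose v := bubble_weight (g / 2 + s) A.
have sum0 (z : Rk) : 0 <= \sum_i (a i + tnth z i) ^+ 2 by apply: sumr_ge0 => i _; exact: sqr_ge0.
have msum : measurable_fun setT (fun z : Rk => (\sum_i (a i + tnth z i) ^+ 2)%R).
  apply: measurable_sum => i; apply: (@measurable_tnth_comp R k (fun x => (a i + x) ^+ 2)%R).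
  by apply: measurable_funX; exact: measurable_funD.
rewrite (@integral_mixture_kpart R k s w a (fun z => (A + \sum_i (a i + tnth z i) ^+ 2) `^ (- (g / 2))) e e0); last 6 first.
- exact: measurable_bubble_weight.
- exact: bubble_weight_ge0.
- exact: bubble_weight0.
- apply: (measurableT_comp (measurable_powR _)); exact: measurable_funD.
- by move=> z; exact: powR_ge0.
- move=> z; rewrite -bubble_mixture//; last by rewrite ltr_pwDl.
  by rewrite divff ?mul1r// gt_eqF.
rewrite -/S.
pose G r : \bar R := (\int[mu]_(t in `]e, +oo[) (w (r - t) * t `^ (- 1 - s))%:E)%E.
have G0 r : (0 <= G r)%E.
  by apply: integral_ge0 => t _; rewrite lee_fin; apply: mulr_ge0; [exact: bubble_weight_ge0|exact: powR_ge0].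
have mw : measurable_fun setT w by exact: measurable_bubble_weight.
have mv : measurable_fun setT v by exact: measurable_bubble_weight.
have mh : measurable_fun setT (fun r : R => heat r S).
  by apply: measurable_heat; [exact: measurable_id|exact: measurable_cst].
have mG : measurable_fun setT G.
  apply: (@measurable_int_on R _ _ RR RR mu setT `]e, +oo[%classic
    (fun q : RR * RR => (w (q.1 - q.2) * q.2 `^ (- 1 - s))%:E)) => //.
    apply: measurable_funTS; apply/measurable_EFinP; apply: measurable_funM.
      by apply: (measurableT_comp mw); exact: measurable_funB.
    by apply: (measurableT_comp (measurable_powR _)).
  by move=> q _; rewrite lee_fin; apply: mulr_ge0; [exact: bubble_weight_ge0|exact: powR_ge0].
have pw r : e < r -> ((h / s * v r)%:E + G r <= (e `^ (- s) / s * w r)%:E)%E.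
  move=> er; have r0 : 0 < r by exact: lt_trans er.
  pose W0 := (levy_mass (g / 2))^-1 * (4 * pi) `^ (k%:R / 2) * expR (- (A / (4 * r))).
  have W00 : 0 <= W0.
    by apply: mulr_ge0; [apply: mulr_ge0; [rewrite invr_ge0 ltW|exact: powR_ge0]|exact: expR_ge0].
  have pi4 : 0 <= 4 * pi :> R by rewrite mulr_ge0 ?pi_ge0.
  have wE b t : 0 < t -> bubble_weight b A t =
      (levy_mass (g / 2))^-1 * (4 * pi) `^ (k%:R / 2) * expR (- (A / (4 * t))) * t `^ (k%:R / 2 - b - 1).
    move=> t0; rewrite /bubble_weight indicE mem_set ?mulr1; last by rewrite /= in_itv/= t0.
    rewrite powRM ?(ltW t0)// /levy.
    have -> : t `^ (k%:R / 2 - b - 1) = t `^ (k%:R / 2) * t `^ (- b - 1).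
      by rewrite -powRD ?addrA// (gt_eqF t0) implybT.
    ring.
  have wr : w r = W0 * r `^ (h - 1) * r `^ s.
    rewrite /w wE// -/W0 -mulrA -powRD; last by rewrite (gt_eqF r0) implybT.
    by congr (_ * _ `^ _); rewrite /h; field.
  have vr : v r = W0 * r `^ (h - 1).
    by rewrite /v wE// -/W0; congr (_ * _ `^ _); rewrite /h; field.
  pose D : set R := `]e, r[%classic; have mDs : measurable (D : set RR) by rewrite /D.
  have GE : G r = (\int[mu]_(t in D) (w (r - t) * t `^ (- 1 - s))%:E)%E.
    rewrite /G /D.
    have -> : (`]e, +oo[%classic : set R) = `]e, r[%classic `|` `[r, +oo[%classic.
      apply/seteqP; split=> t /=; rewrite !in_itv/= !andbT.
        by move=> t0; have [te|te] := ltP t r; [left; rewrite t0|right].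
      by case=> [/andP[]//|]; exact: lt_le_trans.
    rewrite ge0_integral_setU//; last 3 first.
    - apply/measurable_EFinP; apply: measurable_funTS; apply: measurable_funM.
        by apply: (measurableT_comp mw); exact: measurable_funB.
      exact: measurable_powR.
    - by move=> t _; rewrite lee_fin; apply: mulr_ge0; [exact: bubble_weight_ge0|exact: powR_ge0].
    - apply/disj_setPS => t /= [] /=; rewrite !in_itv/= andbT => /andP[_ a1] a2; lra.
    rewrite [X in (_ + X)%E]integral0_eq ?adde0// => t /=; rewrite in_itv/= andbT => rt.
    by rewrite /w bubble_weight0 ?mul0r// subr_le0.
  have mD (f : R -> R) : measurable_fun setT f -> measurable_fun D (EFin \o f).
    by move=> mf; apply/measurable_EFinP; exact: measurable_funTS.
  have mpw : measurable_fun setT (fun t : R => (r - t) `^ (s - 1)).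
    by apply: (measurableT_comp (measurable_powR _)); exact: measurable_funB.
  have mpt : measurable_fun setT (fun t : R => t `^ (- 1 - s)) by exact: measurable_powR.
  have mwr : measurable_fun setT (fun t : R => w (r - t) * t `^ (- 1 - s)).
    by apply: measurable_funM => //; apply: (measurableT_comp mw); exact: measurable_funB.
  (* the gain as an integral with density [(r - t) `^ (s - 1)], to be compared
     pointwise with the integrand of [integral_beta] *)
  pose c1 := W0 * r `^ (h - 1 - s) * h; pose c2 := W0 * r `^ h.
  have c10 : 0 <= c1 by rewrite mulr_ge0 ?(ltW h0)// mulr_ge0 ?powR_ge0.
  have c20 : 0 <= c2 by rewrite mulr_ge0 ?powR_ge0.
  have I1 : (\int[mu]_(t in D) (c1 * (r - t) `^ (s - 1))%:E = (c1 * ((r - e) `^ s / s))%:E)%E.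
    rewrite EFinM -(integral_powR_sub s0 er) -ge0_integralZl_EFin//.
    - by move=> t _; rewrite lee_fin powR_ge0.
    - exact: mD.
  have I2 : (\int[mu]_(t in D) (c2 * ((r - t) `^ (s - 1) * t `^ (- 1 - s)))%:E =
      (c2 * (e `^ (- s) * (r - e) `^ s / (s * r)))%:E)%E.
    rewrite EFinM -(integral_beta s0 e0 er) -ge0_integralZl_EFin//.
    - by move=> t _; rewrite lee_fin mulr_ge0 ?powR_ge0.
    - by apply: mD; exact: measurable_funM.
  have le12 : ((c1 * ((r - e) `^ s / s))%:E + G r <= (c2 * (e `^ (- s) * (r - e) `^ s / (s * r)))%:E)%E.
    rewrite -I1 -I2 GE -ge0_integralD//; last 4 first.
    - by move=> t _; rewrite lee_fin mulr_ge0 ?powR_ge0.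
    - by apply: mD; exact: measurable_funM.
    - by move=> t _; rewrite lee_fin; apply: mulr_ge0; [exact: bubble_weight_ge0|exact: powR_ge0].
    - exact: mD.
    apply: ge0_le_integral => //.
    - move=> t _; rewrite -EFinD lee_fin; apply: addr_ge0; apply: mulr_ge0; rewrite ?powR_ge0//.
      exact: bubble_weight_ge0.
    - by apply: emeasurable_funD; apply: mD => //; exact: measurable_funM.
    - by apply: mD; apply: measurable_funM => //; exact: measurable_funM.
    move=> t; rewrite /D/= in_itv/= => /andP[et tr]; rewrite -EFinD lee_fin.
    have t0 : 0 < t by exact: lt_trans et.
    have rt0 : 0 < r - t by rewrite subr_gt0.
    have wle : w (r - t) <= W0 * (r - t) `^ (s - 1) * (r - t) `^ h.
      rewrite /w wE// -[leRHS]mulrA -powRD; last by rewrite (gt_eqF rt0) implybT.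
      have -> : k%:R / 2 - g / 2 - 1 = s - 1 + h by rewrite /h; field.
      rewrite ler_wpM2r ?powR_ge0// ler_wpM2l//.
        by apply: mulr_ge0; [rewrite invr_ge0 ltW|exact: powR_ge0].
      rewrite ler_expR lerN2 ler_wpM2l ?(ltW A0)// lef_pV2 ?posrE ?mulr_gt0// ler_wpM2l//.
      by rewrite gerBl ltW.
    have hle : (r - t) `^ h <= r `^ h * (1 - h * (t / r)).
      have -> : r - t = r * ((r - t) / r) by field; rewrite gt_eqF.
      have x0 : 0 < (r - t) / r by rewrite divr_gt0.
      rewrite powRM ?(ltW r0) ?(ltW x0)// ler_wpM2l ?powR_ge0//.
      apply: (le_trans (powR_tangent (ltW h0) h1 x0)); rewrite le_eqVlt; apply/orP; left; apply/eqP.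
      by field; rewrite gt_eqF.
    have P0 : 0 <= (r - t) `^ (s - 1) by exact: powR_ge0.
    have T0 : 0 <= t `^ (- 1 - s) by exact: powR_ge0.
    have tsE : t * t `^ (- 1 - s) = t `^ (- s) by rewrite -powRD1//; congr (_ `^ _); ring.
    have rts : r `^ (- s) <= t `^ (- s).
      rewrite !powRN lef_pV2 ?posrE ?powR_gt0//.
      by apply: (ge0_ler_powR (ltW s0)); rewrite ?nnegrE ?(ltW t0) ?(ltW r0) ?(ltW tr).
    apply: (@le_trans _ _ (c1 * (r - t) `^ (s - 1) +
       W0 * (r - t) `^ (s - 1) * (r `^ h * (1 - h * (t / r))) * t `^ (- 1 - s))).
      rewrite lerD2l ler_wpM2r//; apply: (le_trans wle).
      by rewrite ler_wpM2l// mulr_ge0.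
    have -> : c1 = W0 * (r `^ h / r) * r `^ (- s) * h.
      rewrite /c1; have -> : r `^ (h - 1 - s) = r `^ h / r * r `^ (- s).
        rewrite -powR_inv1 ?(ltW r0)// -!powRD ?(gt_eqF r0) ?implybT//.
      ring.
    have -> : W0 * (r - t) `^ (s - 1) * (r `^ h * (1 - h * (t / r))) * t `^ (- 1 - s) =
      c2 * ((r - t) `^ (s - 1) * t `^ (- 1 - s)) - W0 * (r `^ h / r) * (t * t `^ (- 1 - s)) * h * (r - t) `^ (s - 1).
      by rewrite /c2; ring.
    rewrite tsE -subr_ge0.
    have -> : c2 * ((r - t) `^ (s - 1) * t `^ (-1 - s)) - (W0 * (r `^ h / r) * r `^ (- s) * h * (r - t) `^ (s - 1) +
      (c2 * ((r - t) `^ (s - 1) * t `^ (-1 - s)) - W0 * (r `^ h / r) * t `^ (- s) * h * (r - t) `^ (s - 1)))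
      = (W0 * (r `^ h / r)) * (t `^ (- s) - r `^ (- s)) * h * (r - t) `^ (s - 1) by ring.
    apply: mulr_ge0 => //; apply: mulr_ge0; last exact: ltW.
    apply: mulr_ge0; last by rewrite subr_ge0.
    by apply: mulr_ge0 => //; rewrite divr_ge0 ?powR_ge0// ltW.
  have hr : r `^ h = r * r `^ (h - 1) by rewrite -powRD1// subrK.
  have hrs : r `^ (h - 1 - s) = r `^ (h - 1) * r `^ (- s).
    by rewrite -powRD// (gt_eqF r0) implybT.
  have rss : r `^ (- s) * r `^ s = 1.
    by rewrite -powRD ?addNr ?powRr0// (gt_eqF r0) implybT.
  pose X := W0 * r `^ (h - 1) / s; have X0 : 0 <= X.
    by rewrite divr_ge0 ?(ltW s0)// mulr_ge0 ?powR_ge0.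
  have er' : (r - e) `^ s <= r `^ s.
    by apply: (ge0_ler_powR (ltW s0)); rewrite ?nnegrE ?subr_ge0 ?gerBl; exact: ltW.
  have bracket : 0 <= e `^ (- s) - h * r `^ (- s).
    rewrite subr_ge0; apply: (@le_trans _ _ (1 * r `^ (- s))).
      by rewrite ler_wpM2r ?powR_ge0.
    rewrite mul1r !powRN lef_pV2 ?posrE ?powR_gt0//.
    by apply: (ge0_ler_powR (ltW s0)); rewrite ?nnegrE; exact: ltW.
  have Gfin : G r \is a fin_num.
    rewrite ge0_fin_numE//; have c3 : 0 <= c1 * ((r - e) `^ s / s).
      by apply: mulr_ge0 => //; rewrite divr_ge0 ?powR_ge0// ltW.
    apply: le_lt_trans (ltry (c2 * (e `^ (- s) * (r - e) `^ s / (s * r)))); apply: le_trans le12.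
    by rewrite leeDr// lee_fin.
  move: le12; rewrite -(fineK Gfin) -!EFinD !lee_fin => le12.
  rewrite vr wr.
  have -> : h / s * (W0 * r `^ (h - 1)) = X * h by rewrite /X; ring.
  have -> : e `^ (- s) / s * (W0 * r `^ (h - 1) * r `^ s) = X * e `^ (- s) * r `^ s by rewrite /X; ring.
  have e1 : c1 * ((r - e) `^ s / s) = X * (h * r `^ (- s)) * (r - e) `^ s by rewrite /c1 /X hrs; ring.
  have e2 : c2 * (e `^ (- s) * (r - e) `^ s / (s * r)) = X * e `^ (- s) * (r - e) `^ s.
    by rewrite /c2 /X hr; field; rewrite !gt_eqF.
  rewrite e1 e2 in le12.
  have le3 : X * (e `^ (- s) - h * r `^ (- s)) * (r - e) `^ s <= X * (e `^ (- s) - h * r `^ (- s)) * r `^ s.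
    by rewrite ler_wpM2l// mulr_ge0.
  have e4 : X * (e `^ (- s) - h * r `^ (- s)) * r `^ s = X * e `^ (- s) * r `^ s - X * h.
    transitivity (X * e `^ (- s) * r `^ s - X * h * (r `^ (- s) * r `^ s)); first by ring.
    by rewrite rss mulr1.
  have fin (Y a1 a2 a3 a4 f h' : R) : Y * (h' * a3) * a2 + f <= Y * a4 * a2 ->
    Y * (a4 - h' * a3) * a2 <= Y * a4 * a1 - Y * h' -> Y * h' + f <= Y * a4 * a1 by move=> *; lra.
  by apply: (fin _ _ _ _ _ _ _ le12); rewrite -e4.
pose E : set R := `]e, +oo[%classic; have mEs : measurable (E : set RR) by rewrite /E.
have whE r : (e `^ (- s) / s * w r * heat r S)%:E = ((e `^ (- s) / s)%:E * (w r * heat r S)%:E)%E.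
  by rewrite -EFinM; congr EFin; ring.
have es0 : 0 <= e `^ (- s) / s by rewrite divr_ge0 ?powR_ge0// ltW.
have wh0 r : (0 <= (w r * heat r S)%:E)%E by rewrite lee_fin; apply: mulr_ge0; [exact: bubble_weight_ge0|exact: heat_ge0].
have mwh : measurable_fun setT (fun r => (w r * heat r S)%:E).
  by apply/measurable_EFinP; exact: measurable_funM.
have IW : (\int[mu]_r (e `^ (- s) / s * w r * heat r S)%:E = ((A + S) `^ (- (g / 2)) * (e `^ (- s) / s))%:E)%E.
  under eq_integral do rewrite whE.
  rewrite ge0_integralZl_EFin// -bubble_mixture//.
  by rewrite divff ?gt_eqF// mul1r -EFinM mulrC.
pose V r := h / s * v r * heat r S * \1_E r.
have V0 r : 0 <= V r.
  apply: mulr_ge0; last by rewrite indicE.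
  by apply: mulr_ge0; [apply: mulr_ge0 => //; exact: bubble_weight_ge0|exact: heat_ge0].
have mV : measurable_fun setT V.
  apply: measurable_funM; last exact: measurable_indic.
  by apply: measurable_funM => //; exact: measurable_funM.
have IV : (((h / s * (levy_mass (g / 2 + s) / levy_mass (g / 2)) * (A + S) `^ (- (g / 2 + s)))
     - h / s * (C / levy_mass (g / 2)) * e)%:E <= \int[mu]_r (V r)%:E)%E.
  have -> : (\int[mu]_r (V r)%:E = (h / s / levy_mass (g / 2))%:E *
      \int[mu]_(r in `]e, +oo[) (levy (g / 2 + s) (A + S) r)%:E)%E.
    have hm0 : 0 <= h / s / levy_mass (g / 2) by rewrite divr_ge0// ltW.
    rewrite [X in _ = (_ * X)%E]integral_indic_mul -ge0_integralZl_EFin//; last 2 first.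
    - by move=> r _; rewrite lee_fin mulr_ge0 ?levy_ge0// indicE.
    - apply/measurable_EFinP; apply: measurable_funM; first exact: measurable_levy.
      exact: measurable_indic.
    apply: eq_integral => r _; rewrite -EFinM; congr EFin.
    rewrite /V -(mulrA (h / s)) bubble_weight_heat /E !indicE.
    have [re|re] := boolP (r \in (`]e, +oo[%classic : set R)); last by rewrite !mulr0.
    have -> : (r \in (`]0%R, +oo[%classic : set R)) = true.
      by rewrite mem_set//; move: re => /set_mem/=; rewrite !in_itv/= !andbT; exact: lt_trans.
    by rewrite !mulr1; ring.
  have := HC e e0; set I := (\int[mu]_(t in _) _)%E => HCe.
  have hm0 : 0 <= h / s / levy_mass (g / 2) by rewrite divr_ge0// ltW.
  rewrite EFinB leeBlDr//.
  have -> : (h / s * (levy_mass (g / 2 + s) / levy_mass (g / 2)) * (A + S) `^ (- (g / 2 + s)))%:E =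
    ((h / s / levy_mass (g / 2))%:E * (levy_mass (g / 2 + s) * (A + S) `^ (- (g / 2 + s)))%:E)%E.
    by rewrite -EFinM; congr EFin; ring.
  have -> : (h / s * (C / levy_mass (g / 2)) * e)%:E = ((h / s / levy_mass (g / 2))%:E * (C * e)%:E)%E.
    by rewrite -EFinM; congr EFin; ring.
  rewrite addeC -ge0_muleDr; last 2 first.
  - by rewrite lee_fin mulr_ge0// ltW.
  - by apply: integral_ge0 => t _; rewrite lee_fin levy_ge0.
  by rewrite lee_wpmul2l.
have hG0 r : (0 <= (heat r S)%:E * G r)%E by rewrite mule_ge0// lee_fin heat_ge0.
have mhG : measurable_fun setT (fun r : R => (heat r S)%:E * G r)%E.
  by apply: emeasurable_funM => //; apply/measurable_EFinP.
have tot : (\int[mu]_r (V r)%:E + \int[mu]_r ((heat r S)%:E * G r) <=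
    ((A + S) `^ (- (g / 2)) * (e `^ (- s) / s))%:E)%E.
  rewrite -IW -ge0_integralD//; last 2 first.
  - by move=> r _; rewrite lee_fin.
  - exact/measurable_EFinP.
  apply: ge0_le_integral => //.
  - by move=> r _; rewrite adde_ge0// lee_fin.
  - by apply: emeasurable_funD => //; exact/measurable_EFinP.
  - apply/measurable_EFinP; apply: measurable_funM => //; exact: measurable_funM.
  move=> r _; rewrite /V indicE /E; have [re|re] := leP r e.
    rewrite memNset; last by rewrite /= in_itv/= andbT; apply/negP; rewrite -leNgt.
    rewrite mulr0 add0e (_ : G r = 0%E) ?mule0.
      by rewrite lee_fin; apply: mulr_ge0; [apply: mulr_ge0 => //; exact: bubble_weight_ge0|exact: heat_ge0].
    rewrite /G integral0_eq// => t /=; rewrite in_itv/= andbT => et.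
    by rewrite /w bubble_weight0 ?mul0r//; lra.
  rewrite mem_set ?mulr1; last by rewrite /= in_itv/= andbT.
  rewrite mulrC [leRHS]EFinM -[leRHS]muleC EFinM -ge0_muleDr//.
    by rewrite lee_wpmul2l ?lee_fin ?heat_ge0//; exact: pw.
  by rewrite lee_fin; apply: mulr_ge0 => //; exact: bubble_weight_ge0.
rewrite -/(G _); under eq_integral do rewrite -/(G _).
have {IV tot} := le_trans (leeD2r _ IV) tot.
set J := (\int[mu]_r ((heat r S)%:E * G r))%E => tot.
have J0 : (0 <= J)%E by apply: integral_ge0 => r _; exact: hG0.
move: tot J0; rewrite -/J; clearbody J; case: J => [x| |] tot J0 //.
by move: tot; rewrite -EFinD !lee_fin; lra.
Qed.

End bubbles.

(** * Taylor expansion of functions of class C2 *)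

Section taylor.
Context {R : realType} {N : nat}.
Implicit Types x y : 'rV[R]_N.

Lemma derivable_line (f : 'rV[R]_N -> R) x v (t : R) : derivable f (x + t *: v) v ->
  is_derive t 1 (fun h : R => f (x + h *: v)) ('D_v f (x + t *: v)).
Proof.
move=> df.
have E : (fun h : R => h^-1 *: (((fun h : R => f (x + h *: v)) \o shift t) (h *: 1) - f (x + t *: v))) =
    (fun h : R => h^-1 *: ((f \o shift (x + t *: v)) (h *: v) - f (x + t *: v))).
  apply/funext => h; congr (_ *: (_ - _)); rewrite /=; congr f.
  have hA : h *: (1 : R) = h by rewrite /GRing.scale/= mulr1.
  by rewrite [X in x + (X + _) *: _]hA scalerDl addrCA.
split; last by rewrite /derive E.
by rewrite /derivable E.
Qed.

(** The mean value inequality along a segment. *)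
Lemma line_bound (f : 'rV[R]_N -> R) x v (c M : R) :
  (forall t, `|t| <= `|c| -> derivable f (x + t *: v) v /\ `|'D_v f (x + t *: v)| <= M) ->
  `|f (x + c *: v) - f x| <= M * `|c|.
Proof.
move=> H; pose h t := f (x + t *: v).
have dh (t : R) : `|t| <= `|c| -> is_derive t 1 h ('D_v f (x + t *: v)).
  by move=> /H[d _]; exact: derivable_line.
have ch (t : R) : `|t| <= `|c| -> {for t, continuous h}.
  by move=> /dh[+ _]; move=> /derivable1_diffP/differentiable_continuous.
have -> : f x = h 0 by rewrite /h scale0r addr0.
rewrite -/(h c).
have M1 (a b : R) : a <= b -> (forall t, t \in `[a, b] -> `|t| <= `|c|) -> `|h b - h a| <= M * `|b - a|.
  move=> ab I.
  have [| |w wab ->] := @MVT_segment R h (fun t => 'D_v f (x + t *: v)) a b ab.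
  - by move=> t tab; apply: dh; apply: I; apply: subset_itv_oo_cc tab.
  - apply: continuous_in_subspaceT => t; rewrite inE/= => tab.
    by apply: ch; exact: I.
  rewrite normrM ler_wpM2r//.
  by have [] := H w (I _ wab).
have [c0|c0] := leP 0 c.
  have := M1 0 c c0; rewrite subr0; apply => t; rewrite in_itv/= => /andP[t0 tc].
  by rewrite !ger0_norm.
have := M1 c 0 (ltW c0); rewrite sub0r normrN distrC; apply => t; rewrite in_itv/= => /andP[t0 tc].
by rewrite !ler0_norm ?lerN2// ltW.
Qed.

Lemma row_norm_le x (r : R) : 0 <= r -> (`|x| <= r) <-> (forall i, `|x ord0 i| <= r).
Proof.
move=> r0; split=> [xr i|H].
  apply: le_trans xr; rewrite [leRHS]mx_normrE.
  exact: (le_bigmax _ (fun ij : 'I_1 * 'I_N => `|x ij.1 ij.2|) (ord0, i)).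
rewrite [leLHS]mx_normrE; apply: bigmax_le => // -[i j] _ /=; rewrite [i]ord1; exact: H.
Qed.

(** Moving along one coordinate at a time. *)
Lemma partial_bound (f : 'rV[R]_N -> R) x (r M : R) : 0 <= r ->
  (forall y i, `|y - x| <= r -> derivable f y (basis_vec i) /\ `|'D_(basis_vec i) f y| <= M) ->
  forall y, `|y - x| <= r -> `|f y - f x| <= N%:R * (M * r).
Proof.
move=> r0 H y yr; have yri := (row_norm_le (y - x) r0).1 yr.
pose P m : 'rV[R]_N := \row_(i < N) (if (i < m)%N then y ord0 i else x ord0 i).
have P0 : P 0%N = x by apply/rowP => i; rewrite mxE.
have PN : P N = y by apply/rowP => i; rewrite mxE ltn_ord.
have step (m : 'I_N) : `|f (P m.+1) - f (P m)| <= M * r.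
  have PS : P m.+1 = P m + (y - x) ord0 m *: basis_vec m.
    apply/rowP => i; rewrite !mxE eqxx/= ltnS leq_eqVlt.
    have [->|im] := eqVneq i m; first by rewrite eqxx/= ltnn mulr1 addrC subrK.
    by rewrite -val_eqE in im; rewrite (negbTE im)/= mulr0 addr0.
  have M0 : 0 <= M.
    have [] := H x m; first by rewrite subrr normr0.
    by move=> _; apply: le_trans.
  rewrite PS; apply: (le_trans (@line_bound f (P m) (basis_vec m) ((y - x) ord0 m) M _)); last first.
    by rewrite ler_wpM2l.
  move=> t tc; apply: H; apply/(row_norm_le _ r0) => i; rewrite !mxE eqxx/=.
  have [->|im] := eqVneq i m.
    rewrite ltnn mulr1 addrAC subrr add0r; apply: (le_trans tc); exact: yri.
  rewrite mulr0 addr0; case: ifP => _; last by rewrite subrr normr0.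
  by have := yri i; rewrite !mxE.
have tel : f y - f x = \sum_(m < N) (f (P m.+1) - f (P m)).
  rewrite -[in LHS]P0 -[in LHS]PN -(big_mkord xpredT (fun m => f (P m.+1) - f (P m))).
  by rewrite telescope_sumr.
rewrite tel; apply: (le_trans (ler_norm_sum _ _ _)).
apply: (@le_trans _ _ (\sum_(m < N) (M * r))); first by apply: ler_sum => m _.
by rewrite sumr_const card_ord mulr_natl.
Qed.

Lemma derive_sub_lin (f : 'rV[R]_N -> R) (d : 'I_N -> R) x0 i y :
  derivable f y (basis_vec i) ->
  is_derive y (basis_vec i) (fun z => f z - \sum_j d j * (z - x0) ord0 j) ('D_(basis_vec i) f y - d i).
Proof.
move=> df.
have dl : is_derive y (basis_vec i) (fun z : 'rV[R]_N => \sum_j d j * (z - x0) ord0 j) (d i).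
  apply: (@is_derive_quadratic _ _ _ _ _ _ 0) => h; rewrite mulr0 addr0.
  transitivity (\sum_j (d j * (y - x0) ord0 j + (j == i)%:R * (h * d i))).
    apply: eq_bigr => j _; rewrite !mxE eqxx/=.
    by have [->|ji] := eqVneq j i; rewrite /=; ring.
  rewrite big_split/=; congr (_ + _); rewrite (bigD1 i)//= eqxx mul1r big1 ?addr0// => j ji.
  by rewrite (negbTE ji) mul0r.
by apply: is_deriveB => //; exact: derivableP.
Qed.

(** Continuity bounds the second partial derivatives near [x0]. The mean value
    inequality, applied to the first partial derivatives and then to the
    function, turns this into the quadratic remainder. *)
Lemma C2_taylor (phi : 'rV[R]_N -> R) x0 (delta : R) : 0 < delta ->
  C2_on (eball x0 delta) phi ->
  exists d : 'I_N -> R, exists C r : R, [/\ 0 <= C, 0 < r, r <= delta &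
    forall y, enorm (y - x0) < r ->
      `|phi y - phi x0 - \sum_i d i * (y - x0) ord0 i| <= C * edot (y - x0) (y - x0)].
Proof.
move=> delta0 C2.
have FF : Filter (nbhs (x0 : 'rV[R]_N)) by exact: nbhs_filter.
have x0in : eball x0 delta x0 by rewrite /eball/= subrr enorm_lt// edot0l exprn_gt0.
pose D2 i j := 'D_(basis_vec j) ('D_(basis_vec i) phi).
have nball : \forall y \near x0, eball x0 delta y.
  have c := @continuous_edot_sub R N x0 x0.
  have dd : 0 < delta ^+ 2 by rewrite exprn_gt0.
  have := @cvgr_dist_lt R R 'rV[R]_N (nbhs x0) FF _ _ c _ dd; apply: filterS => y.
  rewrite subrr edot0l sub0r normrN ger0_norm ?edot_ge0// => h.
  by rewrite /eball/= enorm_lt.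
have nD2 : \forall y \near x0, forall ij : 'I_N * 'I_N, `|D2 ij.1 ij.2 x0 - D2 ij.1 ij.2 y| < 1.
  apply: (@filter_forall _ _ (fun (ij : 'I_N * 'I_N) (y : 'rV[R]_N) => `|D2 ij.1 ij.2 x0 - D2 ij.1 ij.2 y| < 1) (nbhs x0) FF) => -[i j] /=.
  have [_ /(_ i)[_ _ /(_ j)[_ c]]] := C2 x0 x0in.
  exact: (@cvgr_dist_lt R R 'rV[R]_N (nbhs x0) FF _ _ c _ ltr01).
have [r0 /= r00 Hr0] := (nbhs_ballP x0 _).1 (filterI nball nD2).
pose r := Num.min delta r0.
have r_0 : 0 < r by rewrite lt_min delta0.
pose M := \sum_(ij : 'I_N * 'I_N) (`|D2 ij.1 ij.2 x0| + 1).
have M0 : 0 <= M by apply: sumr_ge0 => ij _; rewrite addr_ge0.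
have yb y : `|y - x0| < r -> ball x0 r0 y.
  move=> yr; rewrite -ball_normE/= distrC; apply: lt_le_trans yr _.
  by rewrite ge_min lexx orbT.
have normle1 (a b : R) : `|a - b| < 1 -> `|b| <= `|a| + 1.
  move=> h; rewrite -[b](subKr a); apply: (le_trans (ler_normB _ _)).
  by rewrite lerD2l ltW.
have D2M i j y : `|y - x0| < r -> `|D2 i j y| <= M.
  move=> yr; have [_ /(_ (i, j))/= h] := Hr0 y (yb y yr).
  rewrite /M (bigD1 (i, j))//=.
  apply: (@le_trans _ _ (`|D2 i j x0| + 1)); last first.
    by rewrite lerDl sumr_ge0// => ij _; rewrite addr_ge0.
  exact: normle1.
have inball y : `|y - x0| < r -> eball x0 delta y.
  by move=> yr; have [] := Hr0 y (yb y yr).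
pose d i := 'D_(basis_vec i) phi x0.
exists d, (N%:R * (N%:R * M)), r; split => //.
- by rewrite !mulr_ge0.
- by rewrite ge_min lexx.
move=> y yr; set rho := `|y - x0|.
have rho0 : 0 <= rho by exact: normr_ge0.
have rhoe : rho ^+ 2 <= edot (y - x0) (y - x0).
  have e0 := edot_ge0 (y - x0).
  rewrite -[leRHS]sqr_sqrtr// ler_pXn2r// ?nnegrE ?sqrtr_ge0//.
  apply/(row_norm_le _ (sqrtr_ge0 _)) => i.
  by rewrite -sqrtr_sqr ler_sqrt//; exact: coord_sqr_le.
have rhor : rho < r.
  rewrite -(@ltr_pXn2r _ 2)// ?nnegrE ?(ltW r_0)//; apply: (le_lt_trans rhoe).
  by rewrite -enorm_lt.
pose f z := phi z - \sum_j d j * (z - x0) ord0 j.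
have first i z : `|z - x0| <= rho -> derivable f z (basis_vec i) /\ `|'D_(basis_vec i) f z| <= N%:R * (M * rho).
  move=> zr; have zr' := le_lt_trans zr rhor.
  have [_ /(_ i)[dphi _ _]] := C2 z (inball z zr').
  have [df ->] := derive_sub_lin d x0 dphi; split => //.
  apply: (@partial_bound ('D_(basis_vec i) phi) x0 rho M) => // w j wr.
  have wr' := le_lt_trans wr rhor.
  have [_ /(_ i)[_ _ /(_ j)[dd _]]] := C2 w (inball w wr').
  by split => //; exact: D2M.
have := @partial_bound f x0 rho (N%:R * (M * rho)) rho0 (fun z i h => first i z h) y (lexx _).
have -> : f y - f x0 = phi y - phi x0 - \sum_i d i * (y - x0) ord0 i.
  rewrite /f (_ : \sum_j d j * (x0 - x0) ord0 j = 0); first by ring.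
  by apply: big1 => j _; rewrite subrr mxE mulr0.
move=> h; apply: (le_trans h).
rewrite (_ : N%:R * (N%:R * (M * rho) * rho) = N%:R * (N%:R * M) * rho ^+ 2); last by ring.
by rewrite ler_wpM2l// !mulr_ge0.
Qed.

End taylor.

(** * Principal values of continuous functions *)

Section borel.
Context {R : realType} (N : nat).
Local Notation RN := (N.-tuple (measurableTypeR R)).

Let box (p : N.-tuple rat * nat) : set 'rV[R]_N :=
  [set x | forall i, `|x ord0 i - ratr (tnth p.1 i)| < (p.2.+1%:R)^-1].

Let measurable_box p : measurable (@vec R N @^-1` box p).
Proof.
rewrite (_ : _ @^-1` _ = \bigcap_(i in [set: 'I_N])
    ((fun t : RN => `|(tnth t i : R) - ratr (tnth p.1 i)|) @^-1` `]-oo, (p.2.+1%:R)^-1[)).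
  apply: fin_bigcap_measurable => // i _; rewrite -[X in measurable X]setTI.
  have mf : measurable_fun setT (fun t : RN => `|(tnth t i : R) - ratr (tnth p.1 i)|).
    apply: (measurable_tnth_comp i (f := fun x : R => `|x - ratr (tnth p.1 i)|)).
    by apply: measurableT_comp => //; exact: measurable_funB.
  exact: mf.
apply/seteqP; split => t H.
  by move=> i _; have := H i; rewrite /= in_itv/= !mxE.
by move=> i; have := H i I; rewrite /= in_itv/= !mxE.
Qed.

(** Rational boxes form a countable basis of the topology. *)
Lemma measurable_vec_open (U : set 'rV[R]_N) : open U -> measurable (@vec R N @^-1` U).
Proof.
move=> oU.
pose F (m : nat) : set RN := if unpickle m is Some p then
  (if `[< box p `<=` U >] then @vec R N @^-1` box p else set0) else set0.
rewrite (_ : _ @^-1` U = \bigcup_m F m); last first.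
  apply/seteqP; split => t; last first.
    by move=> [m _]; rewrite /F; case: unpickle => // p; case: asboolP => // pU /pU.
  move=> Ut; have [r /= r0 Hr] := (nbhs_ballP _ _).1 (open_nbhs_nbhs (conj oU Ut)).
  pose n := Num.truncn (2 / r); have n0 : 2 / r < n.+1%:R by exact: truncnS_gt.
  have nr : (n.+1%:R)^-1 < r / 2 by rewrite -[r / 2]invrK ltf_pV2 ?posrE ?invr_gt0 ?divr_gt0// invfM invrK mulrC.
  have dist_lt (a b c : R) : a - c < b -> b < a + c -> `|a - b| < c.
    by move=> *; rewrite ltr_norml; apply/andP; split; lra.
  have dist_lt2 (a b c d e : R) : c < e / 2 -> `|b - d| < c -> `|a - d| < c -> `|a - b| < e.
    move=> ?; rewrite !ltr_norml => /andP[? ?] /andP[? ?]; apply/andP; split; lra.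
  have inv0 : 0 < (n.+1%:R)^-1 :> R by rewrite invr_gt0.
  have ex i : exists q : rat, `|(tnth t i : R) - ratr q| < (n.+1%:R)^-1.
    have [|q] := @rat_in_itvoo R (tnth t i - (n.+1%:R)^-1) (tnth t i + (n.+1%:R)^-1).
      by rewrite ltrD2l gtrN.
    rewrite in_itv/= => /andP[h1 h2].
    by exists q; exact: dist_lt h1 h2.
  pose q := [tuple xchoose (ex i) | i < N].
  exists (pickle (q, n)) => //; rewrite /F pickleK asboolT; last first.
    move=> x xb; apply: Hr; rewrite -ball_normE/=.
    rewrite [ltLHS]mx_normrE; apply: bigmax_lt => // -[i j] _; rewrite [i]ord1/= {i}.
    have h1 := xb j; have h2 := xchooseP (ex j).
    rewrite tnth_mktuple in h1; rewrite !mxE.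
    exact: dist_lt2 nr h1 h2.
  by move=> i; rewrite mxE tnth_mktuple; exact: xchooseP (ex i).
apply: bigcup_measurable => m _; rewrite /F; case: unpickle => // p.
by case: asboolP.
Qed.

Lemma open_eball (x0 : 'rV[R]_N) (delta : R) : 0 < delta -> open (eball x0 delta).
Proof.
move=> d0.
rewrite (_ : eball x0 delta = (fun x : 'rV[R]_N => edot (x - x0) (x - x0)) @^-1` [set y | y < delta ^+ 2]).
  apply: open_comp; first by move=> x _; exact: continuous_edot_sub.
  exact: open_lt.
by apply/seteqP; split => x; rewrite /eball/= enorm_lt.
Qed.

Lemma measurable_continuous_frame k (xi : 'I_k -> 'rV[R]_N) x0 (delta : R)
    (phi : 'rV[R]_N -> R) : orthonormal_frame xi -> 0 < delta ->
  (forall x, eball x0 delta x -> {for x, continuous phi}) ->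
  measurable_fun [set z : k.-tuple (measurableTypeR R) | sqnorm z < delta ^+ 2]
    (fun z => phi (frame_point xi x0 z)).
Proof.
move=> xio d0 cphi mD.
pose Va a := eball x0 delta `&` [set x | a < phi x].
have oVa a : open (Va a).
  rewrite openE => x [xb ax]; rewrite /interior.
  apply: filterI; first by apply: open_nbhs_nbhs; split => //; exact: open_eball.
  have c := cphi x xb.
  by apply: (c [set y | a < y]); apply: open_nbhs_nbhs; split => //; exact: open_gt.
have inE z : eball x0 delta (frame_point xi x0 z) <-> sqnorm z < delta ^+ 2.
  rewrite /eball/= enorm_lt// /frame_point addrAC subrr add0r.
  by rewrite (edot_frame_vec xio).
set D := [set z | _] in mD *.
have mS a : measurable (D `&` [set z | a < phi (frame_point xi x0 z)]).
  have mi : measurable_fun setT (fun z : k.-tuple (measurableTypeR R) => \1_(Va a) (frame_point xi x0 z) : R).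
    apply: measurable_frame_point.
    rewrite (_ : _ \o _ = \1_(@vec R N @^-1` Va a)); last by apply/funext => t; rewrite /= !indicE.
    by apply: measurable_indic; exact: measurable_vec_open.
  rewrite (_ : _ `&` _ = (fun z : k.-tuple (measurableTypeR R) => \1_(Va a) (frame_point xi x0 z) : R) @^-1` [set 1]).
    by rewrite -[X in measurable X]setTI; exact: mi.
  apply/seteqP; split => z /=; rewrite indicE.
    by move=> [Dz az]; rewrite mem_set//; split => //; apply/inE.
  case: (boolP (_ \in _)) => [/set_mem[/inE Dz az] _|_ /eqP]; first by split.
  by rewrite eq_sym oner_eq0.
apply: (measurability _ (RGenOInfty.measurableE R)) => //.
by move=> _ [_ [a ->] <-]; rewrite (_ : _ `&` _ = D `&` [set z | a < phi (frame_point xi x0 z)])//;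
  apply/seteqP; split => z /=; rewrite in_itv/= andbT.
Qed.

End borel.

Section pv_splitting.
Context {R : realType}.
Local Open Scope ereal_scope.

(** The integral over [B] may be infinite, as happens for a test function that is
    unbounded near the boundary of its ball. *)
Lemma integral_setU_quasi d (T : measurableType d) (m : {measure set T -> \bar R})
    (A B : set T) (f : T -> \bar R) : measurable A -> measurable B ->
  measurable_fun (A `|` B) f -> [disjoint A & B] -> m.-integrable A f ->
  \int[m]_(x in A `|` B) f x = \int[m]_(x in A) f x + \int[m]_(x in B) f x.
Proof.
move=> mA mB mf AB iA.
rewrite integralE [X in _ = X + _]integralE [X in _ = _ + X]integralE.
rewrite !ge0_integral_setU//; try exact: measurable_funepos; try exact: measurable_funeneg.
have p1 : \int[m]_(x in A) f^\+ x \is a fin_num.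
  by apply: integrable_fin_num => //; exact: integrable_funepos.
have p2 : \int[m]_(x in A) f^\- x \is a fin_num.
  by apply: integrable_fin_num => //; exact: integrable_funeneg.
have : 0 <= \int[m]_(x in B) f^\- x by exact: integral_ge0.
have : 0 <= \int[m]_(x in B) f^\+ x by exact: integral_ge0.
move: p1 p2.
move: (\int[m]_(x in A) f^\+ x) (\int[m]_(x in A) f^\- x) (\int[m]_(x in B) f^\+ x) (\int[m]_(x in B) f^\- x).
move=> [a| |]// [b| |]// [c| |]// [e| |]// _ _ _ _.
by rewrite -!EFinD; congr EFin; ring.
Qed.

Context (N k : nat) (s : R).
Hypotheses (k0 : (0 < k)%N) (s0 : (0 < s)%R) (s1 : (s < 1)%R).
Local Notation Rk := (k.-tuple (measurableTypeR R)).
Local Notation Lk := (@lebesgue_tuple R k).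
Local Notation K := (@frac_kernel R k s).

(** Close to the center the principal value is that of a function with a first
    order expansion; over the rest of the ball the integral is an ordinary one,
    possibly infinite. *)
Lemma pv_near_split : exists2 M : R, (0 <= M)%R &
  forall (xi : 'I_k -> 'rV[R]_N) (phi : 'rV[R]_N -> R) x0 (delta d C : R) (c : 'I_k -> R),
  (0 < d)%R -> (d <= delta)%R -> (0 <= C)%R ->
  measurable_fun [set z : Rk | (sqnorm z < delta ^+ 2)%R] (fun z => phi (frame_point xi x0 z)) ->
  (forall z, (sqnorm z < d ^+ 2)%R ->
    (`|phi (frame_point xi x0 z) - phi x0 - linform c z| <= C * sqnorm z)%R) ->
  exists2 L : R, (`|L| <= C * (M * (d ^+ 2) `^ (1 - s)))%R &
    pv_near s xi phi x0 delta = L%:E + \int[Lk]_(z in [set z | (d ^+ 2 <= sqnorm z < delta ^+ 2)%R])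
      ((phi (frame_point xi x0 z) - phi x0) * K z)%:E.
Proof.
have [M M0 HM] := @pv_cvg R k s s0 s1; exists M => //.
move=> xi phi x0 delta d C c d0 dd C0 mphi Hphi.
pose f z := (phi (frame_point xi x0 z) - phi x0)%R.
have delta0 : (0 < delta)%R by exact: lt_le_trans dd.
have d2 : (d ^+ 2 <= delta ^+ 2)%R by rewrite ler_pXn2r ?nnegrE ?(ltW d0) ?(ltW delta0).
have mf : measurable_fun [set z : Rk | (sqnorm z < delta ^+ 2)%R] f by exact: measurable_funB.
have mlt r : measurable [set z : Rk | (sqnorm z < r)%R].
  rewrite (_ : [set z : Rk | _] = [set z | `]-oo, r[%classic (sqnorm z)]).
    exact: measurable_sqnorm_pre.
  by apply/seteqP; split => z /=; rewrite in_itv.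
have mfS A : A `<=` [set z : Rk | (sqnorm z < delta ^+ 2)%R] -> measurable A -> measurable_fun A f.
  by move=> AS mA; apply: measurable_funS mf.
have mK (A : set Rk) : measurable_fun A K.
  by apply: measurable_funTS; exact: measurable_frac_kernel.
have Sd : [set z : Rk | (sqnorm z < d ^+ 2)%R] `<=` [set z : Rk | (sqnorm z < delta ^+ 2)%R].
  by move=> z /= h; exact: lt_le_trans h d2.
have [L Lle Lcvg] := HM f c C d d0 C0 (mfS _ Sd (mlt _)) Hphi.
exists L => //; set B := [set z : Rk | (d ^+ 2 <= sqnorm z < delta ^+ 2)%R].
set I2 := \int[Lk]_(z in B) _.
have mB : measurable B.
  rewrite (_ : B = [set z | `[(d ^+ 2)%R, (delta ^+ 2)%R[%classic (sqnorm z)]).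
    exact: measurable_sqnorm_pre.
  by apply/seteqP; split => z /=; rewrite in_itv.
have split e : (0 < e)%R -> (e < d)%R ->
    increment_integral s xi phi x0 [set z | (e < enorm (vec z) < delta)%R] =
    \int[Lk]_(z in [set z : Rk | (e < enorm (vec z) < d)%R]) (f z * K z)%:E + I2.
  move=> e0 ed; rewrite /increment_integral !annulusE//; set A := [set z : Rk | `](e ^+ 2)%R, (d ^+ 2)%R[%classic (sqnorm z)].
  have mA : measurable A by exact: measurable_sqnorm_pre.
  have AB : [set z : Rk | `](e ^+ 2)%R, (delta ^+ 2)%R[%classic (sqnorm z)] = A `|` B.
    apply/seteqP; split => z; rewrite /A /B /= !in_itv/=.
      by move=> /andP[h1 h2]; have [h|h] := ltP (sqnorm z) (d ^+ 2)%R; [left; rewrite h1|right].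
    case=> [/andP[h1 h2]|/andP[h1 h2]]; rewrite ?h1 ?h2 ?andbT/=.
      exact: lt_le_trans d2.
    by apply: lt_le_trans h1; rewrite ltr_pXn2r ?nnegrE// ltW.
  have ABS : A `|` B `<=` [set z : Rk | (sqnorm z < delta ^+ 2)%R].
    by move=> z; rewrite /A /B /= in_itv/= => -[/andP[_ h]|/andP[]//]; exact: lt_le_trans d2.
  rewrite AB integral_setU_quasi//.
  - apply/measurable_EFinP; apply: measurable_funM => //.
    by apply: mfS => //; exact: measurableU.
  - rewrite disj_set2E; apply/eqP/seteqP; split => z //; rewrite /A /B /= in_itv/= => -[/andP[_ h] /andP[h' _]].
    by move: h; rewrite ltNge h'.
  - have [D D0 HD] := linform_le c.
    have Ale z : A z -> (e ^+ 2 <= sqnorm z)%R by rewrite /A/= in_itv/= => /andP[/ltW].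
    apply: (@integrable_bounded_mul R k A f K (D * (1 + d ^+ 2) + C * d ^+ 2)%R) => //.
    + by apply: mfS => // z Az; apply: ABS; left.
    + move=> z; rewrite /A/= in_itv/= => /andP[_ zd].
      rewrite -(subrK (linform c z) (f z)) addrC; apply: (le_trans (ler_normD _ _)).
      apply: lerD; first by apply: (le_trans (HD z)); rewrite ler_wpM2l// lerD2l ltW.
      by apply: (le_trans (Hphi z zd)); rewrite ler_wpM2l// ltW.
    + by apply: (@integrable_kernel_tail _ _ _ s0 s1 (e ^+ 2)%R) => //; rewrite exprn_gt0.
have cvg : increment_integral s xi phi x0 [set z | (e < enorm (vec z) < delta)%R] @[e --> (0%R : R)^'+] --> L%:E + I2.
  have : (\int[Lk]_(z in [set z : Rk | (e < enorm (vec z) < d)%R]) (f z * K z)%:E + I2) @[e --> (0%R : R)^'+] --> L%:E + I2.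
    by apply: cvgeD; [exact: fin_num_adde_defr|exact: Lcvg|exact: cvg_cst].
  apply: cvg_trans; apply: near_eq_cvg; near=> e.
  have e0 : (0 < e)%R by near: e; exact: nbhs_right_gt.
  have ed : (e < d)%R by near: e; exact: nbhs_right_lt.
  by rewrite split.
exact: cvg_lim cvg.
Unshelve. all: by end_near. Qed.

End pv_splitting.

(** * Powers of 1 + |x|^2 as supersolutions *)

Section bubble_supersolution.
Context {R : realType} (N k : nat) (s g c0 : R).
Hypotheses (k1 : (1 < k)%N) (s0 : (0 < s)%R) (s1 : (s < 1)%R) (g0 : 0 < g) (c00 : 0 < c0).
Local Notation Rk := (k.-tuple (measurableTypeR R)).
Local Notation Lk := (@lebesgue_tuple R k).
Local Notation K := (@frac_kernel R k s).
Local Notation ck := (@ckernel R k s).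
Local Notation h := ((k%:R - g) / 2 - s).
Hypotheses (h0 : 0 < h) (h1 : h <= 1).

Definition bubble (x : 'rV[R]_N) : R := c0 * (1 + edot x x) `^ (- (g / 2)).

Lemma bubble_ge0 x : 0 <= bubble x.
Proof. by rewrite mulr_ge0 ?powR_ge0// ltW. Qed.

Lemma edot1_gt0 (x : 'rV[R]_N) : 0 < 1 + edot x x.
Proof. by rewrite ltr_pwDl// edot_ge0. Qed.

Lemma bubble_le x : bubble x <= c0.
Proof.
rewrite /bubble ler_piMr ?(ltW c00)// -[leRHS](powRr0 (1 + edot x x)); apply: ler_powR.
  by rewrite lerDl edot_ge0.
by rewrite oppr_le0 divr_ge0// ltW.
Qed.

Lemma measurable_bubble : measurable_fun setT (bubble \o @vec R N).
Proof.
apply: measurable_funM => //.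
apply: (measurableT_comp (measurable_powR _)); apply: measurable_funD => //.
rewrite (_ : (fun _ => _) = @sqnorm R N); first exact: measurable_sqnorm.
by apply/funext => t; rewrite /edot; apply: eq_bigr => i _; rewrite !mxE -expr2.
Qed.

(** Powers with negative exponent are convex. *)
Lemma powRN_tangent (m x y : R) : 0 <= m -> 0 < x -> 0 < y ->
  x `^ (- m) - m * x `^ (- m) / x * (y - x) <= y `^ (- m).
Proof.
move=> m0 x0 y0; pose r := y / x; have r0 : 0 < r by rewrite divr_gt0.
have yE : y = x * r by rewrite /r mulrC divfK// gt_eqF.
have -> : x `^ (- m) - m * x `^ (- m) / x * (y - x) = x `^ (- m) * (1 + - m * (r - 1)).
  by rewrite /r; field; rewrite gt_eqF.
rewrite yE powRM ?(ltW x0) ?(ltW r0)// ler_wpM2l ?powR_ge0//.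
rewrite /powR gt_eqF//; apply: le_trans (expR_ge1Dx _); rewrite lerD2l !mulNr lerN2 ler_wpM2l//.
have := expR_ge1Dx (ln r); rewrite lnK ?posrE//; lra.
Qed.

Lemma bubble_convex x0 : exists2 b : R, 0 <= b & forall x : 'rV[R]_N,
  - b * (edot x x - edot x0 x0) <= bubble x - bubble x0.
Proof.
have x00 := edot1_gt0 x0; have m0 : 0 <= g / 2 by rewrite divr_ge0// ltW.
exists (c0 * (g / 2 * (1 + edot x0 x0) `^ (- (g / 2)) / (1 + edot x0 x0))).
  by rewrite mulr_ge0 ?(ltW c00)// divr_ge0 ?(ltW x00)// mulr_ge0 ?powR_ge0.
move=> x; have := powRN_tangent m0 x00 (edot1_gt0 x).
have -> : 1 + edot x x - (1 + edot x0 x0) = edot x x - edot x0 x0 by ring.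
rewrite /bubble; move: (_ / (1 + edot x0 x0)) => D; move: (edot x x - _) => e H.
by have := ler_wpM2l (ltW c00) H; lra.
Qed.

Definition bubble_gain : R := h / s * (levy_mass (g / 2 + s) / levy_mass (g / 2)).

Lemma bubble_gain_gt0 : 0 < bubble_gain.
Proof.
rewrite /bubble_gain mulr_gt0 ?divr_gt0// levy_mass_gt0// ?divr_gt0//.
by rewrite addr_gt0// divr_gt0.
Qed.

Local Open Scope ereal_scope.

(** In the plane through [x0] the quantity [1 + |x|^2] is the sum of a constant,
    at least 1 by the inequality of Bessel, and of a squared distance. *)
Lemma bubble_farK (xi : 'I_k -> 'rV[R]_N) x0 : orthonormal_frame xi ->
  exists2 C : R, (0 <= C)%R & forall e : R, (0 < e)%R ->
  \int[Lk]_z ((bubble (frame_point xi x0 z) - bubble x0) * farK s e z)%:E <=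
  (- (bubble_gain * c0 * (1 + edot x0 x0) `^ (- (g / 2 + s))) + C * e)%:E.
Proof.
move=> xio; pose a i := edot x0 (xi i); pose A := (1 + edot x0 x0 - \sum_i a i ^+ 2)%R.
have A0 : (0 < A)%R by have := bessel xio x0; rewrite /A -/(a _); lra.
have [C C0 HC] := @bubble_far R k s g s0 g0 a A h0 h1 A0.
exists (c0 * C)%R; first by rewrite mulr_ge0// ltW.
move=> e e0.
have AS : (A + \sum_i a i ^+ 2 = 1 + edot x0 x0)%R by rewrite /A; ring.
have bE z : bubble (frame_point xi x0 z) = (c0 * (A + \sum_i (a i + tnth z i) ^+ 2) `^ (- (g / 2)))%R.
  rewrite /bubble -[frame_point xi x0 z]subr0 (edot_frame_point_sq xio).
  by rewrite subr0 /A; congr (_ * _ `^ _)%R; rewrite /a; ring.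
have mb : measurable_fun setT (fun z : Rk => bubble (frame_point xi x0 z)).
  by apply: measurable_frame_point; exact: measurable_bubble.
have ib : Lk.-integrable setT (fun z => (bubble (frame_point xi x0 z) * farK s e z)%:E).
  apply: (@integrable_bounded_mul _ _ _ _ _ c0) => //; last exact: integrable_farK.
  by move=> z _; rewrite ger0_norm ?bubble_ge0 ?bubble_le.
have -> : \int[Lk]_z ((bubble (frame_point xi x0 z) - bubble x0) * farK s e z)%:E =
    \int[Lk]_z (bubble (frame_point xi x0 z) * farK s e z)%:E - (bubble x0)%:E * (e `^ (- s) / s)%:E.
  rewrite -(integral_farK k s0 e0) -integralZl//; last exact: integrable_farK.
  rewrite -integralB//; last by apply: integrableZl => //; exact: integrable_farK.
  by apply: eq_integral => z _; rewrite -EFinM -EFinB; congr EFin; ring.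
have -> : \int[Lk]_z (bubble (frame_point xi x0 z) * farK s e z)%:E =
    c0%:E * \int[Lk]_z (((A + \sum_i (a i + tnth z i) ^+ 2) `^ (- (g / 2)))%:E * kpart s `]e, +oo[ z).
  rewrite -ge0_integralZl_EFin ?(ltW c00)//.
  - by apply: eq_integral => z _; rewrite bE -farKE// -!EFinM mulrA.
  - by move=> z _; rewrite mule_ge0 ?kpart_ge0// lee_fin powR_ge0.
  - apply: emeasurable_funM; last exact: measurable_kpart.
    apply/measurable_EFinP; apply: (measurableT_comp (measurable_powR _)).
    apply: measurable_funD => //; apply: measurable_sum => i.
    by apply: (@measurable_tnth_comp R k (fun x => (a i + x) ^+ 2)%R); apply: measurable_funX; exact: measurable_funD.
rewrite leeBlDr//; apply: (le_trans (lee_wpmul2l _ (HC e e0))); first by rewrite lee_fin ltW.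
by rewrite AS -!EFinM -EFinD lee_fin /bubble /bubble_gain le_eqVlt; apply/orP; left; apply/eqP; ring.
Qed.

(** The contribution of the far part of the kernel carries the sign. The other
    contributions vanish with [d]: over the ball that is left out, the far part is
    handled by convexity and oddness, and outside it the near part has little mass. *)
Lemma bubble_away (xi : 'I_k -> 'rV[R]_N) x0 : orthonormal_frame xi ->
  exists2 C : R, (0 <= C)%R & forall d : R, (0 < d)%R -> (d <= 1)%R ->
  \int[Lk]_(z in [set z | (d <= sqnorm z)%R]) ((bubble (frame_point xi x0 z) - bubble x0) * K z)%:E <=
  (- (ck * (bubble_gain * c0 * (1 + edot x0 x0) `^ (- (g / 2 + s)))) + C * d `^ (1 - s))%:E.
Proof.
move=> xio.
have [C1 C10 HC1] := bubble_farK x0 xio.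
have [C2 C20 HC2] := @near_tail R k s s1.
have [C3 C30 HC3] := @ball_moment R k s s0 s1.
have [b b0 Hb] := bubble_convex x0.
have ck0 := @ckernel_gt0 R k s s0.
have s10 : (0 < 1 - s)%R by rewrite subr_gt0.
pose F z := (bubble (frame_point xi x0 z) - bubble x0)%R.
have mF : measurable_fun setT F.
  by apply: measurable_funB => //; apply: measurable_frame_point; exact: measurable_bubble.
have FB z : (`|F z| <= c0)%R.
  have := bubble_ge0 (frame_point xi x0 z); have := bubble_le (frame_point xi x0 z).
  by have := bubble_ge0 x0; have := bubble_le x0; rewrite /F ler_norml; lra.
have FB1 z : (F z <= c0)%R by apply: le_trans (FB z); exact: ler_norm.
exists (ck * (C1 + c0 * C2 + b * (C3 / ck)))%R.
  by rewrite mulr_ge0 ?(ltW ck0)// !addr_ge0// mulr_ge0 ?(ltW c00)// divr_ge0// ltW.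
move=> d d0 d1; set E := [set z : Rk | (d <= sqnorm z)%R].
have mE : measurable E by exact: measurable_sqnorm_ge.
(* outside the ball the times below [e] have mass of order [e `^ (1 - s) / d],
   which this choice makes equal to [d] *)
pose e := (d `^ (2 / (1 - s)))%R.
have e0 : (0 < e)%R by exact: powR_gt0.
have es : (e `^ (1 - s) = d ^+ 2)%R.
  by rewrite /e -powRrM divfK ?gt_eqF// powR_mulrn// ltW.
have d2 : (d ^+ 2 <= d)%R by rewrite expr2 ler_piMr// ltW.
have ds : (d <= d `^ (1 - s))%R.
  by apply: ger1_powR; [rewrite d0|rewrite gerBl ltW].
have ed : (e <= d)%R.
  by apply: ge1r_powR; [rewrite d0|rewrite ler_pdivlMr// mul1r; move: s0; lra].
have iK : Lk.-integrable E (EFin \o K) by exact: (@integrable_kernel_tail _ _ _ s0 s1 d).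
have inE' : Lk.-integrable E (EFin \o nearK s e) by exact: (@integrable_nearK _ _ _ s0 s1 e d).
have ifar D : measurable D -> Lk.-integrable D (EFin \o farK s e) by move=> mD; exact: integrable_farK.
have iFn : Lk.-integrable E (fun z => (F z * nearK s e z)%:E).
  by apply: (@integrable_bounded_mul _ _ _ _ _ c0) => //; exact: measurable_funTS.
have iFf D : measurable D -> Lk.-integrable D (fun z => (F z * farK s e z)%:E).
  by move=> mD; apply: (@integrable_bounded_mul _ _ _ _ _ c0) => //; [exact: measurable_funTS|exact: ifar].
have split : \int[Lk]_(z in E) (F z * K z)%:E =
    ck%:E * \int[Lk]_(z in E) (F z * nearK s e z)%:E + ck%:E * \int[Lk]_(z in E) (F z * farK s e z)%:E.
  have iFfE := iFf E mE.
  rewrite -!integralZl// -integralD//; try exact: integrableZl.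
  by apply: eq_integral => z _; rewrite -!EFinM -EFinD (frac_kernel_split s0 e); congr EFin; ring.
have near : \int[Lk]_(z in E) (F z * nearK s e z)%:E <= (c0 * (C2 * d))%:E.
  apply: (@le_trans _ _ (c0%:E * \int[Lk]_(z in E) (nearK s e z)%:E)).
    rewrite -integralZl//; apply: le_integral => //; first exact: integrableZl.
    move=> z /set_mem zE; rewrite -EFinM lee_fin ler_wpM2r//.
    by apply: nearK_ge0 => //; exact: lt_le_trans zE.
  rewrite EFinM lee_wpmul2l ?lee_fin ?(ltW c00)//.
  have -> : \int[Lk]_(z in E) (nearK s e z)%:E = \int[Lk]_(z in E) kpart s `]0%R, e] z.
    by apply: eq_integral => z /set_mem zE; rewrite nearKE//; exact: lt_le_trans zE.
  apply: (le_trans (HC2 e d e0 d0)); rewrite lee_fin es le_eqVlt; apply/orP; left; apply/eqP.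
  by field; rewrite gt_eqF.
pose Bl := ~` E; have mBl : measurable Bl by exact: measurableC.
have Bld z : Bl z -> (sqnorm z < d)%R by move=> /negP; rewrite -ltNge.
have sBl z : Bl z -> Bl (tuple_opp z) by rewrite /Bl /E/= sqnorm_opp.
have isK : Lk.-integrable Bl (fun z => (sqnorm z * K z)%:E).
  by apply: (integrable_kernel_moment s0 s1 d0) => // z /Bld /ltW.
have farle z : (sqnorm z * farK s e z <= ck^-1 * (sqnorm z * K z))%R.
  have [z0|z0] := eqVneq (sqnorm z) 0%R; first by rewrite z0 !mul0r mulr0.
  have zp : (0 < sqnorm z)%R by rewrite lt_neqAle eq_sym z0 sqnorm_ge0.
  have := nearK_ge0 s0 e0 zp; rewrite /nearK subr_ge0 => H.
  by rewrite mulrCA ler_wpM2l ?sqnorm_ge0// mulrC.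
have isf : Lk.-integrable Bl (fun z => (sqnorm z * farK s e z)%:E).
  apply: (@le_integrable _ _ _ _ _ mBl _ (fun z => (ck^-1)%:E * (sqnorm z * K z)%:E)).
  - apply/measurable_EFinP; apply: measurable_funM; last exact: measurable_farK.
    by apply: measurable_funTS; exact: measurable_sqnorm.
  - move=> z _; rewrite -EFinM /= lee_fin ger0_norm ?mulr_ge0 ?sqnorm_ge0 ?farK_ge0//.
    by apply: (le_trans (farle z)); exact: ler_norm.
  - exact: integrableZl.
have ball : - (b * (C3 / ck * d `^ (1 - s)))%:E <= \int[Lk]_(z in Bl) (F z * farK s e z)%:E.
  pose c i := (2 * edot x0 (xi i))%R.
  have lin z : Bl z -> (linform (fun i => - b * c i) z - b * sqnorm z <= F z)%R.
    move=> _; apply: le_trans (Hb _).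
    have := edot_frame_point xio x0 0 z; rewrite !subr0 => ->.
    have linZ : linform (fun i => - b * c i)%R z = (- b * linform c z)%R.
      by rewrite /linform mulr_sumr; apply: eq_bigr => i _; ring.
    have -> : (\sum_i 2 * edot x0 (xi i) * tnth z i = linform c z)%R by [].
    by rewrite linZ le_eqVlt; apply/orP; left; apply/eqP; ring.
  apply: le_trans (@integral_ge_quadratic R k (fun i => - b * c i)%R b Bl (farK s e) F mBl sBl (farK_opp s e)
    (fun z _ => farK_ge0 s e z) (ifar _ mBl) isf (measurable_funTS mF) lin).
  rewrite [(- b)%:E]EFinN mulNe leeN2 EFinM; apply: lee_wpmul2l; first by rewrite lee_fin.
  apply: (@le_trans _ _ (\int[Lk]_(z in Bl) ((ck^-1)%:E * (sqnorm z * K z)%:E))).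
    apply: le_integral => //; first exact: integrableZl.
    by move=> z _; rewrite -EFinM lee_fin; exact: farle.
  rewrite integralZl// (_ : (C3 / ck * d `^ (1 - s) = ck^-1 * (C3 * d `^ (1 - s)))%R); last by ring.
  rewrite EFinM lee_wpmul2l ?lee_fin ?invr_ge0 ?(ltW ck0)//.
  apply: le_trans (HC3 d d0); apply: ge0_subset_integral => //.
  - exact: measurable_sqnorm_le.
  - apply/measurable_EFinP; apply: measurable_funTS; apply: measurable_funM.
      exact: measurable_sqnorm.
    exact: measurable_frac_kernel.
  - by move=> z _; rewrite lee_fin mulr_ge0 ?sqnorm_ge0 ?frac_kernel_ge0.
  - by move=> z /Bld /ltW.
have tot : \int[Lk]_z (F z * farK s e z)%:E =
    \int[Lk]_(z in E) (F z * farK s e z)%:E + \int[Lk]_(z in Bl) (F z * farK s e z)%:E.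
  rewrite -(setUv E) integral_setU//.
  - by rewrite setUv; exact: measurable_int (iFf _ measurableT).
  - by rewrite disj_set2E setICr.
have fin (D : set Rk) (f : Rk -> \bar R) : measurable D -> Lk.-integrable D f ->
    exists r : R, \int[Lk]_(z in D) f z = r%:E.
  by move=> mD ig; exists (fine (\int[Lk]_(z in D) f z)); rewrite fineK//; exact: integrable_fin_num.
have [r1 E1] := fin _ _ measurableT (iFf _ measurableT).
have [r2 E2] := fin _ _ mE (iFf _ mE).
have [r3 E3] := fin _ _ mBl (iFf _ mBl).
have [r4 E4] := fin _ _ mE iFn.
have := HC1 e e0; rewrite -/F.
rewrite split E2 E4 -!EFinM -EFinD lee_fin.
rewrite (_ : \int[Lk]_z _ = r1%:E)// lee_fin => HC1e.
rewrite E3 -EFinN lee_fin in ball; rewrite E4 lee_fin in near.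
move: tot; rewrite E1 E2 E3 -EFinD => -[tot].
have ln : (c0 * (C2 * d) <= c0 * C2 * d `^ (1 - s))%R by rewrite mulrA ler_wpM2l ?mulr_ge0 ?(ltW c00).
have l1 : (C1 * e <= C1 * d `^ (1 - s))%R by rewrite ler_wpM2l// (le_trans ed).
have fin2 (c x y G t D : R) : (0 <= c)%R -> (x + y <= - G + D * t)%R ->
    (c * x + c * y <= - (c * G) + c * D * t)%R.
  by move=> c_0 H; have := ler_wpM2l c_0 H; lra.
apply: fin2 => //; first exact: ltW.
move: HC1e ball tot; move: (bubble_gain * _ * _)%R (C3 / ck)%R => G D.
by move: near ln l1; move: (d `^ (1 - s))%R (C1 * e)%R => t Ce *; lra.
Qed.

Lemma le_vanishing (X : \bar R) (L C r t : R) : (0 < t)%R -> (0 <= C)%R -> (0 < r)%R ->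
  (forall d : R, (0 < d)%R -> (d <= r)%R -> X <= (L + C * d `^ t)%:E) -> X <= L%:E.
Proof.
move=> t0 C0 r0 H; apply/lee_addgt0Pr => eps eps0.
have C1 : (0 < C + 1)%R by rewrite ltr_wpDl.
have e1 : (0 < eps / (C + 1))%R by rewrite divr_gt0.
pose d := (Num.min r ((eps / (C + 1)) `^ t^-1))%R.
have d0 : (0 < d)%R by rewrite lt_min r0 powR_gt0.
apply: (le_trans (H d d0 _)); first by rewrite ge_min lexx.
rewrite -EFinD lee_fin lerD2l.
have dt : (d `^ t <= eps / (C + 1))%R.
  have -> : (eps / (C + 1) = ((eps / (C + 1)) `^ t^-1) `^ t)%R.
    by rewrite -powRrM mulVf ?gt_eqF// powRr1// ltW.
  by apply: (ge0_ler_powR (ltW t0)); rewrite ?nnegrE ?powR_ge0 ?(ltW d0)// ge_min lexx orbT.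
apply: (@le_trans _ _ ((C + 1) * (eps / (C + 1)))%R); last by rewrite mulrCA divff ?mulr1// gt_eqF.
by apply: ler_pM => //; rewrite ?powR_ge0 ?lerDl.
Qed.

(** Away from [x0], within its ball, the increments of the test function are
    below those of the bubble, for which the sign is known; in a small ball the
    Taylor expansion bounds the principal value by a quantity that vanishes with
    the radius. *)
Lemma bubble_test (xi : 'I_k -> 'rV[R]_N) x0 (delta : R) (phi : 'rV[R]_N -> R) :
  orthonormal_frame xi -> (0 < delta)%R -> C2_on (eball x0 delta) phi ->
  (forall x, eball x0 delta x -> (bubble x0 - phi x0 <= bubble x - phi x)%R) ->
  pv_near s xi phi x0 delta + away s xi bubble x0 delta <=
  (- (ck * (bubble_gain * c0 * (1 + edot x0 x0) `^ (- (g / 2 + s)))))%:E.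
Proof.
move=> xio delta0 C2 touch.
have k0 := ltnW k1.
have [M M0 HM] := @pv_near_split R N k s s0 s1.
have [A A0 HA] := bubble_away x0 xio.
have [dd [C [r [C0 r0 rd Htay]]]] := C2_taylor delta0 C2.
have mphi := @measurable_continuous_frame R N k xi x0 delta phi xio delta0 (fun x xb => (C2 x xb).1).
pose c (j : 'I_k) := (\sum_i dd i * xi j ord0 i)%R.
have fE z : (frame_point xi x0 z - x0 = \sum_i tnth z i *: xi i)%R.
  by rewrite /frame_point addrAC subrr add0r.
have linE z : (\sum_i dd i * (frame_point xi x0 z - x0) ord0 i = linform c z)%R.
  rewrite fE /linform /c; under eq_bigr => i _ do rewrite summxE mulr_sumr.
  rewrite exchange_big/=; apply: eq_bigr => j _; rewrite mulr_suml; apply: eq_bigr => i _.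
  by rewrite mxE; ring.
have sqE z : (edot (frame_point xi x0 z - x0) (frame_point xi x0 z - x0) = sqnorm z)%R.
  by rewrite fE (edot_frame_vec xio).
pose r' := (Num.min r 1)%R; have r'0 : (0 < r')%R by rewrite lt_min r0 ltr01.
have s10 : (0 < 1 - s)%R by rewrite subr_gt0.
apply: (@le_vanishing _ _ (C * M + A) (r' ^+ 2) (1 - s)).
- exact: s10.
- by rewrite addr_ge0// mulr_ge0.
- by rewrite exprn_gt0.
move=> D D0 Dr; pose d := (Num.sqrt D)%R; have d0 : (0 < d)%R by rewrite sqrtr_gt0.
have dE : (d ^+ 2 = D)%R by rewrite sqr_sqrtr// ltW.
have dr' : (d <= r')%R by rewrite -(@ler_pXn2r _ 2)// ?nnegrE ?(ltW d0) ?(ltW r'0)// dE.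
have dr : (d <= r)%R by apply: le_trans dr' _; rewrite ge_min lexx.
have D1 : (D <= 1)%R.
  rewrite -dE -[leRHS](expr1n _ 2) ler_pXn2r ?nnegrE ?(ltW d0)//.
  by apply: le_trans dr' _; rewrite ge_min lexx orbT.
have ddelta : (d <= delta)%R by exact: le_trans rd.
have Hq z : (sqnorm z < d ^+ 2)%R ->
    (`|phi (frame_point xi x0 z) - phi x0 - linform c z| <= C * sqnorm z)%R.
  move=> zd; rewrite -linE -sqE; apply: Htay; rewrite enorm_lt// sqE.
  by apply: (lt_le_trans zd); rewrite ler_pXn2r ?nnegrE ?(ltW d0) ?(ltW r0).
have [L Lle ->] := HM xi phi x0 delta d C c d0 ddelta C0 mphi Hq.
set I2 := \int[Lk]_(z in _) _.
pose F z := (bubble (frame_point xi x0 z) - bubble x0)%R.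
have mF : measurable_fun setT F.
  by apply: measurable_funB => //; apply: measurable_frame_point; exact: measurable_bubble.
have FB z : (`|F z| <= c0)%R.
  have := bubble_ge0 (frame_point xi x0 z); have := bubble_le (frame_point xi x0 z).
  by have := bubble_ge0 x0; have := bubble_le x0; rewrite /F ler_norml; lra.
pose B := [set z : Rk | (d ^+ 2 <= sqnorm z < delta ^+ 2)%R].
have mB : measurable B.
  rewrite (_ : B = [set z | `[(d ^+ 2)%R, (delta ^+ 2)%R[%classic (sqnorm z)]).
    exact: measurable_sqnorm_pre.
  by apply/seteqP; split => z /=; rewrite in_itv.
pose O := [set z : Rk | (delta ^+ 2 <= sqnorm z)%R].
have mO : measurable O by exact: measurable_sqnorm_ge.
have dle : (d ^+ 2 <= delta ^+ 2)%R by rewrite ler_pXn2r ?nnegrE ?(ltW d0) ?(ltW delta0).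
have BO : [set z : Rk | (d ^+ 2 <= sqnorm z)%R] = B `|` O.
  apply/seteqP; split => z; rewrite /B /O /=.
    by move=> h'; have [zd|zd] := ltP (sqnorm z) (delta ^+ 2)%R; [left; rewrite h'|right].
  by case=> [/andP[]//|]; exact: le_trans.
have mK (D' : set Rk) : measurable_fun D' K.
  by apply: measurable_funTS; exact: measurable_frac_kernel.
have mS : measurable [set z : Rk | (sqnorm z < delta ^+ 2)%R].
  rewrite (_ : [set z : Rk | _] = [set z | `]-oo, (delta ^+ 2)%R[%classic (sqnorm z)]).
    exact: measurable_sqnorm_pre.
  by apply/seteqP; split => z /=; rewrite in_itv.
have I2le : I2 <= \int[Lk]_(z in B) (F z * K z)%:E.
  apply: le_integral_quasi => //.
  - apply/measurable_EFinP; apply: measurable_funM => //; apply: measurable_funB => //.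
    by apply: measurable_funS mphi; [exact: mS|move=> z /andP[]].
  - by apply/measurable_EFinP; apply: measurable_funM => //; exact: measurable_funTS.
  - move=> z /andP[_ zd]; rewrite lee_fin ler_wpM2r ?frac_kernel_ge0//.
    have := touch (frame_point xi x0 z); rewrite /eball/= enorm_lt// sqE => /(_ zd).
    by rewrite /F; lra.
have ee : (0 < d ^+ 2)%R by rewrite exprn_gt0.
have iF (D' : set Rk) : measurable D' -> (forall z, D' z -> (d ^+ 2 <= sqnorm z)%R) ->
    Lk.-integrable D' (fun z => (F z * K z)%:E).
  move=> mD' hD'; apply: (@integrable_bounded_mul _ _ _ _ _ c0) => //; first exact: measurable_funTS.
  exact: (@integrable_kernel_tail _ _ _ s0 s1 (d ^+ 2)%R).
have awE : away s xi bubble x0 delta = \int[Lk]_(z in O) (F z * K z)%:E.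
  by rewrite /away /increment_integral outsideE.
have iU : Lk.-integrable (B `|` O) (fun z => (F z * K z)%:E).
  by apply: iF; [exact: measurableU|rewrite -BO].
have := HA (d ^+ 2)%R ee; rewrite dE => /(_ D1); rewrite -dE BO integral_setU//; last 2 first.
- exact: measurable_int iU.
- rewrite disj_set2E; apply/eqP/seteqP; split => z //; rewrite /B /O /= => -[/andP[_ a1]].
  by rewrite leNgt a1.
move=> HAd.
apply: (@le_trans _ _ (L%:E + (\int[Lk]_(z in B) (F z * K z)%:E + \int[Lk]_(z in O) (F z * K z)%:E))).
  by rewrite awE -addeA; apply: leeD2l; apply: leeD2r.
apply: (le_trans (leeD2l _ HAd)); rewrite -EFinD lee_fin.
have := le_trans (ler_norm _) Lle; rewrite dE => HL.
by rewrite mulrDl; lra.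
Qed.

End bubble_supersolution.

(** * Hausdorff measure of bounded parts of planes *)

Section integrals_of_simple_functions.
Context d (T : measurableType d) (R : realType) (m : {measure set T -> \bar R}).
Import HBNNSimple.
Local Open Scope ereal_scope.

(** The integral of a nonnegative function is a supremum over the simple
    functions below it, so an upper bound may be proved without knowing that
    the function is measurable. *)
Lemma ge0_integral_le_simple (f : T -> \bar R) (c : \bar R) : (forall x, 0 <= f x) ->
  (forall h : {nnsfun T >-> R}, (forall x, (h x)%:E <= f x) -> \int[m]_x (h x)%:E <= c) ->
  \int[m]_x f x <= c.
Proof.
move=> f0 H; rewrite ge0_integralTE//; apply: ge_ereal_sup => _ [h /= hf] <-.
by rewrite -integralT_nnsfun; exact: H.
Qed.

Lemma ge0_le_integral_nonmeasurable (f g : T -> \bar R) :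
  (forall x, 0 <= f x) -> (forall x, f x <= g x) -> measurable_fun setT g ->
  \int[m]_x f x <= \int[m]_x g x.
Proof.
move=> f0 fg mg; apply: ge0_integral_le_simple => // h hf.
apply: ge0_le_integral => //.
- by move=> x _; rewrite lee_fin.
- by apply/measurable_EFinP.
- by move=> x _; exact: le_trans (fg x).
Qed.

Lemma dyadic_layer (x M : R) : (0 < x)%R -> (x <= M)%R ->
  exists2 n, (M * 2^-1 ^+ n.+1 < x)%R & (x <= M * 2^-1 ^+ n)%R.
Proof.
move=> x0 xM; have M0 : (0 < M)%R by exact: lt_le_trans xM.
have ex : exists n, (M * 2^-1 ^+ n.+1 < x)%R.
  pose n := Num.truncn (M / x); have h : (M / x < n.+1%:R)%R by exact: truncnS_gt.
  exists n; rewrite exprVn ltr_pdivrMr ?exprn_gt0// mulrC -ltr_pdivrMr//.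
  by apply: (lt_le_trans h); rewrite -natrX ler_nat ltnW// ltn_expl.
exists (ex_minn ex); case: ex_minnP => // -[|n] hn hmin; first by rewrite expr0 mulr1.
by rewrite leNgt; apply/negP => /hmin; rewrite ltnn.
Qed.

(** Layer cake estimate on dyadic levels. The hypothesis concerns the measurable
    subsets of the level sets, because those may fail to be measurable. *)
Lemma integral_le_layers (f : T -> R) (M : R) (b : nat -> R) : (0 < M)%R ->
  (forall x, 0 <= f x <= M)%R -> (forall n, 0 <= b n)%R ->
  (forall n (A : set T), measurable A -> (forall x, A x -> (M * 2^-1 ^+ n.+1 < f x)%R) ->
     m A <= (b n)%:E) ->
  \int[m]_x (f x)%:E <= \sum_(n <oo) (M * 2^-1 ^+ n * b n)%:E.
Proof.
move=> M0 fM b0 H; apply: ge0_integral_le_simple => [x|h hf].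
  by rewrite lee_fin; have /andP[] := fM x.
pose A n := [set x | (M * 2^-1 ^+ n.+1 < h x)%R].
have mA n : measurable (A n).
  have mh : measurable_fun setT h by [].
  rewrite /A (_ : [set x | _] = h @^-1` `](M * 2^-1 ^+ n.+1)%R, +oo[).
    by rewrite -[X in measurable X]setTI; apply: mh.
  by apply/seteqP; split => x /=; rewrite in_itv/= andbT.
pose g n x : \bar R := (M * 2^-1 ^+ n * \1_(A n) x)%:E.
have Mn n : (0 <= M * 2^-1 ^+ n)%R by rewrite mulr_ge0 ?exprn_ge0 ?invr_ge0// ltW.
have g0 n x : 0 <= g n x by rewrite lee_fin mulr_ge0// indicE.
have mg n : measurable_fun setT (g n).
  by apply/measurable_EFinP; apply: measurable_funM => //; exact: measurable_indic.
apply: (@le_trans _ _ (\int[m]_x \sum_(n <oo) g n x)).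
  apply: ge0_le_integral => //.
  - by move=> x _; rewrite lee_fin.
  - exact/measurable_EFinP.
  - by apply: ge0_emeasurable_sum.
  move=> x _; have h0 : (0 <= h x)%R by [].
  have [hx0|hx0] := eqVneq (h x) 0%R; first by rewrite hx0; apply: nneseries_ge0.
  have hp : (0 < h x)%R by rewrite lt_neqAle eq_sym hx0 h0.
  have hM : (h x <= M)%R.
    by rewrite -lee_fin; apply: (le_trans (hf x)); rewrite lee_fin; have /andP[] := fM x.
  have [n n1 n2] := dyadic_layer hp hM.
  apply: le_trans (nneseries_lim_ge n.+1 _) => //.
  rewrite big_nat_recr//=; apply: (@le_trans _ _ (g n x)); last by rewrite leeDr// sume_ge0.
  by rewrite /g indicE mem_set// mulr1 lee_fin.
rewrite integral_nneseries//; apply: lee_nneseries => [n *|n *].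
  exact: integral_ge0.
rewrite /g; under eq_integral do rewrite EFinM.
rewrite ge0_integralZl_EFin//; last exact/measurable_EFinP.
rewrite integral_indic// setIT [leRHS]EFinM lee_wpmul2l ?lee_fin//.
apply: H => // x Ax; apply: (lt_le_trans Ax); by rewrite -lee_fin.
Qed.

Lemma geometric_series_lty (C r : R) : (0 <= C)%R -> (0 <= r)%R -> (r < 1)%R ->
  \sum_(n <oo) (C * r ^+ n)%:E < +oo.
Proof.
move=> C0 r0 r1; have r10 : (0 < 1 - r)%R by rewrite subr_gt0.
apply: (@le_lt_trans _ _ (C / (1 - r))%:E); last exact: ltry.
apply: lime_le.
  by apply: is_cvg_nneseries => n _ _; rewrite lee_fin mulr_ge0// exprn_ge0.
apply: nearW => n; rewrite sumEFin lee_fin -mulr_sumr ler_wpM2l//.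
rewrite (_ : (\sum_(0 <= i < n) r ^+ i = (1 - r ^+ n) / (1 - r))%R).
  by rewrite ler_pdivrMr// mulVf ?gt_eqF// gerBl exprn_ge0.
elim: n => [|n IH]; first by rewrite big_nil expr0 subrr mul0r.
by rewrite big_nat_recr//= IH exprS; field; rewrite gt_eqF.
Qed.

End integrals_of_simple_functions.

Section hausdorff_planes.
Context {R : realType} {N : nat}.
Local Open Scope ereal_scope.

Definition unit_volume_bound (k : nat) : R := (expR 1 * (pi * 1) `^ (k%:R / 2))%R.

Lemma unit_volume_bound_ge0 k : (0 <= unit_volume_bound k)%R.
Proof. by rewrite mulr_ge0 ?expR_ge0 ?powR_ge0. Qed.

Lemma hausdorff_weight_le k (A : set 'rV[R]_N) (D : R) : (0 <= D)%R ->
  ediam A <= D%:E -> hausdorff_weight k A <= (unit_volume_bound k * (D / 2) ^+ k)%:E.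
Proof.
move=> D0 AD; rewrite /hausdorff_weight; case: ifPn => [_|/set0P A0].
  by rewrite lee_fin mulr_ge0 ?unit_volume_bound_ge0 ?exprn_ge0 ?divr_ge0.
have d0 := ediam_ge0 A0.
have E (z : k.-tuple (measurableTypeR R)) : (enorm (vec z) <= 1)%R = (sqnorm z <= 1)%R.
  by rewrite enorm_vec -[in LHS]sqrtr1 ler_sqrt.
move: AD d0; case: (ediam A) => [r| |]//; rewrite !lee_fin => rD r0.
rewrite -EFinM -EFin_expe EFinM; apply: lee_pmul => //.
  by rewrite lee_fin exprn_ge0// mulr_ge0// invr_ge0.
- apply: le_trans (volume_ball_le k ltr01); apply: le_measure; rewrite ?inE.
  + rewrite (_ : [set z | _] = [set z | (sqnorm z <= 1)%R]); first exact: measurable_sqnorm_le.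
    by apply/seteqP; split => z /=; rewrite E.
  + exact: measurable_sqnorm_le.
  + by move=> z /=; rewrite E.
- rewrite lee_fin; apply: lerXn2r; rewrite ?nnegrE ?mulr_ge0 ?divr_ge0 ?invr_ge0//.
  by rewrite ler_wpM2r// invr_ge0.
Qed.

Lemma enorm_le_sum (v : 'rV[R]_N) : (enorm v <= \sum_j `|v ord0 j|)%R.
Proof.
rewrite -[leRHS]ger0_norm ?sumr_ge0// -sqrtr_sqr ler_sqrt ?sqr_ge0//.
rewrite expr2 mulr_suml; apply: ler_sum => j _.
apply: (@le_trans _ _ (`|v ord0 j| * `|v ord0 j|)%R); first by rewrite -normrM ler_norm.
by rewrite ler_wpM2l// (bigD1 j)//= lerDl sumr_ge0.
Qed.

(** The parallelepiped is covered by [n.+1 ^ k] cells of side proportional to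
    [1 / n], whose weights add up to a quantity bounded uniformly in [n]. *)
Lemma hausdorff_grid k (x0 : 'rV[R]_N) (v : 'I_k -> 'rV[R]_N) (rho : R) :
  (0 < rho)%R ->
  hausdorff k [set (x0 + \sum_i c i *: v i)%R | c in [set c : 'I_k -> R | forall i, `|c i| <= rho]%R]
  <= (unit_volume_bound k * (2 * (rho * \sum_j \sum_i `|v i ord0 j|)) ^+ k)%:E.
Proof.
move=> rho0; set B := (\sum_j \sum_i `|v i ord0 j|)%R; set A := [set _ | _ in _].
have B0 : (0 <= B)%R by apply: sumr_ge0 => j _; exact: sumr_ge0.
apply: ge_ereal_sup => _ [delta delta0 <-].
pose n0 := Num.truncn (2 * rho * B / delta); pose n := n0.+1.
have nlt : (2 * rho * B / delta <= n%:R)%R by apply: ltW; exact: truncnS_gt.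
have n_0 : (0 < n%:R :> R)%R by rewrite ltr0n.
pose D := (2 * rho * B / n%:R)%R.
have D0 : (0 <= D)%R by rewrite divr_ge0// mulr_ge0// mulr_ge0// ltW.
have Dd : (D <= delta)%R by rewrite ler_pdivrMr// [leRHS]mulrC -ler_pdivrMr.
pose I := {ffun 'I_k -> 'I_n.+1}.
pose cell (j : I) : set 'rV[R]_N := [set (x0 + \sum_i c i *: v i)%R | c in
  [set c : 'I_k -> R | forall i, ((j i)%:R <= (c i + rho) * n%:R / (2 * rho) < (j i).+1%:R)%R]].
have cell_diam j : ediam (cell j) <= D%:E.
  apply: ge_ereal_sup => _ [[x y]] /= [[c hc <-] [c' hc' <-]] <-; rewrite lee_fin.
  apply: (le_trans (enorm_le_sum _)).
  have cc i : (`|c i - c' i| <= 2 * rho / n%:R)%R.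
    have /andP[a1 a2] := hc i; have /andP[a3 a4] := hc' i.
    have r2 : (0 < 2 * rho)%R by rewrite mulr_gt0.
    rewrite ler_pdivlMr// in a1; rewrite ltr_pdivrMr// in a2.
    rewrite ler_pdivlMr// in a3; rewrite ltr_pdivrMr// in a4.
    rewrite ler_pdivlMr// -[in leLHS](ger0_norm (ltW n_0)) -normrM ler_norml.
    have nS : ((j i).+1%:R = (j i)%:R + 1 :> R)%R by rewrite natr1.
    rewrite nS in a2; rewrite nS in a4; move: a1 a2 a3 a4 r2.
    by move: (n%:R : R)%R ((j i)%:R : R)%R => t w *; apply/andP; split; lra.
  have -> : D = (\sum_j \sum_i 2 * rho / n%:R * `|v i ord0 j|)%R.
    rewrite /D /B mulrAC mulr_sumr; apply: eq_bigr => l _; rewrite mulr_sumr.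
    by apply: eq_bigr => i _; ring.
  apply: ler_sum => l _.
  have -> : ((x0 + \sum_i c i *: v i - (x0 + \sum_i c' i *: v i)) ord0 l = \sum_i (c i - c' i) * v i ord0 l)%R.
    rewrite !mxE !summxE opprD addrACA subrr add0r -sumrB; apply: eq_bigr => i _.
    by rewrite !mxE mulrBl.
  apply: (le_trans (ler_norm_sum _ _ _)); apply: ler_sum => i _.
  by rewrite normrM ler_wpM2r.
have cover : A `<=` \bigcup_j cell j.
  move=> _ [c hc <-].
  have r2 : (0 < 2 * rho)%R by rewrite mulr_gt0.
  pose t i := ((c i + rho) * n%:R / (2 * rho))%R.
  have t0 i : (0 <= t i)%R.
    have := hc i; rewrite ler_norml => /andP[h1 h2].
    rewrite divr_ge0 ?(ltW r2)// mulr_ge0// ?(ltW n_0)//; lra.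
  have tn i : (Num.truncn (t i) < n.+1)%N.
    rewrite -(ltr_nat R); apply: le_lt_trans (_ : (n%:R < n.+1%:R)%R); last by rewrite ltr_nat.
    apply: le_trans (_ : (t i <= n%:R)%R); first by have /andP[] := truncn_itv (t0 i).
    have := hc i; rewrite ler_norml => /andP[h1 h2].
    rewrite ler_pdivrMr// mulrC ler_wpM2l ?(ltW n_0)//; lra.
  exists ([ffun i => Ordinal (tn i)] : I) => //; exists c => // i.
  by rewrite ffunE /= -/(t i); exact: truncn_itv.
pose F m := nth set0 [seq cell j | j <- enum I] m.
pose w := (unit_volume_bound k * (D / 2) ^+ k)%R.
have w0 : (0 <= w)%R by rewrite mulr_ge0 ?unit_volume_bound_ge0// exprn_ge0// divr_ge0.
have FD m : ediam (F m) <= D%:E.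
  have [msz|msz] := ltnP m (size [seq cell j | j <- enum I]).
    by have /mapP[j _ jE] := mem_nth set0 msz; rewrite /F jE; exact: cell_diam.
  by rewrite /F nth_default// /ediam setX0 image_set0 ereal_sup0 leNye.
apply: (@le_trans _ _ (\sum_(m <oo) hausdorff_weight k (F m))).
  apply: ereal_inf_lbound; exists F => //; split.
    apply: (subset_trans cover) => x [j _ xj].
    exists (index j (enum I)) => //.
    by rewrite /F (nth_map j) ?index_mem ?mem_enum// nth_index// mem_enum.
  by move=> m; apply: le_trans (FD m) _; rewrite lee_fin.
have card : size [seq cell j | j <- enum I] = (n.+1 ^ k)%N.
  by rewrite size_map -cardE card_ffun !card_ord.
apply: (@le_trans _ _ ((n.+1 ^ k)%:R * w)%:E).
  apply: lime_le.
    by apply: is_cvg_nneseries => m _ _; exact: hausdorff_weight_ge0.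
  apply: nearW => m.
  apply: (@le_trans _ _ (\sum_(0 <= i < m) (if (i < n.+1 ^ k)%N then w%:E else 0))).
    apply: lee_sum => i _; case: ifPn => [_|]; first exact: hausdorff_weight_le.
    by rewrite -leqNgt -card => h; rewrite /F nth_default// hausdorff_weight0.
  rewrite (_ : \sum_(0 <= i < m) _ = ((minn m (n.+1 ^ k))%:R * w)%:E).
    by rewrite lee_fin ler_wpM2r// ler_nat geq_minr.
  elim: m => [|m IH]; first by rewrite big_nil min0n mul0r.
  rewrite big_nat_recr//= IH; case: ltnP => h.
    by rewrite (minn_idPl h) -EFinD -natr1 mulrDl mul1r.
  by rewrite adde0 (minn_idPr (leqW h)).
rewrite lee_fin /w mulrCA ler_wpM2l ?unit_volume_bound_ge0// natrX -exprMn.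
have rB0 : (0 <= rho * B)%R by rewrite mulr_ge0// ltW.
have D20 : (0 <= D / 2)%R by rewrite divr_ge0.
apply: lerXn2r; rewrite ?nnegrE; [exact: mulr_ge0|exact: mulr_ge0|].
have -> : (n.+1%:R * (D / 2) = (n.+1%:R / n%:R) * (rho * B))%R.
  by rewrite /D; field; rewrite gt_eqF.
rewrite ler_wpM2r// ler_pdivrMr// -natrM ler_nat mul2n -addnn.
by rewrite -addn1 leq_add2l.
Qed.

(** Coordinates in a basis of the direction of [V] are linear, hence bounded on
    bounded sets: the set lies in a parallelepiped of comparable size. *)
Lemma hausdorff_plane_ball (k : nat) (V : set 'rV[R]_N) : affine_subspace k V ->
  exists2 C : R, (0 <= C)%R & forall (A : set 'rV[R]_N) (r : R), (0 <= r)%R ->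
    (forall x, A x -> V x /\ (enorm x <= r)%R) ->
    hausdorff k A <= (C * (1 + r) ^+ k)%:E.
Proof.
move=> [x0 [W dW VE]]; move: dW => <- {k}; set k := \dim W.
pose b (i : 'I_k) := (vbasis W)`_i.
pose co (i : 'I_k) (v : 'rV[R]_N) : R := coord (vbasis W) i v.
pose Lc := (\sum_i \sum_j `|co i 'e_j|)%R.
have Lc0 : (0 <= Lc)%R by apply: sumr_ge0 => i _; exact: sumr_ge0.
have cole i (v : 'rV[R]_N) (S : R) : (forall j, `|v ord0 j| <= S)%R -> (`|co i v| <= Lc * S)%R.
  move=> vS; have [j0 _|noj] := pickP (fun _ : 'I_N => true); last first.
    have -> : (v = 0)%R by apply/rowP => j; have := noj j.
    rewrite /co linear0 normr0.
    have -> : Lc = 0%R by apply: big1 => i' _; apply: big1 => j _; have := noj j.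
    by rewrite mul0r.
  have S0 : (0 <= S)%R by exact: le_trans (vS j0).
  rewrite {1}(row_sum_delta v) /co linear_sum/=; apply: (le_trans (ler_norm_sum _ _ _)).
  apply: (@le_trans _ _ (\sum_j `|co i 'e_j| * S)%R).
    by apply: ler_sum => j _; rewrite linearZ/= normrM mulrC ler_wpM2l.
  rewrite -mulr_suml ler_wpM2r// /Lc (bigD1 i)//= lerDl.
  by apply: sumr_ge0 => i' _; exact: sumr_ge0.
pose X := (\sum_j `|x0 ord0 j|)%R; have X0 : (0 <= X)%R by exact: sumr_ge0.
pose B := (\sum_j \sum_i `|b i ord0 j|)%R.
have B0 : (0 <= B)%R by apply: sumr_ge0 => j _; exact: sumr_ge0.
pose a := ((Lc + 1) * (1 + X))%R.
have a0 : (0 < a)%R by apply: mulr_gt0; [rewrite ltr_wpDl|rewrite ltr_pwDl].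
exists (unit_volume_bound k * (2 * (a * B)) ^+ k)%R.
  by rewrite mulr_ge0 ?unit_volume_bound_ge0// exprn_ge0// mulr_ge0// mulr_ge0// ltW.
move=> A r r0 HA.
have rho0 : (0 < a * (1 + r))%R by rewrite mulr_gt0// ltr_pwDl.
apply: (@le_trans _ _ (hausdorff k [set (x0 + \sum_i c i *: b i)%R | c in [set c : 'I_k -> R | forall i, `|c i| <= a * (1 + r)]%R])).
  apply: le_hausdorff => x /HA[Vx xr]; move: Vx; rewrite VE/= => xW.
  exists (fun i => co i (x - x0)%R).
    move=> i /=; apply: (@le_trans _ _ (Lc * (r + X))%R).
      apply: cole => j; rewrite !mxE; apply: (le_trans (ler_normB _ _)); apply: lerD.
        apply: le_trans xr; rewrite -sqrtr_sqr ler_sqrt ?edot_ge0//.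
        exact: coord_sqr_le.
      by rewrite /X (bigD1 j)//= lerDl sumr_ge0.
    rewrite /a; have : (0 <= X * r)%R by rewrite mulr_ge0.
    by move: Lc0 X0 r0; clear; nra.
  by rewrite /co /b -(coord_vbasis xW) addrC subrK.
apply: (le_trans (hausdorff_grid x0 b rho0)); rewrite -/B lee_fin -mulrA.
rewrite ler_wpM2l ?unit_volume_bound_ge0// -exprMn le_eqVlt; apply/orP; left; apply/eqP.
by congr (_ ^+ _)%R; ring.
Qed.

End hausdorff_planes.

(** * The critical exponent *)

Section bubble_in_class.
Context {R : realType} (N k : nat) (s g c0 : R).
Hypotheses (k1 : (1 < k)%N) (s0 : (0 < s)%R) (s1 : (s < 1)%R) (g0 : 0 < g) (c00 : 0 < c0).
Local Notation bubble := (@bubble R N g c0).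

Lemma bubble_L1loc : L1loc bubble.
Proof.
split; first exact: measurable_bubble.
move=> A cA; have [M [_ HM]] := compact_bounded cA.
have {}HM x : A x -> `|x| <= `|M| + 1.
  by apply: HM; rewrite (le_lt_trans (ler_norm M))// ltrDl.
(* [M] bounds the sup norm, [r] the squared Euclidean norm *)
pose r := N%:R * (`|M| + 1) ^+ 2 + 1.
have r0 : 0 < r by rewrite ltr_wpDl// mulr_ge0// exprn_ge0// addr_ge0.
pose B := [set t : N.-tuple (measurableTypeR R) | sqnorm t <= r].
have mB : measurable B by exact: measurable_sqnorm_le.
rewrite integral_mkcond.
have mi : measurable_fun setT (fun t => (c0%:E * (\1_B t)%:E)%E).
  by apply: emeasurable_funM => //; apply/measurable_EFinP; exact: measurable_indic.
apply: (@le_lt_trans _ _ (\int[lebesgue_tuple N]_t (c0%:E * (\1_B t)%:E))%E).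
  apply: ge0_le_integral_nonmeasurable => //.
    by move=> t; rewrite patchE; case: ifP => //; rewrite lee_fin.
  move=> t; rewrite patchE; case: ifPn => [/set_mem/= At|_].
    rewrite indicE mem_set ?mule1; last first.
      rewrite /B/= /r; apply: (@le_trans _ _ (N%:R * (`|M| + 1) ^+ 2)); last by rewrite lerDl.
      have h := HM _ At.
      apply: (@le_trans _ _ (\sum_(i < N) (`|M| + 1) ^+ 2)); last by rewrite sumr_const card_ord mulr_natl.
      apply: ler_sum => i _; have M1 : 0 <= `|M| + 1 by rewrite addr_ge0.
      have := (row_norm_le (vec t) M1).1 h i; rewrite mxE => hi.
      by rewrite -real_normK ?num_real//; apply: lerXn2r; rewrite ?nnegrE.
    by rewrite lee_fin ger0_norm ?bubble_ge0 ?bubble_le.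
  by rewrite mule_ge0 ?lee_fin ?(ltW c00)// indicE.
rewrite ge0_integralZl_EFin ?(ltW c00)//; last first.
  by apply/measurable_EFinP; exact: measurable_indic.
rewrite integral_indic// setIT; apply: lte_mul_pinfty; rewrite ?lee_fin ?(ltW c00)//.
by apply: le_lt_trans (volume_ball_le N r0) _; exact: ltry.
Qed.

(** On a [k]-plane the weighted function exceeds the level [2 ^- n] on a set
    whose measure grows like the power [k / (k + 2 s) < 1] of the inverse
    level, so that the layer cake series converges geometrically. *)
Lemma bubble_L1_k2s : L1_k2s k s bubble.
Proof.
split; first exact: bubble_L1loc.
move=> V affV; have [C C0 HC] := hausdorff_plane_ball affV.
pose e := k%:R + 2 * s; have e0 : 0 < e by rewrite ltr_wpDl// mulr_gt0.
(* the weighted function is at most [c0 / 2 ^+ n] beyond distance [rho ^+ n] *)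
pose rho : R := 2 `^ e^-1; have rho0 : 0 < rho by exact: powR_gt0.
have rho1 : 1 <= rho.
  by rewrite -(powRr0 2); apply: ler_powR; rewrite ?ler1n// invr_ge0 ltW.
have rhoe n : (rho ^+ n) `^ e = 2 ^+ n.
  rewrite -powR_mulrn ?(ltW rho0)// /rho -!powRrM.
  have -> : e^-1 * (n%:R * e) = n%:R by field; rewrite gt_eqF.
  by rewrite powR_mulrn.
pose f (y : caratheodory_type (@hausdorff_outer R N k)) : R :=
  if y \in V then `|bubble y| / (1 + enorm (y : 'rV[R]_N) `^ e) else 0.
have den (y : 'rV[R]_N) : 0 < 1 + enorm y `^ e by rewrite ltr_pwDl// powR_ge0.
have fM y : 0 <= f y <= c0.
  rewrite /f; case: ifP => _; last by rewrite lexx ltW.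
  rewrite divr_ge0 ?(ltW (den _))//= ler_pdivrMr//.
  rewrite ger0_norm ?bubble_ge0//; apply: (le_trans (bubble_le _ _ _)) => //.
  by rewrite ler_peMr ?(ltW c00)// lerDl powR_ge0.
rewrite integral_mkcond.
have -> : (\int[@hausdorff_measure R N k]_y
    ((fun y => (`|bubble y| / (1 + enorm (y : 'rV[R]_N) `^ (k%:R + 2 * s)))%:E) \_ V) y
    = \int[@hausdorff_measure R N k]_y (f y)%:E)%E.
  by apply: eq_integral => y _; rewrite patchE /f; case: ifP.
pose b n : R := C * (2 * rho ^+ n.+1) ^+ k.
have b0 n : 0 <= b n by rewrite mulr_ge0// exprn_ge0// mulr_ge0// exprn_ge0// ltW.
apply: le_lt_trans (integral_le_layers (b := b) c00 fM b0 _) _.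
  move=> n A _ HA.
  have rn0 : 0 <= rho ^+ n.+1 by rewrite exprn_ge0// ltW.
  have HAV (x : 'rV[R]_N) : A x -> V x /\ enorm x <= rho ^+ n.+1.
    move=> /HA; rewrite /f; case: ifPn => [/set_mem Vx h|_]; last first.
      by rewrite ltNge mulr_ge0 ?(ltW c00)// exprn_ge0// invr_ge0.
    split=> //; rewrite leNgt; apply/negP => rx.
    move: h; rewrite ltNge => /negP; apply.
    rewrite ler_pdivrMr// ger0_norm ?bubble_ge0//; apply: (le_trans (bubble_le _ _ _)) => //.
    rewrite -mulrA ler_peMr ?(ltW c00)// exprVn ler_pdivlMl ?exprn_gt0// mulr1 -rhoe.
    apply: (@le_trans _ _ (enorm x `^ e)); last by rewrite lerDr.
    by apply: (ge0_ler_powR (ltW e0)); rewrite ?nnegrE ?enorm_ge0// ltW.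
  apply: (le_trans (HC A (rho ^+ n.+1) rn0 HAV)); rewrite lee_fin /b ler_wpM2l//.
  apply: lerXn2r; rewrite ?nnegrE ?addr_ge0 ?mulr_ge0//.
  by rewrite mulrDl mul1r lerD2r exprn_ege1.
rewrite (_ : (\sum_(n <oo) _)%E =
    (\sum_(n <oo) ((c0 * C * 2 ^+ k * rho ^+ k) * (rho ^+ k / 2) ^+ n)%:E)%E); last first.
  apply: eq_eseriesr => n _; congr EFin; rewrite /b.
  have -> : (2 * rho ^+ n.+1) ^+ k = 2 ^+ k * rho ^+ k * (rho ^+ k) ^+ n.
    by rewrite exprMn exprS -mulrA; congr (_ * _); rewrite exprMn -!exprM mulnC.
  have -> : (rho ^+ k / 2) ^+ n = (rho ^+ k) ^+ n * 2^-1 ^+ n by rewrite exprMn.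
  by ring.
apply: geometric_series_lty.
- by rewrite !mulr_ge0 ?exprn_ge0 ?(ltW c00)// ltW.
- by rewrite divr_ge0// exprn_ge0// ltW.
- rewrite ltr_pdivrMr// mul1r -powR_mulrn ?(ltW rho0)// /rho -powRrM.
  rewrite -[ltRHS](powRr1 (ler0n _ 2)).
  have ke : e^-1 * k%:R < 1 by rewrite mulrC ltr_pdivrMr// mul1r /e ltrDl mulr_gt0.
  have l2 : 0 < ln 2 :> R by rewrite ln_gt0// ltr1n.
  by rewrite /powR pnatr_eq0/= ltr_expR ltr_pM2r.
Qed.

Lemma bubble_lsc : lower_semicontinuous (EFin \o bubble).
Proof.
move=> x a ax; rewrite lte_fin in ax.
have [b b0 Hb] := bubble_convex g0 c00 x.
have FF : Filter (nbhs (x : 'rV[R]_N)) by exact: nbhs_filter.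
have b1 : 0 < b + 1 by rewrite ltr_wpDl.
have d0 : 0 < (bubble x - a) / (b + 1) by rewrite divr_gt0// subr_gt0.
have c := @continuous_edot_sub R N 0 x.
exists [set y | `|edot (x - 0) (x - 0) - edot (y - 0) (y - 0)| < (bubble x - a) / (b + 1)].
  exact: (@cvgr_dist_lt R R 'rV[R]_N (nbhs x) FF _ _ c _ d0).
move=> y /=; rewrite !subr0 lte_fin ltr_norml => /andP[h1 _]; have := Hb y.
have h2 : edot y y - edot x x < (bubble x - a) / (b + 1) by move: h1; lra.
have h3 : b * (edot y y - edot x x) <= b * ((bubble x - a) / (b + 1)) by rewrite ler_wpM2l// ltW.
have h4 : (b + 1) * ((bubble x - a) / (b + 1)) = bubble x - a by rewrite mulrCA divff ?mulr1// gt_eqF.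
rewrite mulNr; move: h3 h4 d0; move: ((bubble x - a) / (b + 1)) (edot y y - edot x x) => D E.
by lra.
Qed.

(** The convention for oo - oo is compatible with positive factors. *)
Lemma gt0_muleDr (c : R) (x y : \bar R) : 0 < c -> (c%:E * (x + y) = c%:E * x + c%:E * y)%E.
Proof.
move=> c_0; have cE : (0 < c%:E)%E by rewrite lte_fin.
case: x => [x| |]; case: y => [y| |]; rewrite ?gt0_muley ?gt0_muleNy//.
by rewrite -[(x%:E + y%:E)%E]EFinD -!EFinM -EFinD mulrDr.
Qed.

Hypotheses (h0 : 0 < (k%:R - g) / 2 - s) (h1 : (k%:R - g) / 2 - s <= 1).

(** The hypotheses say that the nonlinearity decays at least as fast as the gain
    and that it is at most the gain at the origin. *)
Lemma bubble_viscosity (p : R) : 0 < p -> g / 2 + s <= g / 2 * p ->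
  c0 `^ p <= @C_ks R k s * (ckernel k s * (bubble_gain k s g * c0)) ->
  viscosity_supersolution k s p bubble.
Proof.
move=> p0 gp c0p; split.
- by move=> x; exact: bubble_ge0.
- exact: bubble_lsc.
- exact: bubble_L1_k2s.
move=> x0 delta phi delta0 C2 touch.
have Cs0 := C_ks_gt0 s0 s1 (ltnW k1).
have Q1 : 1 <= 1 + edot x0 x0 by rewrite lerDl edot_ge0.
have le : (bubble x0) `^ p <= @C_ks R k s * (ckernel k s * (bubble_gain k s g * c0 * (1 + edot x0 x0) `^ (- (g / 2 + s)))).
  rewrite /bubble powRM ?(ltW c00) ?powR_ge0// -powRrM.
  have -> : @C_ks R k s * (ckernel k s * (bubble_gain k s g * c0 * (1 + edot x0 x0) `^ (- (g / 2 + s)))) =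
    (@C_ks R k s * (ckernel k s * (bubble_gain k s g * c0))) * (1 + edot x0 x0) `^ (- (g / 2 + s)) by ring.
  apply: ler_pM; rewrite ?powR_ge0//.
  by apply: ler_powR => //; rewrite mulNr lerN2.
suff : (Jplus_test k s bubble phi x0 delta <= (- (bubble x0 `^ p))%:E)%E.
  by move=> /(leeD2r (bubble x0 `^ p)%:E) h; apply: (le_trans h); rewrite -EFinD addNr.
apply: ge_ereal_sup => _ [xi xio <-]; rewrite -gt0_muleDr//.
apply: (le_trans (lee_wpmul2l _ (bubble_test k1 s0 s1 g0 c00 h0 h1 xio delta0 C2 touch))).
  by rewrite lee_fin ltW.
by rewrite -EFinM lee_fin mulrN lerN2.
Qed.

End bubble_in_class.

Theorem theorem5p3 (R : realType) (N k : nat) (s p : R)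
    (hk : (1 < k)%N) (hkN : (k < N)%N)
    (hs0 : 0 < s) (hs1 : s < 1) (hp : 0 < p) :
  (exists u : 'rV[R]_N -> R,
     viscosity_supersolution k s p u /\ exists x, u x != 0) <->
  k%:R / (k%:R - 2 * s) < p.
Proof.
have k2 : (2 : R) <= k%:R by rewrite ler_nat.
have ks : 0 < k%:R - 2 * s by move: hs1 k2; lra.
split=> [[u [su [x1 ux1]]]|pk].
  have u0 : 0 < u x1 by have [/(_ x1) h _ _ _] := su; rewrite lt_neqAle eq_sym ux1.
  exact: (exponent_gt_critical hk (ltnW hkN) hs0 hs1 hp su u0).
have p1 : 1 < p.
  by apply: le_lt_trans pk; rewrite ler_pdivlMr// mul1r gerBl; apply: mulr_ge0 => //; exact: ltW.
have p10 : 0 < p - 1 by rewrite subr_gt0.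
rewrite ltr_pdivrMr// in pk.
(* the decay exponent must make the nonlinearity decay at least as fast as the
   gain, and stay within 2 of the critical exponent *)
pose g := Num.max (2 * s / (p - 1)) (k%:R - 2 * s - 2).
have ga : 2 * s / (p - 1) <= g by rewrite le_max lexx.
have gb : k%:R - 2 * s - 2 <= g by rewrite le_max lexx orbT.
have g0 : 0 < g by apply: lt_le_trans ga; rewrite divr_gt0// mulr_gt0.
have gk : g < k%:R - 2 * s.
  rewrite gt_max ltr_pdivrMr//; apply/andP; split; last lra.
  by move: pk; lra.
have gp : 2 * s <= g * (p - 1) by rewrite -ler_pdivrMr.
have h0 : 0 < (k%:R - g) / 2 - s by lra.
have h1 : (k%:R - g) / 2 - s <= 1 by lra.
pose A := @C_ks R k s * (ckernel k s * bubble_gain k s g).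
have A0 : 0 < A.
  have Cs0 := C_ks_gt0 hs0 hs1 (ltnW hk); have ck0 := ckernel_gt0 k hs0.
  by apply: mulr_gt0 => //; apply: mulr_gt0 => //; exact: bubble_gain_gt0.
(* the size for which nonlinearity and gain agree at the origin *)
pose c0 := A `^ (p - 1)^-1; have c00 : 0 < c0 by exact: powR_gt0.
exists (@bubble R N g c0); split.
  apply: bubble_viscosity => //.
    by rewrite mulrC; lra.
  have -> : c0 `^ p = c0 * c0 `^ (p - 1) by rewrite -powRD1// subrK.
  rewrite /c0 -powRrM mulVf ?gt_eqF// powRr1 ?(ltW A0)// -/c0 /A.
  by rewrite le_eqVlt; apply/orP; left; apply/eqP; ring.
exists 0; rewrite gt_eqF//; apply: mulr_gt0 => //; apply: powR_gt0.
by rewrite ltr_pwDl// edot_ge0.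
Qed.
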